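(* Let $d\ge5$, let $F(\mathbf z)=\tfrac12A\mathbf z\cdot\mathbf z$ be a non-degenerate quadratic form on $\mathbb R^d$ with integer coefficients, and let $$\mathcal F(\mathbf z)=\tfrac12A\mathbf z\cdot\mathbf z+\mathbf z_*\cdot\mathbf z+\tau,\qquad \mathbf z_*\in\mathbb R^d,\ \tau\in\mathbb R.$$ For any $0<\varepsilon\le1$ there are constants $K_1,K_2,K_3$, depending only on $d$ and $\varepsilon$, such that if $L\ge1$ satisfies $\mathfrak z:=A^{-1}\mathbf z_*\in\mathbb Z^d_L$ and $\tau L^2\in\mathbb Z$, then for every $w\in\mathcal C^{K_1,K_2}(\mathbb R^d)\cap\mathcal C^{0,K_3}(\mathbb R^d)$ $$\bigl|N_L(w;\mathcal F)-\sigma_\infty(w;\mathcal F)\,\sigma(A,L^2m)\,L^{d-2}\bigr|\le C\,L^{d/2+\varepsilon}\bigl(\|w\|_{K_1,K_2}+\|w\|_{0,K_3}\bigr),$$ where $m=\tfrac12\,\mathfrak z\cdot A\mathfrak z-\tau$ and $C$ depends only on $d,\varepsilon,A,\tau$ and $|\mathbf z_*|$.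
   Context: $A$ is a non-degenerate symmetric $d\times d$ matrix with integer entries and even diagonal entries; $F(\mathbf z)=\tfrac12A\mathbf z\cdot\mathbf z$, $F^t=F-t$. For $L\ge1$, $\mathbb Z^d_L=L^{-1}\mathbb Z^d$. $\Sigma^{\mathcal F}=\{\mathbf z\in\mathbb R^d:\mathcal F(\mathbf z)=0\}$, $N_L(w;\mathcal F)=\sum_{\mathbf z\in\Sigma^{\mathcal F}\cap\mathbb Z^d_L}w(\mathbf z)$, and $\sigma_\infty(w;\mathcal F)=\int_{\Sigma^{\mathcal F}}w(\mathbf z)\,|\nabla\mathcal F(\mathbf z)|^{-1}\,dz|_{\Sigma^{\mathcal F}}$, where $dz|_{\Sigma^{\mathcal F}}$ is the Euclidean volume element on (the smooth part of) $\Sigma^{\mathcal F}$. Norms: $\langle\mathbf x\rangle=\max\{1,|\mathbf x|\}$; $\|f\|_{n_1,n_2}=\sup_{\mathbf z\in\mathbb R^d}\max_{|\alpha|_1\le n_1}|\partial^\alpha f(\mathbf z)|\langle\mathbf z\rangle^{n_2}$ for $n_1\in\mathbb N\cup\{0\}$, $n_2\in\mathbb R$; $\mathcal C^{n_1,n_2}(\mathbb R^d)$ is the space of $C^{n_1}$-smooth real functions with $\|f\|_{n_1,n_2}<\infty$. Singular series: $e_q(x)=e^{2\pi ix/q}$; for $q\in\mathbb N$, $t\in\mathbb Z$, $S_q(\mathbf 0;A,t)=\sum^*_{a\,(\mathrm{mod}\,q)}\sum_{\mathbf b\,(\mathrm{mod}\,q)}e_q(aF^t(\mathbf b))$ ($\sum^*$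 over residues $a$ coprime to $q$, $\mathbf b\in(\mathbb Z/q)^d$, $S_1\equiv1$); $\sigma_p(A,t)=\sum_{l\ge0}p^{-dl}S_{p^l}(\mathbf 0;A,t)$ and $\sigma(A,t)=\prod_p\sigma_p(A,t)$ over all primes (limit of partial products over $p\le n$). *)

(* Defs.v *)
From HB Require Import structures.
From mathcomp Require Import all_boot all_order all_algebra.
From mathcomp Require Import all_classical all_reals all_analysis.
From mathcomp.real_closed Require Import complex.
Import Order.TTheory GRing.Theory Num.Theory.
Import numFieldNormedType.Exports.

Set Implicit Arguments.
Unset Strict Implicit.
Unset Printing Implicit Defensive.

Local Open Scope classical_set_scope.
Local Open Scope ring_scope.

Section Euclidean.
Context {R : realType} {d : nat}.
Implicit Types (x y z : 'cV[R]_d) (f : 'cV[R]_d -> R).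

Definition dot x y : R := \sum_i x i 0 * y i 0.

(* The norm [`|x|] of the library on matrices is the sup norm. *)
Definition enorm x : R := Num.sqrt (dot x x).

Definition bracket x : R := Num.max 1 (enorm x).

Definition pd (i : 'I_d) f : 'cV[R]_d -> R :=
  fun z => 'D_(delta_mx i 0) f z.

Definition grad f z : 'cV[R]_d := \col_i pd i f z.

Definition iter_pd (s : seq 'I_d) f : 'cV[R]_d -> R := foldr pd f s.

Definition Csmooth (n : nat) f : Prop :=
  forall s : seq 'I_d, (size s <= n)%N ->
    continuous (iter_pd s f) /\
    ((size s < n)%N ->
       forall i z, derivable (iter_pd s f) z (delta_mx i 0)).

Definition multi_pd (alpha : 'I_d -> nat) f : 'cV[R]_d -> R :=
  foldr (fun i g => iter (alpha i) (pd i) g) f (enum 'I_d).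

Definition Cnorm (n1 : nat) (n2 : R) f : \bar R :=
  ereal_sup [set u | exists z (alpha : 'I_d -> nat),
    (\sum_i alpha i <= n1)%N /\
    u = (`|multi_pd alpha f z| * bracket z `^ n2)%:E].

Definition Cspace (n1 : nat) (n2 : R) : set ('cV[R]_d -> R) :=
  [set f | Csmooth n1 f /\ (Cnorm n1 n2 f < +oo)%E].

Definition lattice (L : R) : set 'cV[R]_d :=
  [set z | exists n : 'cV[int]_d, z = L^-1 *: map_mx intr n].

End Euclidean.

Section Surface.
Context {R : realType}.

Definition borel (n : nat) := g_sigma_algebraType (@open 'cV[R]_n).

(* Lebesgue measure on the Borel sets of R^n, as the n-fold product measure:
   [leb n.+1 E] is the integral over x of the measure of the section of E at
   first coordinate x, which is how the library's [\x] is defined. *)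
Fixpoint leb (n : nat) : set 'cV[R]_n -> \bar R :=
  match n with
  | 0 => fun E => (\1_E (0 : 'cV[R]_0))%:E
  | n'.+1 => fun E =>
      (\int[lebesgue_measure]_(x in [set: R])
         leb [set y : 'cV[R]_n' | E (col_mx (x%:M : 'cV[R]_1) y)])%E
  end.

Context {d : nat}.
Implicit Types (z : 'cV[R]_d) (f : 'cV[R]_d -> R).

Definition insert (i : 'I_d) (y : 'cV[R]_d.-1) (s : R) : 'cV[R]_d :=
  \col_j (if unlift i j is Some k then y k 0 else s).

Definition zero_set f : set 'cV[R]_d := [set z | f z = 0].

Definition smooth_part f : set 'cV[R]_d :=
  zero_set f `&` [set z | grad f z != 0].

(* Where [pd i f != 0] the hypersurface [f = 0] is locally the graph z_i = g(y)
   over the remaining coordinates y, with volume element sqrt(1 + |grad g|^2) dy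
   and grad g given by - pd j f / pd i f, j != i.  The smooth part is the disjoint
   union over i of the sets where i is the first index with [pd i f != 0]; the
   density is summed over the points of the i-th piece above y. *)
Definition graph_piece f (i : 'I_d) : set 'cV[R]_d :=
  [set z | zero_set f z /\ pd i f z != 0 /\
           forall j : 'I_d, (j < i)%N -> pd j f z = 0].

Definition graph_density f (i : 'I_d) z : R :=
  Num.sqrt (1 + \sum_(j | j != i) (pd j f z / pd i f z) ^+ 2).

Definition surface_measure f (E : set (borel d)) : \bar R :=
  (\sum_(i < d)
     \int[@leb d.-1 : set (borel d.-1) -> \bar R]_(y in [set: borel d.-1])
       \esum_(s in [set s | (E `&` graph_piece f i) (insert i y s)])
         (graph_density f i (insert i y s))%:E)%E.

Definition sigma_infty (w f : 'cV[R]_d -> R) : \bar R :=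
  (\int[surface_measure f]_(z in (smooth_part f : set (borel d)))
     (w z / enorm (grad f z))%:E)%E.

(* A series that does not converge absolutely gets an infinite value, since
   +oo - +oo = -oo; it never gets a finite default value. *)
Definition lattice_sum (L : R) (w f : 'cV[R]_d -> R) : \bar R :=
  (\esum_(z in zero_set f `&` lattice L) (fun z => (w z)%:E)^\+ z
   - \esum_(z in zero_set f `&` lattice L) (fun z => (w z)%:E)^\- z)%E.

End Surface.

Section Forms.
Context {R : realType} {d : nat}.
Implicit Type A : 'M[int]_d.

Definition even_symmetric A : Prop :=
  A^T = A /\ forall i, (2 %| A i i)%Z.

Definition real_mx A : 'M[R]_d := map_mx intr A.

Definition qform A (z : 'cV[R]_d) : R := 2^-1 * dot (real_mx A *m z) z.

Definition expq (q : nat) (x : R) : R[i] :=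
  (cos (2 * pi * x / q%:R) +i* sin (2 * pi * x / q%:R))%C.

Definition Sq (q : nat) A (t : int) : R[i] :=
  \sum_(a < q | coprime a q) \sum_(b : 'cV['I_q]_d)
    expq q (a%:R * (qform A (map_mx (fun k : 'I_q => k%:R) b) - t%:~R)).

(* [Sq q A t] is real, since a -> q - a conjugates the summands. *)
Definition singular_factor (p : nat) A (t : int) : R :=
  limn (series (fun l => complex.Re (Sq (p ^ l) A t) / p%:R ^+ (d * l))).

Definition singular_series A (t : int) : R :=
  limn (fun n : nat => \prod_(p < n.+1 | prime p) singular_factor p A t).

End Forms.

(* Main.v *)
(* The circle method without Kloosterman's refinement: the factor L^eps leaves room for it.

   Completing the square, L^2 f(b / L) is the integer F(b + n0) - t for b in Z^d, so N_L(w) is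
   the integral over a period of T(al) = sum_b w(b / L) cos(2 pi al (F(b + n0) - t)). Squaring T
   and summing by parts along the axes bounds |T|^2 by L^d times a product of one-dimensional
   sums, uniformly in the linear part of the phase; on the minor arcs this is the error term.
   Near a/q, T is q^-d times a Gauss sum times a Riemann sum for an oscillatory integral I(g),
   up to an arbitrary power saving. The bound for T passes to the limit L -> oo and gives
   |I(g)| <= C |g|^(-d/2) and a bound q^(d/2) for the Gauss sums; hence the singular series
   and the singular integral converge absolutely, and the Euler product follows by counting
   solutions modulo M.

   The integral of I over the line is the surface integral sigma_oo: by Abel summation it is a
   limit of integrals of w against Poisson kernels of f, which, integrated by parts along the
   zeroth axis, become the sums of w / |d_0 f| over the roots of f on the lines parallel to it.
   These compute sigma_oo because the surface measure is the push-forward of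
   |grad f| / |d_0 f| dy along the two branches of roots, and the part of the quadric where
   d_0 f = 0 is a null set. *)

Require Import Defs.
From HB Require Import structures.
From mathcomp Require Import all_boot all_order all_algebra.
From mathcomp Require Import all_classical all_reals all_analysis.
From mathcomp.real_closed Require complex.
From mathcomp Require Import measurable_realfun ring lra zify.
Import Order.TTheory GRing.Theory Num.Theory.
Import numFieldNormedType.Exports.

Set Implicit Arguments.
Unset Strict Implicit.
Unset Printing Implicit Defensive.

Local Open Scope classical_set_scope.
Local Open Scope ring_scope.

(** * Integration on column vectors *)

(** Everything stays real: the phases carry a free shift [th], and a quarter turn of it supplies the
    sines. This is why sums are differenced twice at a time, the cosine being an eigenfunction of
    the second difference but not of the first. The loss is measured by [Y = L^(eps/d)]. The major
    arcs have radius [1/(8LYq)] with q at most about [L/Y]; they are disjoint and need not cover the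
    period. Off them, al g stays [1/(8LY)] away from the integers for all such g, which is just the
    separation that Weyl's inequality consumes, at a cost of [Y^d = L^eps]. On them each derivative
    of the weight saves a factor of order Y, so about [d^2/eps] derivatives beat the trivial [L^d];
    this fixes K1. The bound on d comes from the series: a Gauss sum over all numerators is of size
    [q^(1-d/2)], which is summable for d at least 5. Surface integral and lattice sum have extended
    real values, so their finiteness has to be proved. For nonnegative weights it comes from
    monotone limits, in the cutoff and on the fibres; a general w is the difference of two such
    weights, obtained by adding a multiple of a smooth majorant. *)

Ltac nng := repeat first [done | assumption | exact: sqr_ge0 | exact: normr_ge0 | apply: exprn_ge0
  | apply: mulr_ge0 | apply: addr_ge0 | rewrite invr_ge0 | by apply: ltW].

Section LebesgueMeasureRn.
Context {R : realType}.
Implicit Type n : nat.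

Definition consv n (p : R * 'cV[R]_n) : 'cV[R]_n.+1 := col_mx (p.1%:M : 'cV_1) p.2.

Lemma consv0 n (p : R * 'cV[R]_n) : consv p 0 0 = p.1.
Proof.
rewrite /consv (_ : (0 : 'I_n.+1) = lshift n (0 : 'I_1)); last exact: val_inj.
by rewrite (col_mxEu (p.1%:M : 'cV_1)) mxE eqxx mulr1n.
Qed.

Lemma consvS n (p : R * 'cV[R]_n) (i : 'I_n) : consv p (lift 0 i) 0 = p.2 i 0.
Proof.
rewrite /consv (_ : lift 0 i = rshift 1 i); last exact: val_inj.
by rewrite (col_mxEd (p.1%:M : 'cV_1)).
Qed.

Lemma forall_ordS n (P : 'I_n.+1 -> Prop) :
  P 0 -> (forall i, P (lift 0 i)) -> forall i, P i.
Proof. by move=> P0 PS i; case: (unliftP 0 i) => [j ->|->]. Qed.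

Lemma consv_eta n (z : 'cV[R]_n.+1) : z = consv (z 0 0, \col_i z (lift 0 i) 0).
Proof.
apply/matrixP => i j; rewrite ord1; elim/forall_ordS : i => [|i].
  by rewrite consv0.
by rewrite consvS mxE.
Qed.

Lemma consv_ball n (p : R * 'cV[R]_n) (v : 'cV[R]_n.+1) e :
  ball v e (consv p) <-> ball (v 0 0) e p.1 /\ ball (\col_i v (lift 0 i) 0) e p.2.
Proof.
split=> [[e0 h]|[h0 [e0 h]]].
  split; first by rewrite -(consv0 p); exact: h.
  split=> // i j; rewrite mxE ord1 -(consvS p); exact: h.
split=> // i j; rewrite ord1; elim/forall_ordS : i => [|i].
  by rewrite consv0.
by rewrite consvS; have := h i 0; rewrite mxE.
Qed.

(** Second countability in the form used for measurability: an open set is a countable union of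
    rational balls, and a sup-norm ball is a product of intervals, so open sets pull back along
    [consv] into the product sigma-algebra. *)
Lemma open_bigcup_ball n (U : set 'cV[R]_n) : open U ->
  U = \bigcup_(p : {p : 'cV[rat]_n * nat | `[< ball (map_mx ratr p.1 : 'cV[R]_n) p.2.+1%:R^-1 `<=` U >]})
        ball (map_mx ratr (val p).1 : 'cV[R]_n) (val p).2.+1%:R^-1.
Proof.
move=> oU; apply/seteqP; split=> [x Ux|x [[p /= /asboolP pU] _]]; last exact: pU.
have /nbhs_ballP[e /= e0 eU] : nbhs x U by exact: open_nbhs_nbhs.
(* This makes [1/(k+1) < e/2]: one radius for the distance from [x] to the rational centre, one for
   the ball around that centre. *)
pose k := Num.truncn (2 / e).
have kp : 0 < k.+1%:R^-1 :> R by rewrite invr_gt0 ltr0n.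
have ke : k.+1%:R^-1 < e / 2.
  rewrite invf_plt ?posrE ?divr_gt0// ?ltr0n// invf_div.
  by apply: truncnS_gt.
have qP i : exists q : rat, `|x i 0 - ratr q| < k.+1%:R^-1.
  have : x i 0 - k.+1%:R^-1 < x i 0 + k.+1%:R^-1 by rewrite ltrD2l gtrN.
  move=> /rat_in_itvoo[q]; rewrite in_itv /= => /andP[q1 q2].
  by exists q; rewrite distrC ltr_distl q1.
pose v : 'cV[rat]_n := \col_i projT1 (cid (qP i)).
have vP i : `|x i 0 - ratr (v i 0)| < k.+1%:R^-1.
  by rewrite mxE; case: cid.
have vU : ball (map_mx ratr v : 'cV[R]_n) k.+1%:R^-1 `<=` U.
  move=> y [_ hy]; apply: eU; split=> // i j.
  rewrite ord1 /ball /=; have := hy i 0; rewrite /ball /= mxE => hy'.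
  rewrite -(subrKA (ratr (v i 0))).
  rewrite (le_lt_trans (ler_normD _ _))// (splitr e).
  by apply: ltrD; [exact: lt_trans (vP i) ke|rewrite distrC distrC; exact: lt_trans hy' ke].
exists (exist _ (v, k) (asboolT vU)) => //=.
by split=> // i j; rewrite /ball /= ord1 mxE distrC.
Qed.

Lemma measurable_open n (U : set (borel n)) : open (U : set 'cV[R]_n) -> measurable U.
Proof. by move=> oU; exact: sub_sigma_algebra. Qed.

Lemma measurable_consv n :
  measurable_fun [set: measurableTypeR R * (@borel R n)] (@consv n : _ -> @borel R n.+1).
Proof.
apply: (@measurability _ _ _ (@borel R n.+1) setT _ (@open 'cV[R]_n.+1)) => //.
move=> _ [U oU <-]; rewrite setTI (open_bigcup_ball oU) preimage_bigcup.
apply: countable_bigcupT_measurable; first exact: countableP.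
move=> [[v k] /= _].
set B := _ @^-1` _.
have -> : B = ball (map_mx ratr v 0 0 : R) k.+1%:R^-1
    `*` (ball (\col_i (map_mx ratr v : 'cV[R]_n.+1) (lift 0 i) 0) k.+1%:R^-1).
  by apply/seteqP; split=> p /consv_ball.
apply: measurableX; first by apply: open_measurable; exact: ball_open.
apply: measurable_open; exact: ball_open.
Qed.

Lemma sigma_finite_dirac0 : sigma_finite setT (@dirac _ (@borel R 0) 0 R).
Proof. by apply: fin_num_fun_sigma_finite; [rewrite measure0|exact: fin_num_measure]. Qed.

HB.instance Definition _ := @isSigmaFinite.Build _ (@borel R 0) R
  (@dirac _ (@borel R 0) 0 R) sigma_finite_dirac0.

Lemma continuous_mx m p (T : topologicalType) (f : T -> 'M[R]_(m, p)) :
  (forall i j, continuous (fun z => f z i j)) -> continuous f.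
Proof.
move=> fc z A /= [P Pz PA]; near=> z'; apply: PA.
near: z'; apply: filter_forall => i; apply: filter_forall => j.
exact: (fc i j z _ (Pz i j)).
Unshelve. all: by end_near. Qed.

Lemma measurable_continuous_borel n m (f : 'cV[R]_n -> 'cV[R]_m) :
  continuous f -> measurable_fun [set: @borel R n] (f : _ -> @borel R m).
Proof.
move=> cf; apply: (@measurability _ _ _ (@borel R m) setT _ (@open 'cV[R]_m)) => //.
move=> _ [U oU <-]; rewrite setTI; apply: measurable_open.
by apply: open_comp => // x _; exact: cf.
Qed.

Lemma measurable_continuousR n (f : 'cV[R]_n -> R) :
  continuous f -> measurable_fun [set: @borel R n] (f : _ -> measurableTypeR R).
Proof.
move=> cf; apply: (measurability _ (RGenOpens.measurableE R)).
move=> _ [_ [a [b ->]] <-]; rewrite setTI; apply: measurable_open.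
apply: open_comp; first by move=> x _; exact: cf.
exact: interval_open.
Qed.

Lemma continuous_coord n i : continuous (fun z : 'cV[R]_n => z i 0).
Proof. exact: coord_continuous. Qed.

Definition unconsv n (z : 'cV[R]_n.+1) : R * 'cV[R]_n := (z 0 0, \col_i z (lift 0 i) 0).

Lemma consvK n : cancel (@consv n) (@unconsv n).
Proof.
move=> [x y]; rewrite /unconsv consv0; congr pair.
by apply/matrixP => i j; rewrite mxE consvS ord1.
Qed.

Lemma unconsvK n : cancel (@unconsv n) (@consv n).
Proof. by move=> z; rewrite -consv_eta. Qed.

Lemma measurable_unconsv n :
  measurable_fun [set: @borel R n.+1] (@unconsv n : _ -> measurableTypeR R * @borel R n).
Proof.
apply: measurable_fun_pair.
  exact: (@measurable_continuousR n.+1 (fun z => z 0 0) (@continuous_coord n.+1 0)).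
apply: (@measurable_continuous_borel n.+1 n (fun z => \col_i z (lift 0 i) 0)); apply: continuous_mx => i j.
under eq_fun do rewrite mxE.
exact: continuous_coord.
Qed.

Section step.
Variables (n : nat) (m : {sigma_finite_measure set (@borel R n) -> \bar R}).

Definition lebS (A : set (@borel R n.+1)) : \bar R :=
  (((@lebesgue_measure R) \x m) ((@consv n) @^-1` A))%E.

Let lebS0 : lebS set0 = 0%E.
Proof. by rewrite /lebS preimage_set0 measure0. Qed.

Let lebS_ge0 A : (0 <= lebS A)%E.
Proof. exact: measure_ge0. Qed.

Let lebS_sigma_additive : semi_sigma_additive lebS.
Proof.
move=> F mF tF mUF; rewrite /lebS preimage_bigcup.
apply: measure_semi_sigma_additive.
- by move=> i; rewrite -[X in measurable X]setTI; exact: measurable_consv.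
- apply/trivIsetP => /= i j _ _ ij; rewrite -preimage_setI.
  by move/trivIsetP : tF => /(_ _ _ _ _ ij) ->//; rewrite preimage_set0.
- by rewrite -preimage_bigcup -[X in measurable X]setTI; exact: measurable_consv.
Qed.

HB.instance Definition _ := isMeasure.Build _ _ _ lebS lebS0 lebS_ge0 lebS_sigma_additive.

Let lebS_sigma_finite : sigma_finite setT lebS.
Proof.
have /sigma_finiteP[F [TF ndF Foo]] := sigma_finiteT (@lebesgue_measure R).
have /sigma_finiteP[G [TG ndG Goo]] := sigma_finiteT m.
exists (fun i => @unconsv n @^-1` (F i `*` G i)).
  rewrite -preimage_bigcup -(preimage_setT (@unconsv n)); congr (_ @^-1` _).
  apply/seteqP; split => // -[x y] _.
  have : [set: R] x by []. have : [set: 'cV[R]_n] y by [].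
  rewrite TF TG => -[k _ Gky] [l _ Flx]; exists (maxn l k) => //; split.
  - by move: x Flx; exact/subsetPset/ndF/leq_maxl.
  - by move: y Gky; exact/subsetPset/ndG/leq_maxr.
move=> i; have [? ?] := Foo i; have [? ?] := Goo i.
have mFG : measurable (F i `*` G i) by exact: measurableX.
split.
  by rewrite -[X in measurable X]setTI; exact: measurable_unconsv.
rewrite /lebS (_ : _ @^-1` _ = F i `*` G i).
  by rewrite product_measure1E// lte_mul_pinfty// ge0_fin_numE.
by apply/funext => x; rewrite /preimage /mkset consvK.
Qed.

HB.instance Definition _ := Measure_isSigmaFinite.Build _ _ _ lebS lebS_sigma_finite.

End step.

(** [leb] is a function on all subsets and carries no measure structure. The same recursion is
    repeated here inside sigma-finite measures, each step being the push-forward of a product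
    measure, so that Fubini and Tonelli become available. *)
Fixpoint lebm n : {sigma_finite_measure set (@borel R n) -> \bar R} :=
  match n return {sigma_finite_measure set (@borel R n) -> \bar R} with
  | 0 => @dirac _ (@borel R 0) 0 R
  | n'.+1 => lebS (lebm n')
  end.

(** Sections of a Borel set are Borel, so the induction hypothesis can be applied under the
    integral. *)
Lemma leb_lebm n (E : set (@borel R n)) : measurable E -> leb E = lebm n E.
Proof.
elim: n E => [//|n IH] E mE /=.
rewrite /lebS /product_measure1; apply: eq_integral => x _ /=.
rewrite -IH.
  by congr leb; apply/seteqP; split=> y; rewrite /xsection /= ?inE.
apply: measurable_xsection; rewrite -[X in measurable X]setTI; exact: measurable_consv.
Qed.

End LebesgueMeasureRn.

Section RealIntegrals.
Context d (T : measurableType d) {R : realType} (mu : {measure set T -> \bar R}).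
Implicit Types f g : T -> R.

Definition Int f := mu.-integrable setT (EFin \o f).

Lemma Int_meas f : Int f -> measurable_fun setT f.
Proof. by move=> /integrableP[/measurable_EFinP]. Qed.

Lemma Int_le f g : measurable_fun setT f -> Int g -> (forall x, `|f x| <= g x) -> Int f.
Proof.
move=> mf ig fg; apply: le_integrable ig => //; first exact/measurable_EFinP.
by move=> x _ /=; rewrite lee_fin (le_trans (fg x))// ler_norm.
Qed.

Lemma Int_norm f : Int f -> Int (fun x => `|f x|).
Proof. exact: integrable_norm. Qed.

Lemma IntZ k f : Int f -> Int (fun x => k * f x).
Proof. by move=> /(integrableZl measurableT k). Qed.

Lemma IntD f g : Int f -> Int g -> Int (fun x => f x + g x).
Proof. by move=> i j; have := integrableD measurableT i j. Qed.

Lemma IntB f g : Int f -> Int g -> Int (fun x => f x - g x).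
Proof. by move=> i j; have := integrableB measurableT i j. Qed.

Lemma Int0 : Int (fun=> 0).
Proof. exact: integrable0. Qed.

Lemma Int_indic (A : set T) : measurable A -> (mu A < +oo)%E -> Int (\1_A : T -> R).
Proof.
move=> mA Afin; apply/integrableP; split.
  by apply/measurable_EFinP; exact: measurable_indic.
rewrite (eq_integral (fun x => (\1_A x)%:E)); last by move=> x _ /=; rewrite ger0_norm.
by rewrite integral_indic// setIT.
Qed.

Lemma Int_sum I (r : seq I) (P : pred I) (F : I -> T -> R) :
  (forall i, Int (F i)) -> Int (fun x => \sum_(i <- r | P i) F i x).
Proof.
move=> h; elim: r => [|i r IH]; first by under eq_fun do rewrite big_nil; exact: Int0.
under eq_fun do rewrite big_cons.
by case: (P i) => //; apply: IntD.
Qed.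

Lemma rint_sum I (r : seq I) (P : pred I) (F : I -> T -> R) :
  (forall i, Int (F i)) ->
  \int[mu]_x (\sum_(i <- r | P i) F i x) = \sum_(i <- r | P i) \int[mu]_x F i x.
Proof.
move=> h; elim: r => [|i r IH].
  under eq_Rintegral do rewrite big_nil.
  by rewrite big_nil Rintegral_cst// mul0r.
under eq_Rintegral do rewrite big_cons.
rewrite big_cons; case: (P i) => //.
by rewrite RintegralD ?IH//; [exact: h|exact: (Int_sum r P h)].
Qed.

Lemma rint_le f g : Int f -> Int g -> (forall x, f x <= g x) ->
  \int[mu]_x f x <= \int[mu]_x g x.
Proof. by move=> i j h; apply: le_Rintegral. Qed.

Lemma rint_abs f g : Int f -> Int g -> (forall x, `|f x| <= g x) ->
  `|\int[mu]_x f x| <= \int[mu]_x g x.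
Proof.
move=> i j h; apply: le_trans (le_normr_Rintegral _ _) _ => //.
by apply: rint_le => //; exact: Int_norm.
Qed.

Lemma rintZ k f : Int f -> \int[mu]_x (k * f x) = k * \int[mu]_x f x.
Proof. by move=> i; rewrite RintegralZl. Qed.

Lemma EFin_rint f : Int f -> (\int[mu]_x f x)%R%:E = (\int[mu]_x (f x)%:E)%E.
Proof. by move=> i; rewrite fineK//; exact: integrable_fin_num. Qed.

Lemma rint_dct (f_ : nat -> T -> R) f g : (forall n, measurable_fun setT (f_ n)) ->
  (forall x, f_ ^~ x @ \oo --> f x) -> Int g -> (forall n x, `|f_ n x| <= g x) ->
  Int f /\ (fun n => \int[mu]_x f_ n x) @ \oo --> \int[mu]_x f x.
Proof.
move=> mf cf ig fg.
have cE x : (EFin \o f_ n) x @[n --> \oo] --> (EFin \o f) x.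
  by apply/fine_cvgP; split; [exact: nearW|exact: cf].
have [] := @dominated_convergence _ _ _ mu setT measurableT
  (fun n => EFin \o f_ n) (EFin \o f) (EFin \o g).
- by move=> n; exact/measurable_EFinP.
- apply: (emeasurable_fun_cvg (fun n => EFin \o f_ n)) => [n|x _]; last exact: cE.
  exact/measurable_EFinP.
- by apply/aeW => x _.
- exact: ig.
- by apply/aeW => x n _ /=; rewrite lee_fin.
move=> iF _ cF; split=> //.
apply: fine_cvg; rewrite fineK//; exact: integrable_fin_num.
Qed.

End RealIntegrals.
Arguments Int {d T R} mu f.

Section RealFubini.
Context d1 d2 (T1 : measurableType d1) (T2 : measurableType d2) {R : realType}.
Variable m1 : {sigma_finite_measure set T1 -> \bar R}.
Variable m2 : {sigma_finite_measure set T2 -> \bar R}.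
Implicit Types f : T1 * T2 -> R.

Lemma Int_prod f h k : measurable_fun setT f -> Int m1 h -> Int m2 k ->
  (forall x, `|f x| <= h x.1 * k x.2) -> Int (m1 \x m2)%E f.
Proof.
move=> mf ih ik fhk; apply/integrable12ltyP; first exact/measurable_EFinP.
apply: (@le_lt_trans _ _ (\int[m1]_x (`|h x| * \int[m2]_y `|k y|)%R%:E)%E).
  apply: ge0_le_integral => //.
  - by move=> x _; exact: integral_ge0.
  - apply: (measurable_fun_fubini_tonelli_F (abse \o (EFin \o f))) => //=.
    by apply: measurableT_comp => //; apply/measurable_EFinP.
  - apply/measurable_EFinP; apply: measurable_funM => //.
    by apply: measurableT_comp => //; exact: Int_meas ih.
  - move=> x _ ; rewrite -rintZ; last exact: Int_norm.
    rewrite EFin_rint; last by apply: IntZ; exact: Int_norm.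
    apply: ge0_le_integral => //=.
    + apply/measurable_EFinP; apply: measurableT_comp => //.
      by apply: (measurableT_comp mf); exact: pair1_measurable.
    + apply/measurable_EFinP; apply: measurable_funM => //.
      by apply: measurableT_comp => //; exact: Int_meas ik.
    + move=> y _; rewrite lee_fin (le_trans (fhk _))//= -normrM ler_norm//.
under eq_integral do rewrite mulrC.
rewrite -EFin_rint ?ltry//; apply: IntZ; exact: Int_norm.
Qed.

Lemma rfubini1 f : Int (m1 \x m2)%E f -> (forall x, Int m2 (fun y => f (x, y))) ->
  \int[(m1 \x m2)%E]_z f z = \int[m1]_x \int[m2]_y f (x, y).
Proof.
move=> i j; rewrite /Rintegral -integral12_prod_meas1//; congr fine.
by apply: eq_integral => x _; rewrite /= EFin_rint.
Qed.

Lemma rfubini2 f : Int (m1 \x m2)%E f -> (forall y, Int m1 (fun x => f (x, y))) ->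
  \int[(m1 \x m2)%E]_z f z = \int[m2]_y \int[m1]_x f (x, y).
Proof.
move=> i j; rewrite /Rintegral -integral21_prod_meas1//; congr fine.
by apply: eq_integral => x _; rewrite /= EFin_rint.
Qed.

Lemma Int_fubini1 f : Int (m1 \x m2)%E f -> (forall x, Int m2 (fun y => f (x, y))) ->
  Int m1 (fun x => \int[m2]_y f (x, y)).
Proof.
move=> i j; have := integrable_fubini_F i; apply: eq_integrable => // x _ /=.
by rewrite EFin_rint.
Qed.

Lemma Int_fubini2 f : Int (m1 \x m2)%E f -> (forall y, Int m1 (fun x => f (x, y))) ->
  Int m2 (fun y => \int[m1]_x f (x, y)).
Proof.
move=> i j.
have i' := i; rewrite /Int in i'.
suff : m2.-integrable setT (fubini_G m1 (EFin \o f)).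
  apply: eq_integrable => // y _ /=.
  by rewrite EFin_rint.
apply/integrableP; split; first exact: (measurable_fubini_G i').
have /integrable21ltyP := i' => /(_ (measurable_int _ i')).
apply: le_lt_trans; apply: ge0_le_integral => //.
- by apply: measurableT_comp => //; exact: (measurable_fubini_G i').
- apply: (measurable_fun_fubini_tonelli_G (abse \o (EFin \o f))) => //=.
  by apply: measurableT_comp => //; exact: (measurable_int _ i').
- move=> y _; apply: le_abse_integral => //.
  exact: (measurable_int _ (j y)).
Qed.

End RealFubini.

Section LebIntegral.
Context {R : realType}.
Implicit Type n : nat.

Lemma Int_lebmS n (f : 'cV[R]_n.+1 -> R) : Int (lebm n.+1) f ->
  Int ((@lebesgue_measure R) \x (lebm n))%E (f \o @consv R n).
Proof.
move=> i; have mc := @measurable_consv R n.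
apply/integrableP; split.
  apply/measurable_EFinP; apply: (measurableT_comp (Int_meas i)).
  exact: mc.
have /integrableP[mf] := i.
apply: le_lt_trans.
have := @ge0_integral_pushforward _ _ _ _ R _ mc ((@lebesgue_measure R) \x (lebm n))%E setT
  (fun z => `|(f z)%:E|)%E measurableT.
rewrite preimage_setT => <-//; first exact: measurableT_comp.
Qed.

Lemma rint_lebmS n (f : 'cV[R]_n.+1 -> R) : Int (lebm n.+1) f ->
  \int[lebm n.+1]_z f z = \int[((@lebesgue_measure R) \x (lebm n))%E]_p f (consv p).
Proof.
move=> i; have mc := @measurable_consv R n.
have := @integral_pushforward _ _ _ _ R _ mc ((@lebesgue_measure R) \x (lebm n))%E setT
  (EFin \o f).
rewrite preimage_setT => H; rewrite /Rintegral; congr fine; apply: H => //.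
  by case/integrableP : i.
exact: Int_lebmS.
Qed.

Definition box n (B : R) : set 'cV[R]_n := [set z | forall i, `|z i 0| <= B].

Lemma box_consv n B : box B = @unconsv R n @^-1` ([set x | `|x| <= B] `*` box B).
Proof.
apply/seteqP; split=> z; rewrite /box /unconsv /=.
  by move=> h; split=> // i; rewrite mxE.
by move=> [h0 h1]; elim/forall_ordS => // i; have := h1 i; rewrite mxE.
Qed.

Lemma normle_itv (B : R) : [set x : R | `|x| <= B] = `[- B, B]%classic.
Proof. by apply/seteqP; split=> x /=; rewrite in_itv /= ler_norml. Qed.

Lemma lebesgue_normle (B : R) : 0 <= B ->
  lebesgue_measure [set x : R | `|x| <= B] = (2 * B)%:E.
Proof.
move=> B0; rewrite normle_itv lebesgue_measure_itv /= lte_fin.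
case: ltP => [_|h]; first by rewrite -EFinD; congr EFin; ring.
by have -> : B = 0 by [apply/eqP; rewrite eq_le B0 andbT; lra|]; rewrite mulr0.
Qed.

Lemma measurable_box n B : measurable (box B : set (@borel R n)).
Proof.
elim: n => [|n IH].
  have -> : box B = [set: 'cV[R]_0] by apply/seteqP; split=> // z _ [].
  exact: measurableT.
rewrite box_consv -[X in measurable X]setTI; apply: measurable_unconsv => //.
by apply: measurableX => //; rewrite normle_itv.
Qed.

Lemma lebm_box n B : 0 <= B -> lebm n (box B) = ((2 * B) ^+ n)%:E.
Proof.
move=> B0; elim: n => [|n IH].
  have -> : box B = [set: 'cV[R]_0] by apply/seteqP; split=> // z _ [].
  by rewrite /= diracT expr0.
rewrite /= /lebS box_consv (_ : _ @^-1` _ = [set x | `|x| <= B] `*` box B).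
  rewrite product_measure1E//; last 2 first.
    by rewrite normle_itv.
    exact: measurable_box.
  rewrite IH; transitivity ((2 * B)%:E * ((2 * B) ^+ n)%:E)%E.
    by congr (_ * _)%E; exact: lebesgue_normle.
  by rewrite -EFinM -exprS.
by apply/funext => x; rewrite /preimage /mkset consvK.
Qed.

Lemma lebm_box_fin n B : (lebm n (box B) < +oo)%E.
Proof.
apply: (@le_lt_trans _ _ (lebm n (box (Num.max B 0)))).
  apply: le_measure; rewrite ?inE; try exact: measurable_box.
  by move=> z h i; rewrite le_max h.
by rewrite lebm_box ?ltry// le_max lexx orbT.
Qed.

Lemma lebesgue_itv_fin (a b : R) : (lebesgue_measure `[a, b]%classic < +oo)%E.
Proof.
by rewrite lebesgue_measure_itv /= lte_fin; case: ifP => _; rewrite ?ltry// -EFinD ltry.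
Qed.

Definition bsupp n (B : R) (f : 'cV[R]_n -> R) :=
  forall (z : 'cV[R]_n) i, B < `|z i 0| -> f z = 0.

Lemma Int_bsupp n (f : 'cV[R]_n -> R) B M :
  measurable_fun [set: @borel R n] (f : @borel R n -> R) ->
  (forall z, `|f z| <= M) -> bsupp B f -> Int (lebm n) f.
Proof.
move=> mf fM fB.
have M0 : 0 <= M by apply: le_trans (fM 0).
pose B' := Num.max B 0.
apply: (@Int_le _ _ _ _ _ (fun z => M * \1_(box B' : set (@borel R n)) z)) => //.
  apply: IntZ; apply: Int_indic; first exact: measurable_box.
  exact: lebm_box_fin.
move=> z; rewrite indicE; case: (pselect (box B' z)) => [h|h].
  by rewrite mem_set// mulr1.
have [i hi] : exists i, B' < `|z i 0|.
  by apply/not_existsP => h'; apply: h => i; rewrite leNgt; apply/negP.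
rewrite (fB z i) ?normr0 ?mulr_ge0// (le_lt_trans _ hi)// /B' le_max lexx//.
Qed.

(** A class that is closed under fixing a coordinate and integrable on every slice, not only on
    almost every one; both orders of Fubini then hold with pointwise equalities. *)
Definition bfun n (f : 'cV[R]_n -> R) :=
  measurable_fun [set: @borel R n] (f : @borel R n -> R) /\
  exists M B, (forall z, `|f z| <= M) /\ bsupp B f.

Lemma bfun_Int n (f : 'cV[R]_n -> R) : bfun f -> Int (lebm n) f.
Proof. by move=> [mf [M [B [fM fB]]]]; exact: Int_bsupp fM fB. Qed.

Lemma measurable_consv1 n (x : R) :
  measurable_fun [set: @borel R n] (fun y : @borel R n => consv (x, y) : @borel R n.+1).
Proof.
by apply: (measurableT_comp (@measurable_consv R n)); exact: pair1_measurable.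
Qed.

Lemma measurable_consv2 n (y : 'cV[R]_n) :
  measurable_fun [set: measurableTypeR R] (fun x => consv (x, y) : @borel R n.+1).
Proof.
by apply: (measurableT_comp (@measurable_consv R n)); exact: pair2_measurable.
Qed.

Lemma bfun_consv1 n (f : 'cV[R]_n.+1 -> R) x : bfun f -> bfun (fun y => f (consv (x, y))).
Proof.
move=> [mf [M [B [fM fB]]]]; split.
  exact: (measurableT_comp mf (measurable_consv1 x)).
exists M, B; split=> // y i hi.
by apply: (fB _ (lift 0 i)); rewrite consvS.
Qed.

Lemma bfun_consv2 n (f : 'cV[R]_n.+1 -> R) y : bfun f ->
  Int (@lebesgue_measure R) (fun x => f (consv (x, y))).
Proof.
move=> [mf [M [B [fM fB]]]].
have M0 : 0 <= M by apply: le_trans (fM 0).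
apply: (@Int_le _ _ _ _ _ (fun x => M * \1_(`[- B, B]%classic : set (measurableTypeR R)) x)) => //.
  exact: (measurableT_comp mf (measurable_consv2 y)).
  apply: IntZ; apply: Int_indic => //.
  exact: lebesgue_itv_fin.
move=> x; rewrite indicE -normle_itv; case: (leP `|x| B) => [h|h].
  by rewrite mem_set// mulr1.
by rewrite (fB _ 0) ?normr0 ?mulr_ge0// consv0.
Qed.

Lemma rint_fubini1 n (f : 'cV[R]_n.+1 -> R) : bfun f ->
  \int[lebm n.+1]_z f z = \int[@lebesgue_measure R]_x \int[lebm n]_y f (consv (x, y)).
Proof.
move=> bf; have i := bfun_Int bf.
rewrite rint_lebmS// rfubini1//; first exact: Int_lebmS.
by move=> x; apply: bfun_Int; exact: bfun_consv1.
Qed.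

Lemma rint_fubini2 n (f : 'cV[R]_n.+1 -> R) : bfun f ->
  \int[lebm n.+1]_z f z = \int[lebm n]_y \int[@lebesgue_measure R]_x f (consv (x, y)).
Proof.
move=> bf; have i := bfun_Int bf.
rewrite rint_lebmS// rfubini2//; first exact: Int_lebmS.
by move=> y; exact: bfun_consv2.
Qed.

Lemma Int_consv1 n (f : 'cV[R]_n.+1 -> R) : bfun f ->
  Int (@lebesgue_measure R) (fun x => \int[lebm n]_y f (consv (x, y))).
Proof.
move=> bf; have := @Int_fubini1 _ _ _ _ R (@lebesgue_measure R) (lebm n) (f \o @consv R n).
apply; first by apply: Int_lebmS; exact: bfun_Int.
by move=> x; apply: bfun_Int; exact: bfun_consv1.
Qed.

Lemma Int_consv2 n (f : 'cV[R]_n.+1 -> R) : bfun f ->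
  Int (lebm n) (fun y => \int[@lebesgue_measure R]_x f (consv (x, y))).
Proof.
move=> bf; have := @Int_fubini2 _ _ _ _ R (@lebesgue_measure R) (lebm n) (f \o @consv R n).
apply; first by apply: Int_lebmS; exact: bfun_Int.
by move=> y; exact: bfun_consv2.
Qed.

End LebIntegral.

(** * Smooth functions of one variable *)

Section DerivativeSequences.
Context {R : realType}.
Implicit Types (f g h : nat -> R -> R) (K l : nat) (x : R).

(** A function is carried together with an explicit list of its derivatives up to order K, so that
    bounds can be proved on formulas instead of on iterated limits. *)
Definition dseq K f := forall l x, (l < K)%N -> is_derive x (1 : R) (f l) (f l.+1 x).

Lemma dseq_le K K' f : (K' <= K)%N -> dseq K f -> dseq K' f.
Proof. by move=> KK df l x lK; apply: df; exact: leq_trans lK KK. Qed.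

Lemma dseqS K f : dseq K.+1 f -> dseq K (fun l => f l.+1).
Proof. by move=> df l x lK; exact: df. Qed.

Lemma dseq_cont K f l x : dseq K f -> (l < K)%N -> {for x, continuous (f l)}.
Proof.
move=> df lK; apply: differentiable_continuous; apply/derivable1_diffP.
by have [] := df l x lK.
Qed.

Lemma is_derive_affine (f : R -> R) (df a b x : R) : is_derive (a * x + b) 1 f df ->
  is_derive x 1 (fun s => f (a * s + b)) (a * df).
Proof.
move=> fd; have H : is_derive x (1 : R) (fun s => a * s + b) a.
  by apply: is_derive_eq; rewrite addr0 /GRing.scale /= mulr1.
have := @is_derive1_comp _ f (fun s => a * s + b) x df a fd H.
by rewrite mulrC.
Qed.

Lemma dseq_affine K f a b : dseq K f -> dseq K (fun l s => a ^+ l * f l (a * s + b)).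
Proof.
move=> df l x lK; rewrite exprSr -mulrA.
have := is_derive_affine (df l (a * x + b) lK).
move=> H; have := @is_deriveZ _ _ _ _ (a ^+ l) x 1 _ H.
by [].
Qed.

Lemma dseqZ K c f : dseq K f -> dseq K (fun l s => c * f l s).
Proof. by move=> df l x lK; exact: (@is_deriveZ _ _ _ (f l) c x 1 _ (df l x lK)). Qed.

(** Leibniz' rule without collecting equal terms: the l-th derivative is a sum of [2 ^+ l] products,
    which is where the factor [2 ^+ l] in all later bounds comes from. *)
Fixpoint mulseq l f g : R -> R := match l with
  | 0 => fun x => f 0 x * g 0 x
  | l'.+1 => fun x => mulseq l' (fun i => f i.+1) g x + mulseq l' f (fun i => g i.+1) x
  end.

Lemma dseq_mul K f g : dseq K f -> dseq K g -> dseq K (fun l => mulseq l f g).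
Proof.
move=> + + l; elim: l K f g => [|l IH] K f g df dg x lK /=.
  have := @is_deriveM _ _ (f 0) (g 0) x 1 _ _ (df 0 x lK) (dg 0 x lK).
  move=> H; apply: is_derive_eq H _.
  by rewrite /GRing.scale /= addrC mulrC.
case: K lK df dg => // K lK df dg.
have H1 := IH K _ _ (dseqS df) (dseq_le (leqnSn K) dg) x lK.
have H2 := IH K _ _ (dseq_le (leqnSn K) df) (dseqS dg) x lK.
exact: (@is_deriveD _ _ _ _ _ x 1 _ _ H1 H2).
Qed.

Lemma mulseq_bound l f g x a b r : 0 <= a -> 0 <= b -> 0 <= r ->
  (forall i, (i <= l)%N -> `|f i x| <= a * r ^+ i) ->
  (forall i, (i <= l)%N -> `|g i x| <= b * r ^+ i) ->
  `|mulseq l f g x| <= 2 ^+ l * (a * b) * r ^+ l.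
Proof.
move=> + + r0; elim: l f g a b => [|l IH] f g a b a0 b0 fa gb /=.
  rewrite normrM expr0 mulr1 mul1r; apply: ler_pM => //.
    by have := fa 0 isT; rewrite expr0 mulr1.
  by have := gb 0 isT; rewrite expr0 mulr1.
rewrite (le_trans (ler_normD _ _))//.
have H1 : `|mulseq l (fun i => f i.+1) g x| <= 2 ^+ l * (a * r * b) * r ^+ l.
  apply: IH => //; first exact: mulr_ge0.
    by move=> i il; have := fa i.+1 il; rewrite exprS mulrA.
  by move=> i il; apply: gb; exact: leq_trans il _.
have H2 : `|mulseq l f (fun i => g i.+1) x| <= 2 ^+ l * (a * (b * r)) * r ^+ l.
  apply: IH => //; first exact: mulr_ge0.
    by move=> i il; apply: fa; exact: leq_trans il _.
  by move=> i il; have := gb i.+1 il; rewrite exprS mulrA.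
apply: le_trans (lerD H1 H2) _.
by rewrite le_eqVlt; apply/orP; left; apply/eqP; rewrite !exprS; ring.
Qed.

(* [trigseq a b c l] lists the derivatives of order l, l, l-1, l-1 of cos P, sin P,
   cos P, sin P where P s = a s^2 + b s + c; as P''' = 0, Leibniz' rule for
   (cos P)' = - P' sin P has only two terms. *)
Fixpoint trigseq (a b c : R) l : R -> R * R * (R * R) := match l with
  | 0 => fun x => (cos (a * x ^+ 2 + b * x + c), sin (a * x ^+ 2 + b * x + c), (0, 0))
  | l'.+1 => fun x => let: (C, D, (C', D')) := trigseq a b c l' x in
      (- ((2 * a * x + b) * D + l'%:R * (2 * a) * D'),
       (2 * a * x + b) * C + l'%:R * (2 * a) * C', (C, D))
  end.

Definition cosseq a b c l x := (trigseq a b c l x).1.1.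

Lemma trigseqS a b c l x :
  (trigseq a b c l.+1 x).1.1 = - ((2 * a * x + b) * (trigseq a b c l x).1.2 +
     l%:R * (2 * a) * (trigseq a b c l x).2.2) /\
  (trigseq a b c l.+1 x).1.2 = (2 * a * x + b) * (trigseq a b c l x).1.1 +
     l%:R * (2 * a) * (trigseq a b c l x).2.1 /\
  (trigseq a b c l.+1 x).2 = (trigseq a b c l x).1.
Proof. by rewrite /=; case: (trigseq a b c l x) => [[? ?] [? ?]]. Qed.

Lemma trigseq_derive a b c l x :
  [/\ is_derive x (1:R) (fun y => (trigseq a b c l y).1.1) (trigseq a b c l.+1 x).1.1,
      is_derive x (1:R) (fun y => (trigseq a b c l y).1.2) (trigseq a b c l.+1 x).1.2,
      is_derive x (1:R) (fun y => l%:R * (2 * a) * (trigseq a b c l y).2.1)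
        (l%:R * (2 * a) * (trigseq a b c l x).1.1) &
      is_derive x (1:R) (fun y => l%:R * (2 * a) * (trigseq a b c l y).2.2)
        (l%:R * (2 * a) * (trigseq a b c l x).1.2)].
Proof.
have dl y : is_derive y (1:R) (fun z => 2 * a * z + b) (2 * a).
  by apply: is_derive_eq; rewrite addr0 /GRing.scale /= mulr1.
elim: l => [|l [IH1 IH2 IH3 IH4]].
  have dP : is_derive x (1:R) (fun y => a * y ^+ 2 + b * y + c) (2 * a * x + b).
    by apply: is_derive_eq; rewrite /GRing.scale /=; ring.
  split.
  - have := @is_derive1_comp _ cos (fun y => a * y ^+ 2 + b * y + c) x _ _ (is_derive_cos _) dP.
    by move=> H; apply: is_derive_eq H _; rewrite /=; ring.
  - have := @is_derive1_comp _ sin (fun y => a * y ^+ 2 + b * y + c) x _ _ (is_derive_sin _) dP.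
    by move=> H; apply: is_derive_eq H _; rewrite /=; ring.
  - rewrite (_ : (fun _ => _) = cst 0) ?mul0r; last by apply/funext => y; rewrite !mul0r.
    exact: is_derive_cst.
  - rewrite (_ : (fun _ => _) = cst 0) ?mul0r; last by apply/funext => y; rewrite !mul0r.
    exact: is_derive_cst.
have E y := trigseqS a b c l y.
have E1 y := trigseqS a b c l.+1 y.
have F1 : (fun y => (trigseq a b c l.+1 y).1.1) = (fun y => - ((2 * a * y + b) * (trigseq a b c l y).1.2 +
     l%:R * (2 * a) * (trigseq a b c l y).2.2)) by apply/funext => y; case: (E y).
have F2 : (fun y => (trigseq a b c l.+1 y).1.2) = (fun y => (2 * a * y + b) * (trigseq a b c l y).1.1 +
     l%:R * (2 * a) * (trigseq a b c l y).2.1) by apply/funext => y; case: (E y) => _ [].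
have F3 : (fun y => (l.+1)%:R * (2 * a) * (trigseq a b c l.+1 y).2.1) = (fun y => (l.+1)%:R * (2 * a) * (trigseq a b c l y).1.1).
  by apply/funext => y; case: (E y) => _ [_ ->].
have F4 : (fun y => (l.+1)%:R * (2 * a) * (trigseq a b c l.+1 y).2.2) = (fun y => (l.+1)%:R * (2 * a) * (trigseq a b c l y).1.2).
  by apply/funext => y; case: (E y) => _ [_ ->].
split.
- rewrite F1; case: (E1 x) => -> [_ _]; case: (E x) => _ [_ ->].
  have H := @is_deriveM _ _ _ _ x 1 _ _ (dl x) IH2.
  have H' := @is_deriveN _ _ _ _ x 1 _ (@is_deriveD _ _ _ _ _ x 1 _ _ H IH4).
  by apply: is_derive_eq H' _; rewrite /GRing.scale [X in X = _]/= -natr1; ring.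
- rewrite F2; case: (E1 x) => _ [-> _]; case: (E x) => _ [_ ->].
  have H := @is_deriveM _ _ _ _ x 1 _ _ (dl x) IH1.
  have H' := @is_deriveD _ _ _ _ _ x 1 _ _ H IH3.
  by apply: is_derive_eq H' _; rewrite /GRing.scale [X in X = _]/= -natr1; ring.
- by rewrite F3; exact: (@is_deriveZ _ _ _ _ _ x 1 _ IH1).
- by rewrite F4; exact: (@is_deriveZ _ _ _ _ _ x 1 _ IH2).
Qed.

Lemma dseq_cos a b c K : dseq K (cosseq a b c).
Proof. by move=> l x _; case: (trigseq_derive a b c l x). Qed.

Lemma cosseq0 a b c x : cosseq a b c 0 x = cos (a * x ^+ 2 + b * x + c).
Proof. by []. Qed.

Lemma trigseq_bound a b c l x t : `|2 * a * x + b| <= t -> `|2 * a| <= t ^+ 2 ->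
  `|(trigseq a b c l x).1.1| <= l.+1`!%:R * t ^+ l /\
  `|(trigseq a b c l x).1.2| <= l.+1`!%:R * t ^+ l.
Proof.
move=> h1 h2; have t0 : 0 <= t by apply: le_trans h1.
(* The lower order terms enter the recursion multiplied by [l]. Bounding them with that factor makes
   the case [l = 0], where they hold the default value 0, fit the induction. *)
suff : [/\ `|(trigseq a b c l x).1.1| <= l.+1`!%:R * t ^+ l,
  `|(trigseq a b c l x).1.2| <= l.+1`!%:R * t ^+ l,
  l%:R * t * `|(trigseq a b c l x).2.1| <= (l * l`!)%:R * t ^+ l &
  l%:R * t * `|(trigseq a b c l x).2.2| <= (l * l`!)%:R * t ^+ l] by case.
elim: l => [|l [A B C D]].
  rewrite /= !mul0r !expr0 !mulr1 factS fact0 muln1 cos_max; split=> //.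
  exact: sin_max.
have [E1 [E2 E3]] := trigseqS a b c l x.
have key (u v : R) : `|u| <= l.+1`!%:R * t ^+ l -> l%:R * t * `|v| <= (l * l`!)%:R * t ^+ l ->
    `|2 * a * x + b| * `|u| + l%:R * `|2 * a| * `|v| <= l.+2`!%:R * t ^+ l.+1.
  move=> hu hv.
  have a1 : `|2 * a * x + b| * `|u| <= t * (l.+1`!%:R * t ^+ l) by apply: ler_pM.
  have a2 : l%:R * `|2 * a| * `|v| <= t * ((l * l`!)%:R * t ^+ l).
    apply: (@le_trans _ _ (t * (l%:R * t * `|v|))); last exact: ler_wpM2l.
    rewrite mulrA (mulrCA t) -expr2.
    by apply: ler_wpM2r => //; apply: ler_wpM2l.
  apply: le_trans (lerD a1 a2) _.
  rewrite (_ : _ + _ = (l.+1`! + l * l`!)%:R * t ^+ l.+1); last by rewrite natrD exprS; ring.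
  apply: ler_wpM2r; first exact: exprn_ge0.
  rewrite ler_nat (factS l.+1) mulSn leq_add2l leq_mul//.
  by rewrite factS leq_pmull.
have nf (u v : R) : `|2 * a * x + b| * `|u| + l%:R * `|2 * a| * `|v| =
   `|(2 * a * x + b) * u| + `|l%:R * (2 * a) * v| by rewrite (normrM (2 * a * x + b)) (normrM (l%:R * (2 * a))) (normrM l%:R) normr_nat.
split.
- rewrite E1 normrN (le_trans (ler_normD _ _))// -nf; exact: key.
- rewrite E2 (le_trans (ler_normD _ _))// -nf; exact: key.
- rewrite E3 exprS natrM -!mulrA; apply: ler_wpM2l => //.
  by rewrite mulrCA; apply: ler_wpM2l.
- rewrite E3 exprS natrM -!mulrA; apply: ler_wpM2l => //.
  by rewrite mulrCA; apply: ler_wpM2l.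
Qed.

Lemma cosseq_bound a b c l x t : `|2 * a * x + b| <= t -> `|2 * a| <= t ^+ 2 ->
  `|cosseq a b c l x| <= l.+1`!%:R * t ^+ l.
Proof. by move=> h1 h2; case: (trigseq_bound c l h1 h2). Qed.

Lemma MVT_dseq (f df : R -> R) a b : a < b -> (forall x, is_derive x (1:R) f (df x)) ->
  exists2 c, a <= c <= b & f b - f a = df c * (b - a).
Proof.
move=> ab fd; have [|c cab E] := MVT_segment (ltW ab) (f := f) (df := df).
  apply: continuous_subspaceT => x; apply: differentiable_continuous.
  by apply/derivable1_diffP; have [] := fd x.
by exists c => //; move: cab; rewrite in_itv.
Qed.

End DerivativeSequences.

Section EulerMaclaurin.
Context {R : realType}.
Notation mu := (@lebesgue_measure R).

(** If F is a primitive of u, then [S s], the sum of the F(i - N + s), satisfies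
    [S 1 - S 0 = F(N) - F(-N)] by telescoping, and the mean value theorem evaluates this difference
    as a shifted lattice sum. *)
Lemma int_mean (u : R -> R) N : (0 < N)%N -> continuous u ->
  exists2 c : R, 0 <= c <= 1 &
  \int[mu]_(x in `[- N%:R, N%:R]) u x = \sum_(i < N.*2) u (i%:R - N%:R + c).
Proof.
move=> N0 cu.
(* The primitive starts one unit to the left of [- N], so that it is differentiable at [- N] as
   well. *)
pose a : R := - N%:R - 1.
pose F x := \int[mu]_(t in `[a, x]) u t.
have iu b c : mu.-integrable `[b, c] (EFin \o u).
  by apply: continuous_compact_integrable; [exact: segment_compact|exact: continuous_subspaceT].
have dF x : a < x -> is_derive x (1:R) F (u x).
  move=> ax; have [] := @continuous_FTC1 _ u (BLeft a) x (x + 1) _ (iu _ _) ax (cu x).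
    by rewrite ltrDl.
  by move=> h1 h2; apply: DeriveDef; [exact: h1|rewrite -derive1E].
pose S (s : R) := \sum_(i < N.*2) F (i%:R - N%:R + s).
have bnd i (s : R) : 0 <= s -> a < i%:R - N%:R + s.
  by move=> s0; rewrite /a; have : (0 : R) <= i%:R by []; lra.
have dS (s : R) : 0 <= s -> is_derive s (1:R) S (\sum_(i < N.*2) u (i%:R - N%:R + s)).
  move=> s0; rewrite (_ : S = \sum_(i < N.*2) (fun s => F (i%:R - N%:R + s))); last first.
    by apply/funext => y; rewrite /S fct_sumE.
  apply: is_derive_sum => i.
  have := @is_derive_affine _ F (u (i%:R - N%:R + s)) 1 (i%:R - N%:R) s.
  rewrite !mul1r => H.
  rewrite (_ : (fun s0 => _) = (fun s0 => F (1 * s0 + (i%:R - N%:R)))); last first.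
    by apply/funext => y; rewrite mul1r addrC.
  by apply: H; rewrite addrC; apply: dF; exact: bnd.
have [c c01 E] : exists2 c : R, c \in `[0, 1] & S 1 - S 0 = (\sum_(i < N.*2) u (i%:R - N%:R + c)) * (1 - 0).
  apply: MVT_segment => //.
    by move=> x; rewrite in_itv /= => /andP[/ltW x0 _]; exact: dS.
  apply: derivable_within_continuous => x; rewrite in_itv /= => /andP[x0 _].
  by have [] := dS x x0.
exists c => //.
rewrite subr0 mulr1 in E; rewrite -E /S.
have -> : \sum_(i < N.*2) F (i%:R - N%:R + 1) = \sum_(i < N.*2) F (i.+1%:R - N%:R).
  by apply: eq_bigr => i _; congr F; rewrite -natr1; ring.
have -> : \sum_(i < N.*2) F (i%:R - N%:R + 0) = \sum_(i < N.*2) F (i%:R - N%:R).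
  by apply: eq_bigr => i _; rewrite addr0.
rewrite -sumrB.
rewrite -(big_mkord xpredT (fun i => F (i.+1%:R - N%:R) - F (i%:R - N%:R))).
rewrite (telescope_sumr (fun i => F (i%:R - N%:R)))//.
rewrite (_ : N.*2%:R - N%:R = N%:R); last by rewrite -addnn natrD; ring.
rewrite sub0r /F.
have := @Rintegral_itvB R u (BLeft a) (BRight N%:R) (- N%:R).
move=> -> //.
- rewrite Rintegral_itv_obnd_cbnd//.
  by apply: (integrableS _ _ _ (iu (- N%:R) N%:R)) => //; exact: subset_itv_oc_cc.
- by rewrite bnd_simp /a; lra.
- by rewrite bnd_simp; have : (0 : R) <= N%:R by []; lra.
Qed.

(* The 1-periodic function s |-> sum_n u (n + s) - int u has a zero by the mean value
   theorem, and so do all its derivatives; hence it is bounded by any one of them. *)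
Lemma euler_maclaurin (g : nat -> R -> R) (N K : nat) (E : R) : (0 < N)%N ->
  dseq K.+1 g -> (forall l x, (l <= K)%N -> N%:R <= `|x| -> g l x = 0) ->
  (forall s : R, 0 <= s <= 1 -> \sum_(i < N.*2) `|g K.+1 (i%:R - N%:R + s)| <= E) ->
  `|\sum_(i < N.*2) g 0 (i%:R - N%:R) - \int[mu]_(x in `[- N%:R, N%:R]) g 0 x| <= E.
Proof.
move=> N0 dg g0 hE.
pose S l (s : R) := \sum_(i < N.*2) g l (i%:R - N%:R + s).
have dS l (s : R) : (l <= K)%N -> is_derive s (1:R) (S l) (S l.+1 s).
  move=> lK; rewrite (_ : S l = \sum_(i < N.*2) (fun s => g l (i%:R - N%:R + s))); last first.
    by apply/funext => y; rewrite /S fct_sumE.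
  apply: is_derive_sum => i.
  have := @is_derive_affine _ (g l) (g l.+1 (i%:R - N%:R + s)) 1 (i%:R - N%:R) s.
  rewrite !mul1r => H.
  rewrite (_ : (fun s0 => _) = (fun s0 => g l (1 * s0 + (i%:R - N%:R)))); last first.
    by apply/funext => y; rewrite mul1r addrC.
  by apply: H; rewrite addrC; exact: dg.
have S01 l : (l <= K)%N -> S l 1 = S l 0.
  move=> lK; apply/eqP; rewrite -subr_eq0 /S -sumrB.
  rewrite (eq_bigr (fun i : 'I_(N.*2) => g l (i.+1%:R - N%:R) - g l (i%:R - N%:R))); last first.
    by move=> i _; rewrite addr0 -natr1; congr (g l _ - _); ring.
  rewrite -(big_mkord xpredT (fun i => g l (i.+1%:R - N%:R) - g l (i%:R - N%:R))).
  rewrite (telescope_sumr (fun i => g l (i%:R - N%:R)))//.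
  by rewrite !g0 ?subr0// ?sub0r ?normrN ?normr_nat// -addnn natrD addrK normr_nat.
have osc l (s s' v : R) : (l <= K)%N -> 0 <= s <= 1 -> 0 <= s' <= 1 ->
    (forall t, 0 <= t <= 1 -> `|S l.+1 t| <= v) -> `|S l s - S l s'| <= v.
  move=> lK; wlog ss' : s s' / s <= s'.
    move=> H hs hs' hv; have [/H|/ltW/H] := leP s s'; first exact.
    by rewrite distrC; apply.
  move=> hs hs' hv; move: ss'; rewrite le_eqVlt => /orP[/eqP ->|ss'].
    rewrite subrr normr0; apply: le_trans (hv 0 _) => //.
    by rewrite lexx ler01.
  have [c hc ec] := MVT_dseq ss' (fun x => dS l x lK).
  rewrite distrC ec normrM (ger0_norm (_ : 0 <= s' - s)); last by rewrite subr_ge0 ltW.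
  rewrite -[leRHS]mulr1; apply: ler_pM => //; first by rewrite subr_ge0 ltW.
    by apply: hv; lra.
  by lra.
(* The index descends from the derivative bounded by hypothesis. Since the next lower function takes
   equal values at 0 and 1, the mean value theorem gives a point [c] where the current one vanishes,
   and its oscillation bounds it. *)
have bd j (s : R) : (j <= K)%N -> 0 <= s <= 1 -> `|S (K.+1 - j)%N s| <= E.
  elim: j s => [|j IH] s jK hs.
    rewrite subn0; apply: le_trans (hE s hs).
    exact: ler_norm_sum.
  have lK : (K - j <= K)%N by exact: leq_subr.
  have [c hc ec] := MVT_dseq (@ltr01 R) (fun x => dS (K - j.+1)%N x (leq_subr _ _)).
  have Sc : S (K - j)%N c = 0.
    move: ec; rewrite S01 ?leq_subr// subrr subr0 mulr1 => /esym.
    by rewrite (_ : (K - j.+1).+1 = K - j)%N; [|lia].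
  rewrite subSS -(subr0 (S _ s)) -Sc; apply: osc => //.
  by move=> t ht; rewrite (_ : (K - j).+1 = K.+1 - j)%N; [apply: IH => //; lia|lia].
have cu : continuous (g 0) by move=> x; exact: dseq_cont dg _.
(* The integral is itself a value of the periodic sum, so what remains is one more oscillation. *)
have [c hc ->] := int_mean N0 cu.
have -> : \sum_(i < N.*2) g 0 (i%:R - N%:R) = S 0 0 by apply: eq_bigr => i _; rewrite addr0.
apply: osc => //; first by rewrite lexx ler01.
by move=> t ht; have := bd K t (leqnn _) ht; rewrite subSnn.
Qed.

End EulerMaclaurin.

(** * Lattice sums and Riemann sums *)

Section LatticeSums.
Context {R : realType}.
Implicit Types (n N : nat).

Definition irange N : seq int := [seq i%:Z - N%:Z | i <- iota 0 N.*2].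

Lemma irange_uniq N : uniq (irange N).
Proof. by rewrite map_inj_uniq ?iota_uniq// => i j /addIr []. Qed.

Lemma mem_irange N (k : int) : (k \in irange N) = (- N%:Z <= k < N%:Z).
Proof.
apply/mapP/idP => [[i]|h].
  by rewrite mem_iota => /andP[_]; rewrite add0n -addnn => iN ->; lia.
exists (absz (k + N%:Z)); last by lia.
by rewrite mem_iota -addnn; lia.
Qed.

Lemma big_irange N (F : int -> R) :
  \sum_(k <- irange N) F k = \sum_(i < N.*2) F (i%:Z - N%:Z).
Proof. by rewrite /irange big_map -{1}(subn0 N.*2) big_mkord. Qed.

Definition consz n (i : int) (b : 'cV[int]_n) : 'cV[int]_n.+1 := col_mx (i%:M : 'cV_1) b.

Definition zR n (b : 'cV[int]_n) : 'cV[R]_n := map_mx intr b.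

Lemma consz0 n i (b : 'cV[int]_n) : consz i b 0 0 = i.
Proof.
rewrite /consz (_ : (0 : 'I_n.+1) = lshift n (0 : 'I_1)); last exact: val_inj.
by rewrite (col_mxEu (i%:M : 'cV_1)) mxE eqxx mulr1n.
Qed.

Lemma conszS n i (b : 'cV[int]_n) j : consz i b (lift 0 j) 0 = b j 0.
Proof.
rewrite /consz (_ : lift 0 j = rshift 1 j); last exact: val_inj.
by rewrite (col_mxEd (i%:M : 'cV_1)).
Qed.

Lemma zR_consz n i (b : 'cV[int]_n) : zR (consz i b) = consv (i%:~R, zR b).
Proof.
apply/matrixP => k l; rewrite ord1 mxE; elim/forall_ordS : k => [|k].
  by rewrite consz0 consv0.
by rewrite conszS consvS mxE.
Qed.

Fixpoint zbox N n : seq 'cV[int]_n := match n with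
  | 0 => [:: 0]
  | n'.+1 => [seq consz i b | i <- irange N, b <- zbox N n']
  end.

Lemma mem_zbox N n (b : 'cV[int]_n) :
  (b \in zbox N n) = [forall i, - N%:Z <= b i 0 < N%:Z].
Proof.
elim: n b => [|n IH] b.
  rewrite /= inE; transitivity true; first by apply/eqP/matrixP => -[].
  by apply/esym/forallP => -[].
apply/allpairsP/forallP => [[[i y] /= [iN yN ->]] k|h].
  elim/forall_ordS : k => [|k]; first by rewrite consz0 -mem_irange.
  by rewrite conszS; move: yN; rewrite IH => /forallP.
exists (b 0 0, \col_i b (lift 0 i) 0); split=> /=.
- by rewrite mem_irange.
- by rewrite IH; apply/forallP => i; rewrite mxE.
apply/matrixP => k l; rewrite ord1; elim/forall_ordS : k => [|k].
  by rewrite consz0.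
by rewrite conszS mxE.
Qed.

Lemma zbox_uniq N n : uniq (zbox N n).
Proof.
elim: n => [//|n IH] /=; apply: allpairs_uniq => //; first exact: irange_uniq.
move=> [i y] [j z] _ _ /= /matrixP e; congr pair.
  by have := e 0 0; rewrite !consz0.
by apply/matrixP => k l; rewrite ord1; have := e (lift 0 k) 0; rewrite !conszS.
Qed.

Lemma big_zboxS N n (F : 'cV[int]_n.+1 -> R) :
  \sum_(b <- zbox N n.+1) F b = \sum_(i <- irange N) \sum_(b <- zbox N n) F (consz i b).
Proof. by rewrite /= big_allpairs_dep. Qed.

Lemma sum_supp (T : eqType) (s s' : seq T) (F : T -> R) : uniq s -> uniq s' ->
  (forall x, F x != 0 -> (x \in s) = (x \in s')) -> \sum_(x <- s) F x = \sum_(x <- s') F x.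
Proof.
move=> us us' h.
have E (r : seq T) : \sum_(x <- r) F x = \sum_(x <- [seq x <- r | F x != 0]) F x.
  rewrite big_filter [LHS](bigID (fun x => F x != 0)) /= [X in _ + X]big1 ?addr0//.
  by move=> x /negPn/eqP.
rewrite E [RHS]E; apply: perm_big; apply: uniq_perm; rewrite ?filter_uniq//.
move=> x; rewrite !mem_filter; case: eqVneq => //= Fx.
by rewrite h.
Qed.

End LatticeSums.

Section RiemannSum.
Context {R : realType}.
Notation mu := (@lebesgue_measure R).
Implicit Types (n N : nat).

Definition pbox n N (beta : 'I_n -> R -> R) (z : 'cV[R]_n) : R :=
  \prod_i (beta i (z i 0) * \1_[set x : R | `|x| <= N%:R] (z i 0)).

Lemma bfun_pbox n N (beta : 'I_n -> R -> R) :
  (forall i, continuous (beta i)) -> (forall i x, 0 <= beta i x <= 1) -> bfun (pbox N beta).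
Proof.
move=> cb b01; split.
  apply: measurable_prod => i _; apply: measurable_funM.
    apply: (measurableT_comp (continuous_measurable_fun (cb i))).
    exact: (@measurable_continuousR R n (fun z => z i 0) (@continuous_coord R n i)).
  have mi : measurable_fun [set: R] (\1_[set x : R | `|x| <= N%:R] : R -> R).
    by apply: measurable_indic; rewrite normle_itv.
  apply: (measurableT_comp mi).
  exact: (@measurable_continuousR R n (fun z => z i 0) (@continuous_coord R n i)).
have ind (x : R) : (0 : R) <= (\1_[set x : R | `|x| <= N%:R] x : R) <= 1.
  by rewrite indicE; case: (_ \in _); rewrite ?ler01 ?lexx.
exists 1, N%:R; split=> [z|z i zi].
  rewrite ger0_norm; last first.
    by apply: prodr_ge0 => i _; rewrite mulr_ge0//; case/andP: (b01 i (z i 0)).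
  apply: prodr_ile1 => i _.
  case/andP: (b01 i (z i 0)) => a1 a2; case/andP: (ind (z i 0)) => a3 a4.
  by rewrite mulr_ge0//= mulr_ile1.
rewrite /pbox (bigD1 i)//= indicE memNset ?mulr0 ?mul0r//=.
by apply/negP; rewrite -ltNge.
Qed.

Lemma rint_restrict N (u : R -> R) : (forall x, N%:R < `|x| -> u x = 0) ->
  \int[mu]_x u x = \int[mu]_(x in `[- N%:R, N%:R]) u x.
Proof.
move=> h; rewrite [RHS]Rintegral_mkcond; apply: eq_Rintegral => x _.
rewrite patchE -normle_itv; case: ifPn => // /negP hx; apply: h.
by rewrite ltNge; apply/negP => h'; apply: hx; rewrite inE.
Qed.

Lemma rint_lebm0 (G : 'cV[R]_0 -> R) : \int[lebm 0]_z G z = G 0.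
Proof.
rewrite (@eq_Rintegral _ _ _ _ _ (cst (G 0))) => [|z _]; last first.
  by congr G; apply/matrixP => -[].
rewrite Rintegral_cst//; transitivity (G 0 * fine (1%E : \bar R)); last by rewrite mulr1.
by congr (_ * fine _); exact: diracT.
Qed.

(** The integral factors, and each factor equals a shifted lattice sum by [int_mean]; thus one bound
    [W] on shifted sums serves both the sums and the integrals in [riemann_zbox]. *)
Lemma rint_pbox n N (beta : 'I_n -> R -> R) (W : R) : (0 < N)%N ->
  (forall i, continuous (beta i)) -> (forall i x, 0 <= beta i x <= 1) ->
  (forall i (s : R), 0 <= s <= 1 -> \sum_(k < N.*2) beta i (k%:R - N%:R + s) <= W) ->
  \int[lebm n]_z pbox N beta z <= W ^+ n.
Proof.
move=> N0; elim: n beta => [|n IH] beta cb b01 hW.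
  by rewrite expr0 rint_lebm0 /pbox big_ord0.
rewrite rint_fubini1; last exact: bfun_pbox.
pose b0 x := beta 0 x * \1_[set x : R | `|x| <= N%:R] x.
have E x y : pbox N beta (consv (x, y)) = b0 x * pbox N (fun i => beta (lift 0 i)) y.
  rewrite /pbox big_ord_recl consv0; congr (_ * _).
  by apply: eq_bigr => i _; rewrite consvS.
have ip : Int (lebm n) (pbox N (fun i => beta (lift 0 i))).
  by apply: bfun_Int; exact: bfun_pbox.
have -> : \int[mu]_x \int[lebm n]_y pbox N beta (consv (x, y)) =
   (\int[lebm n]_y pbox N (fun i => beta (lift 0 i)) y) * \int[mu]_x b0 x.
  rewrite -rintZ.
    apply: eq_Rintegral => x _; rewrite mulrC -rintZ//.
    by apply: eq_Rintegral => y _; rewrite E.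
  apply: (@Int_le _ _ _ mu b0 (\1_(`[- N%:R, N%:R]%classic : set (measurableTypeR R)))).
  - apply: measurable_funM; first exact: continuous_measurable_fun.
    by apply: measurable_indic; rewrite normle_itv.
  - by apply: Int_indic => //; exact: lebesgue_itv_fin.
  move=> x; rewrite /b0 -normle_itv normrM !ger0_norm; last first.
    by case/andP: (b01 0 x).
    by rewrite indicE; case: (_ \in _).
  rewrite ler_piMl//.
  by case/andP: (b01 0 x).
rewrite exprSr; apply: ler_pM.
- by apply: Rintegral_ge0 => y _; apply: prodr_ge0 => i _; rewrite mulr_ge0//; case/andP: (b01 (lift 0 i) (y i 0)).
- apply: Rintegral_ge0 => x _; by rewrite mulr_ge0//; case/andP: (b01 0 x).
- by apply: IH => // i s hs; exact: hW.
rewrite (@rint_restrict N); last first.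
  move=> x hx; rewrite /b0 indicE memNset ?mulr0//=.
  by apply/negP; rewrite -ltNge.
have -> : \int[mu]_(x in `[- N%:R, N%:R]) b0 x = \int[mu]_(x in `[- N%:R, N%:R]) beta 0 x.
  apply: eq_Rintegral.
  by move=> x; rewrite -normle_itv => hx; rewrite /b0 indicE hx mulr1.
have [c hc ->] := int_mean N0 (cb 0).
exact: hW.
Qed.

Lemma entry_shift n (s : R) (j k : 'I_n) : (s *: delta_mx j 0 : 'cV[R]_n) k 0 = s * (k == j)%:R.
Proof. by rewrite !mxE eqxx andbT. Qed.

Lemma consv_shift0 n (x s : R) (y : 'cV[R]_n) :
  consv (x, y) + s *: delta_mx 0 0 = consv (x + s, y).
Proof.
apply/matrixP => k l; rewrite ord1 mxE entry_shift; elim/forall_ordS : k => [|k].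
  by rewrite !consv0 /= mulr1.
by rewrite !consvS /= mulr0 addr0.
Qed.

Lemma consv_shiftS n (x s : R) (y : 'cV[R]_n) j :
  consv (x, y) + s *: delta_mx (lift 0 j) 0 = consv (x, y + s *: delta_mx j 0).
Proof.
apply/matrixP => k l; rewrite ord1 mxE entry_shift; elim/forall_ordS : k => [|k].
  by rewrite !consv0 /= mulr0 addr0.
by rewrite !consvS /= mxE entry_shift (inj_eq lift_inj).
Qed.

Lemma continuous_consv1 n (x : R) : continuous (fun y : 'cV[R]_n => consv (x, y)).
Proof.
apply: continuous_mx => i j; rewrite ord1; elim/forall_ordS : i => [|i].
  by under eq_fun do rewrite consv0; move=> y; exact: cst_continuous.
by under eq_fun do rewrite consvS; exact: continuous_coord.
Qed.

Lemma continuous_consv2 n (y : 'cV[R]_n) : continuous (fun x : R => consv (x, y)).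
Proof.
apply: continuous_mx => i j; rewrite ord1; elim/forall_ordS : i => [|i].
  by under eq_fun do rewrite consv0.
by under eq_fun do rewrite consvS; move=> x; exact: cst_continuous.
Qed.

(** Sums are replaced by integrals one coordinate at a time. The top derivative is dominated by a
    product over the coordinates, so the error of one replacement can still be summed or integrated
    over all the others, at cost [W] each. *)
Lemma riemann_zbox n N K (W E : R) (beta : 'I_n -> R -> R) (G : 'cV[R]_n -> R)
    (D : 'I_n -> nat -> 'cV[R]_n -> R) : (0 < N)%N -> 0 <= E ->
  (forall i, continuous (beta i)) -> (forall i x, 0 <= beta i x <= 1) ->
  (forall i (s : R), 0 <= s <= 1 -> \sum_(k < N.*2) beta i (k%:R - N%:R + s) <= W) ->
  bfun G -> (forall j, D j 0 = G) ->
  (forall j z, dseq K.+1 (fun l s => D j l (z + s *: delta_mx j 0))) ->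
  (forall j l (z : 'cV[R]_n) i, (l <= K)%N -> N%:R <= `|z i 0| -> D j l z = 0) ->
  (forall j z, `|D j K.+1 z| <= E * \prod_i beta i (z i 0)) ->
  `|\sum_(b <- zbox N n) G (zR b) - \int[lebm n]_z G z| <= n%:R * E * W ^+ n.
Proof.
move=> N0; elim: n E beta G D => [|n IH] E beta G D E0 cb b01 hW bG D0 dD vD hD.
  rewrite /= big_seq1 !mul0r normr_le0 subr_eq0; apply/eqP.
  by rewrite rint_lebm0; congr G; apply/matrixP => -[].
have W0 : 0 <= W.
  apply: le_trans (hW 0 0 _); last by rewrite lexx ler01.
  by apply: sumr_ge0 => k _; case/andP: (b01 0 (k%:R - N%:R + 0)).
rewrite big_zboxS.
pose J (x : R) := \int[lebm n]_y G (consv (x, y)).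
(* With the zeroth coordinate fixed, the induction hypothesis applies with [E] replaced by
   [E * beta 0], and summing over that coordinate yields the extra factor [W]. *)
have step1 : `|\sum_(i <- irange N) \sum_(b <- zbox N n) G (zR (consz i b)) - \sum_(i <- irange N) J i%:~R|
    <= n%:R * E * W ^+ n * W.
  rewrite -sumrB; apply: le_trans (ler_norm_sum _ _ _) _.
  apply: (@le_trans _ _ (\sum_(i <- irange N) n%:R * E * W ^+ n * beta 0 (i%:~R))).
    apply: ler_sum => i _.
    under eq_bigr do rewrite zR_consz.
    have := IH (E * beta 0 i%:~R) (fun j => beta (lift 0 j)) (fun y => G (consv (i%:~R, y)))
      (fun j l y => D (lift 0 j) l (consv (i%:~R, y))).
    rewrite -!mulrA (mulrC _ (W ^+ n)); apply=> //.
    - by rewrite mulr_ge0//; case/andP: (b01 0 i%:~R).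
    - by move=> j s hs; exact: hW.
    - exact: bfun_consv1.
    - by move=> j; rewrite D0.
    - move=> j y l s lK; have := dD (lift 0 j) (consv (i%:~R, y)) l s lK.
      under eq_fun do rewrite consv_shiftS.
      by rewrite consv_shiftS.
    - by move=> j l y k lK h; apply: (vD _ l _ (lift 0 k) lK); rewrite consvS.
    - move=> j y; apply: le_trans (hD _ _) _.
      rewrite big_ord_recl consv0 mulrA; apply: ler_wpM2l.
        by rewrite mulr_ge0//; case/andP: (b01 0 i%:~R).
      by rewrite le_eqVlt; apply/orP; left; apply/eqP; apply: eq_bigr => k _; rewrite consvS.
  rewrite -mulr_sumr; apply: ler_wpM2l; first by rewrite !mulr_ge0// exprn_ge0.
  rewrite big_irange; have := hW 0 0; rewrite lexx ler01 => /(_ isT); apply: le_trans.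
  rewrite le_eqVlt; apply/orP; left; apply/eqP; apply: eq_bigr => k _.
  by rewrite addr0 intrB -!pmulrn.
(* Now the other coordinates are already integrated: the one-dimensional estimate in the zeroth
   coordinate is applied for each [y] and its error integrated by [rint_pbox]. *)
have step2 : `|\sum_(i <- irange N) J i%:~R - \int[lebm n.+1]_z G z| <= E * W ^+ n * W.
  have I1 (x : R) : Int (lebm n) (fun y => G (consv (x, y))).
    by apply: bfun_Int; exact: bfun_consv1.
  rewrite /J -rint_sum//.
  rewrite (rint_fubini2 bG) -RintegralB//; last 2 first.
    exact: Int_sum.
    exact: Int_consv2.
  apply: (@le_trans _ _ (\int[lebm n]_y (E * W * pbox N (fun j => beta (lift 0 j)) y))).
    apply: rint_abs.
    - apply: IntB; last exact: Int_consv2.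
      exact: Int_sum.
    - by apply: IntZ; apply: bfun_Int; exact: bfun_pbox.
    move=> y.
    have [[k hk]|h] := pselect (exists k, N%:R < `|y k 0|).
      rewrite big1 => [|i _]; last first.
        by rewrite -(D0 0) (vD _ _ _ (lift 0 k))// consvS ltW.
      rewrite (@eq_Rintegral _ _ _ _ _ (cst 0)) => [|x _]; last first.
        by rewrite -(D0 0) (vD _ _ _ (lift 0 k))// consvS ltW.
      rewrite Rintegral_cst// mul0r subrr normr0 mulr_ge0//; first exact: mulr_ge0.
      by apply: prodr_ge0 => i _; rewrite mulr_ge0//; case/andP: (b01 (lift 0 i) (y i 0)).
    have -> : pbox N (fun j => beta (lift 0 j)) y = \prod_j beta (lift 0 j) (y j 0).
      apply: eq_bigr => j _; rewrite indicE mem_set ?mulr1//=.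
      by rewrite leNgt; apply/negP => hj; apply: h; exists j.
    rewrite (@rint_restrict N); last first.
      move=> x hx; rewrite -(D0 0) (vD _ _ _ 0)// consv0 ltW//.
    rewrite big_irange.
    have := @euler_maclaurin R (fun l x => D 0 l (consv (x, y))) N K (E * W * \prod_j beta (lift 0 j) (y j 0)) N0.
    rewrite D0 => EM.
    rewrite (eq_bigr (fun i : 'I_N.*2 => G (consv (i%:R - N%:R, y)))); last first.
      by move=> i _; congr (G (consv (_, _))); rewrite intrB -!pmulrn.
    apply: EM.
    - move=> l x lK; have := dD 0 (consv (0, y)) l x lK.
      under eq_fun do rewrite consv_shift0 add0r.
      by rewrite consv_shift0 add0r.
    - by move=> l x lK hx; apply: (vD 0 l _ 0 lK); rewrite consv0.
    move=> s hs; apply: (@le_trans _ _ (\sum_(i < N.*2) E * beta 0 (i%:R - N%:R + s) * \prod_j beta (lift 0 j) (y j 0))).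
      apply: ler_sum => i _; apply: le_trans (hD _ _) _.
      rewrite big_ord_recl consv0 mulrA; apply: ler_wpM2l.
        by rewrite mulr_ge0//; case/andP: (b01 0 (i%:R - N%:R + s)).
      by rewrite le_eqVlt; apply/orP; left; apply/eqP; apply: eq_bigr => k _; rewrite consvS.
    rewrite -mulr_suml; apply: ler_wpM2r.
      by apply: prodr_ge0 => j _; case/andP: (b01 (lift 0 j) (y j 0)).
    by rewrite -mulr_sumr; apply: ler_wpM2l => //; exact: hW.
  rewrite rintZ; last by apply: bfun_Int; exact: bfun_pbox.
  rewrite -!mulrA (mulrC (W ^+ n)) mulrA [leRHS]mulrA; apply: ler_wpM2l; first exact: mulr_ge0.
  by apply: rint_pbox => // i s; exact: hW.
rewrite -(subrKA (\sum_(i <- irange N) J i%:~R)) (le_trans (ler_normD _ _))//.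
apply: le_trans (lerD step1 step2) _.
by rewrite le_eqVlt; apply/orP; left; apply/eqP; rewrite exprSr -natr1; ring.
Qed.

End RiemannSum.

Section QuadraticSums.
Context {R : realType}.

Lemma sum_sub (T : eqType) (s s' : seq T) (F : T -> R) : uniq s -> uniq s' ->
  {subset s <= s'} -> (forall x, 0 <= F x) -> \sum_(x <- s) F x <= \sum_(x <- s') F x.
Proof.
move=> us us' ss' F0; rewrite [leRHS](bigID (mem s)) /= -[leLHS]addr0.
apply: lerD; last exact: sumr_ge0.
rewrite le_eqVlt; apply/orP; left; apply/eqP; rewrite -[RHS]big_filter.
apply: perm_big; apply: uniq_perm; rewrite ?filter_uniq// => x.
by rewrite mem_filter /=; case: (boolP (x \in s)) => //= /ss' ->.
Qed.

(** Each term is at most a multiple of [(1 + y n)^-1 - (1 + y (n + 1))^-1], so the sum telescopes,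
    uniformly in [m]. *)
Lemma sum_inv_sqr (y : R) m : 0 < y ->
  \sum_(n < m) (1 + (y * n%:R) ^+ 2)^-1 <= 2 * (1 + y) / y.
Proof.
move=> y0.
apply: (@le_trans _ _ (\sum_(n < m) (2 * (1 + y) / y) * ((1 + y * n%:R)^-1 - (1 + y * n.+1%:R)^-1))).
  apply: ler_sum => n _.
  have t0 : 0 <= y * n%:R by rewrite mulr_ge0// ltW.
  set t := y * n%:R in t0 *.
  have -> : y * n.+1%:R = t + y by rewrite -natr1 mulrDr mulr1.
  have h1 : 0 < 1 + t by lra.
  have h2 : 0 < 1 + (t + y) by lra.
  have h3 : 0 < 1 + t ^+ 2 by have := sqr_ge0 t; lra.
  have -> : 2 * (1 + y) / y * ((1 + t)^-1 - (1 + (t + y))^-1) =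
     2 * (1 + y) / ((1 + t) * (1 + (t + y))) by field; lra.
  rewrite ler_pdivlMr ?mulr_gt0// mulrC ler_pdivrMr//.
  have := sqr_ge0 (t - 1); nra.
rewrite -mulr_sumr -[leRHS]mulr1; apply: ler_wpM2l.
  by rewrite divr_ge0 ?(ltW y0)// mulr_ge0// addr_ge0// ltW.
rewrite -(big_mkord xpredT (fun n => (1 + y * n%:R)^-1 - (1 + y * n.+1%:R)^-1)).
rewrite (eq_bigr (fun n => - (1 + y * n.+1%:R)^-1 - (- (1 + y * n%:R)^-1))); last by move=> i _; ring.
rewrite (telescope_sumr (fun n => - (1 + y * n%:R)^-1))//.
rewrite mulr0 addr0 invr1 opprK gerDr oppr_le0 invr_ge0 addr_ge0// mulr_ge0// ltW//.
Qed.

(* The infimum of |k + t| over 0 <= t < 1. *)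
Definition jz (k : int) : nat := match k with Posz n => n | Negz n => n end.

(** The map [jz] is two-to-one: [k] and [- k - 1] have the same image. *)
Lemma sum_jz (phi : nat -> R) (s : seq int) : uniq s -> (forall n, 0 <= phi n) ->
  exists m, \sum_(k <- s) phi (jz k) <= 2 * \sum_(n < m) phi n.
Proof.
move=> us p0; pose m := (\sum_(k <- s) (absz k).+1)%N.
exists m; apply: (@le_trans _ _ (\sum_(k <- irange m) phi (jz k))).
  apply: sum_sub => //; first exact: irange_uniq.
  move=> k ks; rewrite mem_irange.
  have : ((absz k).+1 <= m)%N by rewrite /m (big_rem k)//= leq_addr.
  by lia.
rewrite big_irange -addnn big_split_ord /= mulr2n mulrDl mul1r; apply: lerD.
  rewrite le_eqVlt; apply/orP; left; apply/eqP.
  rewrite (reindex_inj rev_ord_inj) /=; apply: eq_bigr => i _; congr phi.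
  rewrite (_ : (m - i.+1)%N%:Z - m%:Z = Negz i)//; have := ltn_ord i; lia.
rewrite le_eqVlt; apply/orP; left; apply/eqP; apply: eq_bigr => i _; congr phi.
by rewrite PoszD addrC addKr.
Qed.

Lemma sum_jz_sqr (y : R) (s : seq int) : uniq s -> 0 < y ->
  \sum_(k <- s) (1 + (y * (jz k)%:R) ^+ 2)^-1 <= 4 * (1 + y) / y.
Proof.
move=> us y0; have [|m] := @sum_jz (fun n => (1 + (y * n%:R) ^+ 2)^-1) s us.
  by move=> n; rewrite invr_ge0 addr_ge0// sqr_ge0.
move=> h; apply: le_trans h _.
have := sum_inv_sqr m y0; rewrite -!mulrA => /(ler_wpM2l (ler0n R 2)).
move=> h'; apply: le_trans h' _; rewrite le_eqVlt; apply/orP; left; apply/eqP; ring.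
Qed.

Lemma jz_frac (k : int) (t : R) : 0 <= t < 1 -> (jz k)%:R <= `|k%:~R + t|.
Proof.
move=> /andP[t0 t1]; case: k => n /=.
  by rewrite ger0_norm ?addr_ge0// lerDl.
rewrite NegzE mulrNz ler0_norm; have : (n.+1%:R : R) = n%:R + 1 by rewrite -natr1.
  by rewrite -[n.+1%:~R]/(n.+1%:R) => ->; lra.
by rewrite -[n.+1%:~R]/(n.+1%:R) => ->; have : (0 : R) <= n%:R by []; lra.
Qed.

(** The offset is absorbed into the summation index by a floor, leaving a fractional part in [0,1),
    which [jz] was made for; hence the bound does not see [r] or [s]. *)
Lemma sum_shift_sqr (l r s : R) N : 0 < l <= 1 ->
  \sum_(k < N.*2) (1 + (l * (k%:R - N%:R + s) + r) ^+ 2)^-1 <= 8 / l.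
Proof.
move=> /andP[l0 l1].
pose t := s + r / l - N%:R; pose m := Num.floor t.
have /andP[ft1 ft2] := floor_itv t.
have tm : 0 <= t - m%:~R < 1 by rewrite subr_ge0 ft1 /= ltrBlDl -intrD1.
apply: (@le_trans _ _ (\sum_(k < N.*2) (1 + (l * (jz (k%:Z + m))%:R) ^+ 2)^-1)).
  apply: ler_sum => k _.
  have -> : l * (k%:R - N%:R + s) + r = l * ((k%:Z + m)%:~R + (t - m%:~R)).
    rewrite intrD -pmulrn /t; field; lra.
  rewrite lef_pV2 ?posrE; try by have := sqr_ge0 (l * (jz (k%:Z + m))%:R); have := sqr_ge0 (l * ((k%:Z + m)%:~R + (t - m%:~R))); lra.
  rewrite lerD2l !exprMn ler_wpM2l ?sqr_ge0//.
  by rewrite -[leRHS]real_normK ?num_real// lerXn2r ?nnegrE//; exact: jz_frac.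
have us : uniq [seq k%:Z + m | k <- iota 0 N.*2].
  by rewrite map_inj_uniq ?iota_uniq// => i j /addIr [].
have := sum_jz_sqr us l0; rewrite big_map -{1}(subn0 N.*2) big_mkord => h.
apply: le_trans h _.
by rewrite ler_pM2r ?invr_gt0//; lra.
Qed.

End QuadraticSums.

Section Scaling.
Context {R : realType}.
Notation mu := (@lebesgue_measure R).

Lemma continuous_affine (l r : R) : continuous (fun x : R => l * x + r).
Proof.
move=> x; apply: differentiable_continuous; apply/derivable1_diffP.
have : is_derive x (1 : R) (fun x => l * x + r) l.
  by apply: is_derive_eq; rewrite addr0 /GRing.scale /= mulr1.
by case.
Qed.

Lemma rint_restrict_itv (a b : R) (u : R -> R) : (forall x, x < a \/ b < x -> u x = 0) ->
  \int[mu]_x u x = \int[mu]_(x in `[a, b]) u x.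
Proof.
move=> h; rewrite [RHS]Rintegral_mkcond; apply: eq_Rintegral => x _.
rewrite patchE; case: ifPn => // /negP hx; apply: h.
have [xa|ax] := ltP x a; [by left|right].
by rewrite ltNge; apply/negP => xb; apply: hx; rewrite inE /= in_itv /= ax.
Qed.

Lemma rint_affine1 (u : R -> R) (B l r : R) : 0 < l -> continuous u ->
  (forall x, B < `|x| -> u x = 0) ->
  \int[mu]_x u (l * x + r) = l^-1 * \int[mu]_x u x.
Proof.
move=> l0 cu hB; pose F (x : R) := l * x + r.
have dF x : is_derive x (1 : R) F l.
  by apply: is_derive_eq; rewrite addr0 /GRing.scale /= mulr1.
have F' : derive1 F = cst l.
  by apply/funext => x; rewrite derive1E; apply: derive_val.
have cF : continuous F.
  by move=> x; apply: differentiable_continuous; apply/derivable1_diffP; have [] := dF x.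
pose a := (- Num.max B 0 - r) / l; pose b := (Num.max B 0 - r) / l.
have Fa : F a = - Num.max B 0 by rewrite /F /a; field; rewrite gt_eqF.
have Fb : F b = Num.max B 0 by rewrite /F /b; field; rewrite gt_eqF.
have B0 : 0 <= Num.max B 0 by rewrite le_max lexx orbT.
have BB : B <= Num.max B 0 by rewrite le_max lexx.
have FE x y : (F x < F y) = (x < y) by rewrite /F ltrD2r ltr_pM2l.
have ab : a <= b by rewrite leNgt -FE Fa Fb -leNgt; lra.
have E := @integration_by_substitution_increasing _ F u a b ab.
rewrite (@rint_restrict_itv a b); last first.
  move=> x h; apply: hB; apply: le_lt_trans BB _.
  by move: h => [|]; rewrite -FE ?Fa ?Fb /F => h; rewrite ltr_normr; apply/orP; [right|left]; lra.
rewrite [in RHS](@rint_restrict_itv (F a) (F b)); last first.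
  move=> x h; apply: hB; apply: le_lt_trans BB _.
  by move: h => [|]; rewrite ?Fa ?Fb => h; rewrite ltr_normr; apply/orP; [right|left]; lra.
rewrite {2}/Rintegral E.
- rewrite F' -RintegralZl//.
    by apply: eq_Rintegral => x _; rewrite -[RHS]/(l^-1 * (u (F x) * l)) mulrCA mulVf ?mulr1// gt_eqF.
  apply: continuous_compact_integrable; first exact: segment_compact.
  apply: continuous_subspaceT => x; apply: cvgM; last exact: cvg_cst.
  by apply: continuous_comp; [exact: cF|exact: cu].
- by move=> x y _ _; rewrite FE.
- by rewrite F' => x _; exact: cst_continuous.
- by rewrite F'; exact: is_cvg_cst.
- by rewrite F'; exact: is_cvg_cst.
- split.
  + by move=> x _; have [] := dF x.
  + by apply: cvg_at_right_filter; exact: cF.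
  + by apply: cvg_at_left_filter; exact: cF.
- exact: continuous_subspaceT.
Qed.

Lemma rint_affine n (G : 'cV[R]_n -> R) (B l : R) (r : 'cV[R]_n) : 0 < l -> continuous G ->
  (exists M, forall z, `|G z| <= M) -> bsupp B G ->
  \int[lebm n]_z G (l *: z + r) = (l ^+ n)^-1 * \int[lebm n]_z G z.
Proof.
move=> l0; elim: n G r => [|n IH] G r cG [M hM] hB.
  by rewrite !rint_lebm0 expr0 invr1 mul1r; congr G; apply/matrixP => -[].
have bG : bfun G by split; [exact: measurable_continuousR|exists M, B].
have cA : continuous (fun z : 'cV[R]_n.+1 => G (l *: z + r)).
  move=> z; apply: (@continuous_comp _ _ _ (fun z : 'cV[R]_n.+1 => l *: z + r) G); last exact: cG.
  by apply: continuousD; [exact: scaler_continuous|exact: cst_continuous].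
have bA : bfun (fun z : 'cV[R]_n.+1 => G (l *: z + r)).
  split; first exact: measurable_continuousR.
  exists M, ((B + \sum_i `|r i 0|) / l); split=> // z i.
  rewrite ltr_pdivrMr// => h; apply: (hB _ i); rewrite !mxE.
  have h1 : `|r i 0| <= \sum_i `|r i 0| by rewrite (bigD1 i)//= lerDl sumr_ge0.
  have := lerB_normD (l * z i 0) (r i 0); rewrite normrM (gtr0_norm l0) (mulrC l); lra.
have E (x : R) (y : 'cV[R]_n) : l *: consv (x, y) + r = consv (l * x + r 0 0, l *: y + \col_i r (lift 0 i) 0).
  apply/matrixP => k j; rewrite ord1 mxE [X in X + _]mxE; elim/forall_ordS : k => [|k].
    by rewrite !consv0.
  by rewrite !consvS [RHS]mxE [X in _ = X + _]mxE [X in _ = _ + X]mxE.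
have cx (x : R) : continuous (fun y : 'cV[R]_n => G (consv (x, y))).
  move=> y; apply: (@continuous_comp _ _ _ (fun y => consv (x, y)) G); last exact: cG.
  exact: continuous_consv1.
have cy (y : 'cV[R]_n) : continuous (fun x : R => G (consv (x, y))).
  move=> x; apply: (@continuous_comp _ _ _ (fun x => consv (x, y)) G); last exact: cG.
  exact: continuous_consv2.
(* The intermediate function in which only the zeroth coordinate is rescaled. One order of
   integration removes the rescaling of the other coordinates by induction, the opposite order that
   of the zeroth. *)
have bC : bfun (fun z : 'cV[R]_n.+1 => G (consv (l * z 0 0 + r 0 0, \col_i z (lift 0 i) 0))).
  split.
    apply: measurable_continuousR => z.
    apply: (@continuous_comp _ _ _ (fun z : 'cV[R]_n.+1 => consv (l * z 0 0 + r 0 0, \col_i z (lift 0 i) 0)) G); last exact: cG.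
    apply: continuous_mx => i j; rewrite ord1; elim/forall_ordS : i => [|i].
      under eq_fun do rewrite consv0 /=.
      move=> u; apply: (@continuous_comp _ _ _ (fun z : 'cV[R]_n.+1 => z 0 0) (fun x => l * x + r 0 0)).
        exact: continuous_coord.
      exact: continuous_affine.
    under eq_fun do rewrite consvS /= mxE.
    exact: continuous_coord.
  exists M, (Num.max B ((B + `|r 0 0|) / l)); split=> // z i; rewrite gt_max => /andP[h1 h2].
  elim/forall_ordS : i h1 h2 => [|i] h1 h2.
    apply: (hB _ 0); rewrite consv0 /=; move: h2; rewrite ltr_pdivrMr// => h2.
    have := lerB_normD (l * z 0 0) (r 0 0); rewrite normrM (gtr0_norm l0) (mulrC l); lra.
  by apply: (hB _ (lift 0 i)); rewrite consvS /= mxE.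
have CE (x : R) (y : 'cV[R]_n) : consv (l * consv (x, y) 0 0 + r 0 0, \col_i consv (x, y) (lift 0 i) 0) = consv (l * x + r 0 0, y).
  by rewrite consv0; congr (consv (_, _)); apply/matrixP => k j; rewrite ord1 mxE consvS.
rewrite (rint_fubini1 bA).
transitivity (\int[mu]_x ((l ^+ n)^-1 * \int[lebm n]_y G (consv (l * x + r 0 0, y)))).
  apply: eq_Rintegral => x _; under eq_Rintegral do rewrite E.
  apply: (IH (fun y => G (consv (l * x + r 0 0, y)))) => //; first by exists M.
  by move=> y i hi; apply: (hB _ (lift 0 i)); rewrite consvS.
have EC : \int[lebm n.+1]_z G (consv (l * z 0 0 + r 0 0, \col_i z (lift 0 i) 0)) =
    \int[mu]_x \int[lebm n]_y G (consv (l * x + r 0 0, y)).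
  rewrite (rint_fubini1 bC); apply: eq_Rintegral => x _; apply: eq_Rintegral => y _.
  by rewrite CE.
rewrite RintegralZl//; last first.
  have := Int_consv1 bC; rewrite /Int; apply: eq_integrable => // x _ /=.
  by congr EFin; apply: eq_Rintegral => y _; rewrite CE.
rewrite -EC (rint_fubini2 bC) (rint_fubini2 bG) exprS invfM -mulrA mulrCA; congr (_ * _).
rewrite -RintegralZl//; last exact: Int_consv2.
apply: eq_Rintegral => y _.
under eq_Rintegral do rewrite CE.
apply: (@rint_affine1 (fun x => G (consv (x, y))) B) => //.
by move=> x hx; apply: (hB _ 0); rewrite consv0.
Qed.

End Scaling.

(** * Weight functions and quadratic phases *)

Section Weights.
Context {R : realType} {n : nat}.
Implicit Types (z : 'cV[R]_n) (w f : 'cV[R]_n -> R) (D : 'I_n -> nat -> 'cV[R]_n -> R).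

(** A product is taken in place of a power of the Euclidean norm, so that its sums over boxes and
    its integrals factor over the coordinates. *)
Definition omega z : R := \prod_i (1 + (z i 0) ^+ 2)^-1.

Lemma omega_factor (x : R) : 0 < (1 + x ^+ 2)^-1 <= 1.
Proof.
have h := sqr_ge0 x.
by rewrite invr_gt0 invf_le1 ?ltr_wpDr// ?lerDl.
Qed.

Lemma omega_gt0 z : 0 < omega z.
Proof. by apply: prodr_gt0 => i _; case/andP: (omega_factor (z i 0)). Qed.

Lemma omega_le1 z : omega z <= 1.
Proof.
by apply: prodr_ile1 => i _; case/andP: (omega_factor (z i 0)) => /ltW -> ->.
Qed.

(* [D j l] is the l-th derivative of w in the direction of the j-th coordinate;
   mixed derivatives are never needed. *)
Definition weight (K p : nat) (M B : R) w D := [/\ forall j, D j 0 = w,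
  forall j z, dseq K (fun l s => D j l (z + s *: delta_mx j 0)),
  forall j l z, (l <= K)%N -> `|D j l z| <= M * omega z ^+ p,
  forall j l, (l <= K)%N -> continuous (D j l) &
  forall j l z i, (l <= K)%N -> B <= `|z i 0| -> D j l z = 0].

(* g and h are the first derivatives and half the second ones of the quadratic function f. *)
Definition quadf f (g : 'I_n -> 'cV[R]_n -> R) (h : 'I_n -> R) (C : R) :=
  [/\ continuous f,
  forall z j s, f (z + s *: delta_mx j 0) = f z + s * g j z + s ^+ 2 * h j,
  forall z j s, g j (z + s *: delta_mx j 0) = g j z + 2 * s * h j,
  forall j z, `|g j z| <= C * (omega z)^-1 & forall j, `|h j| <= C].

Definition wphase w f (gam th : R) z : R := w z * cos (2 * pi * (gam * f z + th)).

(** On a line parallel to the j-th axis the phase is a quadratic polynomial in the parameter, with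
    coefficients read off from [f], [g] and [h] at [z]; Leibniz' rule is applied on this line and
    evaluated at parameter 0. *)
Definition wphaseD D f g h (gam th : R) (j : 'I_n) (l : nat) z : R :=
  mulseq l (fun i s => D j i (z + s *: delta_mx j 0))
    (cosseq (2 * pi * gam * h j) (2 * pi * gam * g j z) (2 * pi * (gam * f z + th))) 0.

Lemma trigseq_shift (a b c s : R) l x :
  trigseq a b c l (x + s) = trigseq a (b + 2 * a * s) (a * s ^+ 2 + b * s + c) l x.
Proof.
elim: l => [|l IH] /=.
  by congr (cos _, sin _, _); ring.
rewrite IH; case: (trigseq _ _ _ l x) => [[C S0] [C' S']].
by rewrite (_ : 2 * a * (x + s) + b = 2 * a * x + (b + 2 * a * s)); last by ring.
Qed.

Lemma mulseq_shift l (u v : nat -> R -> R) (s x : R) :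
  mulseq l u v (x + s) = mulseq l (fun i t => u i (t + s)) (fun i t => v i (t + s)) x.
Proof. by elim: l u v => [//|l IH] u v /=; rewrite !IH. Qed.

Lemma wphaseD_shift D f g h C gam th j l z s : quadf f g h C ->
  wphaseD D f g h gam th j l (z + s *: delta_mx j 0) =
  mulseq l (fun i t => D j i (z + t *: delta_mx j 0))
    (cosseq (2 * pi * gam * h j) (2 * pi * gam * g j z) (2 * pi * (gam * f z + th))) s.
Proof.
move=> [_ fE gE _ _]; rewrite /wphaseD -[in RHS](add0r s) mulseq_shift.
congr (mulseq l _ _ 0).
  by apply/funext => i; apply/funext => t; rewrite -addrA -scalerDl (addrC s).
apply/funext => i; apply/funext => t; rewrite /cosseq trigseq_shift fE gE.
by congr ((trigseq _ _ _ _ _).1.1); ring.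
Qed.

Lemma wphaseD0 D w f g h gam th j : D j 0 = w -> wphaseD D f g h gam th j 0 = wphase w f gam th.
Proof.
move=> D0; apply/funext => z; rewrite /wphaseD /= D0 scale0r addr0 /wphase cosseq0.
by congr (_ * cos _); ring.
Qed.

Lemma dseq_wphaseD K p M B w D f g h C gam th j z : weight K p M B w D -> quadf f g h C ->
  dseq K (fun l s => wphaseD D f g h gam th j l (z + s *: delta_mx j 0)).
Proof.
move=> [_ dD _ _ _] qf.
have -> : (fun l s => wphaseD D f g h gam th j l (z + s *: delta_mx j 0)) =
   fun l => mulseq l (fun i t => D j i (z + t *: delta_mx j 0))
    (cosseq (2 * pi * gam * h j) (2 * pi * gam * g j z) (2 * pi * (gam * f z + th))).
  by apply/funext => l; apply/funext => s; exact: wphaseD_shift qf.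
by apply: dseq_mul; [exact: dD|exact: dseq_cos].
Qed.

(** The gradient of the phase grows like [(omega z)^-1], so l derivatives may cost that factor l
    times. Since [l < p], the decay [omega ^+ p] absorbs them and one power is left over for
    summation. *)
Lemma wphaseD_bound K p M B w D f g h C gam th j l z : weight K p M B w D -> quadf f g h C ->
  1 <= C -> 0 <= M -> (l <= K)%N -> (l < p)%N ->
  `|wphaseD D f g h gam th j l z| <=
  2 ^+ l * l.+1`!%:R * M * (4 * pi * C * (1 + `|gam|)) ^+ l * omega z.
Proof.
move=> [_ _ bD _ _] [_ _ _ gC hC] C1 M0 lK lp.
have o0 := omega_gt0 z; have o1 := omega_le1 z.
have pi2 := pi_gt0 R; have pi1 := pi_ge2 R.
have gm := normr_ge0 gam.
set G := 4 * pi * C * (1 + `|gam|).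
have G1 : 1 <= G.
  have h8 : 1 <= 4 * pi * C by nra.
  by rewrite /G; nra.
have i1 : 1 <= (omega z)^-1 by rewrite invf_ge1.
set t := G * (omega z)^-1.
have t1 : 1 <= t by rewrite -[1](mulr1 1) ler_pM.
have t0 : 0 <= t by lra.
have pg : 2 * pi * `|gam| * C <= G / 2.
  rewrite /G (_ : 4 * pi * C * (1 + `|gam|) / 2 = 2 * pi * `|gam| * C + 2 * pi * C); last by field.
  by rewrite lerDl !mulr_ge0//; lra.
have hb : `|2 * (2 * pi * gam * h j) * 0 + 2 * pi * gam * g j z| <= t.
  rewrite mulr0 add0r !normrM (ger0_norm (_ : 0 <= 2))// (gtr0_norm pi2).
  apply: (@le_trans _ _ (2 * pi * `|gam| * (C * (omega z)^-1))).
    by apply: ler_wpM2l; [rewrite !mulr_ge0// ltW|exact: gC].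
  rewrite mulrA /t; apply: ler_wpM2r; first lra.
  by apply: le_trans pg _; lra.
have ha : `|2 * (2 * pi * gam * h j)| <= t ^+ 2.
  apply: (@le_trans _ _ t); last first.
    by rewrite expr2 -[leLHS]mulr1; apply: ler_wpM2l.
  rewrite !normrM (ger0_norm (_ : 0 <= 2))// (gtr0_norm pi2).
  apply: (@le_trans _ _ (2 * (2 * pi * `|gam| * C))).
    by apply: ler_wpM2l => //; apply: ler_wpM2l; [rewrite !mulr_ge0// ltW|exact: hC].
  apply: (@le_trans _ _ G); first lra.
  by rewrite /t -[leLHS]mulr1; apply: ler_wpM2l => //; lra.
have B1 i : (i <= l)%N -> `|D j i (z + 0 *: delta_mx j 0)| <= M * omega z ^+ p * t ^+ i.
  move=> il; rewrite scale0r addr0; apply: le_trans (bD j i z (leq_trans il lK)) _.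
  rewrite -[leLHS]mulr1; apply: ler_wpM2l; last exact: exprn_ege1.
  by rewrite mulr_ge0// exprn_ge0// ltW.
have B2 i : (i <= l)%N -> `|cosseq (2 * pi * gam * h j) (2 * pi * gam * g j z)
   (2 * pi * (gam * f z + th)) i 0| <= l.+1`!%:R * t ^+ i.
  move=> il; apply: le_trans (cosseq_bound _ _ hb ha) _.
  apply: ler_wpM2r; first exact: exprn_ge0.
  by rewrite ler_nat leq_fact.
have H := @mulseq_bound _ l (fun i s => D j i (z + s *: delta_mx j 0)) _ 0 _ _ _ _ _ t0 B1 B2.
rewrite /wphaseD.
apply: le_trans (H _ _) _ => //; first by rewrite mulr_ge0// exprn_ge0// ltW.
rewrite /t exprMn (_ : 2 ^+ l * (M * omega z ^+ p * (l.+1)`!%:R) * (G ^+ l * (omega z)^-1 ^+ l) =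
  2 ^+ l * (l.+1)`!%:R * M * G ^+ l * (omega z ^+ p * (omega z)^-1 ^+ l)); last by ring.
apply: ler_wpM2l; first by rewrite !mulr_ge0// exprn_ge0//; lra.
rewrite -(subnK (ltnW lp)) exprD -mulrA -exprMn mulfV ?gt_eqF// expr1n mulr1.
have : (0 < p - l)%N by rewrite subn_gt0.
by case: (p - l)%N => // k _; rewrite exprS -[leRHS]mulr1; apply: ler_wpM2l; [exact: ltW|exact: exprn_ile1 (ltW o0) o1].
Qed.

Lemma wphaseD_vanish K p M B w D f g h gam th j l z i : weight K p M B w D ->
  (l <= K)%N -> B <= `|z i 0| -> wphaseD D f g h gam th j l z = 0.
Proof.
move=> [_ dD _ _ vD] lK zB; rewrite /wphaseD.
have H m (u v : nat -> R -> R) : (forall k, (k <= m)%N -> u k 0 = 0) -> mulseq m u v 0 = 0.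
  elim: m u v => [|m IH] u v h0 /=; first by rewrite h0// mul0r.
  by rewrite !IH ?addr0// => k km; apply: h0; rewrite // ltnW.
apply: H => k kl; rewrite scale0r addr0.
by apply: (vD j k z i) => //; exact: leq_trans kl lK.
Qed.

Lemma wphase_le w f gam th z : `|wphase w f gam th z| <= `|w z|.
Proof.
rewrite /wphase normrM -[leRHS]mulr1; apply: ler_wpM2l => //.
exact: cos_max.
Qed.

Lemma continuous_wphase w f gam th : continuous w -> continuous f ->
  continuous (wphase w f gam th).
Proof.
move=> cw cf z; apply: (@continuousM _ _ w (fun z => cos (2 * pi * (gam * f z + th)))); first exact: cw.
apply: (@continuous_comp _ _ _ f (fun x => cos (2 * pi * (gam * x + th)))); first exact: cf.
rewrite (_ : (fun x => _) = (fun x => cos (2 * pi * gam * x + 2 * pi * th))); last first.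
  by apply/funext => x; rewrite mulrDr mulrA.
apply: (@continuous_comp _ _ _ (fun x => 2 * pi * gam * x + 2 * pi * th) cos); last exact: continuous_cos.
exact: continuous_affine.
Qed.

End Weights.

Section RiemannPhase.
Context {R : realType} {n : nat}.
Local Notation V := 'cV[R]_n.+1.

Lemma weight_cont K p M B (w : V -> R) D : weight K p M B w D -> continuous w.
Proof. by move=> [D0 _ _ cD _]; rewrite -(D0 0); exact: cD. Qed.

Lemma weight_vanish K p M B (w : V -> R) D (z : V) i : weight K p M B w D ->
  B <= `|z i 0| -> w z = 0.
Proof. by move=> [D0 _ _ _ vD] h; rewrite -(D0 0); exact: (vD 0 0 z i). Qed.

Lemma weight_bound K p M B (w : V -> R) D (z : V) : weight K p M B w D ->
  `|w z| <= M * omega z ^+ p.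
Proof. by move=> [D0 _ bD _ _]; rewrite -(D0 0); exact: bD. Qed.

Lemma weight_ge0 K p M B (w : V -> R) D : weight K p M B w D -> 0 <= M.
Proof.
move=> hw; have := weight_bound 0 hw; rewrite /omega.
by rewrite big1 ?expr1n ?mulr1; [exact: le_trans|move=> i _; rewrite mxE expr0n addr0 invr1].
Qed.

Lemma weight_max K p M B (w : V -> R) D (z : V) : weight K p M B w D -> `|w z| <= M.
Proof.
move=> hw; apply: le_trans (weight_bound z hw) _.
rewrite -[leRHS]mulr1; apply: ler_wpM2l; first exact: weight_ge0 hw.
by apply: exprn_ile1; [exact/ltW/omega_gt0|exact: omega_le1].
Qed.

Lemma weight_bfun K p M B (w : V -> R) D f gam th : weight K p M B w D -> continuous f ->
  bfun (wphase w f gam th).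
Proof.
move=> hw cf; split.
  by apply: measurable_continuousR; apply: continuous_wphase => //; exact: weight_cont hw.
exists M, B; split=> [z|z i zi].
  by apply: le_trans (wphase_le _ _ _ _ _) _; exact: weight_max hw.
by rewrite /wphase (weight_vanish hw (ltW zi)) mul0r.
Qed.

(** The free phase [th] stands for the imaginary part: [th = - 4^-1] turns the cosine into a
    sine. *)
Definition osc (w f : V -> R) (gam th : R) : R := \int[lebm n.+1]_z wphase w f gam th z.

(** The factors are the number of coordinates to be replaced, the Leibniz terms, the derivatives of
    the cosine, the size of the phase, and 8 for each one-dimensional sum of [(1 + x^2)^-1]. *)
Definition CRie (K : nat) (C : R) : R :=
  n.+1%:R * 2 ^+ K * K.+1`!%:R * (4 * pi * C) ^+ K * 8 ^+ n.+1.

(** After rescaling by [lam], each derivative brings a factor [lam], and each derivative of the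
    phase at most [1 + |gam|]. The error is an arbitrary power of [lam * (1 + |gam|)], which is what
    makes arcs with [|gam|] well below [1 / lam] accessible. *)
Lemma riemann_sum K p M B w D f g h C gam th (lam : R) (rho : V) N :
  weight K.+1 p M B w D -> quadf f g h C -> 1 <= C -> (K.+1 < p)%N ->
  0 < lam <= 1 -> (0 < N)%N -> (forall i, B + `|rho i 0| <= lam * N%:R) ->
  `|lam ^+ n.+1 * \sum_(b <- zbox N n.+1) wphase w f gam th (lam *: zR b + rho) - osc w f gam th|
  <= CRie K.+1 C * M * (lam * (1 + `|gam|)) ^+ K.+1.
Proof.
move=> hw qf C1 Kp /andP[l0 l1] N0 hN.
have M0 := weight_ge0 hw.
have cf : continuous f by case: qf.
have cG : continuous (wphase w f gam th) by apply: continuous_wphase => //; exact: weight_cont hw.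
pose G z := wphase w f gam th z.
have bG : forall z, `|G z| <= M.
  by move=> z; apply: le_trans (wphase_le _ _ _ _ _) _; exact: weight_max hw.
have sG : bsupp B G.
  by move=> z i zi; rewrite /G /wphase (weight_vanish hw (ltW zi)) mul0r.
pose G' z := G (lam *: z + rho).
pose D' j l z := lam ^+ l * wphaseD D f g h gam th j l (lam *: z + rho).
pose beta (i : 'I_n.+1) (x : R) := (1 + (lam * x + rho i 0) ^+ 2)^-1.
pose E := lam ^+ K.+1 * (2 ^+ K.+1 * K.+2`!%:R * M * (4 * pi * C * (1 + `|gam|)) ^+ K.+1).
have pi0 := pi_gt0 R.
have E0 : 0 <= E.
  by rewrite /E !mulr_ge0 ?exprn_ge0 ?mulr_ge0 ?(ltW pi0) ?(ltW l0) ?addr_ge0//; lra.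
have sh (z : V) (s : R) j : lam *: (z + s *: delta_mx j 0) + rho = (lam *: z + rho) + (lam * s) *: delta_mx j 0.
  by rewrite scalerDr scalerA addrAC.
have cA : continuous (fun z : V => lam *: z + rho).
  by move=> z; apply: continuousD; [exact: scaler_continuous|exact: cst_continuous].
have cG' : continuous G'.
  by move=> z; apply: (@continuous_comp _ _ _ (fun z : V => lam *: z + rho) G); [exact: cA|exact: cG].
have key := @riemann_zbox R n.+1 N K (8 / lam) E beta G' D' N0 E0.
have /key {key} : forall i, continuous (beta i).
  move=> i x; apply: (@continuous_comp _ _ _ (fun x => lam * x + rho i 0) (fun t => (1 + t ^+ 2)^-1)).
    exact: continuous_affine.
  apply: cvgV; first by rewrite gt_eqF// ltr_wpDr// sqr_ge0.
  by apply: cvgD; [exact: cvg_cst|exact: exprn_continuous].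
have b01 : forall i x, 0 <= beta i x <= 1.
  by move=> i x; case/andP: (omega_factor (lam * x + rho i 0)) => /ltW -> ->.
move=> /(_ b01) key.
have hW i (s : R) : 0 <= s <= 1 -> \sum_(k < N.*2) beta i (k%:R - N%:R + s) <= 8 / lam.
  by move=> _; apply: sum_shift_sqr; rewrite l0.
have D0 j : D' j 0 = G'.
  apply/funext => z; rewrite /D' expr0 mul1r (@wphaseD0 _ _ D w)//.
  by case: hw.
have dD j z : dseq K.+1 (fun l s => D' j l (z + s *: delta_mx j 0)).
  have := dseq_affine lam 0 (dseq_wphaseD gam th j (lam *: z + rho) hw qf).
  move=> H l x lK; have := H l x lK; rewrite /D' !sh addr0.
  by under eq_fun do rewrite addr0 -sh.
have vD j l (z : V) i : (l <= K)%N -> N%:R <= `|z i 0| -> D' j l z = 0.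
  move=> lK hz; rewrite /D' (@wphaseD_vanish _ _ _ _ _ _ _ _ _ _ _ _ _ _ _ _ i hw) ?mulr0//.
    exact: leq_trans lK _.
  rewrite !mxE; have := hN i; have := lerB_normD (lam * z i 0) (rho i 0).
  rewrite normrM (gtr0_norm l0); have : lam * N%:R <= lam * `|z i 0| by rewrite ler_pM2l.
  lra.
have hD j z : `|D' j K.+1 z| <= E * \prod_i beta i (z i 0).
  have -> : \prod_i beta i (z i 0) = omega (lam *: z + rho).
    by apply: eq_bigr => i _; rewrite /beta !mxE.
  rewrite /D' normrM ger0_norm ?exprn_ge0 ?(ltW l0)// /E -mulrA.
  apply: ler_wpM2l; first by rewrite exprn_ge0 ?(ltW l0).
  exact: (wphaseD_bound _ _ _ _ hw qf).
have bG' : bfun G'.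
  split; first exact: measurable_continuousR.
  exists M, ((B + \sum_i `|rho i 0|) / lam); split=> [z|z i]; first exact: bG.
  rewrite ltr_pdivrMr// => hz; apply: (sG _ i); rewrite !mxE.
  have h1 : `|rho i 0| <= \sum_i `|rho i 0| by rewrite (bigD1 i)//= lerDl sumr_ge0.
  have := lerB_normD (lam * z i 0) (rho i 0); rewrite normrM (gtr0_norm l0) (mulrC lam); lra.
have {key} := key hW bG' D0 dD vD hD.
have -> : \int[lebm n.+1]_z G' z = (lam ^+ n.+1)^-1 * osc w f gam th.
  by apply: (@rint_affine _ _ G B) => //; exists M.
move=> key.
have ln : 0 < lam ^+ n.+1 by rewrite exprn_gt0.
rewrite -(ler_pM2l ln) in key; rewrite -{1}(ger0_norm (ltW ln)) -normrM in key.
rewrite mulrBr mulrA mulfV ?gt_eqF// mul1r in key.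
apply: le_trans key _; rewrite le_eqVlt; apply/orP; left; apply/eqP.
rewrite /E /CRie [(8 / lam) ^+ _]exprMn exprVn [(4 * pi * C * _) ^+ _]exprMn [(lam * _) ^+ _]exprMn.
by field; rewrite expf_neq0// gt_eqF.
Qed.

End RiemannPhase.

(** * Weyl's inequality *)

Section SeparatedSums.
Context {R : realType}.

(** With [t = pi x], the mean value theorem gives [sin (t/2) >= (t/2) cos (t/2)]; doubling the angle
    yields [sin t >= t cos^2 (t/2) = t (1 + cos t) / 2 >= t / 2], and [pi >= 2] concludes. *)
Lemma sin_lower (x : R) : 0 <= x <= 2^-1 -> x <= sin (pi * x).
Proof.
move=> /andP[x0 x2]; have p0 := pi_gt0 R; have p2 := pi_ge2 R.
set t := pi * x.
have t0 : 0 <= t by rewrite mulr_ge0// ltW.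
have tp : t <= pi / 2 by rewrite /t ler_pM2l.
have half : t / 2 * cos (t / 2) <= sin (t / 2).
  move: t0; rewrite le_eqVlt => /orP[/eqP <-|t0]; first by rewrite mul0r sin0 mul0r.
  have h0 : 0 < t / 2 by rewrite divr_gt0.
  have [c /andP[c0 c1] e] := MVT_dseq h0 (fun x => is_derive_sin x).
  move: e; rewrite sin0 !subr0 => ->; rewrite mulrC ler_pM2r//.
  move: c1; rewrite le_eqVlt => /orP[/eqP -> //|c1].
  by apply/ltW; rewrite ltr_cos ?in_itv /=//; lra.
have -> : sin t = 2 * (sin (t / 2) * cos (t / 2)).
  by rewrite {1}(splitr t) sinD; ring.
have ct : 0 <= cos t by apply: cos_ge0_pihalf; lra.
have c2 : cos (t / 2) * cos (t / 2) = (1 + cos t) / 2.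
  rewrite {3}(splitr t) cosD; have := cos2Dsin2 (t / 2).
  by rewrite !expr2 => h; lra.
have c0 : 0 <= cos (t / 2) by apply: cos_ge0_pihalf; lra.
apply: (@le_trans _ _ (2 * ((t / 2 * cos (t / 2)) * cos (t / 2)))); last first.
  by rewrite ler_pM2l//; apply: ler_wpM2r.
rewrite -[_ * _ * cos _]mulrA c2 (_ : 2 * (t / 2 * ((1 + cos t) / 2)) = (t + t * cos t) / 2); last by field.
have h1 : 0 <= t * cos t by exact: mulr_ge0.
have h2 : 2 * x <= t by apply: ler_wpM2r.
by lra.
Qed.

Lemma sin2_lower (x : R) : `|x| <= 2^-1 -> x ^+ 2 <= sin (pi * x) ^+ 2.
Proof.
move=> h; have [x0|x0] := leP 0 x.
  rewrite ger0_norm// in h; have := @sin_lower x; rewrite x0 h => /(_ isT).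
  by move=> hs; rewrite lerXn2r ?nnegrE//; apply: le_trans hs.
rewrite ltr0_norm// in h; have := @sin_lower (- x); rewrite h oppr_ge0 ltW// => /(_ isT).
rewrite mulrN sinN => hs; rewrite -sqrrN -[leRHS]sqrrN lerXn2r ?nnegrE//; lra.
Qed.

Lemma sin2_piz (x : R) (k : int) : sin (pi * (x + k%:~R)) ^+ 2 = sin (pi * x) ^+ 2.
Proof.
have nat_case (y : R) (m : nat) : sin (pi * (y + m%:R)) ^+ 2 = sin (pi * y) ^+ 2.
  elim: m => [|m IH]; first by rewrite addr0.
  by rewrite -natr1 addrA mulrDr mulr1 sinDpi sqrrN.
case: k => m; first exact: nat_case.
by rewrite NegzE mulrNz -pmulrn -(nat_case _ m.+1) subrK.
Qed.

(** The points are reduced modulo 1 to around 0 and sorted into cells of length [kap]. Separation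
    puts at most one point into each cell, so the sum is bounded by a sum over distinct cell numbers
    [m i]. *)
Lemma circle_sep_sum (I : eqType) (r : seq I) (x : I -> R) (kap L : R) : uniq r ->
  0 < kap -> 0 < L ->
  {in r &, forall i j, i != j -> forall k : int, kap <= `|x i - x j - k%:~R|} ->
  \sum_(i <- r) (1 + 4 * L ^+ 2 * sin (pi * x i) ^+ 2)^-1 <= 4 * (1 + 2 * L * kap) / (2 * L * kap).
Proof.
move=> ur k0 L0 sep.
pose n i : int := Num.floor (x i + 2^-1).
pose y i := x i - (n i)%:~R.
have yb i : `|y i| <= 2^-1.
  have /andP[h1 h2] := floor_itv (x i + 2^-1); rewrite intrD in h2.
  rewrite /y /n ler_norml; apply/andP; split; lra.
pose m i : int := Num.floor (y i / kap).
have mb i : 0 <= y i / kap - (m i)%:~R < 1.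
  have /andP[h1 h2] := floor_itv (y i / kap); rewrite intrD in h2.
  by apply/andP; split; rewrite /m; lra.
apply: (@le_trans _ _ (\sum_(k <- [seq m i | i <- r]) (1 + (2 * L * kap * (jz k)%:R) ^+ 2)^-1)).
  rewrite big_map; apply: ler_sum => i _.
  rewrite lef_pV2 ?posrE; last 2 first.
    by have := sqr_ge0 (sin (pi * x i)); have := sqr_ge0 L; nra.
    by have := sqr_ge0 (2 * L * kap * (jz (m i))%:R); lra.
  rewrite lerD2l (_ : x i = y i + (n i)%:~R); last by rewrite /y subrK.
  rewrite sin2_piz; have h1 := sin2_lower (yb i).
  apply: (@le_trans _ _ (4 * L ^+ 2 * (y i) ^+ 2)); last first.
    by apply: ler_wpM2l => //; rewrite mulr_ge0// sqr_ge0.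
  rewrite (_ : 4 * L ^+ 2 * (y i) ^+ 2 = (2 * L * kap) ^+ 2 * (y i / kap) ^+ 2); last by field; lra.
  rewrite exprMn; apply: ler_wpM2l; first exact: sqr_ge0.
  have := jz_frac (m i) (mb i); rewrite addrC subrK => h.
  by rewrite -[leRHS]real_normK ?num_real// lerXn2r ?nnegrE.
apply: sum_jz_sqr; last by rewrite !mulr_gt0.
rewrite map_inj_in_uniq// => i j ir jr /= mij; apply/eqP/negP => /negP ij.
have := sep _ _ ir jr ij (n i - n j).
have -> : x i - x j - (n i - n j)%:~R = y i - y j by rewrite /y intrB; ring.
have := mb i; have := mb j; rewrite mij => /andP[a1 a2] /andP[b1 b2].
have : `|y i / kap - y j / kap| < 1 by rewrite ltr_norml; apply/andP; split; lra.
rewrite -mulrBl normrM normfV (gtr0_norm k0) ltr_pdivrMr// mul1r => h1 h2.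
by have := lt_le_trans h1 h2; rewrite ltxx.
Qed.

(** One coordinate of the sum that Weyl differencing leaves: decay at scale [L], times a smooth form
    of the minimum of 1 and [(L ||al k||)^-2], where [||.||] is the distance to the integers. *)
Definition xfac (L al : R) (k : int) : R :=
  (1 + (L^-1 * k%:~R) ^+ 2)^-1 * (1 + 4 * L ^+ 2 * sin (pi * (al * k%:~R)) ^+ 2)^-1.

Lemma xden_ge0 (L s : R) : 0 <= (1 + 4 * L ^+ 2 * s ^+ 2)^-1.
Proof.
rewrite invr_ge0 addr_ge0//.
by apply: mulr_ge0; [apply: mulr_ge0|]; rewrite ?sqr_ge0.
Qed.

Lemma xfac_ge0 L al k : 0 <= xfac L al k.
Proof.
by rewrite /xfac mulr_ge0 ?xden_ge0// invr_ge0 addr_ge0// sqr_ge0.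
Qed.

(** The integers are cut into blocks of length [G]. Inside a block the points [al k] are
    [kap]-separated modulo 1, which gives the factor in [kap]; the decay sums over the blocks and
    gives [1 + L / G]. *)
Lemma xfac_sum (L al kap : R) (G N : nat) : 0 < L -> 0 < kap -> (0 < G)%N ->
  (forall g : nat, (0 < g < G)%N -> forall k : int, kap <= `|al * g%:R - k%:~R|) ->
  \sum_(k <- irange N) xfac L al k <= 16 * (1 + L / G%:R) * (1 + (2 * L * kap)^-1).
Proof.
move=> L0 k0 G0 sep.
pose pr (p : int * nat) : int := (G%:Z * p.1 + p.2%:Z)%R.
pose S := [seq pr p | p <- [seq (q, i) | q <- irange N.+1, i <- iota 0 G]].
have G0' : (G%:Z != 0) by rewrite -lt0n in G0 *; case: (G) G0.
have iotaP (i : nat) : i \in iota 0 G -> (i < G)%N by rewrite mem_iota.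
have prq q i : (i < G)%N -> (pr (q, i) %/ G%:Z)%Z = q /\ (pr (q, i) %% G%:Z)%Z = i%:Z.
  move=> iG; rewrite /pr /= mulrC; split.
    by rewrite divzMDl// divz_small ?addr0//; lia.
  by rewrite modzMDl modz_small//; lia.
have uS : uniq S.
  rewrite map_inj_in_uniq.
    by rewrite allpairs_uniq ?irange_uniq ?iota_uniq// => -[a b] [c d].
  move=> p p' pS p'S E.
  have /allpairsP[[a b] /= [_ /iotaP bG ep]] := pS.
  have /allpairsP[[a' b'] /= [_ /iotaP bG' ep']] := p'S.
  rewrite ep ep' /= in E *.
  have [e1 e2] := prq a b bG; have [e1' e2'] := prq a' b' bG'.
  by move: e1 e2; rewrite E e1' e2' => -> [->].
apply: (@le_trans _ _ (\sum_(k <- S) xfac L al k)).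
  apply: sum_sub => //; first exact: irange_uniq.
    move=> k; rewrite mem_irange => /andP[h1 h2].
    apply/mapP; exists ((k %/ G%:Z)%Z, absz (k %% G%:Z)%Z).
      apply/allpairsP; exists ((k %/ G%:Z)%Z, absz (k %% G%:Z)%Z); split=> //=.
        rewrite mem_irange; have := divz_eq k G%:Z; have := modz_ge0 k G0'.
        have := @ltz_pmod k G%:Z; nia.
      rewrite mem_iota /= add0n; have := modz_ge0 k G0'; have := @ltz_pmod k G%:Z; lia.
    rewrite /pr /= {1}(divz_eq k G%:Z) mulrC; congr (_ + _).
    by have := modz_ge0 k G0'; lia.
  by move=> k; exact: xfac_ge0.
rewrite /S big_map big_allpairs_dep /=.
pose y' := 2 * L * kap; pose y := G%:R / L.
have Gr : 0 < G%:R :> R by rewrite ltr0n.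
have y0 : 0 < y by rewrite divr_gt0.
have y'0 : 0 < y' by rewrite !mulr_gt0.
apply: (@le_trans _ _ (\sum_(q <- irange N.+1) (1 + (y * (jz q)%:R) ^+ 2)^-1 * (4 * (1 + y') / y'))).
  apply: ler_sum => q _.
  apply: (@le_trans _ _ (\sum_(i <- iota 0 G) (1 + (y * (jz q)%:R) ^+ 2)^-1 *
     (1 + 4 * L ^+ 2 * sin (pi * (al * (pr (q, i))%:~R)) ^+ 2)^-1)).
    rewrite big_seq [leRHS]big_seq; apply: ler_sum => i /iotaP iG.
    apply: ler_wpM2r.
      exact: xden_ge0.
    rewrite lef_pV2 ?posrE; try by rewrite ltr_pwDl// sqr_ge0.
    rewrite lerD2l /y (mulrC (G%:R)) -mulrA !exprMn; apply: ler_wpM2l; first exact: sqr_ge0.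
    rewrite -exprMn -natrM -[leRHS]real_normK ?num_real// -intr_norm lerXn2r ?nnegrE//.
    rewrite -[(G * jz q)%:R]/((G * jz q)%N%:~R) ler_int /pr /=.
    case: q => m /=; first by rewrite ger0_norm; lia.
    by rewrite NegzE ltr0_norm; nia.
  rewrite -mulr_sumr; apply: ler_wpM2l; first by rewrite invr_ge0 addr_ge0// sqr_ge0.
  apply: (@circle_sep_sum nat (iota 0 G) (fun i => al * (pr (q, i))%:~R) kap L) => //.
    exact: iota_uniq.
  move=> i j /iotaP iG /iotaP jG ij k.
  rewrite -mulrBr /pr /= !intrD [_ + i%:~R]addrC opprD addrA addrK -!pmulrn.
  wlog ij' : i j iG jG ij k / (j < i)%N.
    move=> H; case: (ltngtP j i) => [h|h|h]; first exact: H.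
      have := H j i jG iG _ (- k) h; rewrite eq_sym => /(_ ij).
      by rewrite mulrNz -normrN; congr (_ <= `|_|); ring.
    by rewrite h eqxx in ij.
  rewrite -natrB ?(ltnW ij')//; apply: sep; rewrite subn_gt0 ij' /=.
  by apply: leq_ltn_trans iG; exact: leq_subr.
rewrite -mulr_suml.
have h1 := sum_jz_sqr (irange_uniq N.+1) y0.
apply: (@le_trans _ _ (4 * (1 + y) / y * (4 * (1 + y') / y'))).
  by apply: ler_wpM2r => //; apply: divr_ge0; [apply: mulr_ge0 => //; lra|exact: ltW].
rewrite le_eqVlt; apply/orP; left; apply/eqP; rewrite /y -/y'; field.
by rewrite !gt_eqF.
Qed.

End SeparatedSums.

Section Differences.
Context {R : realType}.
Implicit Types u v : R -> R.

Definition diff2 u : R -> R := fun s => u (s + 1) + u (s - 1) - 2 * u s.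

Lemma diff2_bound (u u1 u2 : R -> R) x E : (forall s, is_derive s (1:R) u (u1 s)) ->
  (forall s, is_derive s (1:R) u1 (u2 s)) -> (forall s, x - 1 <= s <= x + 1 -> `|u2 s| <= E) ->
  `|diff2 u x| <= 2 * E.
Proof.
move=> d1 d2 hE.
have x1 : x < x + 1 by rewrite ltrDl.
have x2 : x - 1 < x by rewrite gtrBl.
have [c1 /andP[c1a c1b] e1] := MVT_dseq x1 d1.
have [c2 /andP[c2a c2b] e2] := MVT_dseq x2 d1.
have -> : diff2 u x = u1 c1 - u1 c2.
  have -> : diff2 u x = (u (x + 1) - u x) - (u x - u (x - 1)) by rewrite /diff2; ring.
  by rewrite e1 e2; ring.
have [e|c12] := eqVneq c1 c2.
  by rewrite e subrr normr0 mulr_ge0// (le_trans _ (hE x _))//; lra.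
have c21 : c2 < c1 by rewrite lt_neqAle eq_sym c12 /=; lra.
have [c /andP[ca cb] ->] := MVT_dseq c21 d2.
rewrite normrM mulrC; apply: ler_pM => //.
  by rewrite ger0_norm; lra.
by apply: hE; lra.
Qed.

Lemma diff2_iter_bound m (u : nat -> R -> R) x E : dseq m.*2 u ->
  (forall s, x - m%:R <= s <= x + m%:R -> `|u m.*2 s| <= E) ->
  `|iter m diff2 (u 0) x| <= 2 ^+ m * E.
Proof.
elim: m u x E => [|m IH] u x E du hE.
  by rewrite expr0 mul1r; apply: hE; rewrite subr0 addr0 lexx.
rewrite iterSr exprSr -mulrA.
have d2 (l : nat) : (l < m.+1.*2)%N -> forall y, is_derive y (1:R) (diff2 (u l)) (diff2 (u l.+1) y).
  move=> lm y.
  have dp : is_derive y (1:R) (fun s => u l (s + 1)) (u l.+1 (y + 1)).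
    have := @is_derive_affine _ (u l) (u l.+1 (y + 1)) 1 1 y; rewrite !mul1r => h.
    have -> : (fun s => u l (s + 1)) = (fun s => u l (1 * s + 1)) by apply/funext => s; rewrite mul1r.
    by apply: h; exact: du.
  have dm : is_derive y (1:R) (fun s => u l (s - 1)) (u l.+1 (y - 1)).
    have := @is_derive_affine _ (u l) (u l.+1 (y - 1)) 1 (- 1) y; rewrite !mul1r => h.
    have -> : (fun s => u l (s - 1)) = (fun s => u l (1 * s - 1)) by apply/funext => s; rewrite mul1r.
    by apply: h; exact: du.
  have dz := @is_deriveZ _ _ _ (u l) 2 y 1 _ (du l y lm).
  exact: (@is_deriveB _ _ _ _ _ y 1 _ _ (@is_deriveD _ _ _ _ _ y 1 _ _ dp dm) dz).
apply: (IH (fun l => diff2 (u l))).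
  by move=> l y lm; apply: d2; rewrite doubleS; lia.
move=> s /andP[s1 s2].
apply: (@diff2_bound _ (u m.*2.+1) (u m.+1.*2)).
- by move=> y; apply: du; rewrite doubleS; lia.
- by move=> y; apply: du; rewrite doubleS; lia.
move=> y /andP[y1 y2]; apply: hE; rewrite -natr1; apply/andP; split; lra.
Qed.

End Differences.

Section LatticeDifferences.
Context {R : realType} {n : nat}.
Notation Zn := 'cV[int]_n.

Definition ez (j : 'I_n) : Zn := delta_mx j 0.

Definition zdiff2 (j : 'I_n) (g : Zn -> R) : Zn -> R :=
  fun b => g (b + ez j) + g (b - ez j) - 2 * g b.

Definition zsupp (N : nat) (g : Zn -> R) := forall b, g b != 0 -> b \in zbox N n.

Lemma zbox_le N N' b : (N <= N')%N -> b \in zbox N n -> b \in zbox N' n.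
Proof.
move=> NN; rewrite !mem_zbox => /forallP h; apply/forallP => i.
by have := h i; lia.
Qed.

Lemma ezE j i : ez j i 0 = (i == j)%:Z.
Proof. by rewrite mxE eqxx andbT; case: (i == j). Qed.

Lemma zbox_ez N b j : (b + ez j \in zbox N n -> b \in zbox N.+1 n) /\
  (b - ez j \in zbox N n -> b \in zbox N.+1 n).
Proof.
rewrite !mem_zbox; split=> /forallP h; apply/forallP => i; have := h i;
  rewrite !mxE eqxx andbT; case: (i == j) => /=; lia.
Qed.

Lemma zsupp_diff2 N j g : zsupp N g -> zsupp N.+1 (zdiff2 j g).
Proof.
move=> h b; rewrite /zdiff2.
have [/h /(zbox_ez N b j).1 //|/negPn/eqP ->] := boolP (g (b + ez j) != 0).
have [/h /(zbox_ez N b j).2 //|/negPn/eqP ->] := boolP (g (b - ez j) != 0).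
have [/h hb _|/negPn/eqP ->] := boolP (g b != 0); first exact: zbox_le hb.
by rewrite mulr0 addr0 subr0 eqxx.
Qed.

Lemma zsum_shift N N' (F : Zn -> R) c : zsupp N F -> zsupp N' (fun b => F (b + c)) ->
  \sum_(b <- zbox N n) F b = \sum_(b <- zbox N' n) F (b + c).
Proof.
move=> h h'; rewrite -(big_map (fun b => b + c) xpredT F); apply: sum_supp.
- exact: zbox_uniq.
- by rewrite map_inj_uniq ?zbox_uniq//; exact: addIr.
move=> x Fx; rewrite h//; apply/esym/mapP; exists (x - c); last by rewrite subrK.
by apply: h'; rewrite subrK.
Qed.

Lemma zsum_supp N N' (F : Zn -> R) : zsupp N F -> zsupp N' F ->
  \sum_(b <- zbox N n) F b = \sum_(b <- zbox N' n) F b.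
Proof.
by move=> h h'; apply: sum_supp; rewrite ?zbox_uniq// => x Fx; rewrite h// h'.
Qed.

Lemma zsum_parts N j (g phi : Zn -> R) : zsupp N g ->
  \sum_(b <- zbox N.+1 n) zdiff2 j g b * phi b =
  \sum_(b <- zbox N n) g b * (phi (b + ez j) + phi (b - ez j) - 2 * phi b).
Proof.
move=> h.
have E1 : \sum_(b <- zbox N n) g b * phi (b - ez j) = \sum_(b <- zbox N.+1 n) g (b + ez j) * phi b.
  rewrite (@zsum_shift N N.+1 _ (ez j)).
  - by apply: eq_bigr => b _; rewrite addrK.
  - by move=> b hb; apply: h; apply: contraNneq hb => ->; rewrite mul0r.
  - move=> b hb; apply: (zbox_ez N b j).1; apply: h.
    by apply: contraNneq hb => ->; rewrite mul0r.
have E2 : \sum_(b <- zbox N n) g b * phi (b + ez j) = \sum_(b <- zbox N.+1 n) g (b - ez j) * phi b.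
  rewrite (@zsum_shift N N.+1 _ (- ez j)).
  - by apply: eq_bigr => b _; rewrite subrK.
  - by move=> b hb; apply: h; apply: contraNneq hb => ->; rewrite mul0r.
  - move=> b hb; apply: (zbox_ez N b j).2; apply: h.
    by apply: contraNneq hb => ->; rewrite mul0r.
have E3 : \sum_(b <- zbox N n) g b * phi b = \sum_(b <- zbox N.+1 n) g b * phi b.
  apply: zsum_supp => b hb.
    by apply: h; apply: contraNneq hb => ->; rewrite mul0r.
  by apply: (@zbox_le N) => //; apply: h; apply: contraNneq hb => ->; rewrite mul0r.
transitivity (\sum_(b <- zbox N.+1 n) (g (b + ez j) * phi b + g (b - ez j) * phi b - 2 * (g b * phi b))).
  by apply: eq_bigr => b _; rewrite /zdiff2; ring.
rewrite sumrB big_split /= -mulr_sumr -E1 -E2 -E3.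
rewrite mulr_sumr -big_split -sumrB /=.
by apply: eq_bigr => b _; ring.
Qed.

Definition zdot (th : 'I_n -> R) (b : Zn) : R := \sum_i th i * (b i 0)%:~R.

Lemma zdot_ez th b j : zdot th (b + ez j) = zdot th b + th j /\
  zdot th (b - ez j) = zdot th b - th j.
Proof.
have D c : zdot th (b + c) = zdot th b + zdot th c.
  by rewrite /zdot -big_split; apply: eq_bigr => i _; rewrite mxE intrD mulrDr.
have E : zdot th (ez j) = th j.
  rewrite /zdot (bigD1 j)//= ezE eqxx mulr1 big1 ?addr0// => i ij.
  by rewrite ezE (negPf ij) mulr0.
have EN : zdot th (- ez j) = - th j.
  by rewrite -E /zdot -sumrN; apply: eq_bigr => i _; rewrite mxE intrN mulrN.
by rewrite !D E EN.
Qed.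

(** The second difference multiplies the cosine by a scalar, so repeated summation by parts never
    mixes in sines. *)
Lemma cos_diff2 (a b : R) : cos (a + b) + cos (a - b) - 2 * cos a = - (4 * sin (b / 2) ^+ 2) * cos a.
Proof.
rewrite cosD cosB {1 2 3 4}(splitr b) cosD; have := cos2Dsin2 (b / 2).
set c := cos (b / 2); set s := sin (b / 2) => h.
have -> : c * c = 1 - s ^+ 2 by rewrite -expr2; lra.
by rewrite expr2; ring.
Qed.

Lemma zsum_cos_parts m N j g th c : zsupp N g ->
  (- (4 * sin (pi * th j) ^+ 2)) ^+ m * \sum_(b <- zbox N n) g b * cos (2 * pi * (zdot th b + c)) =
  \sum_(b <- zbox (N + m) n) iter m (zdiff2 j) g b * cos (2 * pi * (zdot th b + c)).
Proof.
elim: m N g => [|m IH] N g h; first by rewrite expr0 mul1r addn0.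
rewrite iterSr addnS -addSn -IH; last exact: zsupp_diff2.
rewrite exprSr -mulrA; congr (_ * _).
rewrite (zsum_parts _ (fun b => cos (2 * pi * (zdot th b + c)))) // mulr_sumr.
apply: eq_bigr => b _; have [-> ->] := zdot_ez th b j.
have -> : 2 * pi * (zdot th b + th j + c) = 2 * pi * (zdot th b + c) + 2 * pi * th j by ring.
have -> : 2 * pi * (zdot th b - th j + c) = 2 * pi * (zdot th b + c) - 2 * pi * th j by ring.
rewrite cos_diff2 mulrCA; congr (_ * (- (4 * sin _ ^+ 2) * _)).
by field.
Qed.

Lemma zdiff2_iter (g : Zn -> R) (u : R -> R) j b m : (forall k : int, g (b + k *: ez j) = u k%:~R) ->
  forall k : int, iter m (zdiff2 j) g (b + k *: ez j) = iter m diff2 u k%:~R.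
Proof.
move=> h; elim: m => [|m IH] k; first exact: h.
rewrite !iterS /zdiff2 /diff2 -!IH.
congr (_ + _ - _).
  by rewrite -addrA -[X in _ + (_ + X)]scale1r -scalerDl IH intrD.
by rewrite -addrA -[X in _ + (_ - X)]scale1r -scalerBl IH intrB.
Qed.

Lemma zsum_prod N (be : 'I_n -> int -> R) :
  \sum_(b <- zbox N n) \prod_i be i (b i 0) = \prod_i \sum_(k <- irange N) be i k.
Proof.
elim: n be => [|m IH] be; first by rewrite /= big_seq1 !big_ord0.
rewrite big_zboxS big_ord_recl mulr_suml; apply: eq_bigr => i _.
rewrite -IH mulr_sumr; apply: eq_bigr => b _.
rewrite big_ord_recl consz0; congr (_ * _).
by apply: eq_bigr => k _; rewrite conszS.
Qed.

End LatticeDifferences.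

Section OmegaEstimates.
Context {R : realType} {n : nat}.
Implicit Types z y : 'cV[R]_n.

Lemma sqrfac_shift (x t : R) : (1 + (x + t) ^+ 2)^-1 <= 2 * (1 + t ^+ 2) * (1 + x ^+ 2)^-1.
Proof.
have h1 := sqr_ge0 x; have h2 := sqr_ge0 t; have h3 := sqr_ge0 (x + t).
rewrite ler_pdivlMr ?ltr_pwDl// mulrC ler_pdivrMr ?ltr_pwDl//.
have := sqr_ge0 (x + 2 * t); have := mulr_ge0 h2 h3; nra.
Qed.

Lemma omega_ge0 z : 0 <= omega z.
Proof. exact/ltW/omega_gt0. Qed.

Lemma exprn_prod (c : R) (F : 'I_n -> R) : c ^+ n * \prod_i F i = \prod_i (c * F i).
Proof. by rewrite big_split /= prodr_const card_ord. Qed.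

Lemma omega_shift z j t : omega (z + t *: delta_mx j 0) <= 2 * (1 + t ^+ 2) * omega z.
Proof.
rewrite /omega (bigD1 j)//= [in leRHS](bigD1 j)//= mulrA mxE entry_shift eqxx mulr1.
apply: ler_pM.
- by case/andP: (omega_factor (z j 0 + t)) => /ltW.
- by apply: prodr_ge0 => i _; rewrite invr_ge0 addr_ge0// sqr_ge0.
- exact: sqrfac_shift.
rewrite le_eqVlt; apply/orP; left; apply/eqP; apply: eq_bigr => i ij.
by rewrite mxE entry_shift (negPf ij) mulr0 addr0.
Qed.

Lemma omega_mul z y : omega z * omega y <= 2 ^+ n * omega (y - z).
Proof.
rewrite /omega -big_split /= exprn_prod.
apply: ler_prod => i _; rewrite !mxE.
have a0 := sqr_ge0 (z i 0); have b0 := sqr_ge0 (y i 0); have c0 := sqr_ge0 (y i 0 - z i 0).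
apply/andP; split; first by rewrite mulr_ge0// invr_ge0 addr_ge0.
rewrite ler_pdivlMr ?ltr_pwDl// -invfM mulrC ler_pdivrMr ?mulr_gt0 ?ltr_pwDl//.
by have := sqr_ge0 (y i 0 + z i 0); have := mulr_ge0 a0 b0; nra.
Qed.

Lemma omega_coord z i : `|z i 0| <= (omega z)^-1 /\ 1 + (z i 0) ^+ 2 <= (omega z)^-1.
Proof.
have a0 := sqr_ge0 (z i 0).
have h : 1 + (z i 0) ^+ 2 <= (omega z)^-1.
  rewrite -[leLHS]invrK lef_pV2 ?posrE ?omega_gt0 ?invr_gt0 ?ltr_pwDl//.
  rewrite /omega (bigD1 i)//= ler_piMr ?invr_ge0 ?addr_ge0//.
  by apply: prodr_ile1 => k _; case/andP: (omega_factor (z k 0)) => /ltW -> ->.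
split=> //; apply: le_trans h.
by rewrite -(real_normK (num_real (z i 0))); have := sqr_ge0 (`|z i 0| - 1); nra.
Qed.

(** A linear map mixes the coordinates: the square of each coordinate of [A y] is bounded by a
    multiple of [(omega y)^-1], so each of the n factors on the right costs a whole power of
    [omega y]. *)
Lemma omega_lin (A : 'M[R]_n) : exists2 c, 0 < c & forall y, omega y ^+ n <= c * omega (A *m y).
Proof.
pose S := \sum_i \sum_j `|A i j|.
have S0 : 0 <= S by apply: sumr_ge0 => i _; apply: sumr_ge0.
exists ((1 + S ^+ 2) ^+ n); first by rewrite exprn_gt0// ltr_pwDl// sqr_ge0.
move=> y; rewrite /omega -[X in X <= _](_ : \prod_(i < n) omega y = _); last by rewrite prodr_const card_ord.
rewrite exprn_prod.
apply: ler_prod => i _; rewrite omega_ge0 /=.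
have o0 := omega_gt0 y.
have s0 := sqr_ge0 ((A *m y) i 0); have s1 := sqr_ge0 S.
rewrite ler_pdivlMr ?ltr_pwDl//.
have [q q0 qE] : exists2 q, 0 <= q & q ^+ 2 = (omega y)^-1.
  by exists (Num.sqrt (omega y)^-1); rewrite ?sqrtr_ge0// sqr_sqrtr// invr_ge0 ltW.
have h : `|(A *m y) i 0| <= S * q.
  rewrite mxE (le_trans (ler_norm_sum _ _ _))//.
  apply: (@le_trans _ _ (\sum_j `|A i j| * q)).
    apply: ler_sum => j _; rewrite normrM; apply: ler_wpM2l => //.
    rewrite -ler_sqr ?nnegrE// real_normK ?num_real// qE.
    by have [_ h] := omega_coord y j; apply: le_trans h; rewrite lerDr.
  rewrite -mulr_suml; apply: ler_wpM2r => //.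
  by rewrite [leRHS](bigD1 i)//= lerDl sumr_ge0// => k _; apply: sumr_ge0.
have h2 : ((A *m y) i 0) ^+ 2 <= S ^+ 2 * (omega y)^-1.
  by rewrite -qE -exprMn -real_normK ?num_real// lerXn2r ?nnegrE// mulr_ge0.
have o1 := omega_le1 y.
apply: (@le_trans _ _ (omega y * ((1 + S ^+ 2) * (omega y)^-1))); last first.
  by rewrite mulrCA mulfV ?mulr1// gt_eqF.
apply: ler_wpM2l; first exact: ltW.
rewrite mulrDl mul1r; apply: lerD => //.
by rewrite invf_ge1.
Qed.

End OmegaEstimates.

Section Weyl.
Context {R : realType} {n : nat}.
Notation d := n.+1.
Notation V := 'cV[R]_d.
Notation Zn := 'cV[int]_d.

Lemma zRD (b c : Zn) : @zR R _ (b + c) = zR b + zR c.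
Proof. by apply/matrixP => i j; rewrite !mxE intrD. Qed.

Lemma zRZ (k : int) (b : Zn) : @zR R _ (k *: b) = k%:~R *: zR b.
Proof. by apply/matrixP => i j; rewrite !mxE intrM. Qed.

Lemma zR_mul (A : 'M[int]_d) (h : Zn) : map_mx intr A *m @zR R _ h = zR (A *m h).
Proof.
apply/matrixP => i j; rewrite !mxE rmorph_sum; apply: eq_bigr => k _.
by rewrite !mxE rmorphM.
Qed.

Lemma zR_ez (j : 'I_d) : @zR R _ (ez j) = delta_mx j 0.
Proof. by apply/matrixP => i k; rewrite !mxE; case: (_ && _). Qed.

(** Each second difference of the correlation is two derivatives at scale [lam]; moving the base
    point by at most [m] steps changes [omega] only by a bounded factor. *)
Lemma corr_bound K p M B (w : V -> R) D (lam : R) m j h b :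
  weight K p M B w D -> (m.*2 <= K)%N -> 0 < lam <= 1 ->
  `|iter m (zdiff2 j) (fun b => w (lam *: zR b) * w (lam *: zR (b + h))) b| <=
  2 ^+ m * (2 ^+ m.*2 * M ^+ 2 * lam ^+ m.*2 * (2 * (1 + m%:R ^+ 2)) ^+ p.*2) *
    (omega (lam *: zR b) ^+ p * omega (lam *: zR (b + h)) ^+ p).
Proof.
move=> hw mK /andP[l0 l1].
have M0 := weight_ge0 hw.
have [D0 dD bD _ _] := hw.
set z := lam *: zR b; set z' := lam *: zR (b + h).
pose u l s := lam ^+ l * mulseq l (fun i t => D j i (z + t *: delta_mx j 0))
   (fun i t => D j i (z' + t *: delta_mx j 0)) (lam * s + 0).
have du : dseq m.*2 u.
  exact: (dseq_affine lam 0 (dseq_mul (dseq_le mK (dD j z)) (dseq_le mK (dD j z')))).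
set g := (X in iter m (zdiff2 j) X b).
have gu (k : int) : g (b + k *: ez j) = u 0 k%:~R.
  rewrite /g /u /= expr0 mul1r addr0 !D0 /z /z' -addrA (addrC (k *: _)) addrA.
  by rewrite (zRD b) (zRD (b + h)) !zRZ zR_ez !scalerDr !scalerA.
have := zdiff2_iter m gu 0; rewrite scale0r addr0 => ->.
rewrite -mulrA; apply: diff2_iter_bound => // s /andP[s1 s2].
set c := 2 * (1 + m%:R ^+ 2).
have sm : `|lam * s| <= m%:R.
  rewrite normrM gtr0_norm// -[leRHS]mul1r; apply: ler_pM => //; first exact: ltW.
  by rewrite ler_norml; move: s1 s2; rewrite sub0r add0r => -> ->.
have oc (x : V) : omega (x + (lam * s) *: delta_mx j 0) ^+ p <= c ^+ p * omega x ^+ p.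
  rewrite -exprMn lerXn2r ?nnegrE ?omega_ge0//.
    by rewrite mulr_ge0 ?omega_ge0// /c mulr_ge0// addr_ge0// sqr_ge0.
  apply: le_trans (omega_shift _ _ _) _; apply: ler_wpM2r; first exact: omega_ge0.
  by rewrite /c ler_pM2l// lerD2l -real_normK ?num_real// lerXn2r ?nnegrE.
have c0 : 0 <= c by rewrite /c mulr_ge0// addr_ge0// sqr_ge0.
have bnd (x : V) i : (i <= m.*2)%N -> `|D j i (x + (lam * s + 0) *: delta_mx j 0)| <= M * (c ^+ p * omega x ^+ p) * 1 ^+ i.
  move=> im; rewrite expr1n mulr1 addr0; apply: le_trans (bD j i _ (leq_trans im mK)) _.
  exact: ler_wpM2l (oc x).
have mc (x : V) : 0 <= M * (c ^+ p * omega x ^+ p).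
  by rewrite !mulr_ge0// exprn_ge0// omega_ge0.
have := @mulseq_bound R m.*2 (fun i t => D j i (z + t *: delta_mx j 0))
   (fun i t => D j i (z' + t *: delta_mx j 0)) (lam * s + 0) _ _ 1 (mc z) (mc z') ler01
   (bnd z) (bnd z').
rewrite expr1n mulr1 /u normrM ger0_norm ?exprn_ge0 ?(ltW l0)// => H.
apply: le_trans (ler_wpM2l _ H) _; first by rewrite exprn_ge0// ltW.
rewrite le_eqVlt; apply/orP; left; apply/eqP.
by rewrite -(addnn p) exprD expr2; ring.
Qed.

(** Only the hypothesis for the largest [u j] is used: its d-th power dominates the product of all
    of them. Differencing along single axes thus gives as much as mixed differencing. *)
Lemma prod_min (X Y : R) (u : 'I_d -> R) : 0 <= X -> (forall j, 0 <= u j) -> X <= Y ->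
  (forall j, (u j) ^+ d * X <= Y) -> X <= Y * \prod_j (2 / (1 + u j)).
Proof.
move=> X0 u0 XY Xu; have Y0 : 0 <= Y by apply: le_trans XY.
have [jm hjm] : exists jm, forall j, u j <= u jm.
  pose jm := [arg max_(i > (0 : 'I_d)) u i]%O.
  by exists jm => j; rewrite /jm; case: Order.TotalTheory.arg_maxP => // i _; apply.
have [um|um] := leP (u jm) 1.
  apply: le_trans XY _; rewrite -[leLHS]mulr1; apply: ler_wpM2l => //.
  apply: (@le_trans _ _ (\prod_(j < d) (1 : R))); first by rewrite big1_eq.
  apply: ler_prod => j _; rewrite ler01 /=.
  rewrite ler_pdivlMr ?mul1r ?ltr_pwDl//; have := hjm j; lra.
have um0 : 0 < u jm by lra.
apply: (@le_trans _ _ (Y * (u jm) ^- d)).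
  by rewrite ler_pdivlMr ?exprn_gt0// mulrC.
apply: ler_wpM2l => //; rewrite -exprVn -[in leLHS](card_ord d) -prodr_const.
apply: ler_prod => j _; rewrite invr_ge0 ltW//=.
rewrite -[leLHS]mul1r ler_pdivrMr// mulrAC ler_pdivlMr ?ltr_pwDl//.
by have := hjm j; lra.
Qed.

Lemma zsupp_exists (w : V -> R) (B lam : R) : 0 < lam -> (forall (z : V) i, B <= `|z i 0| -> w z = 0) ->
  exists N, forall N', (N <= N')%N -> zsupp N' (fun b => w (lam *: zR b)).
Proof.
move=> l0 hB; exists (Num.truncn (B / lam)).+1 => N' NN b hb.
rewrite mem_zbox; apply/forallP => i.
have : `|(b i 0)%:~R| < N'%:R :> R.
  rewrite ltNge; apply/negP => h; move/eqP: hb; apply; apply: (hB _ i).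
  rewrite !mxE normrM gtr0_norm// mulrC -ler_pdivrMr//; apply: le_trans h.
  by apply: le_trans (ltW (truncnS_gt _)) _; rewrite ler_nat.
rewrite -intr_norm -[N'%:R]/(N'%:~R) ltr_int => h; lia.
Qed.

Lemma sum_omega (lam : R) N : 0 < lam <= 1 ->
  \sum_(b <- zbox N d) omega (lam *: zR b) <= (8 / lam) ^+ d.
Proof.
move=> l01.
rewrite (eq_bigr (fun b : Zn => \prod_i (1 + (lam * (b i 0)%:~R) ^+ 2)^-1)); last first.
  by move=> b _; apply: eq_bigr => i _; rewrite !mxE.
rewrite (zsum_prod N (fun _ k => (1 + (lam * k%:~R) ^+ 2)^-1)).
rewrite prodr_const card_ord lerXn2r ?nnegrE//.
- by apply: sumr_ge0 => k _; rewrite invr_ge0 addr_ge0// sqr_ge0.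
- by case/andP: l01 => l0 _; rewrite divr_ge0// ltW.
have := @sum_shift_sqr R lam 0 0 N l01; rewrite big_irange; apply: le_trans.
rewrite le_eqVlt; apply/orP; left; apply/eqP; apply: eq_bigr => k _.
by rewrite !addr0 intrB -!pmulrn.
Qed.

End Weyl.

Section WeylBound.
Context {R : realType} {n : nat}.
Notation d := n.+1.
Notation V := 'cV[R]_d.
Notation Zn := 'cV[int]_d.

(** Squaring removes the quadratic part of the phase; the shift [h] leaves the linear phase with
    coefficients [al * (A h)_j]. Along each axis d second differences are performed, whence
    [d.*2 <= K], and [d < p] keeps decay both in the lattice point and in the shift. Because [A] is
    injective, the sum over [h] is at most one over all integer vectors, which factors. *)
Lemma weyl (A : 'M[int]_d) (p K : nat) : \det A != 0 -> (d < p)%N -> (d.*2 <= K)%N ->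
  exists2 C, 0 <= C & forall M B w D, weight K p M B w D ->
  forall L al X, 1 <= L -> (forall N, \sum_(k <- irange N) xfac L al k <= X) ->
  forall ph : Zn -> R,
  (forall h, exists c, forall b, ph (b + h) = ph b + zdot (fun i => al * ((A *m h) i 0)%:~R) b + c) ->
  forall N, zsupp N (fun b => w (L^-1 *: zR b)) ->
  (\sum_(b <- zbox N d) w (L^-1 *: zR b) * cos (2 * pi * ph b)) ^+ 2 <= C * M ^+ 2 * L ^+ d * X ^+ d.
Proof.
move=> detA dp dK.
have [cA cA0 hA] := omega_lin (map_mx intr A : 'M[R]_d).
pose c1 := 2 ^+ d * 2 ^+ d.*2 * (2 * (1 + d%:R ^+ 2)) ^+ p.*2 * (2 ^+ d) ^+ p.-1 * cA : R.
have c10 : 0 <= c1.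
  rewrite /c1; apply: mulr_ge0; last exact: ltW.
  apply: mulr_ge0; last by rewrite !exprn_ge0.
  apply: mulr_ge0; first by apply: mulr_ge0; rewrite exprn_ge0.
  by apply/exprn_ge0/mulr_ge0 => //; rewrite addr_ge0// sqr_ge0.
exists (c1 * 8 ^+ d * 2 ^+ d); first by nng.
move=> M B w D hw L al X L1 hX ph hph N sN.
have M0 := weight_ge0 hw.
have L0 : 0 < L by lra.
set lam := L^-1 in sN *.
have l01 : 0 < lam <= 1 by rewrite /lam invr_gt0 L0 invf_le1.
have [l0 l1] := andP l01.
pose v (b : Zn) := w (lam *: zR b).
pose g (h b : Zn) : R := v b * v (b + h).
have X0 : 0 <= X by apply: le_trans (hX 0); rewrite /irange big_nil.
have omb m j h b : (m <= d)%N -> `|iter m (zdiff2 j) (g h) b| <=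
   c1 * M ^+ 2 * lam ^+ m.*2 * omega (lam *: zR b) * omega (lam *: zR (A *m h)).
  move=> md; apply: le_trans (corr_bound j h b hw _ l01) _.
    by apply: leq_trans dK; rewrite leq_double.
  set o := omega (lam *: zR b); set o' := omega (lam *: zR (b + h)).
  (* One power of each [omega] is split off: that at [b] is kept for the sum over [b], that at
     [b + h] is bounded by 1. The remaining [p - 1 >= d] powers of both become decay in [A h]. *)
  have oo : o ^+ p * o' ^+ p <= o * ((2 ^+ d) ^+ p.-1 * (cA * omega (lam *: zR (A *m h)))).
    rewrite -(prednK (leq_trans (ltn0Sn _) dp)) !exprS prednK ?(leq_trans _ dp)// -(exprS 2 n).
    rewrite mulrACA -exprMn -mulrA; apply: ler_wpM2l; first exact: omega_ge0.
    rewrite -[leRHS]mul1r; apply: ler_pM; rewrite ?omega_ge0 ?omega_le1//.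
      by nng; exact: omega_ge0.
    have := omega_mul (lam *: zR b) (lam *: zR (b + h)).
    rewrite -scalerBr zRD addrAC subrr add0r -zRD -/o -/o' => om.
    apply: (@le_trans _ _ ((2 ^+ d * omega (lam *: zR h)) ^+ p.-1)).
      by rewrite lerXn2r ?nnegrE//; nng; exact: omega_ge0.
    rewrite [(_ * omega (lam *: zR h)) ^+ _]exprMn; apply: ler_wpM2l; first by nng.
    have := hA (lam *: zR h); rewrite -scalemxAr.
    rewrite zR_mul.
    apply: le_trans; rewrite -(subnKC (_ : d <= p.-1)%N); last by rewrite -ltnS prednK// (leq_trans _ dp).
    rewrite exprD -[leRHS]mulr1; apply: ler_wpM2l; first by apply: exprn_ge0; exact: omega_ge0.
    by apply: exprn_ile1; [exact: omega_ge0|exact: omega_le1].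
  have cc : 2 ^+ m * (2 ^+ m.*2 * M ^+ 2 * lam ^+ m.*2 * (2 * (1 + m%:R ^+ 2)) ^+ p.*2) <=
      2 ^+ d * (2 ^+ d.*2 * M ^+ 2 * lam ^+ m.*2 * (2 * (1 + d%:R ^+ 2)) ^+ p.*2) :> R.
    have e2 (i k : nat) : (i <= k)%N -> 2 ^+ i <= 2 ^+ k :> R by move=> ik; rewrite ler_eXn2l// ltr1n.
    have lm : 0 <= lam ^+ m.*2 by rewrite exprn_ge0// ltW.
    have md2 : m%:R ^+ 2 <= d%:R ^+ 2 :> R by rewrite lerXn2r ?nnegrE// ler_nat.
    have m2 := sqr_ge0 (m%:R : R).
    apply: ler_pM; [by nng|by nng|exact: e2|].
    apply: ler_pM; [by nng|by nng| |].
      by apply: ler_wpM2r => //; apply: ler_wpM2r; rewrite ?sqr_ge0// e2// leq_double.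
    by apply: lerXn2r; rewrite ?nnegrE; [by nng|by nng|rewrite ler_pM2l// lerD2l].
  apply: le_trans (ler_pM _ _ cc oo) _.
  - by nng.
  - by nng; exact: omega_ge0.
  by rewrite le_eqVlt; apply/orP; left; apply/eqP; rewrite /c1 -/o; ring.
pose u (h : Zn) (j : 'I_d) : R := 4 * L ^+ 2 * sin (pi * (al * ((A *m h) j 0)%:~R)) ^+ 2.
have u0 h j : 0 <= u h j.
  by apply: mulr_ge0; [apply: mulr_ge0|]; rewrite ?sqr_ge0.
have Sh h c : `|\sum_(b <- zbox N d) g h b * cos (2 * pi * (zdot (fun i => al * ((A *m h) i 0)%:~R) b + c))|
    <= c1 * M ^+ 2 * (8 * L) ^+ d * omega (lam *: zR (A *m h)) * \prod_j (2 / (1 + u h j)).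
  set S := \sum_(b <- _) _.
  have sg : zsupp N (g h).
    by move=> b hb; apply: sN; apply: contraNneq hb; rewrite /g /v => ->; rewrite mul0r.
  have gen m j : (m <= d)%N -> (u h j) ^+ m * `|S| <= c1 * M ^+ 2 * (8 * L) ^+ d * omega (lam *: zR (A *m h)).
    move=> md; have := zsum_cos_parts m j (fun i => al * ((A *m h) i 0)%:~R) c sg.
    move=> /(congr1 Num.norm); rewrite normrM normrX normrN (ger0_norm (_ : 0 <= 4 * sin (pi * (al * ((A *m h) j 0)%:~R)) ^+ 2)); last first.
      by apply: mulr_ge0 => //; exact: sqr_ge0.
    rewrite -/S => E.
    have -> : u h j ^+ m = L ^+ m.*2 * (4 * sin (pi * (al * ((A *m h) j 0)%:~R)) ^+ 2) ^+ m.
      by rewrite -mul2n exprM -exprMn /u; congr (_ ^+ m); ring.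
    rewrite -(mulrA (L ^+ _)) E.
    apply: (@le_trans _ _ (L ^+ m.*2 * \sum_(b <- zbox (N + m) d)
       c1 * M ^+ 2 * lam ^+ m.*2 * omega (lam *: zR (A *m h)) * omega (lam *: zR b))).
      apply: ler_wpM2l; first by rewrite exprn_ge0// ltW.
      apply: le_trans (ler_norm_sum _ _ _) _; apply: ler_sum => b _.
      rewrite normrM (mulrAC _ (omega _) (omega _)) -[leRHS]mulr1; apply: ler_pM => //; first exact: omb.
      exact: cos_max.
    rewrite -mulr_sumr.
    have -> : L ^+ m.*2 * (c1 * M ^+ 2 * lam ^+ m.*2 * omega (lam *: zR (A *m h)) * \sum_(i <- zbox (N + m) d) omega (lam *: zR i))
      = (L * lam) ^+ m.*2 * (c1 * M ^+ 2 * omega (lam *: zR (A *m h))) * \sum_(i <- zbox (N + m) d) omega (lam *: zR i).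
      by rewrite exprMn; ring.
    rewrite /lam mulfV ?gt_eqF// expr1n mul1r -/lam.
    rewrite (mulrAC _ ((8 * L) ^+ d)); apply: ler_wpM2l.
      by nng; exact: omega_ge0.
    by have := sum_omega (N + m) l01; rewrite /lam invrK.
  apply: prod_min => //.
    by have := gen 0 0 isT; rewrite expr0 mul1r.
  by move=> j; exact: gen.
pose T := \sum_(b <- zbox N d) v b * cos (2 * pi * ph b).
(* The sine companion completes the modulus squared: the products of cosines and sines then combine
   into the cosine of a phase difference. *)
pose T' := \sum_(b <- zbox N d) v b * sin (2 * pi * ph b).
have TT : T ^+ 2 <= T ^+ 2 + T' ^+ 2 by rewrite lerDl sqr_ge0.
apply: le_trans TT _.
have E : T ^+ 2 + T' ^+ 2 = \sum_(h <- zbox N.*2 d) \sum_(b <- zbox N d) g h b * cos (2 * pi * ph (b + h) - 2 * pi * ph b).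
  rewrite exchange_big /= !expr2 /T /T' !mulr_suml -big_split /= big_seq [RHS]big_seq.
  apply: eq_bigr => b hb.
  rewrite -!mulrA -mulrDr; rewrite !mulr_sumr -big_split /= mulr_sumr.
  rewrite (@zsum_shift R d N N.*2 _ b).
  - apply: eq_bigr => h _; rewrite cosB /g (addrC h b); ring.
  - move=> b' hb'; apply: sN; apply: contraNneq hb' => e.
    by rewrite /v e !mul0r !mulr0 addr0 mulr0.
  move=> h hh; have : h + b \in zbox N d.
    apply: sN; apply: contraNneq hh => e.
    by rewrite /v e !mul0r !mulr0 addr0 mulr0.
  move: hb; rewrite !mem_zbox => /forallP hb /forallP hhb; apply/forallP => i.
  move: (hb i) (hhb i); rewrite mxE; move: (h i 0) (b i 0) => x y; clear; lia.
rewrite E.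
apply: (@le_trans _ _ (\sum_(h <- zbox N.*2 d) c1 * M ^+ 2 * (8 * L) ^+ d * 2 ^+ d * \prod_j xfac L al ((A *m h) j 0))).
  apply: ler_sum => h _; apply: le_trans (ler_norm _) _.
  have [c hc] := hph h.
  rewrite (eq_bigr (fun b => g h b * cos (2 * pi * (zdot (fun i => al * ((A *m h) i 0)%:~R) b + c)))); last first.
    by move=> b _; congr (_ * cos _); rewrite hc; ring.
  apply: le_trans (Sh h c) _.
  rewrite -(mulrA _ (2 ^+ d)) -(mulrA _ (omega _)); apply: ler_wpM2l.
    by nng.
  rewrite /omega -big_split /= exprn_prod.
  rewrite le_eqVlt; apply/orP; left; apply/eqP; apply: eq_bigr => j _.
  by rewrite /xfac /u !mxE /lam; ring.
rewrite -mulr_sumr.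
have -> : c1 * 8 ^+ d * 2 ^+ d * M ^+ 2 * L ^+ d * X ^+ d = c1 * M ^+ 2 * (8 * L) ^+ d * 2 ^+ d * X ^+ d.
  by rewrite exprMn; ring.
apply: ler_wpM2l; first by nng.
(* A crude size that makes the box contain the images [A h] of all shifts that occur. *)
pose N2 := (\sum_(h <- zbox N.*2 d) \sum_i (absz ((A *m h) i 0%R)).+1)%N.
apply: (@le_trans _ _ (\sum_(y <- zbox N2 d) \prod_j xfac L al (y j 0))).
  rewrite -(big_map (fun h => A *m h) xpredT (fun y : Zn => \prod_j xfac L al (y j 0))).
  apply: sum_sub; rewrite ?zbox_uniq//.
  - rewrite map_inj_uniq ?zbox_uniq// => h h' e.
    have detAR : map_mx (intr : int -> rat) A \in unitmx.
      by rewrite unitmxE det_map_mx unitfE intr_eq0.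
    have : map_mx (intr : int -> rat) (A *m h) = map_mx intr (A *m h') by rewrite e.
    rewrite !map_mxM => /(congr1 (mulmx (invmx (map_mx intr A)))).
    rewrite !mulmxA mulVmx// !mul1mx => /matrixP e'.
    by apply/matrixP => i j; have := e' i j; rewrite !mxE => /eqP; rewrite eqr_int => /eqP.
  - move=> y /mapP[h hh ->]; rewrite mem_zbox; apply/forallP => i.
    have : ((absz ((A *m h) i 0%R)).+1 <= N2)%N.
      by rewrite /N2 (big_rem h)//= (bigD1 i)//= -addnA leq_addr.
    by move: ((A *m h) i 0) (N2) => x m; clear; lia.
  - by move=> y; apply: prodr_ge0 => j _; exact: xfac_ge0.
rewrite (zsum_prod N2 (fun _ k => xfac L al k)) prodr_const card_ord.
rewrite lerXn2r ?nnegrE//; apply: sumr_ge0 => k _; exact: xfac_ge0.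
Qed.

End WeylBound.

(** * Oscillatory integrals *)

Section QuadraticForms.
Context {R : realType} {n : nat}.
Notation d := n.+1.
Notation V := 'cV[R]_d.
Notation Zn := 'cV[int]_d.
Implicit Types (A : 'M[int]_d) (l z y : V) (c r : R).

Lemma dotC z y : dot z y = dot y z.
Proof. by apply: eq_bigr => i _; rewrite mulrC. Qed.

Lemma dotDl z y x : dot (z + y) x = dot z x + dot y x :> R.
Proof. by rewrite /dot -big_split /=; apply: eq_bigr => i _; rewrite mxE mulrDl. Qed.

Lemma dotDr z y x : dot x (z + y) = dot x z + dot x y :> R.
Proof. by rewrite dotC dotDl !(dotC x). Qed.

Lemma dotZl a z x : dot (a *: z) x = a * dot z x :> R.
Proof. by rewrite /dot mulr_sumr; apply: eq_bigr => i _; rewrite mxE mulrA. Qed.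

Lemma dotZr a z x : dot x (a *: z) = a * dot x z :> R.
Proof. by rewrite dotC dotZl dotC. Qed.

Lemma dot_delta z j : dot z (delta_mx j 0) = z j 0 :> R.
Proof.
rewrite /dot (bigD1 j)//= big1 ?addr0; last by move=> i /negPf ij; rewrite mxE ij mulr0.
by rewrite mxE !eqxx mulr1.
Qed.

Lemma dot_mx A z y : A^T = A -> dot (real_mx A *m z) y = dot z (real_mx A *m y) :> R.
Proof.
move=> sA; rewrite /dot.
under eq_bigr do rewrite mxE mulr_suml.
rewrite exchange_big /=; apply: eq_bigr => i _.
rewrite mxE mulr_sumr; apply: eq_bigr => j _.
by rewrite !mxE -[in A j i]sA mxE; ring.
Qed.

Lemma qformD A z y : A^T = A -> qform A (z + y) = qform A z + qform A y + dot (real_mx A *m y) z.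
Proof.
move=> sA; rewrite /qform mulmxDr dotDl !dotDr (dot_mx z y sA) (dotC z).
by field.
Qed.

Lemma qformZ A a z : qform A (a *: z) = a ^+ 2 * qform A z.
Proof. by rewrite /qform -scalemxAr dotZl dotZr; ring. Qed.

Definition qf A l c z : R := qform A z + dot l z + c.
Definition qg A l (j : 'I_d) z : R := (real_mx A *m z) j 0 + l j 0.
Definition qh A (j : 'I_d) : R := (A j j)%:~R / 2.
(** A bound for the derivatives of the phase that knows the linear coefficient only through its size
    [r]; the constant term has no derivative and does not enter. Uniformity of the final constant
    rests on this. *)
Definition qC A r : R := 1 + \sum_i \sum_j `|(A i j)%:~R| + r.

Lemma continuous_bigsum (I : finType) (F : I -> V -> R) :
  (forall i, continuous (F i)) -> continuous (fun z => \sum_i F i z).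
Proof.
move=> cF z; elim: (index_enum I) => [|i s IH].
  by rewrite (_ : (fun _ => _) = fun=> 0); [exact: cst_continuous|apply/funext => y; rewrite big_nil].
rewrite (_ : (fun _ => _) = (fun y => F i y + \sum_(i <- s) F i y)); last first.
  by apply/funext => y; rewrite big_cons.
by apply: continuousD; [exact: cF|exact: IH].
Qed.

Lemma continuous_dot l : continuous (dot l : V -> R).
Proof.
apply: (@continuous_bigsum _ (fun i (y : V) => l i 0 * y i 0)) => i z.
by apply: (@continuousM _ _ (fun=> l i 0) (fun y : V => y i 0)); [exact: cst_continuous|exact: continuous_coord].
Qed.

Lemma continuous_qf A l c : continuous (qf A l c).
Proof.
have e : qf A l c = (fun z => 2^-1 * \sum_i \sum_j (A i j)%:~R * z j 0 * z i 0 + dot l z + c).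
  apply/funext => z; rewrite /qf /qform /dot; congr (_ * _ + _ + _); apply: eq_bigr => i _.
  by rewrite mxE mulr_suml; apply: eq_bigr => j _; rewrite mxE.
pose S z := \sum_i \sum_j (A i j)%:~R * z j 0 * z i 0 : R.
have cS : continuous (S : V -> R).
  apply: (@continuous_bigsum _ (fun i (z : V) => \sum_j (A i j)%:~R * z j 0 * z i 0)) => i.
  apply: (@continuous_bigsum _ (fun j (z : V) => (A i j)%:~R * z j 0 * z i 0)) => j y.
  apply: (@continuousM _ _ (fun y : V => (A i j)%:~R * y j 0) (fun y : V => y i 0)); last exact: continuous_coord.
  by apply: (@continuousM _ _ (fun=> (A i j)%:~R) (fun y : V => y j 0)); [exact: cst_continuous|exact: continuous_coord].
rewrite e => z; apply: (@continuousD _ _ _ (fun z => 2^-1 * S z + dot l z) (fun=> c)); last exact: cst_continuous.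
apply: (@continuousD _ _ _ (fun z => 2^-1 * S z) (dot l)); last exact: continuous_dot.
by apply: (@continuousM _ _ (fun=> 2^-1) S); [exact: cst_continuous|exact: cS].
Qed.

Lemma mxE_add z y i : (z + y) i 0 = z i 0 + y i 0. Proof. by rewrite mxE. Qed.

Lemma mxE_scale a z i : (a *: z) i 0 = a * z i 0. Proof. by rewrite mxE. Qed.

Lemma mulmx_delta A i j : (real_mx A *m (delta_mx j 0 : V)) i 0 = (A i j)%:~R.
Proof.
rewrite mxE (bigD1 j)//= big1 ?addr0; last by move=> k /negPf kj; rewrite !mxE kj mulr0.
by rewrite !mxE !eqxx mulr1.
Qed.

Lemma quadf_qf A l c r : A^T = A -> (forall j, `|l j 0| <= r) ->
  quadf (qf A l c) (qg A l) (qh A) (qC A r).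
Proof.
move=> sA lr; have r0 : 0 <= r by apply: le_trans (lr 0).
have S0 : 0 <= \sum_i \sum_j `|(A i j)%:~R| :> R.
  by apply: sumr_ge0 => i _; apply: sumr_ge0 => j _.
have Si i : \sum_j `|(A i j)%:~R| <= \sum_i \sum_j `|(A i j)%:~R| :> R.
  by rewrite [leRHS](bigD1 i)//= lerDl; apply: sumr_ge0 => k _; apply: sumr_ge0 => j _.
split.
- exact: continuous_qf.
- move=> z j s; rewrite /qf qformD// qformZ dotDr !dotZr -scalemxAr dotZl dot_delta.
  rewrite (dot_mx _ _ sA) (dotC (delta_mx j 0)) dot_delta /qg /qh.
  rewrite [qform A (delta_mx j 0)]/qform dot_delta.
  rewrite mulmx_delta.
  by field.
- move=> z j s; rewrite /qg /qh mulmxDr -scalemxAr.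
  rewrite mxE_add mxE_scale mulmx_delta.
  by field.
- move=> j z; rewrite /qg.
  have o1 : 1 <= (omega z)^-1 by rewrite invf_ge1 ?omega_gt0 ?omega_le1.
  apply: le_trans (ler_normD _ _) _.
  have h : `|(real_mx A *m z) j 0| <= (\sum_i \sum_j `|(A i j)%:~R|) * (omega z)^-1.
    rewrite mxE; apply: le_trans (ler_norm_sum _ _ _) _.
    apply: le_trans (ler_wpM2r _ (Si j)); last by lra.
    rewrite mulr_suml; apply: ler_sum => k _; rewrite normrM mxE.
    by apply: ler_wpM2l => //; have [] := omega_coord z k.
  rewrite /qC; have := lr j; nra.
- move=> j; rewrite /qh /qC.
  have h : `|(A j j)%:~R| <= \sum_i \sum_j `|(A i j)%:~R| :> R.
    by apply: le_trans (Si j); rewrite (bigD1 j)//= lerDl; apply: sumr_ge0.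
  by rewrite normrM (ger0_norm (_ : 0 <= 2^-1)) ?invr_ge0//; have := normr_ge0 ((A j j)%:~R : R); lra.
Qed.

Lemma qC_ge1 A r : 0 <= r -> 1 <= qC A r.
Proof.
move=> r0; rewrite /qC -addrA lerDl addr_ge0//.
by apply: sumr_ge0 => i _; apply: sumr_ge0 => j _.
Qed.

Lemma qf_phase A l c (lam gam th : R) h : A^T = A -> exists e, forall b : Zn,
  gam * qf A l c (lam *: zR (b + h)) + th = gam * qf A l c (lam *: zR b) + th
    + zdot (fun i => gam * lam ^+ 2 * ((A *m h) i 0)%:~R) b + e.
Proof.
move=> sA; exists (gam * (qform A (lam *: zR h) + dot l (lam *: zR h))) => b.
rewrite zRD scalerDr /qf qformD// dotDr -scalemxAr dotZl dotZr zR_mul.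
have -> : zdot (fun i => gam * lam ^+ 2 * ((A *m h) i 0)%:~R) b =
   gam * lam ^+ 2 * dot (zR (A *m h)) (zR b).
  rewrite /zdot /dot mulr_sumr; apply: eq_bigr => i _; rewrite !mxE; ring.
by ring.
Qed.

End QuadraticForms.

Section OscillatoryBound.
Context {R : realType} {n : nat}.
Notation d := n.+1.
Notation V := 'cV[R]_d.

(** Plays the part of the limit [L -> oo] below: for each tolerance a single large [L] is
    exhibited. *)
Lemma sqr_le_approx (x q : R) : (forall e, 0 < e -> exists2 y, y ^+ 2 <= q & `|x - y| <= e) ->
  x ^+ 2 <= q.
Proof.
move=> h; have q0 : 0 <= q.
  by have [y hy _] := h 1 ltr01; apply: le_trans hy; exact: sqr_ge0.
rewrite -real_normK ?num_real// -(sqr_sqrtr q0) lerXn2r ?nnegrE ?sqrtr_ge0//.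
apply/ler_addgt0Pr => e e0; have [y hy hxy] := h e e0.
rewrite -(subrK y x); apply: le_trans (ler_normD _ _) _; rewrite addrC lerD//.
by rewrite -sqrtr_sqr ler_wsqrtr.
Qed.

Lemma weight_le K K' p M B (w : V -> R) D : (K' <= K)%N -> weight K p M B w D -> weight K' p M B w D.
Proof.
move=> KK [h1 h2 h3 h4 h5]; split=> //.
- by move=> j z; exact: dseq_le (h2 j z).
- by move=> j l z lK; apply: h3; exact: leq_trans KK.
- by move=> j l lK; apply: h4; exact: leq_trans KK.
by move=> j l z i lK; apply: h5; exact: leq_trans KK.
Qed.

(* Weyl's inequality at al = gam / L^2: as L -> oo, L^-d times the lattice sum tends to the
   oscillatory integral. *)
Lemma osc_bound (A : 'M[int]_d) p K : A^T = A -> \det A != 0 -> (d < p)%N -> (d.*2 <= K)%N ->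
  exists2 C, 0 <= C & forall M B (w : V -> R) D, weight K p M B w D ->
  forall l c gam th, gam != 0 -> osc w (qf A l c) gam th ^+ 2 <= C * M ^+ 2 / `|gam| ^+ d.
Proof.
move=> sA detA dp dK; have [C0 C00 hC] := weyl (R := R) detA dp dK.
exists (C0 * 32 ^+ d); first by nng.
move=> M B w D hw l c gam th gam0; have M0 := weight_ge0 hw.
have g0 : 0 < `|gam| by rewrite normr_gt0.
pose r := \sum_j `|l j 0|.
have lr j : `|l j 0| <= r by rewrite /r (bigD1 j)//= lerDl sumr_ge0.
have r0 : 0 <= r by apply: sumr_ge0.
have qf' := quadf_qf c sA lr.
set E := @CRie R n 1 (qC A r) * M * (1 + `|gam|).
apply: sqr_le_approx => e e0.
(* The first summand keeps [al g] within 1/2 for [g < L], the second brings the Riemann sum error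
   [E / L] below [e]. *)
pose m := (Num.truncn (2 * `|gam| + `|E| / e)).+1.
have mb : 2 * `|gam| + `|E| / e < m%:R by exact: truncnS_gt.
have Ee : 0 <= `|E| / e by rewrite divr_ge0// ltW.
have m1 : 1 <= m%:R :> R by rewrite ler1n.
have m0 : 0 < m%:R :> R by lra.
set L : R := m%:R in mb m1 m0.
have L0 : 0 < L^-1 by rewrite invr_gt0.
have [N1 hN1] := zsupp_exists L0 (fun z i => weight_vanish hw (z := z) (i := i)).
pose N := (N1 + (Num.truncn (`|B| * L)).+1)%N.
have sN : zsupp N (fun b => w (L^-1 *: zR b)) by apply: hN1; rewrite leq_addr.
pose ph b := gam * qf A l c (L^-1 *: zR b) + th.
pose T := \sum_(b <- zbox N d) w (L^-1 *: zR b) * cos (2 * pi * ph b).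
(* With [al = gam / L^2] and blocks of length [L] nothing wraps around the circle: the points are
   separated by [kap = |gam| / L^2], and [xfac_sum] yields [32 L / |gam|]. *)
have hX N' : \sum_(k <- irange N') xfac L (gam * L^-1 ^+ 2) k <= 32 * L / `|gam|.
  have kap0 : 0 < `|gam| * L^-1 ^+ 2 by rewrite mulr_gt0// exprn_gt0.
  have ngE : `|gam * L^-1 ^+ 2| = `|gam| * L^-1 ^+ 2.
    by rewrite normrM (@ger0_norm _ (L^-1 ^+ 2))// exprn_ge0// ltW.
  have := @xfac_sum R L (gam * L^-1 ^+ 2) (`|gam| * L^-1 ^+ 2) m N' m0 kap0 isT.
  move=> /(_ _)/le_trans; apply.
    move=> g /andP[g1 gm] k; have [->|k0] := eqVneq k 0.
      rewrite subr0 normrM ngE.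
      by rewrite normr_nat ler_peMr ?(ltW kap0)// ler1n.
    have k1 : 1 <= `|k%:~R| :> R by rewrite -intr_norm ler1z -gtz0_ge1 normr_gt0.
    have g2 : `|gam * L^-1 ^+ 2 * g%:R| <= 2^-1.
      rewrite normrM ngE normr_nat.
      have gL : g%:R <= L by rewrite /L ler_nat ltnW.
      apply: (@le_trans _ _ (`|gam| * L^-1 ^+ 2 * L)); first by rewrite ler_wpM2l// ltW.
      by rewrite expr2 -!mulrA mulVf ?gt_eqF// mulr1 ler_pdivrMr//; lra.
    have : `|gam| * L^-1 ^+ 2 <= 2^-1.
      rewrite exprVn ler_pdivrMr ?exprn_gt0// expr2; nra.
    have := ler_normB (gam * L^-1 ^+ 2 * g%:R) (gam * L^-1 ^+ 2 * g%:R - k%:~R).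
    by rewrite subKr; lra.
  have -> : (2 * L * (`|gam| * L^-1 ^+ 2))^-1 = L / (2 * `|gam|) by field; rewrite ?gt_eqF.
  rewrite -/L divff ?gt_eqF//.
  have : 1 <= L / (2 * `|gam|) by rewrite ler_pdivlMr ?mulr_gt0//; lra.
  have -> : 32 * L / `|gam| = 64 * (L / (2 * `|gam|)) by field; rewrite ?gt_eqF.
  by lra.
have hT := hC M B w D hw L _ _ m1 hX ph (fun h => qf_phase l c L^-1 gam th h sA) N sN.
rewrite -/T in hT.
exists (L^-1 ^+ d * T).
  rewrite exprMn; apply: le_trans (ler_wpM2l _ hT) _; first exact: sqr_ge0.
  rewrite le_eqVlt; apply/orP; left; apply/eqP.
  rewrite -exprM mulnC exprM !exprMn !exprVn expr2.
  have Ld : L ^+ d != 0 by rewrite expf_neq0// gt_eqF.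
  have gd : `|gam| ^+ d != 0 by rewrite expf_neq0// gt_eqF.
  by move: (L ^+ d) (`|gam| ^+ d) (32 ^+ d : R) Ld gd => x y k x0 y0; field; rewrite x0 y0.
have Lr : 0 < L^-1 <= 1 by rewrite L0 invf_le1.
have hN i : B + `|(0 : V) i 0| <= L^-1 * N%:R.
  rewrite mxE normr0 addr0 mulrC ler_pdivlMr//.
  apply: (@le_trans _ _ (`|B| * L)); first by rewrite ler_wpM2r ?ler_norm// ltW.
  apply: le_trans (ltW (truncnS_gt _)) _.
  by rewrite ler_nat leq_addl.
have d0 : (0 < d.*2)%N by rewrite double_gt0.
have p1 : (1 < p)%N by apply: leq_ltn_trans dp.
have := riemann_sum gam th (weight_le (leq_trans d0 dK) hw) qf' (qC_ge1 A r0)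
   p1 Lr _ hN.
rewrite expr1 => /(_ _) hR.
rewrite distrC.
have -> : L^-1 ^+ d * T = L^-1 ^+ d * \sum_(b <- zbox N d) wphase w (qf A l c) gam th (L^-1 *: zR b + 0).
  by congr (_ * _); apply: eq_bigr => b _; rewrite addr0.
apply: le_trans (hR _) _; first by rewrite /N addnS.
have -> : @CRie R n 1 (qC A r) * M * (L^-1 * (1 + `|gam|)) = E * L^-1 by rewrite /E; ring.
apply: le_trans (ler_wpM2r (ltW L0) (ler_norm E)) _.
rewrite ler_pdivrMr//; have : `|E| / e <= L by lra.
by rewrite ler_pdivrMr// mulrC.
Qed.

End OscillatoryBound.

(** * Euler product *)

Section Residues.
Context {d : nat}.
Notation Zn := 'cV[int]_d.

Definition ordb (q : nat) (r : 'cV['I_q]_d) : Zn := map_mx (fun k : 'I_q => Posz k) r.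

Definition res (q : nat) (b : Zn) : 'cV['I_q.+1]_d :=
  map_mx (fun k : int => inord (absz (k %% q.+1)%Z)) b.

Lemma res_ordb q b : exists c : Zn, ordb (res q b) = b + q.+1%:Z *: c.
Proof.
exists (map_mx (fun k => - (k %/ q.+1)%Z) b); apply/matrixP => i j; rewrite !mxE.
have h := modz_ge0 (b i j) (isT : q.+1%:Z != 0).
have lt : (b i j %% q.+1 < q.+1)%Z by rewrite ltz_pmod.
rewrite inordK; last by rewrite -ltz_nat gez0_abs.
by rewrite gez0_abs// [X in _ = X + _](divz_eq (b i j) q.+1); ring.
Qed.

Lemma ordb_inj q (r r' : 'cV['I_q]_d) c : ordb r = ordb r' + q%:Z *: c -> r = r'.
Proof.
move=> e; apply/matrixP => i j; apply/val_inj => /=.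
have := congr1 (fun m : Zn => m i j) e; rewrite !mxE => {}e.
have h1 := ltn_ord (r i j); have h2 := ltn_ord (r' i j).
have : (r i j = r' i j %[mod q])%Z by rewrite e addrC mulrC modzMDl.
by rewrite !modz_nat !modn_small//; case.
Qed.

Lemma sum_bij (S : nmodType) (I J : finType) (f : I -> J) (F : J -> S) : injective f ->
  #|I| = #|J| -> \sum_j F j = \sum_i F (f i).
Proof.
move=> fi e; have bf : bijective f by apply: inj_card_bij => //; rewrite e.
by apply: reindex; case: bf => g gK fK; exists g => x _.
Qed.

Lemma card_res (q : nat) : #|{: 'cV['I_q]_d}| = (q ^ d)%N.
Proof. by rewrite card_mx card_ord muln1. Qed.

Definition zper (T : Type) (q : nat) (h : Zn -> T) := forall b c, h (b + q%:Z *: c) = h b.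

Lemma zper_mul T (q m : nat) (h : Zn -> T) : zper q h -> zper (q * m) h.
Proof. by move=> hq b c; rewrite PoszM -scalerA hq. Qed.

Lemma zper_res T (q : nat) (h : Zn -> T) b : zper q.+1 h -> h (ordb (res q b)) = h b.
Proof. by move=> hq; have [c ->] := res_ordb q b; exact: hq. Qed.

Context {R : realType}.
Implicit Types h : Zn -> R.

Lemma sum_res_shift q h n0 : (0 < q)%N -> zper q h ->
  \sum_(r : 'cV['I_q]_d) h (ordb r + n0) = \sum_(r : 'cV['I_q]_d) h (ordb r).
Proof.
case: q => // q _ hq; rewrite [RHS](@sum_bij _ _ _ (fun r : 'cV['I_q.+1]_d => res q (ordb r + n0)))//.
  by apply: eq_bigr => r _; rewrite zper_res.
move=> r r' e; have [c hc] := res_ordb q (ordb r + n0); have [c' hc'] := res_ordb q (ordb r' + n0).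
apply: (@ordb_inj q.+1 _ _ (c' - c)); move: hc; rewrite e hc' => /eqP.
rewrite addrAC (addrAC (ordb r)) (inj_eq (addIr _)) -subr_eq -addrA -scalerBr => /eqP <-.
by [].
Qed.

Lemma sum_res_mul q m h : (0 < q)%N -> (0 < m)%N -> zper q h ->
  \sum_(r : 'cV['I_(q * m)]_d) h (ordb r) = m%:R ^+ d * \sum_(r : 'cV['I_q]_d) h (ordb r).
Proof.
case: q m => // q [//|m] _ _ hq.
have qm : (q.+1 * m.+1)%N = (q.+1 * m.+1).-1.+1 by [].
pose Q := (q.+1 * m.+1).-1.
rewrite -/(Q.+1) in qm *.
have -> : \sum_(r : 'cV['I_(q.+1 * m.+1)]_d) h (ordb r) = \sum_(r : 'cV['I_Q.+1]_d) h (ordb r) by [].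
rewrite (@sum_bij _ ('cV['I_q.+1]_d * 'cV['I_m.+1]_d)%type _
   (fun p : 'cV['I_q.+1]_d * 'cV['I_m.+1]_d => res Q (ordb p.1 + q.+1%:Z *: ordb p.2))); last first.
- by rewrite card_prod !card_res -expnMn.
- move=> [r s] [r' s'] /= e.
  have [c hc] := res_ordb Q (ordb r + q.+1%:Z *: ordb s).
  have [c' hc'] := res_ordb Q (ordb r' + q.+1%:Z *: ordb s').
  move: hc; rewrite e hc' -qm PoszM -!scalerA -!addrA -!scalerDr => e1.
  have rr : r = r'.
    apply: (@ordb_inj q.+1 _ _ ((ordb s' + m.+1%:Z *: c') - (ordb s + m.+1%:Z *: c))).
    by rewrite scalerBr addrA e1 addrK.
  move: e1; rewrite rr => /addrI /(congr1 (fun v : Zn => map_mx (fun k => (k %/ q.+1)%Z) v)) e2.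
  have {}e2 : ordb s' + m.+1%:Z *: c' = ordb s + m.+1%:Z *: c.
    by apply/matrixP => i j; have := congr1 (fun v : Zn => v i j) e2; rewrite !mxE ![(q.+1%:Z * _)%R]mulrC !mulzK.
  congr pair; apply: (@ordb_inj m.+1 _ _ (c' - c)).
  by rewrite scalerBr addrA e2 addrK.
rewrite (eq_bigr (fun p : 'cV['I_q.+1]_d * 'cV['I_m.+1]_d => h (ordb p.1))); last first.
  by move=> p _; rewrite zper_res ?hq// -qm; exact: zper_mul.
rewrite -(pair_bigA _ (fun (r : 'cV['I_q.+1]_d) (_ : 'cV['I_m.+1]_d) => h (ordb r))) /= exchange_big /=.
by rewrite sumr_const card_res -natrX mulr_natl.
Qed.

Lemma sum_res_crt q m h h' : (0 < q)%N -> (0 < m)%N -> coprime q m -> zper q h -> zper m h' ->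
  \sum_(r : 'cV['I_(q * m)]_d) h (ordb r) * h' (ordb r) =
  (\sum_(r : 'cV['I_q]_d) h (ordb r)) * \sum_(r : 'cV['I_m]_d) h' (ordb r).
Proof.
case: q m => // q [//|m] _ _ cqm hq hm.
rewrite big_distrlr /= pair_bigA /=.
rewrite (@sum_bij _ 'cV['I_(q.+1 * m.+1)]_d _ (fun r : 'cV['I_(q.+1 * m.+1)]_d => (res q (ordb r), res m (ordb r)))).
- by apply: eq_bigr => r _ /=; rewrite !zper_res.
- move=> r r' [e1 e2]; have [c hc] := res_ordb q (ordb r); have [c' hc'] := res_ordb q (ordb r').
  have [k hk] := res_ordb m (ordb r); have [k' hk'] := res_ordb m (ordb r').
  apply/matrixP => i j; apply/val_inj => /=.
  have h1 := ltn_ord (r i j); have h2 := ltn_ord (r' i j).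
  have : (r i j = r' i j %[mod q.+1 * m.+1])%N.
    apply/eqP; rewrite chinese_remainder//.
    have f1 : ((r i j)%:Z = (r' i j)%:Z %[mod q.+1])%Z.
      move: hc; rewrite e1 hc' => /(congr1 (fun v : Zn => v i j)); rewrite !mxE => e.
      by rewrite -(modzMDl (c i j)) mulrC addrC -e addrC mulrC modzMDl.
    have f2 : ((r i j)%:Z = (r' i j)%:Z %[mod m.+1])%Z.
      move: hk; rewrite e2 hk' => /(congr1 (fun v : Zn => v i j)); rewrite !mxE => e.
      by rewrite -(modzMDl (k i j)) mulrC addrC -e addrC mulrC modzMDl.
    by move: f1 f2; rewrite !modz_nat => -[->] [->]; rewrite !eqxx.
  by rewrite !modn_small.
by rewrite card_prod !card_res -expnMn.
Qed.

End Residues.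

Section GaussSums.
Context {R : realType} {d : nat}.
Notation Zn := 'cV[int]_d.

Lemma cos_2piz (x : R) (k : int) : cos (x + 2 * pi * k%:~R) = cos x.
Proof.
have H (y : R) (n : nat) : cos (y + 2 * pi * n%:R) = cos y.
  elim: n => [|n IH]; first by rewrite mulr0 addr0.
  have -> : n.+1%:R = n%:R + 1 :> R by rewrite natr1.
  rewrite mulrDr mulr1 addrA.
  by rewrite -[RHS]IH -[RHS]cosD2pi mulr_natl.
case: k => n; first exact: H.
by rewrite NegzE mulrNz mulrN -[LHS](H _ n.+1) subrK.
Qed.

(** If M does not divide k, the vector formed by the cosine sum and the sine sum is fixed by the
    rotation by [th], which is not the identity, so it vanishes. *)
Lemma sum_cos_orth (M : nat) (k : int) : (0 < M)%N ->
  \sum_(a < M) cos (2 * pi * (a%:R * k%:~R / M%:R)) = if (M%:Z %| k)%Z then M%:R else 0 :> R.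
Proof.
move=> M0; have M0' : M%:R != 0 :> R by rewrite pnatr_eq0 -lt0n.
case: ifPn => [/dvdzP[m ->]|nd].
  rewrite (eq_bigr (fun=> 1)) ?sumr_const ?card_ord// => a _.
  rewrite intrM -[M%:~R]/(M%:R) mulrA mulfK// (_ : a%:R * m%:~R = (a%:Z * m)%:~R) ?intrM//.
  by rewrite -intrM -[2 * pi * _]add0r cos_2piz cos0.
set th : R := 2 * pi * (k%:~R / M%:R).
pose S := \sum_(a < M) cos (th * a%:R); pose T := \sum_(a < M) sin (th * a%:R).
have -> : \sum_(a < M) cos (2 * pi * (a%:R * k%:~R / M%:R)) = S.
  by apply: eq_bigr => a _; congr cos; rewrite /th; ring.
have thM : th * M%:R = 2 * pi * k%:~R by rewrite /th -!mulrA mulVf// mulr1.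
have tel (u : nat -> R) : u M = u 0%N -> \sum_(a < M) u a = \sum_(a < M) u a.+1.
  move=> e; have := telescope_sumr u (leq0n M); rewrite e subrr big_mkord sumrB => /eqP.
  by rewrite subr_eq0 => /eqP.
have s2 (m : int) : sin (2 * pi * m%:~R) = 0 :> R.
  have := cos_2piz (- (pi / 2)) m; rewrite cosD cosN sinN cos_pihalf mul0r sin_pihalf mulN1r opprK add0r.
  by [].
have eS : S = cos th * S - sin th * T.
  rewrite {1}/S (tel (fun a => cos (th * a%:R))); last first.
    by rewrite thM mulr0 cos0 -[2 * pi * _]add0r cos_2piz cos0.
  rewrite !mulr_sumr -sumrB; apply: eq_bigr => a _.
  by rewrite -natr1 mulrDr mulr1 cosD; ring.
have eT : T = sin th * S + cos th * T.
  rewrite {1}/T (tel (fun a => sin (th * a%:R))); last by rewrite thM mulr0 sin0 s2.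
  rewrite !mulr_sumr -big_split; apply: eq_bigr => a _ /=.
  by rewrite -natr1 mulrDr mulr1 sinD; ring.
(* Otherwise the sine of half the angle vanishes, contradicting [sin2_lower] at the fractional part
   of [k / M], moved by 1 if it exceeds 1/2. *)
have c1 : cos th != 1.
  apply/negP => /eqP c1.
  have s0 : sin (th / 2) = 0.
    have : cos th = 1 - 2 * sin (th / 2) ^+ 2.
      rewrite [in LHS](_ : th = th / 2 + th / 2); last by field.
      have := cos2Dsin2 (th / 2); rewrite cosD; lra.
    rewrite c1 => h; apply/eqP; rewrite -sqrf_eq0; apply/eqP; lra.
  have {}s0 : sin (pi * (k%:~R / M%:R)) ^+ 2 = 0 :> R.
    by rewrite (_ : pi * (k%:~R / M%:R) = th / 2) ?s0 ?expr0n// /th; field.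
  have M00 : 0 < M%:R :> R by rewrite ltr0n.
  pose r := (k %% M)%Z; have r0 : 0 <= r by rewrite modz_ge0// -lt0n.
  have rM : (r < M)%R by rewrite ltz_pmod.
  have rn : r != 0 by rewrite /r; apply: contra nd => /eqP/dvdz_mod0P.
  have kr : k%:~R / M%:R = r%:~R / M%:R + (k %/ M)%Z%:~R :> R.
    by rewrite {1}(divz_eq k M) intrD intrM mulrDl mulfK// addrC.
  rewrite kr sin2_piz in s0.
  have r1 : 0 < r%:~R / M%:R :> R by rewrite divr_gt0// ltr0z lt_neqAle eq_sym rn.
  have r2 : r%:~R / M%:R < 1 :> R by rewrite ltr_pdivrMr// mul1r -[M%:R]/(M%:~R) ltr_int.
  have [h|h] := leP (r%:~R / M%:R : R) 2^-1.
    have := @sin2_lower R (r%:~R / M%:R); rewrite ger0_norm ?(ltW r1)// s0 => /(_ h).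
    by rewrite leNgt exprn_gt0.
  have : (r%:~R / M%:R + (-1)%:~R) ^+ 2 <= 0 :> R.
    by rewrite -s0 -(sin2_piz _ (-1)); apply: sin2_lower; rewrite ler0_norm; lra.
  by rewrite real_leNgt ?num_real// exprn_even_gt0//= subr_eq0 lt_eqF.
(* The factor is the squared modulus of [1 - exp (i th)]. *)
have : ((1 - cos th) ^+ 2 + sin th ^+ 2) * S = 0.
  have e1 : (1 - cos th) * S = - (sin th * T) by rewrite mulrBl mul1r {1}eS; ring.
  have e2 : (1 - cos th) * T = sin th * S by rewrite mulrBl mul1r {1}eT; ring.
  rewrite mulrDl expr2 -mulrA e1 mulrN mulrCA e2; ring.
move/eqP; rewrite mulf_eq0 => /orP[|/eqP//].
rewrite paddr_eq0 ?sqr_ge0// sqrf_eq0 subr_eq0 => /andP[/eqP e _].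
by rewrite -e eqxx in c1.
Qed.

Variable P : Zn -> int.
Hypothesis perP : forall (M : nat) b c, (M%:Z %| P (b + M%:Z *: c) - P b)%Z.

Lemma period_cong M b c : exists k : int, P (b + M%:Z *: c) = P b + k * M%:Z.
Proof. by have /dvdzP[k hk] := perP M b c; exists k; rewrite -hk addrCA subrr addr0. Qed.

Definition Gsum (q : nat) : R :=
  \sum_(a < q | coprime a q) \sum_(r : 'cV['I_q]_d) cos (2 * pi * (a%:R * (P (ordb r))%:~R / q%:R)).

Lemma zper_cos (a q : nat) : (0 < q)%N ->
  zper q (fun b => cos (2 * pi * (a%:R * (P b)%:~R / q%:R)) : R).
Proof.
move=> q0 b c; have [k ->] := period_cong q b c.
have q0' : q%:R != 0 :> R by rewrite pnatr_eq0 -lt0n.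
have -> : 2 * pi * (a%:R * (P b + k * q%:Z)%:~R / q%:R) =
    2 * pi * (a%:R * (P b)%:~R / q%:R) + 2 * pi * (a%:Z * k)%:~R :> R.
  by rewrite intrD !intrM -[q%:~R]/(q%:R) -[a%:~R]/(a%:R); field.
by rewrite cos_2piz.
Qed.

Definition divis_count (M : nat) : R :=
  \sum_(r : 'cV['I_M]_d) (if (M%:Z %| P (ordb r))%Z then 1 else 0).

(* By orthogonality this is the sum over q | M of Gsum q / q^d, so the product of its values
   at prime powers is again such a partial sum. *)
Definition divis_density (M : nat) : R := M%:R * divis_count M / M%:R ^+ d.

Lemma zper_dvd (M : nat) : zper M (fun b => if (M%:Z %| P b)%Z then 1 else 0 : R).
Proof.
move=> b c; have := perP M b c => h.
have -> : (M%:Z %| P (b + M%:Z *: c))%Z = (M%:Z %| P b)%Z; last by [].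
by rewrite -[P (b + _)](subrK (P b)) rpredDl.
Qed.

Lemma divis_density1 : divis_density 1 = 1.
Proof.
rewrite /divis_density /divis_count expr1n divr1 mul1r (eq_bigr (fun=> 1)); last by move=> r _; rewrite dvd1z.
by rewrite sumr_const card_res exp1n.
Qed.

Lemma divis_density_mul (M M' : nat) : (0 < M)%N -> (0 < M')%N -> coprime M M' -> divis_density (M * M') = divis_density M * divis_density M'.
Proof.
move=> M0 M0' cM.
have e : divis_count (M * M') = divis_count M * divis_count M'.
  rewrite /divis_count -(sum_res_crt M0 M0' cM (zper_dvd M) (zper_dvd M')).
  apply: eq_bigr => r _; rewrite PoszM Gauss_dvdz ?coprimezE//.
  by case: ifP => [/andP[-> ->]|/negbT]; rewrite ?mulr1// negb_and => /orP[]/negPf->; rewrite ?mul0r ?mulr0.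
have [m0 m0'] : M%:R != 0 :> R /\ M'%:R != 0 :> R by rewrite !pnatr_eq0 -!lt0n.
rewrite /divis_density e natrM exprMn; field.
by rewrite !expf_neq0.
Qed.

(** The numerators [a] modulo [q m] for which [a / (q m)] has reduced denominator q are those with
    gcd exactly m, that is, the multiples by m of the residues prime to q. *)
Lemma sum_denominator (q m : nat) (h : nat -> R) : (0 < q)%N -> (0 < m)%N ->
  \sum_(a < q * m | (q * m %/ gcdn a (q * m) == q)%N) h a =
  \sum_(a < q | coprime a q) h (a * m)%N.
Proof.
move=> q0 m0; have gM a : ((q * m %/ gcdn a (q * m) == q) = (gcdn a (q * m) == m))%N.
  apply/eqP/eqP => [e|->]; last by rewrite mulnK.
  by apply/eqP; rewrite -(eqn_pmul2l q0) -[X in (X * _)%N]e divnK// dvdn_gcdr.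
rewrite (eq_bigl (fun a : 'I_(q * m) => gcdn a (q * m) == m)) => [|a]; last exact: gM.
rewrite -(big_mkord (fun a => gcdn a (q * m) == m) h) -[LHS]big_filter.
rewrite -(big_mkord (fun a => coprime a q) (fun a => h (a * m)%N)) -[RHS]big_filter.
rewrite -(big_map (fun a => a * m)%N xpredT h).
apply: perm_big; apply: uniq_perm.
- by rewrite filter_uniq// iota_uniq.
- rewrite map_inj_uniq ?filter_uniq ?iota_uniq// => x y /eqP.
  by rewrite eqn_pmul2r// => /eqP.
move=> a; apply/idP/mapP.
  rewrite mem_filter mem_index_iota /= => /andP[/eqP ga aM].
  have ma : (m %| a)%N by rewrite -ga dvdn_gcdl.
  exists (a %/ m)%N; last by rewrite divnK.
  rewrite mem_filter mem_index_iota /= ltn_divLR// aM andbT /coprime.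
  by rewrite -(eqn_pmul2r m0) mul1n muln_gcdl divnK// ga.
move=> [a']; rewrite mem_filter mem_index_iota /= => /andP[/eqP c a'q] ->.
by rewrite mem_filter mem_index_iota /= -muln_gcdl c mul1n eqxx ltn_pmul2r.
Qed.

Lemma divis_density_block (q m : nat) : (0 < q)%N -> (0 < m)%N ->
  (\sum_(a < q * m | (q * m %/ gcdn a (q * m) == q)%N) \sum_(r : 'cV['I_(q * m)]_d)
     cos (2 * pi * (a%:R * (P (ordb r))%:~R / (q * m)%:R))) / (q * m)%:R ^+ d = Gsum q / q%:R ^+ d.
Proof.
move=> q0 m0.
rewrite (sum_denominator (fun a => \sum_(r : 'cV['I_(q * m)]_d)
     cos (2 * pi * (a%:R * (P (ordb r))%:~R / (q * m)%:R))))//.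
rewrite /Gsum !mulr_suml; apply: eq_bigr => a _.
have e (r : 'cV['I_(q * m)]_d) : cos (2 * pi * ((a * m)%N%:R * (P (ordb r))%:~R / (q * m)%:R)) =
    cos (2 * pi * (a%:R * (P (ordb r))%:~R / q%:R)) :> R.
  congr (cos (_ * _)); rewrite !natrM; field.
  by rewrite !pnatr_eq0 -!lt0n q0 m0.
rewrite (eq_bigr _ (fun r _ => e r)).
rewrite (sum_res_mul q0 m0 (zper_cos a q0)) natrM exprMn.
field; rewrite !expf_neq0// pnatr_eq0 -lt0n//.
Qed.

Lemma divis_density_sum (M : nat) : (0 < M)%N ->
  divis_density M = \sum_(q < M.+1 | (q %| M)%N) Gsum q / q%:R ^+ d.
Proof.
move=> M0; have m0 : M%:R != 0 :> R by rewrite pnatr_eq0 -lt0n.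
pose h (a : nat) : R := \sum_(r : 'cV['I_M]_d) cos (2 * pi * (a%:R * (P (ordb r))%:~R / M%:R)).
have -> : divis_density M = (\sum_(a < M) h a) / M%:R ^+ d.
  rewrite /h exchange_big /= /divis_density /divis_count mulr_sumr; congr (_ / _).
  apply: eq_bigr => r _; rewrite sum_cos_orth//.
  by case: ifP; rewrite ?mulr1 ?mulr0.
have pos (a : 'I_M) : (M %/ gcdn a M %| M)%N /\ (M %/ gcdn a M < M.+1)%N.
  by rewrite ltnS leq_div dvdn_div// dvdn_gcdr.
rewrite (partition_big (fun a : 'I_M => inord (M %/ gcdn a M) : 'I_M.+1) (fun q => (q %| M)%N)) /=; last first.
  by move=> a _; have [h1 h2] := pos a; rewrite inordK.
rewrite mulr_suml; apply: eq_bigr => q qM.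
rewrite (eq_bigl (fun i : 'I_M => M %/ gcdn i M == q :> nat)%N); last first.
  by move=> a; rewrite -val_eqE /= inordK//; have [] := pos a.
have q0 : (0 < q)%N by apply: dvdn_gt0 qM.
have [m eM] : exists m, M = (q * m)%N by exists (M %/ q)%N; rewrite mulnC divnK.
have mm0 : (0 < m)%N by move: M0; rewrite eM muln_gt0 => /andP[].
by have := divis_density_block q0 mm0; rewrite -eM.
Qed.

Lemma divis_density_prime_pow (p n : nat) : prime p ->
  divis_density (p ^ n) = \sum_(l < n.+1) Gsum (p ^ l) / (p ^ l)%:R ^+ d.
Proof.
move=> pp; rewrite divis_density_sum ?expn_gt0 ?prime_gt0//.
rewrite -(big_mkord (fun q => q %| p ^ n)%N (fun q => Gsum q / q%:R ^+ d)).
rewrite -(big_mkord xpredT (fun l => Gsum (p ^ l) / (p ^ l)%:R ^+ d)) -[LHS]big_filter.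
rewrite -(big_map (fun l => p ^ l)%N xpredT (fun q => Gsum q / q%:R ^+ d)).
apply: perm_big; apply: uniq_perm.
- by rewrite filter_uniq// iota_uniq.
- rewrite map_inj_uniq ?iota_uniq// => x y /eqP.
  by rewrite eqn_exp2l ?prime_gt1// => /eqP.
move=> q; apply/idP/mapP.
  rewrite mem_filter => /andP[/(dvdn_pfactor _ _ pp)[m mn ->] _]; exists m => //.
  by rewrite mem_index_iota.
move=> [m hm ->]; move: hm; rewrite mem_filter !mem_index_iota /= => mn.
by rewrite dvdn_exp2l//= ltnS leq_pexp2l ?prime_gt0.
Qed.

Lemma divis_density_prod (s : seq nat) (N : nat) : uniq s -> all prime s ->
  \prod_(p <- s) divis_density (p ^ N) = divis_density (\prod_(p <- s) p ^ N).
Proof.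
elim: s => [|p s IH] /=; first by rewrite !big_nil divis_density1.
move=> /andP[ps us] /andP[pp als]; rewrite !big_cons IH//.
have s0 : (0 < \prod_(p0 <- s) p0 ^ N)%N.
  by rewrite big_seq prodn_cond_gt0// => i si; rewrite expn_gt0 prime_gt0// (allP als).
rewrite divis_density_mul// ?expn_gt0 ?prime_gt0//.
rewrite big_seq; apply: (big_ind (fun x => coprime (p ^ N) x)) => [|x y|q qs].
- exact: coprimen1.
- by move=> hx hy; rewrite coprimeMr hx.
rewrite coprimeXl// coprimeXr// prime_coprime// dvdn_prime2// ?(allP als)//.
by apply: contraNneq ps => ->.
Qed.

(** Large powers of the primes up to n form a modulus divisible by every q up to n; its divisor sum
    therefore contains a full initial segment of the series. *)
Lemma dvdn_prime_prod (q n N : nat) : (0 < q <= n)%N -> (n <= N)%N ->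
  (q %| \prod_(p <- [seq p <- iota 0 n.+1 | prime p]) p ^ N)%N.
Proof.
move=> /andP[q0 qn] nN; rewrite -{1}(partnT q0) (widen_partn predT qn) big_filter.
rewrite /index_iota subn0 (bigID prime) /= [X in (_ * X)%N]big1 ?muln1; last first.
  by move=> p /negPf np; rewrite lognE np.
apply: (big_ind2 (fun x y => x %| y)%N) => // [a b c e|p pp]; first exact: dvdn_mul.
rewrite dvdn_exp2l//; apply: leq_trans nN; apply: leq_trans qn.
by apply: ltnW; apply: leq_trans (ltn_expl _ (prime_gt1 pp)) _; rewrite dvdn_leq// pfactor_dvdn.
Qed.

Variables (c T : nat -> R).
Hypothesis c0 : forall q, 0 <= c q.
Hypothesis Gc : forall q, (0 < q)%N -> `|Gsum q / q%:R ^+ d| <= c q.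
Hypothesis cT : forall Q Q', (0 < Q)%N -> \sum_(Q <= q < Q') c q <= T Q.
Hypothesis T0 : T @ \oo --> 0.

Let G q := Gsum q / q%:R ^+ d.

(** All q below Q divide M, so the divisor sum and the partial sum of the series differ only by
    terms with q at least Q. *)
Lemma divis_density_tail (M Q : nat) : (0 < Q)%N -> (0 < M)%N ->
  (forall q, (0 < q < Q)%N -> (q %| M)%N) ->
  `|divis_density M - \sum_(1 <= q < Q) G q| <= T Q.
Proof.
move=> Q0 M0 hM; rewrite divis_density_sum//.
rewrite -(big_mkord (fun q => q %| M)%N G).
(* Otherwise [M.+1] would be among the q below Q, and would divide M. *)
have QM : (Q <= M.+1)%N.
  rewrite leqNgt; apply/negP => h.
  have := hM M.+1; rewrite ltn0Sn h => /(_ isT) /dvdn_leq -/(_ M0); by rewrite ltnn.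
rewrite big_ltn_cond//= dvd0n eqn0Ngt M0 /= (big_cat_nat _ (n := Q))//= addrC.
have -> : \sum_(1 <= q < Q | (q %| M)%N) G q = \sum_(1 <= q < Q) G q.
  rewrite big_nat_cond [RHS]big_nat_cond; apply: eq_bigl => q.
  by case: (boolP (1 <= q < Q)%N) => //= h; rewrite hM.
rewrite addrK; apply: le_trans (ler_norm_sum _ _ _) _.
apply: le_trans (cT M.+1 Q0); rewrite big_mkcond /= big_nat_cond [leRHS]big_nat_cond.
apply: ler_sum => q /andP[/andP[Qq _] _]; case: ifP => _; last exact: c0.
by apply: Gc; exact: leq_trans Qq.
Qed.

Definition Ssum : R := limn (fun Q => \sum_(1 <= q < Q) G q).

Lemma Gsum_abs_bounded (s : seq nat) : uniq s -> all (leq 1) s -> \sum_(q <- s) `|G q| <= T 1.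
Proof.
move=> us s1; pose m := (\sum_(q <- s) q).+1.
apply: le_trans (cT m _) => //; apply: (@le_trans _ _ (\sum_(q <- s) c q)).
  by rewrite big_seq [leRHS]big_seq; apply: ler_sum => q qs; apply: Gc; exact: (allP s1).
apply: sum_sub => //; first exact: iota_uniq.
by move=> q qs; rewrite mem_index_iota (allP s1)//= /m ltnS (big_rem q)//= leq_addr.
Qed.

Lemma cvg_abs_sum (u : nat -> R) (E : R) : (forall n, \sum_(0 <= i < n) `|u i| <= E) ->
  cvgn (series u).
Proof.
move=> hE; apply: normed_cvg; apply: nondecreasing_is_cvgn.
  by move=> n m; apply: nondecreasing_series => i _ _; exact: normr_ge0.
by exists E => _ [n _ <-]; exact: hE.
Qed.

Lemma cvg_factor (p : nat) : prime p ->
  (fun n => divis_density (p ^ n)) @ \oo --> limn (series (fun l => Gsum (p ^ l) / p%:R ^+ (d * l))).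
Proof.
move=> pp; pose u l := Gsum (p ^ l) / p%:R ^+ (d * l).
have uE l : u l = G (p ^ l) by rewrite /u /G natrX -exprM mulnC.
have cu : cvgn (series u).
  apply: (@cvg_abs_sum _ (T 1)) => n.
  rewrite (eq_bigr (fun l => `|G (p ^ l)|)); last by move=> l _; rewrite uE.
  rewrite -(big_map (fun l => p ^ l)%N xpredT (fun q => `|G q|)); apply: Gsum_abs_bounded.
    rewrite map_inj_uniq ?iota_uniq// => x y /eqP.
    by rewrite eqn_exp2l ?prime_gt1// => /eqP.
  by apply/allP => _ /mapP[l _ ->]; rewrite expn_gt0 prime_gt0.
have -> : (fun n => divis_density (p ^ n)) = (fun n => series u n.+1).
  apply/funext => n; rewrite divis_density_prime_pow// /series /= big_mkord.
  by apply: eq_bigr => l _; rewrite uE.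
by rewrite (cvg_shiftS (series u)).
Qed.

Lemma cvg_Ssum : (fun Q => \sum_(1 <= q < Q) G q) @ \oo --> Ssum.
Proof.
have : cvgn (series (fun i => G i.+1)).
  apply: (@cvg_abs_sum _ (T 1)) => n.
  rewrite -(big_map succn xpredT (fun q => `|G q|)); apply: Gsum_abs_bounded.
    by rewrite map_inj_uniq ?iota_uniq// => x y [].
  by apply/allP => _ /mapP[l _ ->].
have e : (fun n => \sum_(1 <= q < n.+1) G q) = series (fun i => G i.+1).
  by apply/funext => n; rewrite /series /= big_add1.
rewrite -e => /cvg_ex[x hx]; have : (fun Q => \sum_(1 <= q < Q) G q) @ \oo --> x.
  by rewrite -(cvg_shiftS (fun Q => \sum_(1 <= q < Q) G q)).
by move=> h; rewrite /Ssum (cvg_lim _ h).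
Qed.

Lemma Ssum_tail Q : (0 < Q)%N -> `|Ssum - \sum_(1 <= q < Q) G q| <= T Q.
Proof.
move=> Q0; have h : (fun n => `|\sum_(1 <= q < n) G q - \sum_(1 <= q < Q) G q|) @ \oo -->
    `|Ssum - \sum_(1 <= q < Q) G q|.
  by apply: cvg_norm; apply: cvgB; [exact: cvg_Ssum|exact: cvg_cst].
apply: (cvgr_to_le h); near=> n.
have Qn : (Q <= n)%N by near: n; exact: nbhs_infty_ge.
rewrite (big_cat_nat _ (n := Q))//= addrAC subrr add0r.
apply: le_trans (ler_norm_sum _ _ _) _; apply: le_trans (cT n Q0).
rewrite big_nat [leRHS]big_nat; apply: ler_sum => q /andP[Qq _].
by apply: Gc; exact: leq_trans Qq.
Unshelve. all: by end_near. Qed.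

(** For fixed n the exponent N tends to infinity in the density of the product of the [p ^ N], p up
    to n. Every such density is within [T n.+1] of the partial sum, so the finite Euler product is
    too; only then does n grow. *)
Lemma euler_product :
  limn (fun n : nat => \prod_(p < n.+1 | prime p)
     limn (series (fun l => Gsum (p ^ l) / p%:R ^+ (d * l)))) = Ssum.
Proof.
pose sg p := limn (series (fun l => Gsum (p ^ l) / p%:R ^+ (d * l))).
pose ps n := [seq p <- iota 0 n.+1 | prime p].
have psE n (F : nat -> R) : \prod_(p < n.+1 | prime p) F p = \prod_(p <- ps n) F p.
  by rewrite big_filter -(big_mkord prime F) /index_iota subn0.
have near_prod n : `|\prod_(p <- ps n) sg p - \sum_(1 <= q < n.+1) G q| <= T n.+1.
  have h : (fun N => \prod_(p <- ps n) divis_density (p ^ N)) @ \oo --> \prod_(p <- ps n) sg p.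
    have : all prime (ps n) by apply: filter_all.
    elim: (ps n) => [|p s IH] /=.
      move=> _; rewrite big_nil (_ : (fun _ => _) = fun=> 1); first exact: cvg_cst.
      by apply/funext => N; rewrite big_nil.
    move=> /andP[pp als]; rewrite big_cons.
    rewrite (_ : (fun _ => _) = (fun N => divis_density (p ^ N) * \prod_(p <- s) divis_density (p ^ N))); last first.
      by apply/funext => N; rewrite big_cons.
    by apply: cvgM; [exact: cvg_factor|exact: IH].
  have h2 : (fun N => `|\prod_(p <- ps n) divis_density (p ^ N) - \sum_(1 <= q < n.+1) G q|) @ \oo -->
      `|\prod_(p <- ps n) sg p - \sum_(1 <= q < n.+1) G q|.
    by apply: cvg_norm; apply: cvgB; [exact: h|exact: cvg_cst].
  apply: (cvgr_to_le h2); near=> N.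
  have nN : (n <= N)%N by near: N; exact: nbhs_infty_ge.
  rewrite divis_density_prod ?filter_uniq ?iota_uniq ?filter_all//.
  apply: divis_density_tail => //.
    rewrite big_seq prodn_cond_gt0// => i; rewrite mem_filter => /andP[pi _].
    by rewrite expn_gt0 prime_gt0.
  by move=> q /andP[q0 qn]; apply: dvdn_prime_prod => //; rewrite q0.
apply: cvg_lim => //.
rewrite (_ : (fun _ => _) = (fun n => \prod_(p <- ps n) sg p)); last first.
  by apply/funext => n; rewrite (psE n sg).
have h3 : (fun n => \prod_(p <- ps n) sg p - \sum_(1 <= q < n.+1) G q) @ \oo --> 0.
  apply/cvgr0Pnorm_le => e e0.
  have hT : \forall n \near \oo, `|T n.+1| <= e.
    have : (fun n => T n.+1) @ \oo --> 0 by rewrite (cvg_shiftS T).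
    by move=> /cvgr0Pnorm_le; apply.
  near=> n; apply: le_trans (near_prod n) _; apply: le_trans (ler_norm _) _.
  by near: n.
have h4 : (fun n => \sum_(1 <= q < n.+1) G q) @ \oo --> Ssum.
  by rewrite (cvg_shiftS (fun Q => \sum_(1 <= q < Q) G q)); exact: cvg_Ssum.
have h5 := cvgD h3 h4; rewrite add0r in h5.
have -> : (fun n => \prod_(p <- ps n) sg p) = (fun n => \prod_(p <- ps n) sg p - \sum_(1 <= q < n.+1) G q) + (fun n => \sum_(1 <= q < n.+1) G q).
  by apply/funext => n; rewrite /= fctE subrK.
exact: h5.
Unshelve. all: by end_near. Qed.

End GaussSums.

(** * Majorants and cutoffs *)

Section SmoothClass.
Context {R : realType} {n : nat}.
Notation V := 'cV[R]_n.
Implicit Types (w v : V -> R) (D E : 'I_n -> nat -> V -> R).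

Definition smooth (K p : nat) (M : R) w D := [/\ forall j, D j 0 = w,
  forall j z, dseq K (fun l s => D j l (z + s *: delta_mx j 0)),
  forall j l z, (l <= K)%N -> `|D j l z| <= M * omega z ^+ p &
  forall j l, (l <= K)%N -> continuous (D j l)].

Lemma smooth_weight K p M B w D : smooth K p M w D ->
  (forall j l (z : V) i, (l <= K)%N -> B <= `|z i 0| -> D j l z = 0) -> weight K p M B w D.
Proof. by case. Qed.

Lemma weight_smooth K p M B w D : weight K p M B w D -> smooth K p M w D.
Proof. by case. Qed.

Fixpoint mulv l (f g : nat -> V -> R) : V -> R := match l with
  | 0 => fun z => f 0%N z * g 0%N z
  | l'.+1 => fun z => mulv l' (fun i => f i.+1) g z + mulv l' f (fun i => g i.+1) z
  end.

Lemma mulv_shift l f g (z e : V) (s : R) :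
  mulv l f g (z + s *: e) = mulseq l (fun i s => f i (z + s *: e)) (fun i s => g i (z + s *: e)) s.
Proof. by elim: l f g => [//|l IH] f g /=; rewrite !IH. Qed.

Lemma continuous_mulv l f g : (forall i, (i <= l)%N -> continuous (f i)) ->
  (forall i, (i <= l)%N -> continuous (g i)) -> continuous (mulv l f g).
Proof.
elim: l f g => [|l IH] f g cf cg z /=.
  by apply: (@continuousM _ _ (f 0%N) (g 0%N)); [exact: cf|exact: cg].
apply: (@continuousD _ _ _ (mulv l (fun i => f i.+1) g) (mulv l f (fun i => g i.+1))).
  by apply: IH => i il; [exact: cf|apply: cg; exact: leqW].
by apply: IH => i il; [apply: cf; exact: leqW|exact: cg].
Qed.

Lemma mulv_bound l f g z (a b : R) : (forall i, (i <= l)%N -> `|f i z| <= a) ->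
  (forall i, (i <= l)%N -> `|g i z| <= b) -> `|mulv l f g z| <= 2 ^+ l * (a * b).
Proof.
elim: l f g => [|l IH] f g hf hg /=.
  by rewrite expr0 mul1r normrM; apply: ler_pM => //; [exact: hf|exact: hg].
apply: le_trans (ler_normD _ _) _; rewrite exprS -mulrA mulr2n mulrDl !mul1r.
apply: lerD; apply: IH => i il; by [exact: hf|exact: hg|apply: hf; exact: leqW|apply: hg; exact: leqW].
Qed.

Lemma mulv_eq0 l f g z : (forall i, (i <= l)%N -> g i z = 0) -> mulv l f g z = 0.
Proof.
elim: l f g => [|l IH] f g hg /=; first by rewrite hg ?mulr0.
by rewrite !IH ?addr0// => i il; apply: hg => //; exact: leqW.
Qed.

Lemma smooth_mul K p M M' w v D E : 0 <= M -> 0 <= M' -> smooth K p M w D -> smooth K 0 M' v E ->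
  smooth K p (2 ^+ K * (M * M')) (fun z => w z * v z) (fun j l => mulv l (D j) (E j)).
Proof.
move=> M0 M0' [D0 dD bD cD] [E0 dE bE cE]; split.
- by move=> j; apply/funext => z /=; rewrite D0 E0.
- move=> j z; rewrite (_ : (fun l s => _) = (fun l => mulseq l (fun i s => D j i (z + s *: delta_mx j 0))
    (fun i s => E j i (z + s *: delta_mx j 0)))).
    by apply: dseq_mul; [exact: dD|exact: dE].
  by apply/funext => l; apply/funext => s; exact: mulv_shift.
- move=> j l z lK; apply: le_trans (@mulv_bound l _ _ z (M * omega z ^+ p) M' _ _) _.
  + by move=> i il; apply: bD; exact: leq_trans lK.
  + by move=> i il; have := bE j i z (leq_trans il lK); rewrite expr0 mulr1.
  rewrite (_ : M * omega z ^+ p * M' = (M * M') * omega z ^+ p); last by ring.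
  rewrite [leLHS]mulrA; apply: ler_wpM2r; first by apply: exprn_ge0; exact: omega_ge0.
  by apply: ler_wpM2r; [nng|rewrite ler_eXn2l// ltr1n].
by move=> j l lK; apply: continuous_mulv => i il; [apply: cD|apply: cE]; exact: leq_trans lK.
Qed.

Lemma weight_mul K p M M' B w v D E : 0 <= M -> 0 <= M' -> smooth K p M w D -> weight K 0 M' B v E ->
  weight K p (2 ^+ K * (M * M')) B (fun z => w z * v z) (fun j l => mulv l (D j) (E j)).
Proof.
move=> M0 M0' sw wv; have sv := weight_smooth wv; case: wv => _ _ _ _ vE.
apply: smooth_weight; first exact: smooth_mul.
move=> j l z i lK Bz; apply: mulv_eq0 => k kl; apply: (vE j k z i) => //; exact: leq_trans lK.
Qed.

Lemma smoothD K p M M' w v D E : smooth K p M w D -> smooth K p M' v E ->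
  smooth K p (M + M') (fun z => w z + v z) (fun j l z => D j l z + E j l z).
Proof.
move=> [D0 dD bD cD] [E0 dE bE cE]; split.
- by move=> j; apply/funext => z; rewrite D0 E0.
- move=> j z l x lK; have h1 := dD j z l x lK; have h2 := dE j z l x lK.
  exact: is_deriveD.
- move=> j l z lK; apply: le_trans (ler_normD _ _) _; rewrite mulrDl.
  by apply: lerD; [exact: bD|exact: bE].
by move=> j l lK z; apply: (@continuousD _ _ _ (D j l) (E j l)); [exact: cD|exact: cE].
Qed.

Lemma smoothZ K p M (c : R) w D : 0 <= c -> smooth K p M w D ->
  smooth K p (c * M) (fun z => c * w z) (fun j l z => c * D j l z).
Proof.
move=> c0 [D0 dD bD cD]; split.
- by move=> j; apply/funext => z; rewrite D0.
- by move=> j z; exact: dseqZ (dD j z).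
- by move=> j l z lK; rewrite normrM ger0_norm// -mulrA; apply: ler_wpM2l => //; exact: bD.
by move=> j l lK z; apply: (@continuousM _ _ (fun=> c) (D j l)); [exact: cst_continuous|exact: cD].
Qed.

Definition prodD (u : nat -> R -> R) (j : 'I_n) l (z : V) : R :=
  \prod_i u (if i == j then l else 0%N) (z i 0).

Lemma continuous_bigprod (F : 'I_n -> V -> R) :
  (forall i, continuous (F i)) -> continuous (fun z => \prod_i F i z).
Proof.
move=> cF z; elim: (index_enum 'I_n) => [|i s IH].
  by rewrite (_ : (fun _ => _) = fun=> 1); [exact: cst_continuous|apply/funext => y; rewrite big_nil].
rewrite (_ : (fun _ => _) = (fun y => F i y * \prod_(i <- s) F i y)); last first.
  by apply/funext => y; rewrite big_cons.
by apply: (@continuousM _ _ (F i) (fun y => \prod_(i <- s) F i y)); [exact: cF|exact: IH].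
Qed.

Lemma smooth_prod K p M u : dseq K u ->
  (forall l x, (l <= K)%N -> `|u l x| <= M * (1 + x ^+ 2)^-1 ^+ p) ->
  (forall l, (l <= K)%N -> continuous (u l)) ->
  smooth K p (M ^+ n) (fun z => \prod_i u 0%N (z i 0)) (prodD u).
Proof.
move=> du bu cu; have ifK (i j : 'I_n) l : (l <= K)%N -> ((if i == j then l else 0%N) <= K)%N by case: eqP.
split.
- by move=> j; apply/funext => z; apply: eq_bigr => i _; case: eqP.
- move=> j z; pose c := \prod_(i | i != j) u 0%N (z i 0).
  rewrite (_ : (fun l s => _) = (fun l s => c * (1 ^+ l * u l (1 * s + z j 0)))).
    by apply: dseqZ; apply: dseq_affine.
  apply/funext => l; apply/funext => s; rewrite /prodD (bigD1 j)//= eqxx expr1n !mul1r mulrC.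
  rewrite mxE entry_shift eqxx mulr1 addrC; congr (_ * _); apply: eq_bigr => i ij.
  by rewrite (negPf ij) mxE entry_shift (negPf ij) mulr0 addr0.
- move=> j l z lK; rewrite /prodD normr_prod.
  have -> : M ^+ n * omega z ^+ p = \prod_i (M * (1 + (z i 0) ^+ 2)^-1 ^+ p).
    by rewrite big_split /= prodr_const card_ord /omega prodrXl.
  by apply: ler_prod => i _; rewrite normr_ge0 bu// ifK.
move=> j l lK; apply: (@continuous_bigprod (fun i z => u (if i == j then l else 0%N) (z i 0))) => i z.
apply: (@continuous_comp _ _ _ (fun z : V => z i 0)); first exact: continuous_coord.
by apply: cu; exact: ifK.
Qed.

End SmoothClass.

Section Majorant.
Context {R : realType}.
Implicit Types x : R.

(** Leibniz' rule applied to [(1 + x^2) q = 1] gives [(1 + x^2) q^(l) + 2 l x q^(l-1) + l (l-1)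
    q^(l-2) = 0], a recursion on pairs of consecutive derivatives of q. *)
Fixpoint invseq l x : R * R := match l with
  | 0 => ((1 + x ^+ 2)^-1, 0)
  | l'.+1 => let: (a, b) := invseq l' x in
      (- ((1 + x ^+ 2)^-1 * (2 * l'.+1%:R * x * a + l'.+1%:R * l'%:R * b)), a)
  end.

Lemma is_derive_inv1sqr x :
  is_derive x (1:R) (fun x : R => (1 + x ^+ 2)^-1) (- (2 * x * (1 + x ^+ 2)^-1 ^+ 2)).
Proof.
have h0 : 1 + x ^+ 2 != 0 by rewrite gt_eqF// ltr_wpDr// sqr_ge0.
have h : is_derive x (1:R) (fun x : R => 1 + x ^+ 2) (2 * x).
  by apply: is_derive_eq; rewrite /GRing.scale /= ?expr1; ring.
by apply: is_derive_eq; rewrite /GRing.scale /= -exprVn; ring.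
Qed.

(** The factor [l] in the second part kills the default value 0 that stands in the pair for the
    derivative of order -1. *)
Lemma invseq_derive l x :
  is_derive x (1:R) (fun y => (invseq l y).1) (invseq l.+1 x).1 /\
  is_derive x (1:R) (fun y => l%:R * (invseq l y).2) (l%:R * (invseq l x).1).
Proof.
elim: l x => [|l IH] x.
  split; last first.
    rewrite !mul0r; rewrite (_ : (fun _ => _) = cst 0); first exact: is_derive_cst.
    by apply/funext => y; rewrite mul0r.
  apply: is_derive_eq; first exact: is_derive_inv1sqr.
  by rewrite /=; ring.
have [d1 d2] := IH x.
have e y : (invseq l.+1 y).1 = - ((1 + y ^+ 2)^-1 * (2 * l.+1%:R * y * (invseq l y).1 + l.+1%:R * (l%:R * (invseq l y).2))).
  by rewrite /=; case: (invseq l y) => a b /=; ring.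
have e2 y : (invseq l.+1 y).2 = (invseq l y).1 by rewrite /=; case: (invseq l y).
have e3 y : (invseq l.+2 y).1 = - ((1 + y ^+ 2)^-1 * (2 * l.+2%:R * y * (invseq l.+1 y).1 + l.+2%:R * l.+1%:R * (invseq l y).1)).
  by rewrite -e2 /=; case: (invseq l y).
split; last first.
  rewrite (_ : (fun y => _) = (fun y => l.+1%:R * (invseq l y).1)); last by apply/funext => y; rewrite e2.
  by apply: is_derive_eq.
rewrite (_ : (fun y => _) = (fun y => - ((1 + y ^+ 2)^-1 * (2 * l.+1%:R * y * (invseq l y).1 + l.+1%:R * (l%:R * (invseq l y).2))))); last first.
  by apply/funext => y; rewrite e.
have di := is_derive_inv1sqr x.
have d3 : is_derive x (1:R) (fun y => 2 * l.+1%:R * y * (invseq l y).1 + l.+1%:R * (l%:R * (invseq l y).2))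
   (2 * l.+1%:R * (invseq l x).1 + 2 * l.+1%:R * x * (invseq l.+1 x).1 + l.+1%:R * (l%:R * (invseq l x).1)).
  have dx : is_derive x (1:R) (fun y => 2 * l.+1%:R * y) (2 * l.+1%:R).
    by apply: is_derive_eq; rewrite /GRing.scale /= mulr1.
  by apply: is_derive_eq; rewrite /GRing.scale /=; ring.
have h0 : 1 + x ^+ 2 != 0 by rewrite gt_eqF// ltr_wpDr// sqr_ge0.
apply: is_derive_eq; rewrite e3 e /GRing.scale /= -!natr1.
by field.
Qed.

Lemma dseq_inv K : dseq K (fun l x => (invseq l x).1).
Proof. by move=> l x _; have [] := invseq_derive l x. Qed.

Lemma invseq_bound l x : `|(invseq l x).1| <= 4 ^+ l * l`!%:R * (1 + x ^+ 2)^-1 /\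
  `|l%:R * (invseq l x).2| <= 4 ^+ l * l`!%:R * (1 + x ^+ 2)^-1.
Proof.
have q0 := omega_factor x; case/andP: q0 => q0 q1.
set q := (1 + x ^+ 2)^-1 in q0 q1 *.
elim: l => [|l [IH1 IH2]].
  rewrite /= expr0 (_ : 0`!%:R = 1 :> R)// !mul1r mul0r normr0.
  by rewrite -/q ger0_norm (ltW q0).
have xq : `|x| * q <= 1.
  rewrite /q ler_pdivrMr ?ltr_wpDr ?sqr_ge0// mul1r -(real_normK (num_real x)).
  have := sqr_ge0 (`|x| - 1); have := normr_ge0 x; nra.
set c : R := 4 ^+ l * l`!%:R in IH1 IH2.
have cE : 4 ^+ l.+1 * l.+1`!%:R = 4 * l.+1%:R * c :> R by rewrite factS natrM exprS /c; ring.
have c0 : 0 <= c by rewrite /c mulr_ge0.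
have l1 : 1 <= l.+1%:R :> R by rewrite ler1n.
split; last first.
  have -> : (invseq l.+1 x).2 = (invseq l x).1 by rewrite /=; case: (invseq l x).
  rewrite normrM normr_nat cE; have := normr_ge0 (invseq l x).1.
  have := ler_wpM2l (_ : 0 <= l.+1%:R) IH1; rewrite ler0n => /(_ isT).
  have : 0 <= l.+1%:R * (c * q) by rewrite !mulr_ge0// ltW.
  lra.
have -> : (invseq l.+1 x).1 = - (2 * l.+1%:R * (x * q * (invseq l x).1) + l.+1%:R * (q * (l%:R * (invseq l x).2))).
  by rewrite /=; case: (invseq l x) => a b /=; rewrite -/q; ring.
rewrite normrN cE; apply: le_trans (ler_normD _ _) _.
have h1 : `|x * q * (invseq l x).1| <= c * q.
  by rewrite 2!normrM (gtr0_norm q0) -[leRHS]mul1r; apply: ler_pM => //; rewrite mulr_ge0// ltW.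
have h2 : `|q * (l%:R * (invseq l x).2)| <= c * q.
  by rewrite normrM (gtr0_norm q0) -[leRHS]mul1r; apply: ler_pM => //; exact: ltW.
rewrite !(normrM (_%:R * _)) !(normrM l.+1%:R) normrM !normr_nat.
have l0 : 0 <= l.+1%:R :> R by [].
have := ler_wpM2l l0 h1; have := ler_wpM2l l0 h2.
have : 0 <= l.+1%:R * (c * q) by rewrite !mulr_ge0// ltW.
by rewrite !mulrA; lra.
Qed.

Fixpoint invpow p : nat -> R -> R := match p with
  | 0 => fun l x => if l is 0%N then 1 else 0
  | p'.+1 => fun l => mulseq l (fun i x => (invseq i x).1) (invpow p')
  end.

Lemma invpow0 p x : invpow p 0 x = (1 + x ^+ 2)^-1 ^+ p.
Proof. by elim: p => [|p IH]; [rewrite expr0|rewrite exprS -IH]. Qed.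

Lemma dseq_invpow p K : dseq K (invpow p).
Proof.
elim: p => [|p IH] /=; last by apply: dseq_mul => //; exact: dseq_inv.
by move=> [|l] x _ /=; exact: is_derive_cst.
Qed.

Lemma invpow_bound p K : exists2 C : R, 1 <= C & forall l x, (l <= K)%N ->
  `|invpow p l x| <= C * (1 + x ^+ 2)^-1 ^+ p.
Proof.
elim: p => [|p [C C1 hC]].
  by exists 1 => // -[|l] x _ /=; rewrite expr0 mulr1 ?normr1// normr0.
pose c : R := 4 ^+ K * K`!%:R.
have c1 : 1 <= c.
  by rewrite mulr_ege1 ?exprn_ege1 ?ler1n ?fact_gt0.
exists (2 ^+ K * (c * C)).
  by apply: mulr_ege1; [rewrite exprn_ege1// ler1n|exact: mulr_ege1].
move=> l x lK /=; have [q0 q1] := andP (omega_factor x).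
set q := (1 + x ^+ 2)^-1 in q0 q1 *.
have b1 i : (i <= l)%N -> `|(invseq i x).1| <= c * q * 1 ^+ i.
  move=> il; have [h _] := invseq_bound i x; rewrite expr1n mulr1; apply: le_trans h _.
  apply: ler_wpM2r; first exact: ltW.
  have iK := leq_trans il lK.
  apply: ler_pM; rewrite ?exprn_ge0//; first by rewrite ler_eXn2l// ltr1n.
  by rewrite ler_nat leq_fact.
have b2 i : (i <= l)%N -> `|invpow p i x| <= C * q ^+ p * 1 ^+ i.
  by move=> il; rewrite expr1n mulr1 /q; apply: hC; exact: leq_trans lK.
have cq0 : 0 <= c * q by rewrite mulr_ge0 ?(ltW q0)//; lra.
have Cq0 : 0 <= C * q ^+ p by rewrite mulr_ge0 ?exprn_ge0 ?(ltW q0)//; lra.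
apply: le_trans (mulseq_bound cq0 Cq0 ler01 b1 b2) _.
rewrite expr1n mulr1 exprS.
have -> : 2 ^+ K * (c * C) * (q * q ^+ p) = 2 ^+ K * (c * q * (C * q ^+ p)) by ring.
by apply: ler_wpM2r; [rewrite mulr_ge0|rewrite ler_eXn2l// ltr1n].
Qed.

(** [omega ^+ p] dominates its own derivatives up to a constant, so adding a multiple of it makes a
    weight nonnegative without leaving the class. *)
Lemma majorant n K p : exists2 M, 1 <= M & exists D, smooth K p M (fun z : 'cV[R]_n => omega z ^+ p) D.
Proof.
have [C C1 hC] := invpow_bound p K.
exists (C ^+ n); first exact: exprn_ege1.
exists (prodD (invpow p)).
have h := smooth_prod (n := n) (dseq_invpow p (K := K)) hC.
have -> : (fun z : 'cV[R]_n => omega z ^+ p) = (fun z => \prod_i invpow p 0 (z i 0)).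
  by apply/funext => z; rewrite /omega -prodrXl; apply: eq_bigr => i _; rewrite invpow0.
apply: h => l lK x; exact: (dseq_cont (dseq_invpow p (K := K.+1))).
Qed.

End Majorant.

Section Cutoff.
Context {R : realType}.
Implicit Types x : R.

Definition posp x : R := Num.max 0 x.

Lemma continuous_posp : continuous posp.
Proof. by move=> x; apply: continuous_max; [exact: cst_continuous|exact: cvg_id]. Qed.

Lemma is_derive_pospX m x : is_derive x (1:R) (fun y => posp y ^+ m.+2) (m.+2%:R * posp x ^+ m.+1).
Proof.
have pw (y : R) : is_derive y (1:R) (fun y : R => y ^+ m.+2) (m.+2%:R * y ^+ m.+1).
  rewrite (_ : (fun _ => _) = (id : R -> R) ^+ m.+2); last by apply/funext => t; rewrite exprfctE.
  apply: is_derive_eq (@is_deriveX _ _ id m.+2 y 1 1 (is_derive_id y 1)) _.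
  by rewrite /GRing.scale /= mulr1.
have [x0|x0|->] := ltgtP x 0.
- rewrite {2}/posp (max_idPl (ltW x0)) expr0n mulr0.
  apply: (near_eq_is_derive _ (is_derive_cst (0 : R) x (1 : R))).
  have : \forall y \near x, (id : R -> R) y < 0 by apply: (cvgr_lt x cvg_id).
  by apply: filterS => y /= y0; rewrite /posp (max_idPl (ltW y0)) expr0n.
- rewrite {2}/posp (max_idPr (ltW x0)).
  apply: (near_eq_is_derive _ (pw x)).
  have : \forall y \near x, 0 < (id : R -> R) y by apply: (cvgr_gt x cvg_id).
  by apply: filterS => y /= y0; rewrite /posp (max_idPr (ltW y0)).
rewrite {2}/posp maxxx expr0n mulr0.
apply/is_derive1_caratheodory; exists (fun z => posp z ^+ m.+1); split.
- move=> z; rewrite subr0 /posp maxxx expr0n subr0 exprSr; have [z0|z0] := leP z 0; last by [].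
  by rewrite expr0n !mul0r.
- apply: (@continuous_comp _ _ _ posp (fun t : R => t ^+ m.+1)); first exact: continuous_posp.
  exact: exprn_continuous.
by rewrite /posp maxxx expr0n.
Qed.

Definition pospseq N l x : R := (N ^_ l)%:R * posp x ^+ (N - l).

Lemma dseq_posp K N : (K < N)%N -> dseq K (pospseq N).
Proof.
move=> KN l x lK; have [m e] : exists m, (N - l = m.+2)%N by exists (N - l).-2; lia.
rewrite /pospseq e ffactnSr e (_ : (N - l.+1 = m.+1)%N); last by lia.
have h := is_derive_pospX m x.
by apply: is_derive_eq; rewrite /GRing.scale /= natrM mulrA.
Qed.

Definition cutseq N (B : R) l x : R :=
  mulseq l (fun i s => (- B^-1) ^+ i * pospseq N i (- B^-1 * s + 1))
           (fun i s => B^-1 ^+ i * pospseq N i (B^-1 * s + 1)) x.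

Lemma dseq_cut K N B : (K < N)%N -> dseq K (cutseq N B).
Proof. by move=> KN; apply: dseq_mul; apply: dseq_affine; exact: dseq_posp. Qed.

(** This is [(1 - x^2 / B^2)^N] on [-B, B] and 0 outside. Finite smoothness suffices, and unlike a
    generic bump this one visibly increases with B, as monotone convergence demands. *)
Definition cut1 N (B : R) x : R := (posp (- B^-1 * x + 1) * posp (B^-1 * x + 1)) ^+ N.

Lemma cutseq0 N B x : cutseq N B 0 x = cut1 N B x.
Proof. by rewrite /cutseq /= /pospseq !expr0 !subn0 !ffactn0 !mul1r /cut1 exprMn. Qed.

Lemma mulseq_eq0 l (f g : nat -> R -> R) x :
  (forall i, (i <= l)%N -> f i x = 0) \/ (forall i, (i <= l)%N -> g i x = 0) -> mulseq l f g x = 0.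
Proof.
elim: l f g => [|l IH] f g h /=; first by case: h => -> //; rewrite ?mul0r ?mulr0.
by rewrite !IH ?addr0//; case: h => h; [left|right|left|right] => i il; apply: h => //; exact: leqW.
Qed.

Lemma cutseq_vanish N B l x : (l < N)%N -> 0 < B -> B <= `|x| -> cutseq N B l x = 0.
Proof.
move=> lN B0 Bx; apply: mulseq_eq0.
have pz i (y : R) : (i <= l)%N -> y <= 0 -> pospseq N i y = 0.
  move=> il y0; rewrite /pospseq /posp (max_idPl y0) expr0n.
  by rewrite (_ : (N - i == 0)%N = false) ?mulr0//; apply/negbTE; rewrite subn_eq0 -ltnNge (leq_ltn_trans il).
have [x0|x0] := leP 0 x.
  left=> i il; rewrite pz ?mulr0//.
  rewrite mulNr addrC subr_le0 mulrC ler_pdivlMr// mul1r.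
  by rewrite ger0_norm in Bx.
right=> i il; rewrite pz ?mulr0//.
rewrite ler0_norm ?(ltW x0)// in Bx.
by rewrite -lerBrDr sub0r mulrC ler_pdivrMr// mulN1r; lra.
Qed.

Lemma cutseq_bound N B l x : (l < N)%N -> 1 <= B -> `|cutseq N B l x| <= 2 ^+ l * ((N`!%:R * 2 ^+ N) * (N`!%:R * 2 ^+ N)).
Proof.
move=> lN B1; have B0 : 0 < B by lra.
have Bi : B^-1 <= 1 by rewrite invf_le1.
have Bi0 : 0 < B^-1 by rewrite invr_gt0.
have F0 : 0 <= N`!%:R * 2 ^+ N :> R by rewrite mulr_ge0// exprn_ge0.
have [Bx|xB] := leP B `|x|.
  by rewrite cutseq_vanish// normr0 !mulr_ge0// exprn_ge0.
have bx : `|B^-1 * x| <= 1.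
  by rewrite normrM gtr0_norm// mulrC ler_pdivrMr// mul1r ltW.
have pb i (y : R) : (i <= l)%N -> `|y| <= 1 -> `|pospseq N i (y + 1)| <= N`!%:R * 2 ^+ N.
  rewrite ler_norml => il /andP[y1 y2]; have iN := leq_ltn_trans il lN.
  rewrite /pospseq /posp (max_idPr _); last by lra.
  rewrite normrM normr_nat; apply: ler_pM => //.
    by rewrite ler_nat -(ffact_fact (ltnW iN)) leq_pmulr// fact_gt0.
  rewrite normrX ger0_norm; last by lra.
  apply: (@le_trans _ _ (2 ^+ (N - i))); last by rewrite ler_eXn2l ?ltr1n// leq_subr.
  by apply: lerXn2r; rewrite ?nnegrE; lra.
have b1 i : (i <= l)%N -> `|(- B^-1) ^+ i * pospseq N i (- B^-1 * x + 1)| <= N`!%:R * 2 ^+ N * 1 ^+ i.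
  move=> il; rewrite expr1n mulr1 normrM -[leRHS]mul1r; apply: ler_pM => //.
    by rewrite normrX normrN gtr0_norm// exprn_ile1// ltW.
  by apply: pb => //; rewrite mulNr normrN.
have b2 i : (i <= l)%N -> `|B^-1 ^+ i * pospseq N i (B^-1 * x + 1)| <= N`!%:R * 2 ^+ N * 1 ^+ i.
  move=> il; rewrite expr1n mulr1 normrM -[leRHS]mul1r; apply: ler_pM => //.
    by rewrite normrX gtr0_norm// exprn_ile1// ltW.
  exact: pb.
have := @mulseq_bound R l (fun i s => (- B^-1) ^+ i * pospseq N i (- B^-1 * s + 1))
  (fun i s => B^-1 ^+ i * pospseq N i (B^-1 * s + 1)) x _ _ _ F0 F0 ler01 b1 b2.
by rewrite expr1n mulr1.
Qed.

Lemma cut1_itv N B x : 0 < B -> 0 <= cut1 N B x <= 1.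
Proof.
move=> B0; have p0 y : 0 <= posp y by rewrite /posp le_max lexx.
rewrite /cut1 exprn_ge0 ?mulr_ge0//= exprn_ile1 ?mulr_ge0// /posp mulNr.
set t := B^-1 * x.
have [h1|h1] := leP (- t + 1) 0; first by rewrite mul0r.
have [h2|h2] := leP (t + 1) 0; first by rewrite mulr0.
by have := sqr_ge0 t; nra.
Qed.

Lemma cut1_homo N B B' x : 0 < B -> B <= B' -> cut1 N B x <= cut1 N B' x.
Proof.
move=> B0 BB; have B'0 : 0 < B' by lra.
have p0 y : 0 <= posp y by rewrite /posp le_max lexx.
rewrite /cut1 lerXn2r ?nnegrE ?mulr_ge0// /posp !mulNr.
set t := B^-1 * x; set t' := B'^-1 * x.
have tt : t' ^+ 2 <= t ^+ 2.
  rewrite /t /t' !exprMn ler_wpM2r ?sqr_ge0// lerXn2r ?nnegrE ?invr_ge0 ?(ltW B0) ?(ltW B'0)//.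
  by rewrite lef_pV2 ?posrE.
have [h1|h1] := leP (- t + 1) 0; first by rewrite mul0r mulr_ge0// le_max lexx.
have [h2|h2] := leP (t + 1) 0; first by rewrite mulr0 mulr_ge0// le_max lexx.
have t1 : t ^+ 2 < 1 by nra.
have h3 : 0 < - t' + 1 by nra.
have h4 : 0 < t' + 1 by nra.
rewrite (max_idPr (ltW h3)) (max_idPr (ltW h4)).
by nra.
Qed.

Lemma cut1_cvg N x : (fun k => cut1 N k.+1%:R x) @ \oo --> (1 : R).
Proof.
have : (fun k => (posp (- (k.+1%:R)^-1 * x + 1) * posp ((k.+1%:R)^-1 * x + 1)) ^+ N) @ \oo -->
   (posp (- 0 * x + 1) * posp (0 * x + 1)) ^+ N.
  have h : (fun k => (k.+1%:R)^-1 : R) @ \oo --> (0 : R) by exact: cvg_harmonic.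
  have c1 : (fun k => posp ((k.+1%:R)^-1 * x + 1)) @ \oo --> posp (0 * x + 1).
    have a : (fun k => (k.+1%:R)^-1 * x + 1 : R) @ \oo --> (0 * x + 1 : R).
      by apply: cvgD; [apply: cvgM => //; exact: cvg_cst|exact: cvg_cst].
    exact: (cvg_comp _ _ a (@continuous_posp _)).
  have c2 : (fun k => posp (- (k.+1%:R)^-1 * x + 1)) @ \oo --> posp (- 0 * x + 1).
    have a : (fun k => - (k.+1%:R)^-1 * x + 1 : R) @ \oo --> (- 0 * x + 1 : R).
      by apply: cvgD; [apply: cvgM; [exact: cvgN|exact: cvg_cst]|exact: cvg_cst].
    exact: (cvg_comp _ _ a (@continuous_posp _)).
  exact: (cvg_comp _ _ (cvgM c2 c1) (@exprn_continuous _ N _)).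
by rewrite oppr0 !mul0r add0r /posp (max_idPr ler01) mul1r expr1n.
Qed.

Definition cutoff n N (B : R) (z : 'cV[R]_n) : R := \prod_i cut1 N B (z i 0).

Lemma cutoff_itv n N B (z : 'cV[R]_n) : 0 < B -> 0 <= cutoff N B z <= 1.
Proof.
move=> B0; rewrite /cutoff prodr_ge0 /=; last by move=> i _; have /andP[] := cut1_itv N (z i 0) B0.
by apply: prodr_ile1 => i _; exact: cut1_itv.
Qed.

Lemma cutoff_homo n N B B' (z : 'cV[R]_n) : 0 < B -> B <= B' -> cutoff N B z <= cutoff N B' z.
Proof.
move=> B0 BB; apply: ler_prod => i _; rewrite cut1_homo// andbT.
by have /andP[] := cut1_itv N (z i 0) B0.
Qed.

Lemma cutoff_cvg n N (z : 'cV[R]_n) : (fun k => cutoff N k.+1%:R z) @ \oo --> (1 : R).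
Proof.
suff : (fun k => cutoff N k.+1%:R z) @ \oo --> (\prod_(i < n) (1 : R)) by rewrite big1_eq.
rewrite /cutoff; elim: (index_enum 'I_n) => [|i s IH].
  rewrite big_nil (_ : (fun _ => _) = fun=> 1); first exact: cvg_cst.
  by apply/funext => k; rewrite big_nil.
rewrite big_cons (_ : (fun _ => _) = (fun k => cut1 N k.+1%:R (z i 0) * \prod_(i <- s) cut1 N k.+1%:R (z i 0))); last first.
  by apply/funext => k; rewrite big_cons.
by apply: cvgM => //; exact: cut1_cvg.
Qed.

(** The order of quantifiers matters: [M] is chosen before [B], so estimates for cut-off weights
    survive the removal of the cutoff. *)
Lemma cutoff_weight n K : exists2 M, 0 <= M & forall B, 1 <= B -> exists D,
  weight K 0 M B (cutoff K.+2 B : 'cV[R]_n -> R) D.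
Proof.
pose F : R := K.+2`!%:R * 2 ^+ K.+2; pose C : R := 2 ^+ K * (F * F).
have F0 : 0 <= F by rewrite mulr_ge0// exprn_ge0.
exists (C ^+ n); first by rewrite /C; nng.
move=> B B1; have B0 : 0 < B by lra.
exists (prodD (cutseq K.+2 B)).
have -> : cutoff K.+2 B = (fun z : 'cV[R]_n => \prod_i cutseq K.+2 B 0 (z i 0)).
  by apply/funext => z; apply: eq_bigr => i _; rewrite cutseq0.
apply: smooth_weight; last first.
  move=> j l z i lK Bz; rewrite /prodD (bigD1 i)//= cutseq_vanish ?mul0r//.
  by case: eqP => _ //; lia.
apply: smooth_prod.
- by apply: dseq_cut.
- move=> l x lK; rewrite expr0 mulr1; apply: le_trans (cutseq_bound x _ B1) _; first by lia.
  by apply: ler_wpM2r; [rewrite mulr_ge0|rewrite ler_eXn2l// ltr1n].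
move=> l lK x; apply: (dseq_cont (dseq_cut B (K := K.+1) (N := K.+2) _)) => //.
Qed.

End Cutoff.

(** * The singular integral *)

Section Laplace.
Context {R : realType}.
Notation mu := (@lebesgue_measure R).
Implicit Types (dl t : R).

Lemma rint_ftc (F f : R -> R) (a b : R) : a <= b -> (forall x, is_derive x (1:R) F (f x)) ->
  continuous f -> \int[mu]_(x in `[a, b]) f x = F b - F a.
Proof.
move=> ab dF cf; have [->|ab'] := eqVneq a b.
  by rewrite set_itv1 Rintegral_set1 subrr.
have {}ab : a < b by rewrite lt_neqAle ab' ab.
have cF x : {for x, continuous F} by apply: differentiable_continuous; apply/derivable1_diffP; have [] := dF x.
rewrite /Rintegral (@continuous_FTC2 _ f F)//.
- exact: continuous_subspaceT.
- split=> [x _||]; first by have [] := dF x.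
  + by apply: cvg_at_right_filter; exact: cF.
  + by apply: cvg_at_left_filter; exact: cF.
by move=> x _; rewrite derive1E; have [_ ->] := dF x.
Qed.

Lemma mem_itvE (a b x : R) : (x \in `[a, b]%classic) = (x \in [set x | a <= x <= b]).
Proof. by congr (x \in _); apply/seteqP; split=> y /=; rewrite in_itv. Qed.

Lemma rint_on (a b : R) (f : R -> R) :
  \int[mu]_(x in `[a, b]) f x = \int[mu]_x (\1_[set x | a <= x <= b] x * f x).
Proof.
rewrite Rintegral_mkcond; congr (fine _); apply: eq_integral => x _; congr EFin.
rewrite /patch indicE mem_itvE.
by case: ifP; rewrite ?mul1r ?mul0r.
Qed.

Lemma Int_on (a b : R) (f : R -> R) : continuous f ->
  Int mu (fun x => \1_[set x | a <= x <= b] x * f x).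
Proof.
move=> cf; have : mu.-integrable `[a, b] (EFin \o f).
  by apply: continuous_compact_integrable; [exact: segment_compact|exact: continuous_subspaceT].
rewrite integrable_mkcond//= /Int; congr (_.-integrable _ _); apply/funext => x /=.
rewrite /patch indicE mem_itvE.
by case: ifP; rewrite ?mul1r ?mul0r.
Qed.

Lemma cvg_on (f : R -> R) x :
  (fun N : nat => \1_[set x : R | - N%:R <= x <= N%:R] x * f x) @ \oo --> f x.
Proof.
apply: cvg_near_cst; near=> N; rewrite indicE mem_set ?mul1r//=.
have : `|x| <= N%:R by near: N; exact: nbhs_infty_ger.
by rewrite ler_norml.
Unshelve. all: by end_near. Qed.

Lemma Int_exhaust (f : R -> R) (E : R) : continuous f -> (forall x, 0 <= f x) ->
  (forall N : nat, \int[mu]_(x in `[- N%:R, N%:R]) f x <= E) -> Int mu f.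
Proof.
move=> cf f0 fE.
have mf : measurable_fun setT f by exact: continuous_measurable_fun.
apply/integrableP; split; first exact/measurable_EFinP.
pose g (N : nat) (x : R) := (\1_[set x : R | - N%:R <= x <= N%:R] x * f x)%:E.
have ig N : Int mu (fun x => \1_[set x : R | - N%:R <= x <= N%:R] x * f x) by exact: Int_on.
have mg N : measurable_fun setT (g N) by apply/measurable_EFinP; exact: Int_meas (ig N).
have g0 N x : setT x -> (0 <= g N x)%E by move=> _; rewrite lee_fin mulr_ge0.
have gm x : setT x -> {homo g ^~ x : i j / (i <= j)%N >-> (i <= j)%E}.
  move=> _ i j ij; rewrite lee_fin; apply: ler_wpM2r => //.
  have sub : x \in [set x : R | - i%:R <= x <= i%:R] -> x \in [set x : R | - j%:R <= x <= j%:R].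
    move=> /set_mem /= h; apply/mem_set => /=; have : i%:R <= j%:R :> R by rewrite ler_nat.
    by lra.
  by rewrite !indicE; case: (x \in _) sub => [->//|_]; rewrite ler0n.
have := @cvg_monotone_convergence _ _ _ mu setT measurableT g mg g0 gm.
have -> : (fun x : R => limn (g ^~ x)) = (fun x => `|(EFin \o f) x|%E).
  apply/funext => x; rewrite /= ger0_norm//; apply/cvg_lim => //.
  by apply: cvg_EFin; [near=> N|exact: cvg_on].
move=> h; rewrite -(cvg_lim _ h)//; apply: (@le_lt_trans _ _ E%:E); last exact: ltry.
apply: lime_le; first by apply/cvg_ex; eexists; exact: h.
near=> N; rewrite /g -EFin_rint// lee_fin -rint_on; exact: fE.
Unshelve. all: by end_near. Qed.

Lemma cvg_rint (f : R -> R) : continuous f -> Int mu f ->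
  (fun N : nat => \int[mu]_(x in `[- N%:R, N%:R]) f x) @ \oo --> \int[mu]_x f x.
Proof.
move=> cf fi; under eq_fun do rewrite rint_on.
have bnd (N : nat) (x : R) : `|\1_[set x : R | - N%:R <= x <= N%:R] x * f x| <= `|f x|.
  rewrite normrM -[leRHS]mul1r; apply: ler_wpM2r => //.
  by rewrite indicE; case: (_ \in _); rewrite ?normr1 ?normr0.
by have [_ h] := rint_dct (fun N => Int_meas (Int_on _ _ cf)) (@cvg_on f) (Int_norm fi) bnd.
Qed.

Lemma rint_split (f : R -> R) (N : nat) : continuous f ->
  \int[mu]_(x in `[- N%:R, N%:R]) f x = \int[mu]_(x in `[- N%:R, 0]) f x + \int[mu]_(x in `[0, N%:R]) f x.
Proof.
move=> cf; have ci (a b : R) : mu.-integrable `[a, b] (EFin \o f).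
  by apply: continuous_compact_integrable; [exact: segment_compact|exact: continuous_subspaceT].
have := @Rintegral_itvB _ f (BLeft (- N%:R)) (BRight N%:R) 0 (ci _ _).
rewrite !bnd_simp oppr_le0 ler0n => /(_ isT isT) => /eqP.
rewrite subr_eq addrC => /eqP ->; congr (_ + _).
rewrite Rintegral_itv_obnd_cbnd//; apply: integrableS (ci 0 N%:R) => //.
by apply: subset_itv; rewrite bnd_simp.
Qed.

Lemma Int_inv1sqr : Int mu (fun x => (1 + x ^+ 2)^-1).
Proof.
have cf : continuous (fun x : R => (1 + x ^+ 2)^-1).
  by move=> x; exact: (@dseq_cont R 1 (fun l x => (invseq l x).1) 0 x (@dseq_inv R 1) isT).
apply: (@Int_exhaust _ pi) => // [x|N]; first by case/andP: (omega_factor x) => /ltW.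
rewrite (@rint_ftc atan)//.
- by rewrite -[leRHS](mulr1 pi); have := atan_ltpi2 (N%:R : R); have := atan_gtNpi2 (- N%:R : R); lra.
by rewrite ge0_cp.
Qed.

(** The factor for Abel summation of integrals over the line. Its cosine transform, computed in
    [laplace], is the Poisson kernel. *)
Definition expabs dl (x : R) : R := expR (- (dl * `|x|)).

Lemma continuous_expabs dl : continuous (expabs dl).
Proof.
move=> x; apply: (@continuous_comp _ _ _ (fun x => - (dl * `|x|)) expR); last exact: continuous_expR.
apply: (@continuousN _ _ _ (fun x => dl * `|x|)).
by apply: (@continuousM _ _ (fun=> dl) (fun x => `|x|)); [exact: cst_continuous|exact: norm_continuous].
Qed.

Lemma Int_expabs dl : 0 < dl -> Int mu (expabs dl).
Proof.
move=> d0; apply: (Int_le _ (IntZ (1 + 4 / dl ^+ 2) Int_inv1sqr)).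
  by apply: continuous_measurable_fun; exact: continuous_expabs.
move=> x; rewrite ger0_norm ?expR_ge0// /expabs.
have d2 : 0 < dl ^+ 2 by rewrite exprn_gt0.
have h : 1 + dl ^+ 2 / 4 * x ^+ 2 <= expR (dl * `|x|).
  have -> : dl * `|x| = dl * `|x| / 2 + dl * `|x| / 2 by field.
  rewrite expRD -expr2; have := expR_ge1Dx (dl * `|x| / 2).
  set t := dl * `|x| / 2 => h; have t0 : 0 <= t by rewrite /t divr_ge0// mulr_ge0// ltW.
  apply: (@le_trans _ _ ((1 + t) ^+ 2)); last by apply: lerXn2r; rewrite ?nnegrE ?expR_ge0//; lra.
  have -> : dl ^+ 2 / 4 * x ^+ 2 = t ^+ 2 by rewrite /t -(real_normK (num_real x)); field.
  nra.
rewrite expRN; have x2 := sqr_ge0 x.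
rewrite ler_pdivlMr ?ltr_pwDl// mulrC ler_pdivrMr ?expR_gt0//.
apply: le_trans (ler_wpM2l _ h); last by rewrite addr_ge0// divr_ge0// ltW.
have -> : (1 + 4 / dl ^+ 2) * (1 + dl ^+ 2 / 4 * x ^+ 2) = 1 + x ^+ 2 + 4 / dl ^+ 2 + dl ^+ 2 / 4 * x ^+ 2.
  by field; rewrite gt_eqF.
have h1 : 0 <= 4 / dl ^+ 2 by rewrite divr_ge0// ltW.
have h2 : 0 <= dl ^+ 2 / 4 * x ^+ 2 by rewrite mulr_ge0// divr_ge0// ltW.
by lra.
Qed.

Lemma continuous_cosM (c : R) : continuous (fun x : R => cos (c * x)).
Proof.
move=> x; apply: (@continuous_comp _ _ _ (fun x => c * x) cos); last exact: continuous_cos.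
by apply: (@continuousM _ _ (fun=> c) id); [exact: cst_continuous|exact: cvg_id].
Qed.

Lemma laplace_ftc (s c : R) (a b : R) : s != 0 -> a <= b ->
  \int[mu]_(x in `[a, b]) (expR (s * x) * cos (c * x)) =
  (expR (s * b) * (s * cos (c * b) + c * sin (c * b)) -
   expR (s * a) * (s * cos (c * a) + c * sin (c * a))) / (s ^+ 2 + c ^+ 2).
Proof.
move=> s0 ab; have D0 : s ^+ 2 + c ^+ 2 != 0.
  by rewrite gt_eqF// ltr_wpDr ?sqr_ge0// exprn_even_gt0.
pose F x := (s ^+ 2 + c ^+ 2)^-1 * (expR (s * x) * (s * cos (c * x) + c * sin (c * x))).
have dF (x : R) : is_derive x (1:R) F (expR (s * x) * cos (c * x)).
  have d1 (k : R) : is_derive x (1:R) (fun x => k * x) k.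
    by apply: is_derive_eq; rewrite /GRing.scale /= mulr1.
  have e1 : is_derive x (1:R) (fun x => expR (s * x)) (expR (s * x) * s).
    exact: (@is_derive1_comp _ expR (fun x => s * x) x _ _ (is_derive_expR _) (d1 s)).
  have e2 : is_derive x (1:R) (fun x => cos (c * x)) (- sin (c * x) * c).
    exact: (@is_derive1_comp _ cos (fun x => c * x) x _ _ (is_derive_cos _) (d1 c)).
  have e3 : is_derive x (1:R) (fun x => sin (c * x)) (cos (c * x) * c).
    exact: (@is_derive1_comp _ sin (fun x => c * x) x _ _ (is_derive_sin _) (d1 c)).
  rewrite /F; apply: is_derive_eq; rewrite /GRing.scale /=.
  by field.
rewrite (rint_ftc ab dF) /F; first by rewrite mulrBl !(mulrC _^-1).
move=> x; apply: (@continuousM _ _ (fun x => expR (s * x)) (fun x => cos (c * x))); last exact: continuous_cosM.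
apply: (@continuous_comp _ _ _ (fun x => s * x) expR); last exact: continuous_expR.
by apply: (@continuousM _ _ (fun=> s) id); [exact: cst_continuous|exact: cvg_id].
Qed.

Lemma Int_expabs_cos dl c : 0 < dl -> Int mu (fun g => expabs dl g * cos (c * g)).
Proof.
move=> d0; apply: (Int_le _ (Int_expabs d0)).
  apply: continuous_measurable_fun => x; apply: (@continuousM _ _ (expabs dl)).
    exact: continuous_expabs.
  exact: continuous_cosM.
move=> x; rewrite normrM ger0_norm ?expR_ge0// -[leRHS]mulr1.
by apply: ler_wpM2l; [exact: expR_ge0|exact: cos_max].
Qed.

Lemma cvg_inv_lin dl : 0 < dl -> (fun N : nat => (1 + dl * N%:R)^-1) @ \oo --> (0 : R).
Proof.
move=> d0; apply: (@squeeze_cvgr _ _ _ _ (fun=> 0) (fun N => (1 + dl^-1) * harmonic N)).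
- near=> N; apply/andP; split.
    by rewrite invr_ge0 addr_ge0// mulr_ge0// ltW.
  rewrite /harmonic /= -[leLHS]mul1r ler_pdivrMr; last by rewrite ltr_pwDl// mulr_ge0// ltW.
  rewrite mulrAC ler_pdivlMr// mul1r -natr1.
  have -> : (1 + dl^-1) * (1 + dl * N%:R) = 1 + dl^-1 + dl * N%:R + N%:R.
    by field; rewrite gt_eqF.
  have : 0 < dl^-1 by rewrite invr_gt0.
  have : 0 <= dl * N%:R by rewrite mulr_ge0// ltW.
  by lra.
- exact: cvg_cst.
rewrite -[X in _ --> X](mulr0 (1 + dl^-1)); apply: cvgM; first exact: cvg_cst.
exact: cvg_harmonic.
Unshelve. all: by end_near. Qed.

Lemma laplace dl c : 0 < dl ->
  \int[mu]_g (expabs dl g * cos (c * g)) = 2 * dl / (dl ^+ 2 + c ^+ 2).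
Proof.
move=> d0; have D0 : 0 < dl ^+ 2 + c ^+ 2 by rewrite ltr_wpDr ?sqr_ge0// exprn_gt0.
have cf : continuous (fun g => expabs dl g * cos (c * g)).
  move=> x; apply: (@continuousM _ _ (expabs dl)); first exact: continuous_expabs.
  exact: continuous_cosM.
have h := cvg_rint cf (Int_expabs_cos c d0).
pose u (N : nat) := 2 * (dl + expR (- (dl * N%:R)) * (c * sin (c * N%:R) - dl * cos (c * N%:R))) / (dl ^+ 2 + c ^+ 2).
have e N : \int[mu]_(x in `[- N%:R, N%:R]) (expabs dl x * cos (c * x)) = u N.
  rewrite rint_split//.
  have -> : \int[mu]_(x in `[- N%:R, 0]) (expabs dl x * cos (c * x)) =
     \int[mu]_(x in `[- N%:R, 0]) (expR (dl * x) * cos (c * x)).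
    congr (fine _); apply: eq_integral => x; rewrite inE /= in_itv /= => /andP[_ x0].
    by rewrite /expabs ler0_norm// mulrN opprK.
  have -> : \int[mu]_(x in `[0, N%:R]) (expabs dl x * cos (c * x)) =
     \int[mu]_(x in `[0, N%:R]) (expR (- dl * x) * cos (c * x)).
    congr (fine _); apply: eq_integral => x; rewrite inE /= in_itv /= => /andP[x0 _].
    by rewrite /expabs ger0_norm// mulNr.
  rewrite !laplace_ftc ?oppr_le0 ?ler0n ?oppr_eq0 ?gt_eqF// sqrrN !mulr0 expR0 cos0 sin0.
  rewrite /u !mulrN !mulNr cosN sinN; field; rewrite gt_eqF//.
rewrite (_ : (fun N : nat => _) = u) in h; last by apply/funext.
have hu : u @ \oo --> 2 * (dl + 0) / (dl ^+ 2 + c ^+ 2).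
  apply: cvgM; last exact: cvg_cst.
  apply: cvgM; first exact: cvg_cst.
  apply: cvgD; first exact: cvg_cst.
  have hb : (fun N : nat => (`|c| + dl) * (1 + dl * N%:R)^-1) @ \oo --> (`|c| + dl) * 0.
    apply: cvgM; first exact: cvg_cst.
    exact: cvg_inv_lin.
  rewrite mulr0 in hb.
  apply: (@squeeze_cvgr _ _ _ _ (fun N : nat => - ((`|c| + dl) * (1 + dl * N%:R)^-1)) (fun N : nat => (`|c| + dl) * (1 + dl * N%:R)^-1)) => //.
    near=> N; rewrite -ler_norml normrM mulrC; apply: ler_pM => //.
      apply: le_trans (ler_normB _ _) _; apply: lerD.
        by rewrite normrM -[leRHS]mulr1; apply: ler_wpM2l => //; exact: sin_max.
      rewrite normrM gtr0_norm// -[leRHS]mulr1; apply: ler_wpM2l; first exact: ltW.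
      exact: cos_max.
    rewrite ger0_norm ?expR_ge0// expRN lef_pV2 ?posrE ?expR_gt0//.
      exact: expR_ge1Dx.
    by rewrite ltr_pwDl// mulr_ge0// ltW.
  by rewrite -oppr0; exact: cvgN.
rewrite addr0 in hu; exact: (cvg_unique _ h hu).
Unshelve. all: by end_near. Qed.

End Laplace.

(** * Simple roots of a quadratic polynomial and integration by parts on a line *)

Section Line.
Context {R : realType}.
Notation mu := (@lebesgue_measure R).

Definition quad (a b c s : R) : R := a * s ^+ 2 + b * s + c.

(** Only the simple roots: at a double root the derivative vanishes, the sign of the polynomial does
    not jump there, and the surface is not a graph over the other coordinates. *)
Definition sroots (a b c : R) : seq R :=
  let D := b ^+ 2 - 4 * a * c in
  if a == 0 then (if b == 0 then [::] else [:: - c / b])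
  else if 0 < D then [:: (- b - Num.sqrt D) / (2 * a); (- b + Num.sqrt D) / (2 * a)] else [::].

Lemma quad_sqr a b c s : 4 * a * quad a b c s = (2 * a * s + b) ^+ 2 - (b ^+ 2 - 4 * a * c).
Proof. by rewrite /quad; ring. Qed.

Lemma sroots_mem a b c s : reflect (quad a b c s = 0 /\ 2 * a * s + b != 0) (s \in sroots a b c).
Proof.
rewrite /sroots; set D := b ^+ 2 - 4 * a * c; apply: (iffP idP).
  have [a0|a0] := eqVneq a 0.
    have [b0|b0] := eqVneq b 0; first by rewrite in_nil.
    rewrite inE => /eqP ->; split; last by rewrite a0 mulr0 mul0r add0r.
    by rewrite /quad a0 mul0r add0r; field.
  case: ifP => // D0; have sD := sqr_sqrtr (ltW D0).
  have sD0 : Num.sqrt D != 0 by rewrite gt_eqF// sqrtr_gt0.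
  have a40 : 4 * a != 0 by rewrite mulf_neq0.
  rewrite !inE => /orP[]/eqP ->; (split; [apply: (mulfI a40); rewrite mulr0 quad_sqr -/D|]).
  - rewrite (_ : 2 * a * _ + b = - Num.sqrt D); last by field.
    by rewrite sqrrN sD subrr.
  - by rewrite (_ : 2 * a * _ + b = - Num.sqrt D) ?oppr_eq0//; field.
  - rewrite (_ : 2 * a * _ + b = Num.sqrt D); last by field.
    by rewrite sD subrr.
  - by rewrite (_ : 2 * a * _ + b = Num.sqrt D)//; field.
move=> [q0 l0]; have := quad_sqr a b c s; rewrite q0 mulr0 -/D => /eqP; rewrite eq_sym subr_eq0 => /eqP sq.
have [a0|a0] := eqVneq a 0.
  move: l0 q0; rewrite /quad a0 mulr0 !mul0r !add0r => b0 e; rewrite (negPf b0) inE.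
  by apply/eqP; apply: (mulfI b0); rewrite mulrCA divff// mulr1; apply/eqP; rewrite -addr_eq0 e.
have D0 : 0 < D by rewrite -sq exprn_even_gt0.
rewrite D0; have : (2 * a * s + b) ^+ 2 == (Num.sqrt D) ^+ 2 by rewrite sqr_sqrtr ?(ltW D0)// sq.
rewrite eqf_sqr => /orP[]/eqP e; rewrite !inE; apply/orP; [right|left]; apply/eqP.
  by rewrite -e; field.
by rewrite -[Num.sqrt D]opprK -e; field.
Qed.

Lemma sroots_uniq a b c : uniq (sroots a b c).
Proof.
rewrite /sroots; case: eqP => [_|/eqP a0]; first by case: eqP.
case: ifP => // D0; rewrite /= andbT inE; apply/negP => /eqP /(congr1 (fun x => x * (2 * a))).
rewrite !divfK ?mulf_neq0// => /addrI /eqP; rewrite eq_sym -subr_eq0 opprK -mulr2n mulrn_eq0 /=.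
by rewrite gt_eqF// sqrtr_gt0.
Qed.

Lemma sroots_slope a b c s : s \in sroots a b c -> `|2 * a * s + b| = Num.sqrt (b ^+ 2 - 4 * a * c).
Proof.
move=> /sroots_mem[q0 _]; have := quad_sqr a b c s; rewrite q0 mulr0 => /eqP.
by rewrite eq_sym subr_eq0 => /eqP <-; rewrite sqrtr_sqr.
Qed.

Variables (V V' : R -> R) (B : R).
Hypothesis B0 : 0 < B.
Hypothesis dV : forall x, is_derive x (1:R) V (V' x).
Hypothesis cV' : continuous V'.
Hypothesis V0 : forall x, B <= `|x| -> V x = 0.
Hypothesis V'0 : forall x, B <= `|x| -> V' x = 0.

Lemma cV : continuous V.
Proof. by move=> x; apply: differentiable_continuous; apply/derivable1_diffP; have [] := dV x. Qed.

Lemma is_derive_quad a b c x : is_derive x (1:R) (quad a b c) (2 * a * x + b).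
Proof. by rewrite /quad; apply: is_derive_eq; rewrite /GRing.scale /= ?expr1; ring. Qed.

Lemma continuous_quad a b c : continuous (quad a b c).
Proof. by move=> x; apply: differentiable_continuous; apply/derivable1_diffP; have [] := is_derive_quad a b c x. Qed.

Lemma rint_line_parts a b c (Phi P : R -> R) : (forall x, is_derive x (1:R) Phi (P x)) -> continuous P ->
  \int[mu]_s (V s * (2 * a * s + b) * P (quad a b c s)) = - \int[mu]_s (V' s * Phi (quad a b c s)).
Proof.
move=> dP cP.
have cPhi : continuous Phi.
  by move=> x; apply: differentiable_continuous; apply/derivable1_diffP; have [] := dP x.
have cl : continuous (fun s : R => 2 * a * s + b) by exact: continuous_affine.
have c1 : continuous (fun s => V s * (2 * a * s + b) * P (quad a b c s)).
  move=> s; apply: (@continuousM _ _ (fun s => V s * (2 * a * s + b)) (fun s => P (quad a b c s))).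
    by apply: (@continuousM _ _ V); [exact: cV|exact: cl].
  by apply: (@continuous_comp _ _ _ (quad a b c) P); [exact: continuous_quad|exact: cP].
have c2 : continuous (fun s => V' s * Phi (quad a b c s)).
  move=> s; apply: (@continuousM _ _ V' (fun s => Phi (quad a b c s))); first exact: cV'.
  by apply: (@continuous_comp _ _ _ (quad a b c) Phi); [exact: continuous_quad|exact: cPhi].
have out x : x < - B \/ B < x -> B <= `|x|.
  by case=> h; [have := ler_norm (- x); rewrite normrN; lra|have := ler_norm x; lra].
rewrite (@rint_restrict_itv _ (- B) B); last by move=> x /out h; rewrite V0// !mul0r.
rewrite (@rint_restrict_itv _ (- B) B); last by move=> x /out h; rewrite V'0// mul0r.
have ci (u : R -> R) : continuous u -> mu.-integrable `[- B, B] (EFin \o u).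
  by move=> cu; apply: continuous_compact_integrable; [exact: segment_compact|exact: continuous_subspaceT].
apply/eqP; rewrite -addr_eq0 -RintegralD//; [|exact: ci|exact: ci].
have dF (s : R) : is_derive s (1:R) (fun s => V s * Phi (quad a b c s))
   (V s * (2 * a * s + b) * P (quad a b c s) + V' s * Phi (quad a b c s)).
  have h1 := @is_derive1_comp _ Phi (quad a b c) s _ _ (dP _) (is_derive_quad a b c s).
  have h2 := dV s.
  have := is_deriveM h2 h1; rewrite /GRing.scale /= => h; apply: is_derive_eq h _.
  by rewrite /=; ring.
have b0 := B0; have BB : - B <= B by lra.
rewrite (rint_ftc BB dF); last first.
  move=> s; apply: (@continuousD _ _ _ (fun s => V s * (2 * a * s + b) * P (quad a b c s)) (fun s => V' s * Phi (quad a b c s))).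
    exact: c1.
  exact: c2.
by rewrite !V0 ?normrN ?ler_norm// !mul0r subrr.
Qed.

Lemma Int_V' : Int mu V'.
Proof.
have h := @Int_on R (- B) B V' cV'; rewrite (_ : V' = (fun x => \1_[set x | - B <= x <= B] x * V' x))//.
apply/funext => x; rewrite indicE; case: (boolP (x \in _)) => [_|]; first by rewrite mul1r.
rewrite notin_setE /= mul0r => /negP; rewrite -ler_norml -ltNge => h'.
by rewrite V'0// ltW.
Qed.

Lemma Int_V'k (k : R -> R) : measurable_fun setT k -> (forall s, `|k s| <= 1) -> Int mu (fun s => V' s * k s).
Proof.
move=> mk k1; have iV := Int_V'; apply: (Int_le _ (Int_norm iV)).
  by apply: measurable_funM => //; exact: continuous_measurable_fun.
by move=> x; rewrite normrM -[leRHS]mulr1; apply: ler_wpM2l.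
Qed.

Lemma measurable_sgr : measurable_fun setT (Num.sg : R -> R).
Proof.
rewrite (_ : Num.sg = (fun x : R => \1_[set x | 0 < x] x - \1_[set x | x < 0] x)); last first.
  apply/funext => x; rewrite !indicE; case: sgrP => [->|x0|x0].
  - by rewrite !memNset /= ?ltxx// subrr.
  - by rewrite mem_set// memNset/= ?subr0//; apply/negP; rewrite -leNgt ltW.
  - by rewrite memNset/= ?mem_set ?sub0r//; apply/negP; rewrite -leNgt ltW.
apply: measurable_funB; apply: measurable_indic.
  rewrite (_ : [set x | 0 < x] = `]0, +oo[%classic); first exact: measurable_itv.
  by apply/seteqP; split => y /=; rewrite in_itv /= andbT.
rewrite (_ : [set x | x < 0] = `]-oo, 0[%classic); first exact: measurable_itv.
by apply/seteqP; split => y /=; rewrite in_itv.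
Qed.

Lemma sgr_norm1 (x : R) : `|Num.sg x| <= 1.
Proof. by rewrite normr_sg; case: (x != 0). Qed.

Lemma rint_jump (k : R -> R) (r k1 k2 : R) : measurable_fun setT k -> (forall s, `|k s| <= 1) ->
  (forall s, s < r -> k s = k1) -> (forall s, r < s -> k s = k2) ->
  \int[mu]_s (V' s * k s) = (k1 - k2) * V r.
Proof.
move=> mk bk hk1 hk2; pose B' := B + `|r| + 1; have b0 := B0.
have r0 := normr_ge0 r.
have [rB1 rB2] : - B' < r /\ r < B'.
  by rewrite /B'; have := ler_norm r; have := ler_norm (- r); rewrite normrN; split; lra.
have out x : x < - B' \/ B' < x -> B <= `|x|.
  by case=> h; [have := ler_norm (- x); rewrite normrN|have := ler_norm x]; rewrite /B' in h; lra.
rewrite (@rint_restrict_itv _ (- B') B'); last by move=> x /out h; rewrite V'0// mul0r.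
have ik (D : set R) : measurable D -> mu.-integrable D (EFin \o (fun s => V' s * k s)).
  by move=> mD; apply: integrableS (Int_V'k mk bk).
have iV (D : set R) c : measurable D -> mu.-integrable D (EFin \o (fun s => c * V' s)).
  by move=> mD; apply: (@integrableS _ _ _ _ setT) => //; apply: IntZ; exact: Int_V'.
have := @Rintegral_itvB _ (fun s => V' s * k s) (BLeft (- B')) (BRight B') r (ik _ (measurable_itv _)).
rewrite !bnd_simp (ltW rB1) (ltW rB2) => /(_ isT isT) /eqP; rewrite subr_eq => /eqP ->.
have Bb : B <= `|B'| by apply: le_trans (ler_norm _); rewrite /B'; lra.
have E1 : \int[mu]_(t in `[- B', r]) (V' t * k t) = k1 * (V r - V (- B')).
  rewrite -Rintegral_itv_bndo_bndc; last exact: ik.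
  have -> : \int[mu]_(t in `[- B', r[) (V' t * k t) = \int[mu]_(t in `[- B', r[) (k1 * V' t).
    congr (fine _); apply: eq_integral => x; rewrite inE /= in_itv /= => /andP[_ xr].
    by rewrite hk1// mulrC.
  rewrite Rintegral_itv_bndo_bndc; last exact: iV.
  rewrite RintegralZl//; last by apply: (@integrableS _ _ _ _ setT) => //; exact: Int_V'.
  by rewrite (rint_ftc (ltW rB1) dV cV').
have E2 : \int[mu]_(t in `]r, B']) (V' t * k t) = k2 * (V B' - V r).
  have -> : \int[mu]_(t in `]r, B']) (V' t * k t) = \int[mu]_(t in `]r, B']) (k2 * V' t).
    congr (fine _); apply: eq_integral => x; rewrite inE /= in_itv /= => /andP[rx _].
    by rewrite hk2// mulrC.
  rewrite Rintegral_itv_obnd_cbnd; last exact: iV.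
  rewrite RintegralZl//; last by apply: (@integrableS _ _ _ _ setT) => //; exact: Int_V'.
  by rewrite (rint_ftc (ltW rB2) dV cV').
by rewrite E1 E2 (V0 Bb) (V0 (x := - B')) ?normrN//; ring.
Qed.

Lemma rint_V' : \int[mu]_s V' s = 0.
Proof.
have := @rint_jump (fun=> 1) 0 1 1 (measurable_cst _) _ (fun _ _ => erefl) (fun _ _ => erefl).
rewrite subrr mul0r => h; rewrite -[RHS]h; last by move=> s; rewrite normr1.
by apply: eq_Rintegral => s _; rewrite mulr1.
Qed.

Lemma measurable_sgr_sub r : measurable_fun setT (fun s : R => Num.sg (s - r)).
Proof.
apply: (measurableT_comp measurable_sgr).
by apply: continuous_measurable_fun => x; apply: continuousB; [exact: cvg_id|exact: cst_continuous].
Qed.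

Lemma rint_sgn_sub r : \int[mu]_s (V' s * Num.sg (s - r)) = - 2 * V r.
Proof.
rewrite (@rint_jump _ r (-1) 1); first by congr (_ * _); lra.
- exact: measurable_sgr_sub.
- by move=> s; exact: sgr_norm1.
- by move=> s sr; rewrite ltr0_sg// subr_lt0.
by move=> s sr; rewrite gtr0_sg// subr_gt0.
Qed.

(** For [r1 < r2] the product of the two signs equals [1 - Num.sg (s - r1) + Num.sg (s - r2)] at
    every point, the roots included. *)
Lemma rint_sgn_prod k r1 r2 : r1 < r2 ->
  \int[mu]_s (V' s * (k * (Num.sg (s - r1) * Num.sg (s - r2)))) = 2 * k * (V r1 - V r2).
Proof.
move=> r12.
have i1 r : Int mu (fun s => V' s * Num.sg (s - r)).
  by apply: Int_V'k; [exact: measurable_sgr_sub|move=> s; exact: sgr_norm1].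
have i0 := Int_V'.
have e s : V' s * (k * (Num.sg (s - r1) * Num.sg (s - r2))) =
   k * (V' s - V' s * Num.sg (s - r1) + V' s * Num.sg (s - r2)).
  rewrite mulrCA; congr (_ * _); rewrite -[X in X - _ + _]mulr1 -mulrBr -mulrDr; congr (_ * _).
  have [h1|h1|->] := ltgtP s r1.
  - by rewrite !ltr0_sg ?subr_lt0 ?(lt_trans h1 r12)//; ring.
  - rewrite (@gtr0_sg _ (s - r1)) ?subr_gt0//; ring.
  - by rewrite subrr sgr0 ltr0_sg ?subr_lt0//; ring.
rewrite (_ : (fun s => V' s * _) = (fun s => k * (V' s - V' s * Num.sg (s - r1) + V' s * Num.sg (s - r2)))); last exact/funext.
rewrite rintZ; last by apply: IntD => //; apply: IntB.
have i2 := IntB i0 (i1 r1).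
rewrite (RintegralD measurableT i2 (i1 r2)) (RintegralB measurableT i0 (i1 r1)).
by rewrite rint_V' !rint_sgn_sub; ring.
Qed.

(** The sign of the polynomial jumps by twice the sign of its slope at each simple root and nowhere
    else; integrating [V'] against a step function collects these jumps. Without simple roots the
    sign is constant except possibly at one point. *)
Lemma rint_line a b c :
  - 2^-1 * \int[mu]_s (V' s * Num.sg (quad a b c s)) =
  \sum_(s <- sroots a b c) V s * Num.sg (2 * a * s + b).
Proof.
have iV' k : \int[mu]_s (V' s * k) = 0.
  rewrite (_ : (fun s => V' s * _) = (fun s => k * V' s)); last by apply/funext => s; rewrite mulrC.
  rewrite rintZ ?rint_V' ?mulr0//.
  exact: Int_V'.
rewrite /sroots; set D := b ^+ 2 - 4 * a * c.
have [a0|a0] := eqVneq a 0.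
  have qE s : quad a b c s = b * s + c by rewrite /quad a0 mul0r add0r.
  have [b0|b0] := eqVneq b 0.
    rewrite big_nil (_ : (fun s => V' s * _) = (fun s => V' s * Num.sg c)) ?iV' ?mulr0//.
    by apply/funext => s; rewrite qE b0 mul0r add0r.
  rewrite big_seq1 a0 mulr0 mul0r add0r.
  have e s : V' s * Num.sg (quad a b c s) = Num.sg b * (V' s * Num.sg (s - (- c / b))).
    rewrite qE (_ : b * s + c = b * (s - - c / b)); last by field.
    by rewrite sgrM; ring.
  rewrite -a0 (_ : (fun s => V' s * _) = (fun s => Num.sg b * (V' s * Num.sg (s - - c / b)))); last exact/funext.
  rewrite rintZ; last by apply: Int_V'k; [exact: measurable_sgr_sub|move=> s; exact: sgr_norm1].
  by rewrite rint_sgn_sub; field.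
have a40 : 4 * a != 0 by rewrite mulf_neq0.
case: ltP => D0.
  have sD := sqr_sqrtr (ltW D0); have sp : 0 < Num.sqrt D by rewrite sqrtr_gt0.
  set r1 := (- b - _) / _; set r2 := (- b + _) / _.
  have qE s : quad a b c s = a * ((s - r1) * (s - r2)).
    apply: (mulfI a40); rewrite quad_sqr -/D -sD /r1 /r2; field; exact: a0.
  have l1 : 2 * a * r1 + b = - Num.sqrt D by rewrite /r1; field.
  have l2 : 2 * a * r2 + b = Num.sqrt D by rewrite /r2; field.
  have r12 : a * (r2 - r1) = Num.sqrt D by rewrite /r1 /r2; field.
  rewrite big_cons big_seq1 l1 l2 sgrN (gtr0_sg sp).
  have e s : V' s * Num.sg (quad a b c s) = V' s * (Num.sg a * (Num.sg (s - r1) * Num.sg (s - r2))).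
    by rewrite qE !sgrM.
  rewrite (_ : (fun s => V' s * _) = (fun s => V' s * (Num.sg a * (Num.sg (s - r1) * Num.sg (s - r2))))); last exact/funext.
  have [ap|an] : 0 < a \/ a < 0 by case: (ltgtP a 0) a0 => // h _; [right|left].
    rewrite rint_sgn_prod ?gtr0_sg//; first by field.
    by rewrite -subr_gt0 -(pmulr_rgt0 _ ap) r12.
  rewrite (_ : (fun s => V' s * _) = (fun s => V' s * (Num.sg a * (Num.sg (s - r2) * Num.sg (s - r1))))); last first.
    by apply/funext => s; rewrite [Num.sg (s - r1) * _]mulrC.
  rewrite rint_sgn_prod ?ltr0_sg//; first by field.
  by rewrite -subr_lt0 -(nmulr_rgt0 _ an) r12.
rewrite big_nil.
have e s : s != - b / (2 * a) -> Num.sg (quad a b c s) = Num.sg a.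
  move=> sr; have h : 0 < 4 * a * quad a b c s.
    rewrite quad_sqr -/D; have : 0 < (2 * a * s + b) ^+ 2; last by lra.
    rewrite exprn_even_gt0//=; apply: contra sr => /eqP h; apply/eqP.
    by have -> : s = (2 * a * s + b - b) / (2 * a); [field|rewrite h sub0r].
  rewrite -mulrA pmulr_rgt0// in h.
  have : Num.sg (a * quad a b c s) = 1 by rewrite gtr0_sg.
  rewrite sgrM => h2; rewrite -[LHS]mul1r -h2.
  have q0 : quad a b c s != 0 by apply: contraTneq h => ->; rewrite mulr0 ltxx.
  by rewrite -mulrA -expr2 sqr_sg q0 mulr1.
rewrite (@rint_jump _ (- b / (2 * a)) (Num.sg a) (Num.sg a)) ?subrr ?mul0r ?mulr0//.
- by apply: (measurableT_comp measurable_sgr); apply: continuous_measurable_fun; exact: continuous_quad.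
- by move=> s; exact: sgr_norm1.
- by move=> s sr; rewrite e// lt_eqF.
by move=> s sr; rewrite e// gt_eqF.
Qed.

End Line.

Section Superpose.
Context {R : realType} {n : nat}.
Notation mu := (@lebesgue_measure R).
Notation V := 'cV[R]_n.
Implicit Types (W cf : V -> R).

Section Kernel.
Variables (W cf : V -> R) (dl : R).
Hypothesis bW : bfun W.
Hypothesis ccf : continuous cf.
Hypothesis dl0 : 0 < dl.

Let F (p : measurableTypeR R * @borel R n) : R := expabs dl p.1 * (W p.2 * cos (cf p.2 * p.1)).

Lemma measurable_wcos g : measurable_fun setT ((fun z => W z * cos (cf z * g)) : @borel R n -> R).
Proof.
case: bW => mW _; apply: measurable_funM => //.
apply: (measurableT_comp (f := cos) (g := fun z : @borel R n => cf z * g)).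
  by apply: continuous_measurable_fun; exact: continuous_cos.
by apply: measurable_funM => //; exact: measurable_continuousR.
Qed.

Lemma bfun_wcos g : bfun (fun z => W z * cos (cf z * g)).
Proof.
split; first exact: measurable_wcos.
case: bW => _ [M [B [hM hB]]]; exists M, B; split.
  move=> z; rewrite normrM -[leRHS]mulr1; apply: ler_pM => //; exact: cos_max.
by move=> z i h; rewrite (hB z i h) mul0r.
Qed.

Lemma IntF : Int ((@lebesgue_measure R) \x (lebm n))%E F.
Proof.
apply: (@Int_prod _ _ _ _ _ (@lebesgue_measure R) (lebm n) F (expabs dl) (fun z : @borel R n => `|W z|)).
- apply: measurable_funM.
    apply: (measurableT_comp (f := expabs dl)); last exact: measurable_fst.
    by apply: continuous_measurable_fun; exact: continuous_expabs.
  apply: measurable_funM; first by case: bW => mW _; apply: (measurableT_comp mW); exact: measurable_snd.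
  apply: (measurableT_comp (f := cos)); first by apply: continuous_measurable_fun; exact: continuous_cos.
  apply: measurable_funM; last exact: measurable_fst.
  by apply: (measurableT_comp (measurable_continuousR ccf)); exact: measurable_snd.
- exact: Int_expabs.
- by apply: Int_norm; exact: bfun_Int.
move=> [g z]; rewrite /F /= normrM ger0_norm ?expR_ge0//; apply: ler_wpM2l; first exact: expR_ge0.
by rewrite normrM -[leRHS]mulr1; apply: ler_wpM2l => //; exact: cos_max.
Qed.

Lemma superpose : \int[lebm n]_z (W z * (2 * dl / (dl ^+ 2 + cf z ^+ 2))) =
  \int[mu]_g (expabs dl g * \int[lebm n]_z (W z * cos (cf z * g))).
Proof.
have i1 g : Int (lebm n) (fun z => F (g, z)) by rewrite /F /=; apply: IntZ; exact: bfun_Int (bfun_wcos g).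
have i2 z : Int mu (fun g => F (g, z)).
  have := IntZ (W z) (Int_expabs_cos (cf z) dl0); congr (Int _ _).
  by apply/funext => g; rewrite /F /=; ring.
have := rfubini1 IntF i1; rewrite (rfubini2 IntF i2) => E.
transitivity (\int[lebm n]_z \int[mu]_g F (g, z)).
  apply: eq_Rintegral => z _; rewrite /F /= -(laplace (cf z) dl0) -rintZ; last exact: Int_expabs_cos.
  by apply: eq_Rintegral => g _; ring.
rewrite E; apply: eq_Rintegral => g _; rewrite /F /= rintZ//.
exact: bfun_Int (bfun_wcos g).
Qed.

Lemma Int_superpose : Int mu (fun g => expabs dl g * \int[lebm n]_z (W z * cos (cf z * g))).
Proof.
have i1 g : Int (lebm n) (fun z => F (g, z)) by rewrite /F /=; apply: IntZ; exact: bfun_Int (bfun_wcos g).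
have := Int_fubini1 IntF i1; congr (Int _ _); apply/funext => g; rewrite /F /= rintZ//.
exact: bfun_Int (bfun_wcos g).
Qed.

End Kernel.

(** [(1 + cf^2)^-1] is the average of [cos (cf g)] with respect to the probability density
    [expabs 1 g / 2], so a bound uniform in g passes to it. *)
Lemma superpose_bound W cf (b : R) : bfun W -> continuous cf ->
  (forall g, `|\int[lebm n]_z (W z * cos (cf z * g))| <= b) ->
  `|\int[lebm n]_z (W z * (1 + cf z ^+ 2)^-1)| <= b.
Proof.
move=> bW ccf hb.
have := superpose bW ccf ltr01; rewrite expr1n mulr1.
have -> : (fun z => W z * (2 / (1 + cf z ^+ 2))) = (fun z => 2 * (W z * (1 + cf z ^+ 2)^-1)).
  by apply/funext => z; ring.
have iW : Int (lebm n) (fun z => W z * (1 + cf z ^+ 2)^-1).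
  apply: (Int_le _ (Int_norm (bfun_Int bW))).
    apply: measurable_funM; first by case: bW.
    apply: (measurableT_comp (f := fun x : R => (1 + x ^+ 2)^-1)); last exact: measurable_continuousR.
    exact: Int_meas Int_inv1sqr.
  move=> z; rewrite normrM -[leRHS]mulr1; apply: ler_wpM2l => //.
  by have /andP[h1 h2] := omega_factor (cf z); rewrite ger0_norm// ltW.
rewrite rintZ// => E.
have b0 : 0 <= b by apply: le_trans (hb 0).
have : `|2 * \int[lebm n]_z (W z * (1 + cf z ^+ 2)^-1)| <= \int[mu]_g (b * expabs 1 g).
  rewrite E; apply: rint_abs; [exact: Int_superpose|apply: IntZ; exact: Int_expabs|].
  move=> g; rewrite normrM ger0_norm ?expR_ge0// mulrC; apply: ler_wpM2r => //; exact: expR_ge0.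
rewrite rintZ; last exact: Int_expabs.
have -> : \int[mu]_g expabs 1 g = 2.
  have := laplace 0 (ltr01 : (0 : R) < 1); rewrite expr1n expr0n addr0 divr1 mulr1 => <-.
  by apply: eq_Rintegral => g _; rewrite mul0r cos0 mulr1.
by rewrite normrM ger0_norm//; lra.
Qed.

End Superpose.

(** * Zero sets of quadratic functions are null sets *)

Section NullSets.
Context {R : realType}.
Notation mu := (@lebesgue_measure R).

Definition affine_fun n (f : 'cV[R]_n -> R) :=
  exists k : 'cV[R]_n -> R, forall z e s, f (z + s *: e) = f z + s * k e.

(** Being quadratic is expressed along lines; this form is stable under affine substitutions, and no
    coefficients need be tracked through slicing. *)
Definition quadratic_fun n (f : 'cV[R]_n -> R) :=
  exists (g : 'cV[R]_n -> 'cV[R]_n -> R) (h : 'cV[R]_n -> R),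
    (forall z e s, f (z + s *: e) = f z + s * g z e + s ^+ 2 * h e) /\
    forall e, affine_fun (g^~ e).

Lemma affine_quadratic n (f : 'cV[R]_n -> R) : affine_fun f -> quadratic_fun f.
Proof.
move=> [k hk]; exists (fun _ e => k e), (fun=> 0); split=> [z e s|e].
  by rewrite hk mulr0 addr0.
by exists (fun=> 0) => z e' s; rewrite mulr0 addr0.
Qed.

Lemma affine_comp n m (T : 'cV[R]_n -> 'cV[R]_m) T' (f : 'cV[R]_m -> R) :
  (forall y e s, T (y + s *: e) = T y + s *: T' e) -> affine_fun f -> affine_fun (f \o T).
Proof. by move=> hT [k hk]; exists (k \o T') => z e s /=; rewrite hT hk. Qed.

Lemma quadratic_comp n m (T : 'cV[R]_n -> 'cV[R]_m) T' (f : 'cV[R]_m -> R) :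
  (forall y e s, T (y + s *: e) = T y + s *: T' e) -> quadratic_fun f -> quadratic_fun (f \o T).
Proof.
move=> hT [g [h [hf hg]]]; exists (fun y e => g (T y) (T' e)), (h \o T'); split=> [z e s|e] /=.
  by rewrite hT hf.
by have [k hk] := hg (T' e); exists (k \o T') => z e' s /=; rewrite hT hk.
Qed.

Lemma consv_lin n (x : R) (y e : 'cV[R]_n) (s : R) : consv (x, y + s *: e) = consv (x, y) + s *: consv (0, e).
Proof.
apply/matrixP => i j; rewrite ord1; case: (unliftP 0 i) => [k|] ->.
  by rewrite [RHS]mxE [X in _ = _ + X]mxE !consvS [LHS]mxE [X in _ + X = _]mxE.
by rewrite [RHS]mxE [X in _ = _ + X]mxE !consv0 mulr0 addr0.
Qed.

Lemma rint_finite_set (v : R -> R) (S : seq R) :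
  \int[mu]_x (v x * (x \in S)%:R) = 0.
Proof.
have mS : measurable_fun setT (fun x => v x * (x \in S)%:R).
  rewrite (_ : (fun x => _) = (fun x => \sum_(r <- undup S) v r * \1_[set r] x)).
    apply: measurable_sum => r.
    have mr : measurable_fun setT (\1_[set r] : measurableTypeR R -> R).
      exact: (measurable_indic (measurable_set1 r)).
    exact: (measurable_funM (measurable_cst (v r)) mr).
  apply/funext => x; case: (boolP (x \in S)) => xS.
    rewrite mulr1 (bigD1_seq x) ?mem_undup ?undup_uniq//= indicE mem_set// mulr1.
    rewrite big1 ?addr0// => r /negPf rx; rewrite indicE memNset ?mulr0//= => e.
    by rewrite e eqxx in rx.
  rewrite mulr0 big_seq big1// => r; rewrite mem_undup => rS; rewrite indicE memNset ?mulr0//= => e.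
  by rewrite e rS in xS.
have : (\int[mu]_x (v x * (x \in S)%:R)%:E = \int[mu]_x (0 : \bar R))%E.
  apply: ae_eq_integral => //; first exact/measurable_EFinP.
  exists [set` S]; split.
  - exact: countable_measurable (finite_set_countable (finite_seq S)).
  - by apply: countable_lebesgue_measure0; apply: finite_set_countable; exact: finite_seq.
  move=> x /= h; apply: contrapT => xS; apply: h => _; congr EFin.
  by move/negP/negPf: xS => ->; rewrite mulr0.
by rewrite integral0 /Rintegral => ->.
Qed.

Lemma rint_quad_zero (v : R -> R) (a b c : R) : [|| a != 0, b != 0 | c != 0] ->
  \int[mu]_x (v x * (quad a b c x == 0)%:R) = 0.
Proof.
move=> abc; pose D := b ^+ 2 - 4 * a * c.
pose S := [:: - c / b; (- b - Num.sqrt D) / (2 * a); (- b + Num.sqrt D) / (2 * a)].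
have hS x : quad a b c x = 0 -> x \in S.
  move=> q0; rewrite /S !inE; have [a0|a0] := eqVneq a 0.
    move: q0 abc; rewrite /quad a0 mul0r add0r eqxx /=.
    have [->|b0] := eqVneq b 0; first by rewrite mul0r add0r => ->; rewrite eqxx.
    move=> e _; apply/orP; left; apply/eqP; apply: (mulfI b0).
    by rewrite mulrCA divff// mulr1; apply/eqP; rewrite -addr_eq0 e.
  have := quad_sqr a b c x; rewrite q0 mulr0 -/D => /eqP; rewrite eq_sym subr_eq0 => /eqP sq.
  have D0 : 0 <= D by rewrite -sq sqr_ge0.
  have : (2 * a * x + b) ^+ 2 == (Num.sqrt D) ^+ 2 by rewrite sqr_sqrtr// sq.
  rewrite eqf_sqr => /orP[]/eqP e; apply/orP; right; apply/orP; [right|left]; apply/eqP.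
    by rewrite -e; field.
  by rewrite -[Num.sqrt D]opprK -e; field.
rewrite -[RHS](rint_finite_set (fun x => v x * (quad a b c x == 0)%:R) S).
apply: eq_Rintegral => x _; rewrite -mulrA; congr (_ * _).
by case: eqP => [/hS ->|_]; rewrite ?mulr1 ?mul0r.
Qed.

Lemma eq0_indic n (f : 'cV[R]_n -> R) z : (f z == 0)%:R = \1_(f @^-1` [set 0]) z :> R.
Proof. by rewrite indicE; case: eqP => h; [rewrite mem_set|rewrite memNset]. Qed.

Lemma bfun_eq0 n (u f : 'cV[R]_n -> R) : bfun u ->
  measurable_fun setT (f : @borel R n -> R) -> bfun (fun z => u z * (f z == 0)%:R).
Proof.
move=> [mu' [M [B [hM hB]]]] mf; split.
  apply: measurable_funM => //.
  rewrite (_ : (fun _ => _) = \1_(f @^-1` [set 0])); last first.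
    by apply/funext => z; exact: eq0_indic.
  by apply: measurable_indic; rewrite -[_ @^-1` _]setTI; apply: mf => //; exact: measurable_set1.
exists M, B; split; last by move=> z i h; rewrite (hB z i h) mul0r.
move=> z; rewrite normrM -[leRHS]mulr1; apply: ler_pM => //.
by case: eqP; rewrite ?normr1 ?normr0.
Qed.

Lemma bfun_slice_int n (u : 'cV[R]_n.+1 -> R) : bfun u ->
  bfun (fun y => \int[mu]_x u (consv (x, y))).
Proof.
move=> bu; split; first exact: Int_meas (Int_consv2 bu).
have [_ [M [B [hM hB]]]] := bu.
have M0 : 0 <= M by apply: le_trans (hM 0).
have hB' x y i : B < `|consv (x, y) i 0| -> u (consv (x, y)) = 0 by exact: hB.
exists (\int[mu]_x (M * \1_[set x : R | - `|B| <= x <= `|B|] x)), B; split.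
  move=> y; apply: rint_abs; first exact: bfun_consv2.
    have := @Int_on R (- `|B|) `|B| (fun=> M) (@cst_continuous _ _ M).
    by congr (Int _ _); apply/funext => x; rewrite mulrC.
  move=> x; rewrite indicE; case: (boolP (x \in _)) => [_|]; first by rewrite mulr1.
  rewrite notin_setE /= mulr0 => /negP; rewrite -ler_norml -ltNge => h.
  rewrite (hB' x y 0) ?normr0//.
  have -> : consv (x, y) 0 0 = x by rewrite consv0.
  by apply: le_lt_trans h; exact: ler_norm.
move=> y i h; rewrite /Rintegral (eq_integral (fun=> 0%E)) ?integral0// => x _.
by rewrite (hB' x y (lift 0 i))// consvS.
Qed.

(** Induction by slicing along the zeroth axis, where the function is [a x^2 + b(y) x + c(y)] with
    constant a. A slice contributes only if a, b(y) and c(y) all vanish; as the function is not zero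
    everywhere, this confines y to the zero set of a nonzero b or c in one dimension less. *)
Lemma rint_zero_set n (f : 'cV[R]_n -> R) (u : 'cV[R]_n -> R) : quadratic_fun f ->
  measurable_fun setT (f : @borel R n -> R) -> (exists z, f z != 0) -> bfun u ->
  \int[lebm n]_z (u z * (f z == 0)%:R) = 0.
Proof.
elim: n f u => [|n IH] f u qf mf [z0 fz0] bu.
  rewrite rint_lebm0 (_ : 0 = z0); last by apply/matrixP => -[].
  by rewrite (negPf fz0) mulr0.
rewrite rint_fubini2; last exact: bfun_eq0.
have [g [h [hf hg]]] := qf.
pose e0 : 'cV[R]_n.+1 := delta_mx 0 0.
pose b y := g (consv (0, y)) e0; pose c y := f (consv (0, y)).
have fE x y : f (consv (x, y)) = quad (h e0) (b y) (c y) x.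
  rewrite -[x]add0r -consv_shift0 hf /quad -/(b y) -/(c y) add0r -/e0; ring.
pose phi y := \int[mu]_x (u (consv (x, y)) * (f (consv (x, y)) == 0)%:R).
have bphi : bfun phi by apply: (bfun_slice_int (u := fun z => u z * (f z == 0)%:R)); exact: bfun_eq0.
have phi0 y : [|| h e0 != 0, b y != 0 | c y != 0] -> phi y = 0.
  move=> abc; rewrite -[RHS](rint_quad_zero (fun x => u (consv (x, y))) abc).
  by apply: eq_Rintegral => x _; rewrite fE.
have red (k : 'cV[R]_n -> R) : quadratic_fun k -> measurable_fun setT (k : @borel R n -> R) -> (exists y, k y != 0) ->
    (forall y, k y != 0 -> phi y = 0) -> \int[lebm n]_y phi y = 0.
  move=> qk mk ek hk; rewrite -[RHS](IH k phi qk mk ek bphi); apply: eq_Rintegral => y _.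
  by case: eqP => [_|/eqP ky]; rewrite ?mulr1// mulr0 hk.
have mc x : measurable_fun setT ((fun y => f (consv (x, y))) : @borel R n -> R).
  by apply: (measurableT_comp mf); exact: measurable_consv1.
have [a0|a0] := eqVneq (h e0) 0; last first.
  transitivity (\int[lebm n]_y (0 : R)); last by rewrite /Rintegral integral0.
  by apply: eq_Rintegral => y _; apply: phi0; rewrite a0.
have [[y1 by1]|nb] := pselect (exists y, b y != 0).
  apply: (red b); last 1 first.
  - by move=> y by0; apply: phi0; rewrite by0 orbT.
  - by apply: affine_quadratic; apply: affine_comp (hg e0) => y e s; exact: consv_lin.
  - rewrite (_ : b = (fun y => 2^-1 * (f (consv (1, y)) - f (consv (-1, y))))).
      by apply: measurable_funM => //; apply: measurable_funB; exact: mc.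
    by apply/funext => y; rewrite !fE /quad a0; field.
  by exists y1.
apply: (red c).
- by apply: quadratic_comp qf => y e s; exact: consv_lin.
- exact: mc.
- apply: contrapT => nc; move/negP: fz0; apply; rewrite -[z0]unconsvK.
  case: (unconsv z0) => x y; rewrite fE a0.
  have -> : b y = 0 by apply/eqP; apply: contrapT => /negP h1; apply: nb; exists y.
  have -> : c y = 0 by apply/eqP; apply: contrapT => /negP h1; apply: nc; exists y.
  by rewrite /quad !mul0r !addr0.
by move=> y cy; apply: phi0; rewrite cy !orbT.
Qed.

(** The vanishing of integrals is known for bounded support only, hence the exhaustion by boxes. *)
Lemma lebm_zero_set n (f : 'cV[R]_n -> R) : quadratic_fun f ->
  measurable_fun setT (f : @borel R n -> R) -> (exists z, f z != 0) -> lebm n (f @^-1` [set 0]) = 0%E.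
Proof.
move=> qf mf ef.
have mZ : measurable (f @^-1` [set 0] : set (@borel R n)).
  by rewrite -[_ @^-1` _]setTI; apply: mf => //; exact: measurable_set1.
have box0 (N : nat) : lebm n (f @^-1` [set 0] `&` box N%:R) = 0%E.
  have mI : measurable (f @^-1` [set 0] `&` box N%:R : set (@borel R n)) by apply: measurableI => //; exact: measurable_box.
  have bu : bfun (\1_(box N%:R) : 'cV[R]_n -> R).
    split; first by apply: measurable_indic; exact: measurable_box.
    exists 1, N%:R; split.
      by move=> z; rewrite indicE; case: (_ \in _); rewrite ?normr1 ?normr0.
    move=> z i h; rewrite indicE memNset//= => /(_ i); by rewrite leNgt h.
  have := rint_zero_set qf mf ef bu.
  rewrite (_ : (fun z => _) = \1_(f @^-1` [set 0] `&` box N%:R)); last first.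
    apply/funext => z; rewrite indicI /= mulrC; congr (_ * _).
    exact: eq0_indic.
  have fI : (lebm n (f @^-1` [set 0%R] `&` box N%:R)%classic < +oo)%E.
    apply: le_lt_trans (lebm_box_fin n N%:R).
    by apply: le_measure; rewrite ?inE//; exact: measurable_box.
  have := EFin_rint (Int_indic mI fI); rewrite integral_indic// setIT => <- ->.
  by [].
have -> : f @^-1` [set 0] = \bigcup_N (f @^-1` [set 0] `&` box N%:R).
  rewrite -setI_bigcupr -[LHS]setIT; congr (_ `&` _); apply/esym; rewrite -subTset => z _.
  pose N := Num.truncn (\sum_i `|z i 0|); exists N.+1 => // i.
  apply: le_trans (ltW (truncnS_gt _)).
  by rewrite (bigD1 i)//= lerDl sumr_ge0.
have mN (N : nat) : measurable (f @^-1` [set 0] `&` box N%:R : set (@borel R n)).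
  by apply: measurableI => //; exact: measurable_box.
apply/(@negligibleP _ _ _ (lebm n)); first exact: bigcup_measurable.
apply: negligible_bigcup => N; apply/(@negligibleP _ _ _ (lebm n)); first exact: mN.
exact: box0.
Qed.

End NullSets.

(** * The integral of the oscillatory integral as an integral over fibres *)

Section SingularIntegral.
Context {R : realType} {n : nat}.
Notation mu := (@lebesgue_measure R).
Notation d := n.+1.
Notation V := 'cV[R]_d.
Variables (A : 'M[int]_d) (l : V) (c : R).
Hypothesis symA : A^T = A.
Hypothesis detA : \det A != 0.
Hypothesis d4 : (4 <= d)%N.

Let f := qf A l c.
Let x (z : V) := qg A l 0 z.
Let a0 : R := qh A 0.
Definition lcoef (y : 'cV[R]_n) : R := qg A l 0 (consv (0, y)).
Definition ccoef (y : 'cV[R]_n) : R := qf A l c (consv (0, y)).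
Definition disc y : R := lcoef y ^+ 2 - 4 * qh A 0 * ccoef y.
Definition yroots y := sroots (qh A 0) (lcoef y) (ccoef y).

Lemma quadf_any : exists C, 1 <= C /\ quadf f (qg A l) (qh A) C.
Proof.
pose r := \sum_j `|l j 0|.
have lr j : `|l j 0| <= r by rewrite /r (bigD1 j)//= lerDl sumr_ge0.
exists (qC A r); split; last exact: quadf_qf.
by apply: qC_ge1; apply: sumr_ge0.
Qed.

Lemma f_line s y : f (consv (s, y)) = quad (qh A 0) (lcoef y) (ccoef y) s.
Proof.
have [C [_ [_ fE _ _ _]]] := quadf_any.
rewrite -[s]add0r -consv_shift0 fE /quad /lcoef /ccoef /f add0r; ring.
Qed.

Lemma x_line s y : x (consv (s, y)) = 2 * qh A 0 * s + lcoef y.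
Proof.
have [C [_ [_ _ gE _ _]]] := quadf_any.
rewrite -[s]add0r -consv_shift0 /x gE add0r /lcoef; ring.
Qed.

Lemma continuous_f : continuous f.
Proof. exact: continuous_qf. Qed.

Lemma continuous_x : continuous x.
Proof.
have -> : x = (fun z => dot (\col_j (A 0 j)%:~R) z + l 0 0).
  by apply/funext => z; rewrite /x /qg mxE; congr (_ + _); apply: eq_bigr => j _; rewrite !mxE.
move=> z; apply: (@continuousD _ _ _ (dot (\col_j (A 0 j)%:~R))); last exact: cst_continuous.
exact: continuous_dot.
Qed.

Lemma affine_x : affine_fun x.
Proof.
exists (fun e => (real_mx A *m e) 0 0) => z e s; rewrite /x /qg mulmxDr -scalemxAr.
by rewrite mxE_add mxE_scale; ring.
Qed.

Lemma x_neq0 : exists z, x z != 0.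
Proof.
apply: contrapT => h.
have x0 z : x z = 0 by apply/eqP; apply: contrapT => /negP hz; apply: h; exists z.
have A0 j : A 0 j = 0.
  have := x0 (delta_mx j 0); have := x0 0; rewrite /x /qg mulmx0 mxE add0r => ->.
  by rewrite addr0 mulmx_delta => /eqP; rewrite intr_eq0 => /eqP.
move/negP: detA; apply; apply/eqP; rewrite (expand_det_row _ 0) big1// => j _.
by rewrite A0 mul0r.
Qed.

Variables (w : V -> R) (D : 'I_d -> nat -> V -> R) (K p : nat) (M B : R).
Hypothesis dp : (d < p)%N.
Hypothesis dK : (d.*2 <= K)%N.
Hypothesis hw : weight K p M B w D.
Hypothesis B0 : 0 < B.

Let K1 : (1 <= K)%N. Proof. by apply: leq_trans dK; rewrite double_gt0. Qed.
Let M0 : 0 <= M. Proof. exact: weight_ge0 hw. Qed.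
Let D0E : D 0 0 = w. Proof. by case: hw => ->. Qed.
Let cw : continuous w. Proof. exact: weight_cont hw. Qed.

Lemma bfun_contB (u : V -> R) (E : R) : continuous u -> (forall z, `|u z| <= E) ->
  (forall (z : V) i, B <= `|z i 0| -> u z = 0) -> bfun u.
Proof.
move=> cu hu h0; split; first exact: measurable_continuousR.
by exists E, B; split=> // z i h; apply: (h0 z i); exact: ltW.
Qed.

Let w0 (z : V) i : B <= `|z i 0| -> w z = 0.
Proof. exact: weight_vanish hw. Qed.

Definition phi (eta : R) z : R := (1 + (x z / eta) ^+ 2)^-1.

Lemma continuous_inv1sqr : continuous (fun t : R => (1 + t ^+ 2)^-1).
Proof. by move=> t; exact: (@dseq_cont R 1 (fun l x => (invseq l x).1) 0 t (@dseq_inv R 1) isT). Qed.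

Lemma continuous_phi eta : continuous (phi eta).
Proof.
move=> z; apply: (@continuous_comp _ _ _ (fun z => x z / eta) (fun t => (1 + t ^+ 2)^-1)); last exact: continuous_inv1sqr.
by apply: (@continuousM _ _ x (fun=> eta^-1)); [exact: continuous_x|exact: cst_continuous].
Qed.

Lemma phi_itv eta z : 0 < phi eta z <= 1.
Proof. exact: omega_factor. Qed.

Lemma bfun_w : bfun w.
Proof. by apply: (bfun_contB (E := M)) => // z; exact: weight_max hw. Qed.

Lemma bfun_wphi eta : bfun (fun z => w z * phi eta z).
Proof.
apply: (bfun_contB (E := M)).
- by move=> z; apply: (@continuousM _ _ w (phi eta)); [exact: cw|exact: continuous_phi].
- move=> z; have /andP[h1 h2] := phi_itv eta z; rewrite normrM -[leRHS]mulr1.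
  by apply: ler_pM => //; [exact: weight_max hw|rewrite gtr0_norm].
by move=> z i h; rewrite (w0 h) mul0r.
Qed.

Definition oscW (W : V -> R) (g : R) : R := \int[lebm d]_z (W z * cos (2 * pi * f z * g)).

Let c2f : continuous (fun z => 2 * pi * f z).
Proof. by move=> z; apply: (@continuousM _ _ (fun=> 2 * pi) f); [exact: cst_continuous|exact: continuous_f]. Qed.

Lemma osc_oscW g : osc w f g 0 = oscW w g.
Proof. by apply: eq_Rintegral => z _; rewrite /wphase; congr (_ * cos _); ring. Qed.

(** Measurability comes for free with Fubini for the damped integrand; multiplying by [expR |g|]
    removes the damping. *)
Lemma measurable_oscW W : bfun W -> measurable_fun setT (oscW W).
Proof.
move=> bW; have h := Int_meas (Int_superpose bW c2f ltr01).
rewrite (_ : oscW W = (fun g => expR `|g| * (expabs 1 g * \int[lebm d]_z (W z * cos (2 * pi * f z * g))))).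
  apply: measurable_funM => //; apply: continuous_measurable_fun => g.
  by apply: (@continuous_comp _ _ _ (fun x : R => `|x|) expR); [exact: norm_continuous|exact: continuous_expR].
by apply/funext => g; rewrite mulrA /expabs mul1r -expRD subrr expR0 mul1r.
Qed.

(** For w this is [osc_bound], with [|g|^(-d/2) <= g^-2] for [|g| >= 1] because d is at least 4. For
    [w phi] the derivatives of phi blow up with [1 / eta], so the bound is not applied to that
    weight. Instead phi is a superposition of cosines of [x / eta], which only change the linear and
    constant part of the phase, where [osc_bound] is uniform. *)
Lemma osc_decay : exists2 C, 0 <= C & forall eta g, 0 < eta ->
  `|oscW w g| <= C * (1 + g ^+ 2)^-1 /\ `|oscW (fun z => w z * phi eta z) g| <= C * (1 + g ^+ 2)^-1.
Proof.
have [C1 C10 hC] := osc_bound (R := R) symA detA dp dK.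
pose I := \int[lebm d]_z `|w z|.
have iw := bfun_Int bfun_w.
have I0 : 0 <= I by apply: Rintegral_ge0.
pose C := 2 * (I + Num.sqrt (C1 * M ^+ 2)).
have S0 : 0 <= Num.sqrt (C1 * M ^+ 2) by exact: sqrtr_ge0.
exists C; first by rewrite /C mulr_ge0// addr_ge0.
move=> eta g eta0.
have triv W : bfun W -> (forall z, `|W z| <= `|w z|) -> `|oscW W g| <= I.
  move=> bW hW; apply: rint_abs; [exact: bfun_Int (bfun_wcos bW c2f g)|exact: Int_norm|].
  move=> z; rewrite normrM -[leRHS]mulr1; apply: ler_pM => //; exact: cos_max.
have wphi z : `|w z * phi eta z| <= `|w z|.
  have /andP[h1 h2] := phi_itv eta z; rewrite normrM -[leRHS]mulr1.
  by apply: ler_pM => //; rewrite gtr0_norm.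
pose s := Num.sqrt (C1 * M ^+ 2 / `|g| ^+ d).
have ob l' c' th : g != 0 -> `|osc w (qf A l' c') g th| <= s.
  by move=> g0; rewrite -sqrtr_sqr; apply: ler_wsqrtr; exact: (hC _ _ _ _ hw).
have fin (v : R) : `|v| <= I -> (g != 0 -> `|v| <= s) -> `|v| <= C * (1 + g ^+ 2)^-1.
  move=> h1 h2; have g20 := sqr_ge0 g.
  rewrite ler_pdivlMr ?ltr_pwDl//.
  have [g1|g1] := leP (g ^+ 2) 1.
    apply: (@le_trans _ _ (I * 2)); last by rewrite /C; lra.
    by apply: ler_pM => //; lra.
  have g0 : g != 0 by apply: contraTneq g1 => ->; rewrite expr0n ltr10.
  have sle : s <= Num.sqrt (C1 * M ^+ 2) / g ^+ 2.
    rewrite /s sqrtrM; last by rewrite mulr_ge0// sqr_ge0.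
    have gd : 0 < `|g| ^+ d by rewrite exprn_gt0// normr_gt0.
    have g2 : 0 < g ^+ 2 by lra.
    apply: ler_wpM2l => //; rewrite sqrtrV ?(ltW gd)// lef_pV2 ?posrE ?sqrtr_gt0//.
    have g4 : g ^+ 2 = Num.sqrt (`|g| ^+ 4) by rewrite (exprM _ 2 2) sqrtr_sqr real_normK ?num_real// ger0_norm.
    rewrite g4 ler_wsqrtr// ler_weXn2l// -(@expr_ge1 _ 2)// real_normK ?num_real//; lra.
  apply: (@le_trans _ _ (Num.sqrt (C1 * M ^+ 2) / g ^+ 2 * (2 * g ^+ 2))).
    by apply: ler_pM; [by []|by lra|exact: le_trans (h2 g0) sle|by lra].
  by rewrite mulrCA divfK ?gt_eqF//; [rewrite /C; lra|lra].
split; apply: fin.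
- by apply: triv; [exact: bfun_w|].
- by move=> g0; rewrite -osc_oscW; exact: ob.
- by apply: triv; [exact: bfun_wphi|].
move=> g0; rewrite /oscW.
have -> : (fun z => w z * phi eta z * cos (2 * pi * f z * g)) =
    (fun z => (w z * cos (2 * pi * f z * g)) * (1 + (x z / eta) ^+ 2)^-1).
  by apply/funext => z; rewrite mulrAC.
apply: superpose_bound.
- exact: bfun_wcos bfun_w c2f g.
- by move=> z; apply: (@continuousM _ _ x (fun=> eta^-1)); [exact: continuous_x|exact: cst_continuous].
move=> h.
(* The multiple of x that must be added to f in order that g times the change produces the phase
   [x h / eta]. *)
pose t : R := h / (2 * pi * g * eta).
have p0 : pi != 0 :> R by rewrite gt_eqF// pi_gt0.
have e0 : eta != 0 by rewrite gt_eqF.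
pose lr : V := \col_j (A 0 j)%:~R.
have xE z : x z = dot lr z + l 0 0.
  by rewrite /x /qg mxE; congr (_ + _); apply: eq_bigr => j _; rewrite !mxE.
pose fp (e : R) := qf A (l + (e * t) *: lr) (c + e * t * l 0 0).
have fpE e z : 2 * pi * (g * fp e z + 0) = 2 * pi * f z * g + e * (x z / eta * h).
  rewrite /fp /f /qf dotDl dotZl xE /t.
  by move: p0; move: (pi : R) => P p0; field; rewrite e0 g0 p0.
have -> : (fun z => w z * cos (2 * pi * f z * g) * cos (x z / eta * h)) =
   (fun z => 2^-1 * wphase w (fp 1) g 0 z + 2^-1 * wphase w (fp (-1)) g 0 z).
  by apply/funext => z; rewrite /wphase !fpE mul1r mulN1r cosB cosD; field.
have iph e : Int (lebm d) (wphase w (fp e) g 0).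
  by apply: bfun_Int; apply: (weight_bfun _ _ hw); exact: continuous_qf.
rewrite RintegralD//; [|by apply: IntZ|by apply: IntZ].
rewrite !rintZ//; have := ob (l + (1 * t) *: lr) (c + 1 * t * l 0 0) 0 g0.
have := ob (l + (-1 * t) *: lr) (c + -1 * t * l 0 0) 0 g0.
rewrite /osc -/(fp 1) -/(fp (-1)) => h1 h2.
apply: le_trans (ler_normD _ _) _; rewrite !normrM (ger0_norm (_ : 0 <= 2^-1)) ?invr_ge0//.
by lra.
Qed.

(* w is the sum of w phi and V x, with phi := eta^2 / (x^2 + eta^2); V1 is the derivative of V
   along the zeroth axis. The factor x in V x is the derivative of f, so only the second part
   survives integration by parts, and the first tends to 0 with eta. *)
Definition psi (eta : R) z : R := (x z ^+ 2 + eta ^+ 2)^-1.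

Lemma psi_den eta z : 0 < eta -> 0 < x z ^+ 2 + eta ^+ 2.
Proof. by move=> e0; rewrite ltr_wpDl ?sqr_ge0// exprn_gt0. Qed.

Lemma continuous_psi eta : 0 < eta -> continuous (psi eta).
Proof.
move=> e0 z; apply: (@continuousV _ _ (fun z => x z ^+ 2 + eta ^+ 2)); first by rewrite gt_eqF// psi_den.
apply: (@continuousD _ _ _ (fun z => x z ^+ 2) (fun=> eta ^+ 2)); last exact: cst_continuous.
apply: (@continuous_comp _ _ _ x (fun t : R => t ^+ 2)); [exact: continuous_x|exact: exprn_continuous].
Qed.

Definition Vfun eta z : R := w z * x z * psi eta z.

Definition V1fun eta z : R := D 0 1%N z * x z * psi eta z + w z * (2 * qh A 0) * psi eta z
  - w z * x z * (2 * x z * (2 * qh A 0)) * psi eta z ^+ 2.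

Lemma continuous_V eta : 0 < eta -> continuous (Vfun eta).
Proof.
move=> e0 z; apply: (@continuousM _ _ (fun z => w z * x z) (psi eta)); last exact: continuous_psi.
by apply: (@continuousM _ _ w x); [exact: cw|exact: continuous_x].
Qed.

Lemma continuous_V1 eta : 0 < eta -> continuous (V1fun eta).
Proof.
move=> e0; have cD : continuous (D 0 1%N) by case: hw => _ _ _ h _; exact: h.
have cc (k : R) : continuous (fun _ : V => k) by exact: cst_continuous.
have cM (u v : V -> R) : continuous u -> continuous v -> continuous (fun z => u z * v z).
  by move=> cu cv z; apply: (@continuousM _ _ u v); [exact: cu|exact: cv].
have cp := continuous_psi e0; have cx := continuous_x.
have c1 : continuous (fun z => D 0 1%N z * x z * psi eta z) by do 2!apply: (cM) => //.
have c2 : continuous (fun z => w z * (2 * qh A 0) * psi eta z) by do 2!apply: (cM) => //.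
have c3 : continuous (fun z => w z * x z * (2 * x z * (2 * qh A 0)) * psi eta z ^+ 2).
  apply: (cM); last by rewrite (_ : (fun z => _) = (fun z => psi eta z * psi eta z)); [exact: cM|].
  by apply: (cM); [exact: cM|apply: (cM) => //; exact: cM].
move=> z; apply: (@continuousB _ _ _ (fun z => D 0 1%N z * x z * psi eta z + w z * (2 * qh A 0) * psi eta z)); last exact: c3.
by apply: (@continuousD _ _ _ (fun z => D 0 1%N z * x z * psi eta z)); [exact: c1|exact: c2].
Qed.

Lemma psi_bounds eta z : 0 < eta ->
  [/\ 0 <= psi eta z, psi eta z <= eta ^- 2, `|x z| * psi eta z <= eta^-1 & x z ^+ 2 * psi eta z <= 1].
Proof.
move=> e0; have d0 := psi_den z e0; have e2 : 0 < eta ^+ 2 by rewrite exprn_gt0.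
have x2 := sqr_ge0 (x z); split.
- by rewrite invr_ge0 ltW.
- by rewrite /psi lef_pV2 ?posrE//; lra.
- rewrite /psi ler_pdivrMr// mulrDr -[eta ^+ 2]/(eta * eta) mulKf ?gt_eqF//.
  have := sqr_ge0 (`|x z| - eta); rewrite sqrrB real_normK ?num_real// => h.
  rewrite -(ler_pM2l e0) mulrDr mulrA divff ?gt_eqF// mul1r -expr2; lra.
by rewrite /psi ler_pdivrMr// mul1r; lra.
Qed.

Lemma D1_bound z : `|D 0 1%N z| <= M.
Proof.
case: hw => _ _ hD _ _; apply: le_trans (hD 0 1%N z K1) _.
rewrite -[leRHS]mulr1; apply: ler_wpM2l => //.
by apply: exprn_ile1; [exact: omega_ge0|exact: omega_le1].
Qed.

Lemma w_bound z : `|w z| <= M. Proof. exact: weight_max hw. Qed.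

Lemma V1_bfun eta : 0 < eta -> bfun (V1fun eta).
Proof.
move=> e0; apply: (bfun_contB (E := M * eta^-1 + M * `|2 * qh A 0| * eta ^- 2 + 2 * M * `|2 * qh A 0| * eta ^- 2)).
- exact: continuous_V1.
- move=> z; have [p0 p1 p2 p3] := psi_bounds z e0; have wM := w_bound z; have dM := D1_bound z.
  have h0 : 0 <= `|2 * qh A 0| := normr_ge0 (2 * qh A 0 : R).
  apply: le_trans (ler_normB _ _) _; apply: lerD.
    apply: le_trans (ler_normD _ _) _; apply: lerD.
      rewrite -mulrA normrM; apply: ler_pM => //; by rewrite normrM (ger0_norm p0).
    rewrite 2!normrM (ger0_norm p0); apply: ler_pM; [exact: mulr_ge0|by []| |by []].
    exact: ler_wpM2r.
  have -> : w z * x z * (2 * x z * (2 * qh A 0)) * psi eta z ^+ 2 =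
     2 * w z * (2 * qh A 0) * ((x z ^+ 2 * psi eta z) * psi eta z) by ring.
  have q0 : 0 <= x z ^+ 2 * psi eta z by apply: mulr_ge0 => //; exact: sqr_ge0.
  have q1 : 0 <= x z ^+ 2 * psi eta z * psi eta z by exact: mulr_ge0.
  have w2 : 0 <= 2 * `|w z| by apply: mulr_ge0.
  rewrite 3!normrM (@ger0_norm _ 2)// (ger0_norm q1).
  apply: ler_pM; [exact: mulr_ge0|exact: q1| |].
    by apply: ler_wpM2r => //; rewrite ler_pM2l.
  by rewrite -[leRHS]mul1r; apply: ler_pM.
move=> z i h; rewrite /V1fun (w0 h); case: hw => _ _ _ _ hv; rewrite (hv 0 1%N z i)//.
by rewrite !mul0r addr0 subr0.
Qed.

Lemma V_bound eta z : 0 < eta -> `|Vfun eta z * x z| <= `|w z|.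
Proof.
move=> e0; have [p0 p1 p2 p3] := psi_bounds z e0.
have -> : Vfun eta z * x z = w z * (x z ^+ 2 * psi eta z) by rewrite /Vfun; ring.
rewrite normrM -[leRHS]mulr1; apply: ler_wpM2l => //.
by rewrite ger0_norm// mulr_ge0// sqr_ge0.
Qed.

Lemma w_split eta z : 0 < eta -> w z = w z * phi eta z + Vfun eta z * x z.
Proof.
move=> e0; have d0 := psi_den z e0; have e1 : eta != 0 by rewrite gt_eqF.
have -> : phi eta z = eta ^+ 2 * psi eta z.
  rewrite /phi /psi -[eta ^+ 2]invrK -invfM; congr (_^-1); field.
  by rewrite e1.
by rewrite /Vfun /psi; field; rewrite gt_eqF.
Qed.

Lemma V_derive eta y s : 0 < eta ->
  is_derive s (1:R) (fun s => Vfun eta (consv (s, y))) (V1fun eta (consv (s, y))).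
Proof.
move=> e0.
have dw : is_derive s (1:R) (fun s => w (consv (s, y))) (D 0 1%N (consv (s, y))).
  have h : dseq K (fun l s => D 0 l (consv (0, y) + s *: delta_mx 0 0)) by case: hw => _ h _ _ _; exact: h.
  have := h 0%N s K1; rewrite consv_shift0 add0r D0E.
  rewrite (_ : (fun s => w (consv (0, y) + s *: delta_mx 0 0)) = (fun s => w (consv (s, y))))//.
  by apply/funext => t; rewrite consv_shift0 add0r.
have dx : is_derive s (1:R) (fun s => x (consv (s, y))) (2 * qh A 0).
  rewrite (_ : (fun s => _) = (fun s => 2 * qh A 0 * s + lcoef y)); last by apply/funext => t; exact: x_line.
  by apply: is_derive_eq; rewrite /GRing.scale /=; ring.
have x2 := psi_den (consv (s, y)) e0.
have dden : is_derive s (1:R) (fun s => x (consv (s, y)) ^+ 2 + eta ^+ 2) (2 * x (consv (s, y)) * (2 * qh A 0)).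
  have h := is_deriveM dx dx.
  have h2 := is_deriveD h (is_derive_cst (eta ^+ 2) s (1:R)).
  by apply: is_derive_eq h2 _; rewrite /GRing.scale /=; ring.
have dpsi : is_derive s (1:R) (fun s => psi eta (consv (s, y)))
    (- (psi eta (consv (s, y)) ^+ 2 * (2 * x (consv (s, y)) * (2 * qh A 0)))).
  have x20 : x (consv (s, y)) ^+ 2 + eta ^+ 2 != 0 by rewrite gt_eqF.
  by rewrite /psi; apply: is_derive_eq; rewrite /GRing.scale /= exprVn mulNr.
have h := is_deriveM (is_deriveM dw dx) dpsi.
by apply: is_derive_eq h _; rewrite /GRing.scale /= fctE /V1fun; ring.
Qed.

(** At a root the zeroth partial derivative has absolute value [sqrt disc]. The density
    [1 / sqrt disc], unbounded near the branch locus, is replaced by a bounded one increasing to it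
    as eta decreases. *)
Definition smoothed_fiber eta : R := \int[lebm n]_y \sum_(s <- yroots y)
  w (consv (s, y)) * (Num.sqrt (disc y) / (disc y + eta ^+ 2)).

Lemma bfun_mulk (u k : V -> R) : bfun u -> measurable_fun setT (k : @borel R d -> R) ->
  (forall z, `|k z| <= 1) -> bfun (fun z => u z * k z).
Proof.
move=> [mu' [E [C [hE hC]]]] mk k1; split; first exact: measurable_funM.
exists E, C; split; last by move=> z i h; rewrite (hC z i h) mul0r.
by move=> z; rewrite normrM -[leRHS]mulr1; apply: ler_pM.
Qed.

Lemma V_vanish eta y s : B <= `|s| -> Vfun eta (consv (s, y)) = 0.
Proof. by move=> h; rewrite /Vfun (@w0 _ 0) ?consv0// !mul0r. Qed.

Lemma V1_vanish eta y s : B <= `|s| -> V1fun eta (consv (s, y)) = 0.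
Proof.
move=> h; rewrite /V1fun (@w0 _ 0) ?consv0//; case: hw => _ _ _ _ hv.
by rewrite (hv 0 1%N _ 0) ?consv0// !mul0r addr0 subr0.
Qed.

Lemma continuous_V1_line eta y : 0 < eta -> continuous (fun s => V1fun eta (consv (s, y))).
Proof.
move=> e0 s; apply: (@continuous_comp _ _ _ (fun s => consv (s, y)) (V1fun eta)).
  exact: continuous_consv2.
exact: continuous_V1.
Qed.

Lemma measurable_sgf : measurable_fun setT ((fun z => Num.sg (f z)) : @borel R d -> R).
Proof.
by apply: (measurableT_comp (@measurable_sgr R)); apply: measurable_continuousR; exact: continuous_f.
Qed.

Lemma smoothed_fiber_sgn eta : 0 < eta ->
  smoothed_fiber eta = - 2^-1 * \int[lebm d]_z (V1fun eta z * Num.sg (f z)).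
Proof.
move=> e0; have bV : bfun (fun z => V1fun eta z * Num.sg (f z)).
  by apply: bfun_mulk; [exact: V1_bfun|exact: measurable_sgf|move=> z; exact: sgr_norm1].
have /= iV := Int_consv2 bV; rewrite rint_fubini2// -(rintZ _ iV).
apply: eq_Rintegral => y _.
have -> : \int[mu]_s (V1fun eta (consv (s, y)) * Num.sg (f (consv (s, y)))) =
   \int[mu]_s (V1fun eta (consv (s, y)) * Num.sg (quad (qh A 0) (lcoef y) (ccoef y) s)).
  by apply: eq_Rintegral => s _; rewrite f_line.
rewrite (rint_line B0 (fun s => V_derive y s e0) (continuous_V1_line (y := y) e0)
  (fun s h => V_vanish eta y h) (fun s h => V1_vanish eta y h)).
rewrite big_seq [RHS]big_seq; apply: eq_bigr => s hs.
have /sroots_mem[q0 l0] := hs.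
have := quad_sqr (qh A 0) (lcoef y) (ccoef y) s; rewrite q0 mulr0 -/(disc y) => /eqP.
rewrite eq_sym subr_eq0 => /eqP sq.
rewrite /Vfun /psi x_line -[X in Num.sqrt X]sq sqrtr_sqr -sq normrEsg.
by ring.
Qed.

(** The Poisson kernel in the variable [2 pi t], as produced by [laplace]. Its primitive [Phi] is
    bounded by 1 and tends to half the sign of t. *)
Definition Pker (dl t : R) : R := 2 * dl / (dl ^+ 2 + (2 * pi * t) ^+ 2).

Definition Phi (dl t : R) : R := atan (2 * pi * t / dl) / pi.

Lemma Pker_den (dl t : R) : 0 < dl -> 0 < dl ^+ 2 + (2 * pi * t) ^+ 2.
Proof. by move=> d0; rewrite ltr_wpDr ?sqr_ge0// exprn_gt0. Qed.

Lemma Phi_derive (dl t : R) : 0 < dl -> is_derive t (1:R) (Phi dl) (Pker dl t).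
Proof.
move=> d0; have p0 : pi != 0 :> R by rewrite gt_eqF// pi_gt0.
have d1 : is_derive t (1:R) (fun t => 2 * pi * t / dl) (2 * pi / dl).
  by apply: is_derive_eq; rewrite /GRing.scale /=; ring.
have h := @is_derive1_comp _ atan (fun t => 2 * pi * t / dl) t _ _ (is_derive1_atan _) d1.
rewrite (_ : Phi dl = (fun t => pi^-1 * (atan \o (fun t => 2 * pi * t / dl)) t)); last first.
  by apply/funext => s; rewrite /Phi mulrC.
apply: is_derive_eq; rewrite /GRing.scale /= /Pker.
have := Pker_den t d0; have : 0 < 1 + (2 * pi * t / dl) ^+ 2 by rewrite ltr_wpDr ?sqr_ge0.
move: p0; move: (pi : R) => P p0 h1 h2; field.
rewrite p0 (gt_eqF d0) /=.
by rewrite andbT gt_eqF.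
Qed.

Lemma continuous_Pker (dl : R) : 0 < dl -> continuous (Pker dl).
Proof.
move=> d0 t; apply: (@continuousM _ _ (fun=> 2 * dl) (fun t => (dl ^+ 2 + (2 * pi * t) ^+ 2)^-1)); first exact: cst_continuous.
apply: (@continuousV _ _ (fun t => dl ^+ 2 + (2 * pi * t) ^+ 2)); first by rewrite gt_eqF// Pker_den.
apply: (@continuousD _ _ _ (fun=> dl ^+ 2) (fun t => (2 * pi * t) ^+ 2)); first exact: cst_continuous.
apply: (@continuous_comp _ _ _ (fun t => 2 * pi * t) (fun t : R => t ^+ 2)); last exact: exprn_continuous.
by apply: (@continuousM _ _ (fun=> 2 * pi) id); [exact: cst_continuous|exact: cvg_id].
Qed.

Lemma continuous_Phi (dl : R) : 0 < dl -> continuous (Phi dl).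
Proof.
by move=> d0 t; apply: differentiable_continuous; apply/derivable1_diffP; have [] := Phi_derive t d0.
Qed.

Lemma Phi_bound (dl t : R) : `|Phi dl t| <= 1.
Proof.
have p0 := pi_gt0 R; rewrite /Phi normrM (gtr0_norm (_ : 0 < pi^-1)) ?invr_gt0//.
rewrite ler_pdivrMr// mul1r ler_norml.
by have := atan_ltpi2 (2 * pi * t / dl); have := atan_gtNpi2 (2 * pi * t / dl); lra.
Qed.

Lemma Phi_cvg t : (fun k => Phi (k.+1%:R)^-1 t) @ \oo --> 2^-1 * Num.sg t.
Proof.
have p0 := pi_gt0 R; have p1 : pi != 0 :> R by rewrite gt_eqF.
have pos (s : R) : 0 < s -> (fun k => Phi (k.+1%:R)^-1 s) @ \oo --> (2^-1 : R).
  move=> s0; have h : (fun k : nat => 2 * pi * s / (k.+1%:R)^-1) @ \oo --> +oo.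
    apply/cvgryPge => a; near=> k; rewrite invrK.
    have ps : 0 < 2 * pi * s by rewrite !mulr_gt0.
    rewrite mulrC -ler_pdivrMr//; apply: (@le_trans _ _ k%:R); last by rewrite ler_nat.
    by near: k; exact: nbhs_infty_ger.
  have := cvg_comp _ _ h (@cvgy_atan R) => h2.
  rewrite (_ : (2^-1 : R) = pi / 2 / pi); last by rewrite mulrAC divff// mul1r.
  by apply: cvgM; [exact: h2|exact: cvg_cst].
case: (sgrP t) => [->|t0|t0].
- rewrite mulr0 (_ : (fun k => _) = fun=> 0); first exact: cvg_cst.
  by apply/funext => k; rewrite /Phi mulr0 mul0r atan0 mul0r.
- by rewrite mulr1; exact: pos.
rewrite (_ : (fun k => _) = (fun k => - Phi (k.+1%:R)^-1 (- t))); last first.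
  by apply/funext => k; rewrite /Phi mulrN mulNr atanN mulNr opprK.
by rewrite mulrN1; apply: cvgN; apply: pos; rewrite oppr_gt0.
Unshelve. all: by end_near. Qed.

Lemma Pker_bound dl t : 0 < dl -> `|Pker dl t| <= 2 / dl.
Proof.
move=> d0; have h := Pker_den t d0.
rewrite /Pker ger0_norm ?divr_ge0 ?mulr_ge0 ?(ltW h) ?(ltW d0)//.
by rewrite ler_pdivrMr// mulrAC ler_pdivlMr// -(mulrA 2 dl dl) -expr2 ler_pM2l// lerDl sqr_ge0.
Qed.

Lemma bfun_wphiP dl eta : 0 < dl -> bfun (fun z => w z * phi eta z * Pker dl (f z)).
Proof.
move=> d0; apply: (bfun_contB (E := M * (2 / dl))).
- move=> z; apply: (@continuousM _ _ (fun z => w z * phi eta z) (fun z => Pker dl (f z))).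
    by apply: (@continuousM _ _ w (phi eta)); [exact: cw|exact: continuous_phi].
  apply: (@continuous_comp _ _ _ f (Pker dl)); [exact: continuous_f|exact: continuous_Pker].
- move=> z; rewrite normrM; apply: ler_pM => //; last exact: Pker_bound.
  have /andP[h1 h2] := phi_itv eta z; rewrite normrM -[leRHS]mulr1.
  by apply: ler_pM => //; [exact: w_bound|rewrite gtr0_norm].
by move=> z i h; rewrite (w0 h) !mul0r.
Qed.

Lemma bfun_VP dl eta : 0 < dl -> 0 < eta -> bfun (fun z => Vfun eta z * x z * Pker dl (f z)).
Proof.
move=> d0 e0; apply: (bfun_contB (E := M * (2 / dl))).
- move=> z; apply: (@continuousM _ _ (fun z => Vfun eta z * x z) (fun z => Pker dl (f z))).
    by apply: (@continuousM _ _ (Vfun eta) x); [exact: continuous_V|exact: continuous_x].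
  apply: (@continuous_comp _ _ _ f (Pker dl)); [exact: continuous_f|exact: continuous_Pker].
- move=> z; rewrite normrM; apply: ler_pM => //.
    by apply: le_trans (V_bound z e0) _; exact: w_bound.
  exact: Pker_bound.
by move=> z i h; rewrite /Vfun (w0 h) !mul0r.
Qed.

Lemma V_parts dl eta : 0 < dl -> 0 < eta ->
  \int[lebm d]_z (Vfun eta z * x z * Pker dl (f z)) = - \int[lebm d]_z (V1fun eta z * Phi dl (f z)).
Proof.
move=> d0 e0; rewrite rint_fubini2; last exact: bfun_VP.
have bV : bfun (fun z => V1fun eta z * Phi dl (f z)).
  apply: bfun_mulk; [exact: V1_bfun| |by move=> z; exact: Phi_bound].
  apply: measurable_continuousR => z; apply: (@continuous_comp _ _ _ f (Phi dl)); first exact: continuous_f.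
  exact: continuous_Phi.
have /= iV := Int_consv2 bV; rewrite [in RHS]rint_fubini2// -mulN1r -(rintZ _ iV).
apply: eq_Rintegral => y _; rewrite mulN1r.
have := rint_line_parts B0 (fun s => V_derive y s e0) (continuous_V1_line (y := y) e0)
  (fun s h => V_vanish eta y h) (fun s h => V1_vanish eta y h) (qh A 0) (lcoef y) (ccoef y)
  (fun t => Phi_derive t d0) (continuous_Pker d0).
have -> : (fun s => Vfun eta (consv (s, y)) * (2 * qh A 0 * s + lcoef y) * Pker dl (quad (qh A 0) (lcoef y) (ccoef y) s))
  = (fun s => Vfun eta (consv (s, y)) * x (consv (s, y)) * Pker dl (f (consv (s, y)))).
  by apply/funext => s; rewrite x_line f_line.
have -> : (fun s => V1fun eta (consv (s, y)) * Phi dl (quad (qh A 0) (lcoef y) (ccoef y) s))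
  = (fun s => V1fun eta (consv (s, y)) * Phi dl (f (consv (s, y)))).
  by apply/funext => s; rewrite f_line.
by [].
Qed.

Lemma V_limit eta : 0 < eta ->
  (fun k => \int[lebm d]_z (Vfun eta z * x z * Pker (k.+1%:R)^-1 (f z))) @ \oo --> smoothed_fiber eta.
Proof.
move=> e0; have dk k : 0 < (k.+1%:R : R)^-1 by rewrite invr_gt0.
have bV := V1_bfun e0.
have mPhi k : measurable_fun setT ((fun z => V1fun eta z * Phi (k.+1%:R)^-1 (f z)) : @borel R d -> R).
  apply: measurable_funM; first by case: bV.
  apply: measurable_continuousR => z; apply: (@continuous_comp _ _ _ f (Phi (k.+1%:R)^-1)); first exact: continuous_f.
  exact: continuous_Phi.
have cv z : (fun k => V1fun eta z * Phi (k.+1%:R)^-1 (f z)) @ \oo --> V1fun eta z * (2^-1 * Num.sg (f z)).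
  by apply: cvgM; [exact: cvg_cst|exact: Phi_cvg].
have dom k z : `|V1fun eta z * Phi (k.+1%:R)^-1 (f z)| <= `|V1fun eta z|.
  by rewrite normrM -[leRHS]mulr1; apply: ler_wpM2l => //; exact: Phi_bound.
have [_ h] := rint_dct mPhi cv (Int_norm (bfun_Int bV)) dom.
have -> : smoothed_fiber eta = - \int[lebm d]_z (V1fun eta z * (2^-1 * Num.sg (f z))).
  rewrite smoothed_fiber_sgn// mulNr -rintZ; last first.
    by apply: bfun_Int; apply: bfun_mulk; [|exact: measurable_sgf|move=> z; exact: sgr_norm1].
  by congr (- _); apply: eq_Rintegral => z _; rewrite mulrCA.
rewrite (_ : (fun k => _) = (fun k => - \int[lebm d]_z (V1fun eta z * Phi (k.+1%:R)^-1 (f z)))); last first.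
  by apply/funext => k; exact: V_parts.
exact: cvgN.
Qed.

Lemma expabs_cvg (g : R) : (fun k => expabs (k.+1%:R)^-1 g) @ \oo --> (1 : R).
Proof.
have h : (fun k => - ((k.+1%:R)^-1 * `|g|)) @ \oo --> (- (0 * `|g|) : R).
  by apply: cvgN; apply: cvgM; [exact: cvg_harmonic|exact: cvg_cst].
have := cvg_comp _ _ h (@continuous_expR R _).
by rewrite mul0r oppr0 expR0.
Qed.

(** The decay of order [g^-2] is an integrable majorant, so the damping may be removed under the
    integral. *)
Lemma abel_limit W C : bfun W -> (forall g, `|oscW W g| <= C * (1 + g ^+ 2)^-1) ->
  Int mu (oscW W) /\
  (fun k => \int[mu]_g (expabs (k.+1%:R)^-1 g * oscW W g)) @ \oo --> \int[mu]_g oscW W g.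
Proof.
move=> bW hC; have mo := measurable_oscW bW.
have iC : Int mu (fun g => C * (1 + g ^+ 2)^-1) by apply: IntZ; exact: Int_inv1sqr.
have mf k : measurable_fun setT (fun g => expabs (k.+1%:R)^-1 g * oscW W g).
  by apply: measurable_funM => //; apply: continuous_measurable_fun; exact: continuous_expabs.
have cv g : (fun k => expabs (k.+1%:R)^-1 g * oscW W g) @ \oo --> oscW W g.
  by rewrite -[X in _ --> X]mul1r; apply: cvgM; [exact: expabs_cvg|exact: cvg_cst].
have dom k g : `|expabs (k.+1%:R)^-1 g * oscW W g| <= C * (1 + g ^+ 2)^-1.
  rewrite normrM; apply: le_trans (hC g); rewrite -[leRHS]mul1r; apply: ler_wpM2r => //.
  by rewrite ger0_norm ?expR_ge0// /expabs expR_le1 oppr_le0 mulr_ge0// invr_ge0.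
have [h1 h2] := @rint_dct _ _ _ mu (fun k g => expabs (k.+1%:R)^-1 g * oscW W g) (oscW W) (fun g => C * (1 + g ^+ 2)^-1) mf cv iC dom.
by split; [exact: h1|exact: h2].
Qed.

(** For positive damping both sides are integrals against the Poisson kernel of f and [w_split] is
    an identity of integrands. Only the part containing [V x] is integrated by parts; the part with
    phi keeps its oscillatory form. *)
Lemma oscW_split eta : 0 < eta ->
  \int[mu]_g oscW w g = \int[mu]_g oscW (fun z => w z * phi eta z) g + smoothed_fiber eta.
Proof.
move=> e0; have [C C0 hC] := osc_decay.
have [_ h1] := abel_limit bfun_w (fun g => (hC eta g e0).1).
have [_ h2] := abel_limit (bfun_wphi eta) (fun g => (hC eta g e0).2).
have h3 := cvgD h2 (V_limit e0).
apply: (cvg_unique _ h1) => //.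
rewrite (_ : (fun k => \int[mu]_g (expabs k.+1%:R^-1 g * oscW w g)) =
  (fun k => \int[mu]_g (expabs k.+1%:R^-1 g * oscW (fun z => w z * phi eta z) g)) +
  (fun k => \int[lebm d]_z (Vfun eta z * x z * Pker (k.+1%:R)^-1 (f z)))); first exact: h3.
apply/funext => k; rewrite fctE.
have dk : 0 < (k.+1%:R : R)^-1 by rewrite invr_gt0.
rewrite -(superpose bfun_w c2f dk) -(superpose (bfun_wphi eta) c2f dk) -/(Pker _ _).
rewrite -RintegralD//; last 2 first.
- exact: bfun_Int (bfun_wphiP eta dk).
- exact: bfun_Int (bfun_VP dk e0).
apply: eq_Rintegral => z _; by rewrite {1}(w_split z e0) /Pker; ring.
Qed.

Lemma phi_le k z : 0 <= phi (k.+1%:R)^-1 z <= (1 + x z ^+ 2 * k%:R)^-1.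
Proof.
have /andP[p0 _] := phi_itv (k.+1%:R)^-1 z; rewrite (ltW p0) /=.
have x2 : 0 <= x z ^+ 2 by exact: sqr_ge0.
have h1 : 0 < 1 + x z ^+ 2 * k%:R by rewrite ltr_pwDl//; exact: mulr_ge0.
have h2 : 0 < 1 + (x z / (k.+1%:R)^-1) ^+ 2 by rewrite ltr_pwDl// sqr_ge0.
rewrite /phi lef_pV2 ?posrE// lerD2l invrK exprMn; apply: ler_wpM2l => //.
by rewrite -natrX ler_nat -mulnn mulSn; lia.
Qed.

(** As eta tends to 0, phi tends to the indicator of the hyperplane [x = 0], a null set, so [oscW]
    of [w phi] tends to 0 for each g. The decay in [osc_decay] does not depend on eta and dominates
    this in g. *)
Lemma smoothed_fiber_limit : (fun k => smoothed_fiber (k.+1%:R)^-1) @ \oo --> \int[mu]_g osc w f g 0.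
Proof.
have ek k : 0 < (k.+1%:R : R)^-1 by rewrite invr_gt0.
have [C C0 hC] := osc_decay.
have -> : \int[mu]_g osc w f g 0 = \int[mu]_g oscW w g.
  by apply: eq_Rintegral => g _; exact: osc_oscW.
pose o k g := oscW (fun z => w z * phi (k.+1%:R)^-1 z) g.
have oc g : o ^~ g @ \oo --> (0 : R).
  have bc := bfun_wcos bfun_w c2f g.
  have mf k : measurable_fun setT ((fun z => w z * phi (k.+1%:R)^-1 z * cos (2 * pi * f z * g)) : @borel R d -> R).
    by have [] := bfun_wcos (bfun_wphi (k.+1%:R)^-1) c2f g.
  have cv z : (fun k => w z * phi (k.+1%:R)^-1 z * cos (2 * pi * f z * g)) @ \oo -->
      w z * cos (2 * pi * f z * g) * (x z == 0)%:R.
    rewrite [X in _ --> X]mulrAC; apply: cvgM; last exact: cvg_cst.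
    apply: cvgM; first exact: cvg_cst.
    case: eqP => [x0|/eqP x0].
      rewrite (_ : (fun k => _) = fun=> 1); first exact: cvg_cst.
      by apply/funext => k; rewrite /phi x0 mul0r expr0n addr0 invr1.
    apply: (@squeeze_cvgr _ _ _ _ (fun=> 0) (fun k => (1 + x z ^+ 2 * k%:R)^-1)).
    - by apply: nearW => k; exact: phi_le.
    - exact: cvg_cst.
    by apply: cvg_inv_lin; rewrite exprn_even_gt0//=.
  have dom k z : `|w z * phi (k.+1%:R)^-1 z * cos (2 * pi * f z * g)| <= `|w z|.
    have /andP[p0 p1] := phi_itv (k.+1%:R)^-1 z.
    rewrite !normrM -mulrA -[leRHS]mulr1; apply: ler_wpM2l => //.
    by rewrite -[leRHS]mulr1; apply: ler_pM => //; [rewrite gtr0_norm|exact: cos_max].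
  have [_] := rint_dct mf cv (Int_norm (bfun_Int bfun_w)) dom.
  rewrite (rint_zero_set (affine_quadratic affine_x) (measurable_continuousR continuous_x) x_neq0 bc).
  by [].
have mo k : measurable_fun setT (o k) by exact: measurable_oscW (bfun_wphi _).
have [_] := @rint_dct _ _ _ mu o (fun=> 0) (fun g => C * (1 + g ^+ 2)^-1) mo oc (IntZ C Int_inv1sqr) (fun k g => (hC _ g (ek k)).2).
have z0 : \int[mu]_x 0 = 0 :> R by rewrite (@Rintegral_cst _ _ _ mu _ measurableT) mul0r.
rewrite z0 => h.
rewrite -[X in _ --> X]subr0.
rewrite (_ : (fun k => _) = (fun k => \int[mu]_g oscW w g - \int[mu]_g o k g)); last first.
  by apply/funext => k; rewrite (oscW_split (ek k)) /o addrAC subrr add0r.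
by apply: cvgB; [exact: cvg_cst|exact: h].
Qed.

End SingularIntegral.

(** * Gauss sums and the singular series *)

Section GaussBound.
Context {R : realType} {n : nat}.
Notation d := n.+1.
Notation V := 'cV[R]_d.
Notation Zn := 'cV[int]_d.

Lemma res_period q (r : 'cV['I_q.+1]_d) (s : Zn) : res q (ordb r + q.+1%:Z *: s) = r.
Proof.
have [c hc] := res_ordb q (ordb r + q.+1%:Z *: s).
apply/(@ordb_inj _ _ _ _ (s + c)).
by rewrite hc scalerDr addrA.
Qed.

Lemma zsum_residues q N N' (h : Zn -> R) : (0 < q)%N -> zsupp N h -> (N < N')%N ->
  \sum_(b <- zbox N d) h b = \sum_(r : 'cV['I_q]_d) \sum_(s <- zbox N' d) h (ordb r + q%:Z *: s).
Proof.
case: q => // q _ sN NN.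
rewrite (partition_big (res q) predT)//=; apply: eq_bigr => r _.
rewrite -big_filter -(big_map (fun s => ordb r + q.+1%:Z *: s) predT h).
apply: sum_supp.
- by apply: filter_uniq; exact: zbox_uniq.
- rewrite map_inj_uniq; first exact: zbox_uniq.
  move=> s s' /addrI /matrixP hs; apply/matrixP => i j; have := hs i j.
  by rewrite !mxE; apply: mulfI.
move=> b hb; rewrite mem_filter (sN b hb) andbT; apply/eqP/mapP => [br|[s _ ->]]; last exact: res_period.
have [c hc] := res_ordb q b.
exists (- c); last by rewrite -br hc scalerN addrK.
rewrite mem_zbox; apply/forallP => i.
have := sN b hb; rewrite mem_zbox => /forallP/(_ i).
have := congr1 (fun M : Zn => M i 0) hc; rewrite !mxE /=.
move: (inord _) => k; have := ltn_ord k; move: (b i 0) (c i 0) => x y h1 h2 h3.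
by have h4 := h3; move: NN; nia.
Qed.

Lemma open_box m : open [set z : 'cV[R]_m | forall i, 0 < z i 0 < 1].
Proof.
have -> : [set z : 'cV[R]_m | forall i, 0 < z i 0 < 1] = ball (const_mx 2^-1 : 'cV[R]_m) 2^-1; last exact: ball_open.
apply/seteqP; split=> [z h|z [_ h] i].
  split=> // i j; rewrite ord1 mxE /ball /= distrC ltr_distl; have := h i; lra.
by have := h i 0; rewrite mxE /ball /= distrC ltr_distl; lra.
Qed.

Lemma lebm_unit_box m : lebm m [set z : 'cV[R]_m | forall i, 0 < z i 0 < 1] = 1%E.
Proof.
elim: m => [|m IH].
  rewrite /= diracE; rewrite mem_set// => i; by case: i.
rewrite /= /lebS (_ : _ @^-1` _ = `]0, 1[%classic `*` [set z : 'cV[R]_m | forall i, 0 < z i 0 < 1]).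
  rewrite product_measure1E; last 2 first.
  - exact: measurable_itv.
  - apply: measurable_open; exact: open_box.
  have := @lebesgue_measure_itv R `]0, 1[; rewrite /= lte_fin ltr01 oppr0 adde0 => ->.
  by rewrite mul1e IH.
apply/seteqP; split=> [[x y] /= h|[x y] /= [h1 h2]].
  split; first by have := h 0; rewrite consv0 in_itv.
  by move=> i; have := h (lift 0 i); rewrite consvS.
apply: forall_ordS => [|i]; first by rewrite consv0 /=; move: h1; rewrite in_itv.
by rewrite consvS.
Qed.

Lemma rint_gt0 (w : V -> R) : bfun w -> (forall z, 0 <= w z) ->
  (forall z : V, (forall i, 0 < z i 0 < 1) -> 0 < w z) -> 0 < \int[lebm d]_z w z.
Proof.
move=> bw w0 wp; rewrite lt_neqAle Rintegral_ge0// andbT; apply/negP => /eqP I0.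
have iw := bfun_Int bw.
have := EFin_rint iw; rewrite -I0 => /esym hI.
have /(ae_eq_integral_abs (lebm d) measurableT (measurable_int _ iw)) hae : (\int[lebm d]_z `|(EFin \o w) z| = 0)%E.
  by rewrite -[RHS]hI; apply: eq_integral => z _ /=; rewrite ger0_norm.
have [N [mN N0 hN]] := hae.
have : (lebm d [set z : V | forall i, (0 < z i 0 < 1)%R] <= lebm d N)%E.
  apply: le_measure; rewrite ?inE//; first by apply: measurable_open; exact: open_box.
  move=> z hz; apply: hN => /=; move=> /(_ I) [] h; have := wp z hz; by rewrite h ltxx.
by rewrite lebm_unit_box N0 lee_fin ler10.
Qed.

(** A fixed weight with positive integral, through which bounds for lattice sums are turned into
    bounds for the Gauss sum by division. *)
Lemma gauss_weight K p : exists w D, exists2 M, 0 <= M & weight K p M 1 w D /\ 0 < \int[lebm d]_z (w z : R).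
Proof.
have [M M1 [D sD]] := @majorant R d K p.
have [M' M0 /(_ 1 (lexx _))[E wE]] := @cutoff_weight R d K.
have M00 : 0 <= M by apply: le_trans M1.
pose w (z : V) := omega z ^+ p * cutoff K.+2 1 z.
have hw := weight_mul M00 M0 sD wE.
do 2 eexists; exists (2 ^+ K * (M * M')); first by nng.
split; first exact: hw.
have cw : continuous w by exact: weight_cont hw.
apply: rint_gt0.
- split; first exact: measurable_continuousR.
  exists (2 ^+ K * (M * M')), 1; split; first by move=> z; exact: weight_max hw.
  by move=> z i h; apply: (weight_vanish hw (i := i)); exact: ltW.
- move=> z; have /andP[h _] := @cutoff_itv R d K.+2 1 z ltr01.
  by rewrite mulr_ge0// exprn_ge0// omega_ge0.
move=> z hz; rewrite mulr_gt0// ?exprn_gt0 ?omega_gt0//.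
apply: prodr_gt0 => i _; rewrite /cut1 exprn_gt0// mulr_gt0// /posp lt_max invr1; have := hz i; lra.
Qed.

Lemma coprime_far (a q g : nat) (k : int) : (0 < g < q)%N -> coprime a q ->
  q%:R^-1 <= `|a%:R / q%:R * g%:R - k%:~R : R|.
Proof.
move=> /andP[g0 gq] co; have q0 : (0 < q)%N by exact: leq_trans gq.
have q0' : 0 < q%:R :> R by rewrite ltr0n.
have -> : a%:R / q%:R * g%:R - k%:~R = ((a * g)%N%:Z - k * q%:Z)%:~R / q%:R :> R.
  rewrite intrB intrM -!pmulrn natrM; field; by rewrite gt_eqF.
rewrite normrM (@gtr0_norm _ (q%:R^-1)) ?invr_gt0// ler_peMl ?invr_ge0 ?(ltW q0')//.
rewrite -intr_norm ler1z -gtz0_ge1 normr_gt0 subr_eq0; apply/eqP => h.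
have : (q %| a * g)%N.
  by have : (q%:Z %| (a * g)%N%:Z)%Z by rewrite h dvdz_mull.
rewrite Gauss_dvdr 1?coprime_sym// => /dvdn_leq; rewrite g0 => /(_ isT).
by rewrite leqNgt gq.
Qed.

Lemma qform_shift (A : 'M[int]_d) (al th : R) h : A^T = A -> exists e, forall b : Zn,
  al * qform A (zR (b + h)) + th = al * qform A (zR b) + th
    + zdot (fun i => al * ((A *m h) i 0)%:~R) b + e.
Proof.
move=> sA; have [e he] := qf_phase 0 0 1 al th h sA; exists e => b.
have := he b; rewrite /qf !scale1r expr1n mulr1.
by rewrite /dot !big1; [rewrite !addr0|move=> i _; rewrite mxE mul0r|move=> i _; rewrite mxE mul0r].
Qed.

(** Integral points with integral value are closed under addition, the mixed term of the form being
    integral, and contain the multiples of the basis vectors, whose values are integral because the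
    diagonal is even. *)
Lemma qform_int (A : 'M[int]_d) : even_symmetric A ->
  exists F : Zn -> int, (forall b, qform A (zR b) = (F b)%:~R :> R) /\
    forall (q : nat) b c, (q%:Z %| F (b + q%:Z *: c) - F b)%Z.
Proof.
move=> [sA dA].
have h (b : Zn) : exists k : int, qform A (zR b) = k%:~R :> R.
  pose Q (z : V) := exists b : Zn, z = zR b /\ exists k : int, qform A z = k%:~R.
  suff [_ [_ //]] : Q (zR b).
  rewrite (_ : zR b = \sum_j (b j 0)%:~R *: delta_mx j 0); last first.
    apply/matrixP => i k; rewrite ord1 !mxE summxE (bigD1 i)//= !mxE !eqxx mulr1 big1 ?addr0// => j ji.
    by rewrite !mxE eq_sym (negPf ji) mulr0.
  apply: (big_ind Q).
  - exists 0; split; first by apply/matrixP => i j; rewrite !mxE.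
    by exists 0; rewrite /qform mulmx0 /dot big1 ?mulr0// => i _; rewrite mxE mul0r.
  - move=> z y [b1 [-> [k1 e1]]] [b2 [-> [k2 e2]]]; exists (b1 + b2); split; first by rewrite zRD.
    exists (k1 + k2 + \sum_i (A *m b2) i 0 * b1 i 0).
    rewrite qformD// e1 e2 zR_mul !intrD rmorph_sum; congr (_ + _ + _); apply: eq_bigr => i _.
    by rewrite /= intrM !mxE.
  move=> j _; exists (b j 0 *: ez j); split; first by rewrite zRZ zR_ez.
  have /dvdzP[k hk] := dA j.
  exists ((b j 0) ^+ 2 * k); rewrite qformZ /qform dot_delta mulmx_delta hk expr2 !intrM.
  by field.
have [F hF] := choice h.
exists F; split=> // q b c; apply/dvdzP.
exists (q%:Z * F c + \sum_i (A *m c) i 0 * b i 0).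
apply: (@intr_inj R); rewrite !(intrB, intrM, intrD) -!hF zRD zRZ qformD// qformZ -scalemxAr dotZl zR_mul rmorph_sum hF.
have -> : dot (zR (A *m c)) (zR b) = \sum_i ((A *m c) i 0 * b i 0)%:~R :> R.
  by apply: eq_bigr => i _; rewrite !mxE intrM.
by ring.
Qed.

(* Weyl's inequality at al = a / q for a positive weight: as L -> oo, L^-d times the lattice
   sum tends to q^-d times the Gauss sum times the integral of the weight. *)
Lemma gauss_bound (A : 'M[int]_d) : even_symmetric A -> \det A != 0 -> exists2 C, 0 <= C &
  forall a q th, (0 < q)%N -> coprime a q ->
  (\sum_(r : 'cV['I_q]_d) cos (2 * pi * (a%:R / q%:R * qform A (zR (ordb r)) + th))) ^+ 2
    <= C * q%:R ^+ d :> R.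
Proof.
move=> eA detA; have [sA _] := eA; have [F [FE Fper]] := qform_int eA.
have [w [D [M M0 [hw I0]]]] := gauss_weight d.*2 d.+1.
have [C0 C00 hC] := weyl (R := R) detA (ltnSn d) (leqnn _).
set I := \int[lebm d]_z w z in I0.
exists (C0 * M ^+ 2 * 64 ^+ d / I ^+ 2); first by nng.
move=> a q th q0 co; set S := \sum_r _.
pose ph b := a%:R / q%:R * qform A (zR b) + th.
have per : zper q (fun b => cos (2 * pi * ph b) : R).
  move=> b c; have /dvdzP[k /eqP] := Fper q b c; rewrite subr_eq => /eqP hk.
  rewrite /ph !FE hk -(cos_2piz _ (- (a%:Z * k))); congr cos.
  by rewrite !(rmorphN, intrD, intrM) -!pmulrn /=; field; rewrite pnatr_eq0 -lt0n.
(* [(q / L)^d T] tends to [I S]. With blocks of length q and separation [1 / q] the one-dimensional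
   sums are at most [64 L / q], which explains [64 ^+ d]. *)
suff : (I * S) ^+ 2 <= C0 * M ^+ 2 * 64 ^+ d * q%:R ^+ d.
  rewrite exprMn mulrC -ler_pdivlMr ?exprn_gt0//; by rewrite mulrAC.
apply: sqr_le_approx => e e0.
have q1 : 1 <= q%:R :> R by rewrite ler1n.
pose E := @CRie R n 1 (qC A 0) * M * q%:R * q%:R ^+ d.
pose m := (Num.truncn (q%:R + `|E| / e)).+1.
have mb : q%:R + `|E| / e < m%:R by exact: truncnS_gt.
have Ee : 0 <= `|E| / e by rewrite divr_ge0// ltW.
set L : R := m%:R in mb.
have L0 : 0 < L^-1 by rewrite invr_gt0; lra.
have Lq : 0 < q%:R / L <= 1 by rewrite ltr_pdivlMr ?ler_pdivrMr; lra.
have [N1 hN1] := zsupp_exists L0 (fun z i => weight_vanish hw (z := z) (i := i)).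
pose N := (N1 + (Num.truncn (L + q%:R)).+1)%N.
have sN : zsupp N (fun b => w (L^-1 *: zR b)) by apply: hN1; rewrite leq_addr.
pose T := \sum_(b <- zbox N d) w (L^-1 *: zR b) * cos (2 * pi * ph b).
have hX N' : \sum_(k <- irange N') xfac L (a%:R / q%:R) k <= 64 * L / q%:R.
  have q0' : 0 < q%:R^-1 :> R by rewrite invr_gt0; lra.
  have L0' : 0 < L by lra.
  apply: le_trans (xfac_sum N' L0' q0' q0 (fun g hg k => coprime_far k hg co)) _.
  have u1 : 1 <= L / q%:R by rewrite ler_pdivlMr; lra.
  have -> : (2 * L / q%:R)^-1 = (L / q%:R)^-1 / 2 by field; rewrite !gt_eqF//; lra.
  have : (L / q%:R)^-1 <= 1 by rewrite invf_le1//; lra.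
  have : 0 < (L / q%:R)^-1 by rewrite invr_gt0; lra.
  rewrite -(mulrA 64) -(mulrA 16); move: (L / q%:R) ((L / q%:R)^-1) u1 => u v u1 v0 v1.
  have : (1 + u) * (1 + v / 2) <= (2 * u) * 2 by apply: ler_pM; lra.
  by lra.
have L1 : 1 <= L by lra.
have hT := hC M 1 w D hw L _ _ L1 hX ph (fun h => qform_shift _ th h sA) N sN.
rewrite -/T in hT.
exists ((q%:R / L) ^+ d * T).
  rewrite exprMn; apply: le_trans (ler_wpM2l _ hT) _; first exact: sqr_ge0.
  rewrite le_eqVlt; apply/orP; left; apply/eqP.
  rewrite -exprM mulnC exprM !exprMn !exprVn expr2.
  have Ld : L ^+ d != 0 by rewrite expf_neq0// gt_eqF//; lra.
  have qd : q%:R ^+ d != 0 :> R by rewrite expf_neq0// gt_eqF//; lra.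
  by move: (L ^+ d) (q%:R ^+ d) (64 ^+ d : R) Ld qd => x y k x0 y0; field; rewrite x0 y0.
have TE : T = \sum_(r : 'cV['I_q]_d) cos (2 * pi * ph (ordb r)) * \sum_(s <- zbox N.+1 d) w ((q%:R / L) *: zR s + L^-1 *: zR (ordb r)).
  rewrite /T (zsum_residues q0 _ (ltnSn N)); last first.
    by move=> b; rewrite mulf_eq0 negb_or => /andP[h _]; exact: sN.
  apply: eq_bigr => r _; rewrite mulr_sumr; apply: eq_bigr => s _.
  rewrite per mulrC; congr (_ * w _).
  by rewrite zRD zRZ scalerDr scalerA addrC mulrC.
rewrite TE mulr_sumr /S mulr_sumr -sumrB.
have hr (r : 'cV['I_q]_d) : `|(q%:R / L) ^+ d * \sum_(s <- zbox N.+1 d) w ((q%:R / L) *: zR s + L^-1 *: zR (ordb r)) - I| <= e / q%:R ^+ d.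
  have := @riemann_sum R n 0 d.+1 M 1 w D (qf A 0 0) (qg A 0) (qh A) (qC A 0) 0 0 (q%:R / L)
    (L^-1 *: zR (ordb r)) N.+1 (weight_le _ hw) (quadf_qf _ sA _) (qC_ge1 _ (lexx _)) _ Lq _ _.
  rewrite expr1 normr0 addr0 mulr1 => hR.
  have -> : \sum_(b <- zbox N.+1 d) w ((q%:R / L) *: zR b + L^-1 *: zR (ordb r)) =
      \sum_(b <- zbox N.+1 d) wphase w (qf A 0 0) 0 0 ((q%:R / L) *: zR b + L^-1 *: zR (ordb r)).
    by apply: eq_bigr => b _; rewrite /wphase mul0r addr0 mulr0 cos0 mulr1.
  have -> : I = osc w (qf A 0 0) 0 0.
    by apply: eq_Rintegral => z _; rewrite /wphase mul0r addr0 mulr0 cos0 mulr1.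
  apply: le_trans (hR _ _ _ _ _) _ => //.
  - by move=> j; rewrite mxE normr0.
  - move=> i; rewrite !mxE /= normrM (gtr0_norm L0) -pmulrn normr_nat.
    have hr' : L^-1 * (nat_of_ord (r i 0))%:R <= 1.
      rewrite mulrC ler_pdivrMr; last lra.
      have : (nat_of_ord (r i 0))%:R <= q%:R :> R by rewrite ler_nat ltnW.
      by lra.
    have hN : L + q%:R <= N.+1%:R.
      apply: le_trans (ltW (truncnS_gt _)) _; by rewrite ler_nat; exact: leqW (leq_addl _ _).
    apply: (@le_trans _ _ (q%:R / L * (L + q%:R))); last by rewrite ler_wpM2l//; lra.
    rewrite mulrDr divfK; last by rewrite gt_eqF//; lra.
    apply: lerD; first by lra.
    apply: (@le_trans _ _ (q%:R / L * 1)); last by apply: ler_wpM2l => //; lra.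
    by rewrite mulr1 (mulrC L^-1) ler_wpM2r ?(ltW L0)// ler_nat ltnW.
  have -> : @CRie R n 1 (qC A 0) * M * (q%:R / L) = E / q%:R ^+ d / L.
    by rewrite /E mulfK ?expf_neq0 ?gt_eqF//; [ring|lra].
  rewrite mulrAC; apply: ler_wpM2r; first by nng.
  apply: le_trans (ler_wpM2r (ltW L0) (ler_norm E)) _.
  have : `|E| / e <= L by lra.
  by rewrite !ler_pdivrMr//; lra.
apply: le_trans (ler_norm_sum _ _ _) _.
apply: (@le_trans _ _ (\sum_(r : 'cV['I_q]_d) e / q%:R ^+ d)).
  apply: ler_sum => r _.
  rewrite -/(ph _) (mulrCA _ (cos _)) (mulrC I) -mulrBr normrM -[leRHS]mul1r.
  by apply: ler_pM => //; [exact: cos_max|rewrite distrC].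
rewrite sumr_const card_res -[_ *+ (q ^ d)]mulr_natr natrX divfK//.
by rewrite gt_eqF// exprn_gt0//; lra.
Qed.

End GaussBound.

(** * The singular series *)

Section SingularSeries.
Context {R : realType} {n : nat}.
Notation d := n.+1.
Notation V := 'cV[R]_d.
Notation Zn := 'cV[int]_d.
Variable A : 'M[int]_d.
Hypothesis eA : even_symmetric A.
Hypothesis detA : \det A != 0.
Hypothesis d5 : (5 <= d)%N.

(** The floor rounds nothing: the value of the form is an integer, and the floor only moves it to
    the type [int]. *)
Definition qpoly (t : int) (b : Zn) : int := Num.floor (qform A (zR b) : R) - t.

Lemma qpolyE t b : (qpoly t b)%:~R = qform A (zR b) - t%:~R :> R.
Proof.
have [F [FE _]] := @qform_int R n A eA.
by rewrite /qpoly intrB FE intrKfloor.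
Qed.

Lemma qpoly_period t (q : nat) b c : (q%:Z %| qpoly t (b + q%:Z *: c) - qpoly t b)%Z.
Proof.
have [F [FE Fper]] := @qform_int R n A eA.
by rewrite /qpoly !FE !intrKfloor opprB addrA subrK.
Qed.

(** Half-integral powers such as [q^(d/2)] are written as natural powers of this square root. *)
Definition sqrtn (q : nat) : R := Num.sqrt q%:R.

Lemma sqrtn_gt0 q : (0 < q)%N -> 0 < sqrtn q.
Proof. by move=> q0; rewrite sqrtr_gt0 ltr0n. Qed.

Lemma sqrtn_sqr q : sqrtn q ^+ 2 = q%:R.
Proof. by rewrite sqr_sqrtr. Qed.

Lemma gauss_qpoly : exists2 C, 0 <= C & forall t (a q : nat) th, (0 < q)%N -> coprime a q ->
  `|\sum_(r : 'cV['I_q]_d) cos (2 * pi * (a%:R * (qpoly t (ordb r))%:~R / q%:R + th))| <= C * sqrtn q ^+ d.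
Proof.
have [C C0 hC] := gauss_bound (R := R) eA detA.
exists (Num.sqrt C) => [|t a q th q0 co]; first exact: sqrtr_ge0.
have := hC a q (th - a%:R * t%:~R / q%:R) q0 co.
set S := \sum_r _; set S' := \sum_r _.
have -> : S = S'.
  by apply: eq_bigr => r _; rewrite qpolyE; congr (cos (_ * _)); ring.
move=> h; rewrite -sqrtr_sqr; apply: le_trans (ler_wsqrtr h) _.
rewrite sqrtrM// ler_wpM2l ?sqrtr_ge0// -(sqr_sqrtr (_ : 0 <= q%:R))// -exprM mulnC exprM sqrtr_sqr.
by rewrite ger0_norm// exprn_ge0// sqrtr_ge0.
Qed.

Definition Gconst : R := sval (cid2 gauss_qpoly).

Lemma Gconst_ge0 : 0 <= Gconst.
Proof. by rewrite /Gconst; case: cid2. Qed.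

Lemma gauss_qpolyP t (a q : nat) th : (0 < q)%N -> coprime a q ->
  `|\sum_(r : 'cV['I_q]_d) cos (2 * pi * (a%:R * (qpoly t (ordb r))%:~R / q%:R + th))| <= Gconst * sqrtn q ^+ d.
Proof. by rewrite /Gconst; case: cid2 => /= C C0 h; exact: h. Qed.

Lemma Gsum_bound t q : (0 < q)%N -> `|Gsum (qpoly t) q / q%:R ^+ d : R| <= Gconst * (q%:R / sqrtn q ^+ d).
Proof.
move=> q0; have s0 := sqrtn_gt0 q0; have sd : 0 < sqrtn q ^+ d by rewrite exprn_gt0.
rewrite normrM normfV -sqrtn_sqr -exprM mulnC exprM (@ger0_norm _ ((_ ^+ d) ^+ 2)) ?sqr_ge0//.
rewrite ler_pdivrMr ?exprn_gt0//.
have -> : Gconst * (sqrtn q ^+ 2 / sqrtn q ^+ d) * (sqrtn q ^+ d) ^+ 2 = q%:R * (Gconst * sqrtn q ^+ d).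
  rewrite sqrtn_sqr; move: (sqrtn q ^+ d) sd => x x0; by field; rewrite gt_eqF.
apply: le_trans (ler_norm_sum _ _ _) _.
rewrite big_mkcond /=.
apply: (@le_trans _ _ (\sum_(a < q) (Gconst * sqrtn q ^+ d))).
  apply: ler_sum => a _; case: ifP => co; last by rewrite mulr_ge0 ?Gconst_ge0// ltW.
  apply: le_trans (gauss_qpolyP t 0 q0 co).
  by rewrite le_eqVlt; apply/orP; left; apply/eqP; congr (`|_|); apply: eq_bigr => r _; rewrite addr0.
by rewrite sumr_const card_ord -[leLHS]mulr_natl.
Qed.

(** Summability of [q^(-3/2)], the borderline case d = 5; the constant 4 has room for
    [sqrt (q + 1) <= 3/2 sqrt q]. *)
Lemma inv_sqrt_telescope q : (0 < q)%N -> (q%:R * sqrtn q)^-1 <= 4 * ((sqrtn q)^-1 - (sqrtn q.+1)^-1).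
Proof.
move=> q0; have a0 := sqrtn_gt0 q0; have b0 := sqrtn_gt0 (ltn0Sn q).
have ab : sqrtn q.+1 ^+ 2 = sqrtn q ^+ 2 + 1 by rewrite !sqrtn_sqr natr1.
have a1 : 1 <= sqrtn q ^+ 2 by rewrite sqrtn_sqr ler1n.
rewrite -sqrtn_sqr; move: (sqrtn q) (sqrtn q.+1) a0 b0 ab a1 => a b a0 b0 ab a1.
have b2 : b <= 3 / 2 * a.
  by rewrite -(@ler_pXn2r _ 2) ?nnegrE ?(ltW b0) ?mulr_ge0 ?(ltW a0)// exprMn ab; lra.
have -> : a^-1 - b^-1 = (a * b * (a + b))^-1.
  have -> : a^-1 - b^-1 = (b - a) / (a * b) by field; rewrite !gt_eqF.
  have -> : b - a = (a + b)^-1.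
    by apply: (@mulIf _ (a + b)); [rewrite gt_eqF//; lra|rewrite mulVf ?gt_eqF//; [nra|lra]].
  by rewrite mulrC -invfM.
rewrite -ler_pdivrMl// mulrC; rewrite -invfM lef_pV2 ?posrE; last 2 first.
- by rewrite !mulr_gt0// ?exprn_gt0.
- by rewrite !mulr_gt0//; lra.
apply: (@le_trans _ _ (a * (3 / 2 * a) * (a + 3 / 2 * a))).
  by apply: ler_pM; [exact: mulr_ge0 (ltW a0) (ltW b0)|lra|exact: ler_wpM2l (ltW a0) _ _ b2|lra].
have : 0 <= a ^+ 2 * a by rewrite mulr_ge0 ?sqr_ge0 ?ltW.
have -> : a * (3 / 2 * a) * (a + 3 / 2 * a) = 15 / 4 * (a ^+ 2 * a) by field.
by lra.
Qed.

(** The quotient is [Q^(2 - d/2)], the tail of the series of [q^(1 - d/2)]. *)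
Definition Gtail (Q : nat) : R := 4 * Gconst * (Q%:R ^+ 2 / sqrtn Q ^+ d).

Lemma Gconst_tail Q Q' : (0 < Q)%N ->
  \sum_(Q <= q < Q') Gconst * (q%:R / sqrtn q ^+ d) <= Gtail Q.
Proof.
move=> Q0; rewrite -mulr_sumr /Gtail -mulrA mulrCA ler_wpM2l ?Gconst_ge0//.
have sQ := sqrtn_gt0 Q0.
(* The [d - 5] surplus half-powers of q are estimated by those of Q; what remains is [q^(-3/2)],
   which telescopes. *)
have eE : d = ((d - 5) + 5)%N by rewrite subnK.
set e := (d - 5)%N in eE.
have te q : (Q <= q)%N -> q%:R / sqrtn q ^+ d <= (sqrtn Q ^+ e)^-1 * (4 * ((sqrtn q)^-1 - (sqrtn q.+1)^-1)).
  move=> Qq; have q0 : (0 < q)%N by exact: leq_trans Qq.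
  have sq := sqrtn_gt0 q0.
  have -> : q%:R / sqrtn q ^+ d = (sqrtn q ^+ e)^-1 * (q%:R * sqrtn q)^-1.
    rewrite eE exprD -sqrtn_sqr; have : sqrtn q ^+ e != 0 by rewrite expf_neq0// gt_eqF.
    by move: (sqrtn q) (sqrtn q ^+ e) sq => s x s0 x0; field; rewrite x0 gt_eqF.
  apply: ler_pM.
  - by rewrite invr_ge0 exprn_ge0// ltW.
  - by rewrite invr_ge0 mulr_ge0// ltW.
  - rewrite lef_pV2 ?posrE ?exprn_gt0//; apply: lerXn2r; rewrite ?nnegrE ?(ltW sq) ?(ltW sQ)//.
    by rewrite ler_wsqrtr// ler_nat.
  exact: inv_sqrt_telescope.
apply: (@le_trans _ _ (\sum_(Q <= q < Q') (sqrtn Q ^+ e)^-1 * (4 * ((sqrtn q)^-1 - (sqrtn q.+1)^-1)))).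
  by rewrite big_nat_cond [leRHS]big_nat_cond; apply: ler_sum => q /andP[/andP[h _] _]; exact: te.
have -> : Q%:R ^+ 2 / sqrtn Q ^+ d = (sqrtn Q ^+ e)^-1 * (sqrtn Q)^-1.
  rewrite eE exprD -sqrtn_sqr; have : sqrtn Q ^+ e != 0 by rewrite expf_neq0// gt_eqF.
  by move: (sqrtn Q) (sqrtn Q ^+ e) sQ => s x s0 x0; field; rewrite x0 gt_eqF.
rewrite -mulr_sumr mulrCA; apply: ler_wpM2l; first by rewrite invr_ge0 exprn_ge0// ltW.
rewrite -mulr_sumr; apply: ler_wpM2l => //.
have [QQ|QQ] := leqP Q' Q; first by rewrite big_geq// invr_ge0 ltW.
have := @telescope_sumr R Q Q' (fun q => - (sqrtn q)^-1) (ltnW QQ).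
rewrite (eq_bigr (fun q => (sqrtn q)^-1 - (sqrtn q.+1)^-1)) => [->|q _]; last by rewrite opprK addrC.
by rewrite opprK addrC gerBl invr_ge0 sqrtr_ge0.
Qed.

Lemma Gtail_cvg : Gtail @ \oo --> (0 : R).
Proof.
rewrite -cvg_shiftS /=.
apply: (@squeeze_cvgr _ _ _ _ (fun=> 0) (fun Q => 4 * Gconst * Num.sqrt (Q.+1%:R)^-1)).
- apply: nearW => Q; have sQ := sqrtn_gt0 (ltn0Sn Q).
  have s1 : 1 <= sqrtn Q.+1 by rewrite -[leLHS]sqrtr1 ler_wsqrtr// ler1n.
  have sd : 0 <= sqrtn Q.+1 ^+ d by rewrite exprn_ge0// ltW.
  have G0 : 0 <= 4 * Gconst by rewrite mulr_ge0 ?Gconst_ge0.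
  rewrite /Gtail mulr_ge0 ?divr_ge0//=.
  rewrite sqrtrV// -/(sqrtn _); apply: ler_wpM2l => //.
  rewrite -sqrtn_sqr -exprM ler_pdivrMr ?exprn_gt0// ler_pdivlMl// -exprS.
  by rewrite ler_weXn2l.
- exact: cvg_cst.
rewrite -(mulr0 (4 * Gconst)); apply: cvgM; first exact: cvg_cst.
have := cvg_comp _ _ (@cvg_harmonic R) (@sqrt_continuous R 0).
by rewrite sqrtr0.
Qed.

Definition singular_sum (t : int) : R := Ssum (qpoly t).

Lemma singular_sum_tail t Q : (0 < Q)%N -> `|singular_sum t - \sum_(1 <= q < Q) Gsum (qpoly t) q / q%:R ^+ d| <= Gtail Q.
Proof.
move=> Q0; apply: (@Ssum_tail R d (qpoly t) (fun q => Gconst * (q%:R / sqrtn q ^+ d)) Gtail _ _ _ Q Q0).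
- by move=> q; rewrite mulr_ge0 ?Gconst_ge0// divr_ge0// exprn_ge0// sqrtr_ge0.
- by move=> q; exact: Gsum_bound.
by move=> Q1 Q2; exact: Gconst_tail.
Qed.

Import complex.

Lemma Re_sum (I : finType) (P : pred I) (F : I -> complex.complex R) :
  complex.Re (\sum_(i | P i) F i) = \sum_(i | P i) complex.Re (F i).
Proof.
by apply: (big_morph (@complex.Re R)) => // [[a b] [a' b']].
Qed.

Lemma Re_Sq t (q : nat) : complex.Re (Sq q A t) = Gsum (qpoly t) q :> R.
Proof.
rewrite /Sq Re_sum; apply: eq_bigr => a _; rewrite Re_sum; apply: eq_bigr => r _.
rewrite /expq qpolyE /=; have -> : map_mx (fun k : 'I_q => k%:R) r = zR (ordb r) :> V.
  by apply/matrixP => i j; rewrite !mxE.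
by rewrite -!mulrA.
Qed.

Lemma singular_seriesE t : singular_series A t = singular_sum t.
Proof.
rewrite /singular_sum -(euler_product (qpoly_period t) (c := fun q => Gconst * (q%:R / sqrtn q ^+ d)) (T := Gtail)).
- rewrite /singular_series /singular_factor; congr (limn _); apply/funext => m; apply: eq_bigr => p _.
  by congr (limn (series _)); apply/funext => l; rewrite Re_Sq.
- by move=> q; rewrite mulr_ge0 ?Gconst_ge0// divr_ge0// exprn_ge0// sqrtr_ge0.
- by move=> q; exact: Gsum_bound.
- by move=> Q1 Q2; exact: Gconst_tail.
exact: Gtail_cvg.
Qed.

End SingularSeries.

(** * Major and minor arcs *)

Section FareyArcs.
Context {R : realType}.
Notation mu := (@lebesgue_measure R).

Definition fracs (G : nat) : seq (nat * nat) :=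
  [seq (q, a) | q <- index_iota 1 G, a <- [seq a <- index_iota 0 q | coprime a q]].

Lemma mem_fracs G x : x \in fracs G -> [/\ (0 < x.1 < G)%N, (x.2 < x.1)%N & coprime x.2 x.1].
Proof.
move=> /allpairsPdep[q [a [hq ha ->]]] /=.
by move: hq ha; rewrite mem_filter !mem_index_iota /= => h /andP[].
Qed.

Lemma fracs_mem G q a : (0 < q < G)%N -> (a < q)%N -> coprime a q -> (q, a) \in fracs G.
Proof.
move=> h1 h2 h3; apply/allpairsPdep; exists q, a; split=> //; first by rewrite mem_index_iota.
by rewrite mem_filter h3 mem_index_iota.
Qed.

Lemma fracs_uniq G : uniq (fracs G).
Proof.
apply: allpairs_uniq_dep => [|q _|[q a] [q' a'] _ _ /= [-> ->]//]; first exact: iota_uniq.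
by rewrite filter_uniq// iota_uniq.
Qed.

Lemma sum_fracs G (F : nat -> nat -> R) :
  \sum_(x <- fracs G) F x.1 x.2 = \sum_(1 <= q < G) \sum_(a < q | coprime a q) F q a.
Proof.
rewrite big_allpairs_dep; apply: eq_bigr => q _ /=.
by rewrite big_filter big_mkord.
Qed.

Lemma sum_indic (T : eqType) (s : seq T) (P : pred T) : uniq s ->
  {in s &, forall x y, P x -> P y -> x = y} -> \sum_(x <- s) (P x)%:R = (has P s)%:R :> R.
Proof.
move=> us h; have [/hasP[x xs Px]|/hasPn nP] := boolP (has P s).
  rewrite (bigD1_seq x)//= Px big1_seq ?addr0// => y /andP[yx ys].
  by case: (boolP (P y)) => // Py; rewrite (h y x) ?eqxx in yx.
by rewrite big1_seq// => x /andP[_ xs]; rewrite (negPf (nP x xs)).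
Qed.

(** The radius shrinks like [1 / q], so that membership means [|al q - a| <= kap] with one and the
    same kap for all denominators. *)
Definition arc (kap : R) (x : nat * nat) : set R :=
  [set al | x.2%:R / x.1%:R - kap / x.1%:R <= al <= x.2%:R / x.1%:R + kap / x.1%:R].

Variables (kap : R) (G : nat).
Hypothesis kap0 : 0 < kap.
Hypothesis kapG : 2 * kap * G%:R <= 1.

Lemma arc_scaled x al : (0 < x.1)%N -> arc kap x al <-> `|al * x.1%:R - x.2%:R| <= kap.
Proof.
move=> q0; have q0' : 0 < x.1%:R :> R by rewrite ltr0n.
rewrite /arc /= -mulrBl -mulrDl ler_pdivrMr// ler_pdivlMr// ler_distl.
by split.
Qed.

(** Two distinct reduced fractions satisfy [|a q' - a' q| >= 1], whereas a common point of their
    arcs makes this at most [kap (q + q')], which is less than [2 kap G]. *)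
Lemma arcs_disjoint al : {in fracs G &, forall x y, arc kap x al -> arc kap y al -> x = y}.
Proof.
move=> [q a] [q' a'] /mem_fracs[/= /andP[q0 qG] aq co] /mem_fracs[/= /andP[q'0 q'G] aq' co'].
move=> /(arc_scaled (x := (q, a)) al q0) /= h /(arc_scaled (x := (q', a')) al q'0) /= h'.
have E : (a * q' = a' * q)%N.
  apply/eqP; rewrite -eqz_nat -subr_eq0; apply: contrapT => /negP ne.
  have : 1 <= `|((a * q')%N%:Z - (a' * q)%N%:Z)%:~R : R|.
    by rewrite -intr_norm ler1z -gtz0_ge1 normr_gt0.
  rewrite intrB -!pmulrn !natrM.
  have -> : a%:R * q'%:R - a'%:R * q%:R = (al * q'%:R - a'%:R) * q%:R - (al * q%:R - a%:R) * q'%:R :> R by ring.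
  apply/negP; rewrite -ltNge; apply: le_lt_trans (ler_normB _ _) _.
  have q1 : 0 < q%:R :> R by rewrite ltr0n.
  have q2 : 0 < q'%:R :> R by rewrite ltr0n.
  have l1 : q.+1%:R <= G%:R :> R by rewrite ler_nat.
  have l2 : q'.+1%:R <= G%:R :> R by rewrite ler_nat.
  rewrite !normrM !(gtr0_norm q1) (gtr0_norm q2).
  apply: (@le_lt_trans _ _ (kap * q%:R + kap * q'%:R)).
    by apply: lerD; apply: ler_wpM2r => //; exact: ltW.
  rewrite -mulrDr; move: l1 l2; rewrite -!natr1 => l1 l2.
  apply: lt_le_trans kapG; rewrite (mulrC 2) -mulrA ltr_pM2l//; lra.
have dq : (q %| q')%N by rewrite -(@Gauss_dvdr q a) 1?coprime_sym// E dvdn_mull.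
have dq' : (q' %| q)%N by rewrite -(@Gauss_dvdr q' a') 1?coprime_sym// -E dvdn_mull.
have qq : q = q' by apply/eqP; rewrite eqn_dvd dq dq'.
by move: E; rewrite qq => /eqP; rewrite eqn_pmul2r// => /eqP ->.
Qed.

Lemma arc_sub x al : x \in fracs G -> arc kap x al -> - kap <= al <= 1 - kap.
Proof.
case: x => q a /mem_fracs[/= /andP[q0 qG] aq co] /(arc_scaled (x := (q, a)) al q0) /=.
have q1 : 1 <= q%:R :> R by rewrite ler1n.
have l1 : q.+1%:R <= G%:R :> R by rewrite ler_nat.
have l2 : a.+1%:R <= q%:R :> R by rewrite ler_nat.
have a0 : 0 <= a%:R :> R by [].
move: l1 l2; rewrite -!natr1 ler_distl => l1 l2 /andP[h1 h2].
have kq : kap * (q%:R + 1) <= 2^-1.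
  have : kap * (q%:R + 1) <= kap * G%:R by rewrite ler_pM2l.
  by move: kapG; rewrite (mulrC 2) -mulrA => ?; lra.
apply/andP; split.
  rewrite -(ler_pM2r (_ : 0 < q%:R)); last lra.
  apply: le_trans _ h1; have : kap * 1 <= kap * q%:R by rewrite ler_pM2l.
  by rewrite mulNr; lra.
rewrite -(ler_pM2r (_ : 0 < q%:R)); last lra.
by apply: le_trans h2 _; rewrite mulrBl mul1r; lra.
Qed.

(** If [al g] is within kap of [k], then [al] lies in the arc of the reduced form of [k / g], as
    cancelling a common divisor only shrinks the error. The chosen period forces [0 <= k < g], so
    this fraction is among those listed. *)
Lemma minor_sep al : - kap <= al <= 1 - kap -> (forall x, x \in fracs G -> ~ arc kap x al) ->
  forall g : nat, (0 < g < G)%N -> forall k : int, kap <= `|al * g%:R - k%:~R|.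
Proof.
move=> /andP[al0 al1] nar g /andP[g0 gG] k; rewrite leNgt; apply/negP => hk.
have [k0|k0] := leP 0 k; last first.
  have : k%:~R <= - 1 :> R by rewrite -[X in _ <= X](intrN R 1) ler_int; lia.
  have g1 : 1 <= g%:R :> R by rewrite ler1n.
  move: hk; rewrite ltr_distl => /andP[_ hk] k1.
  have : kap * g.+1%:R <= kap * G%:R by rewrite ler_pM2l// ler_nat.
  have : - kap * g%:R <= al * g%:R by rewrite ler_wpM2r.
  have : kap * g.+1%:R = kap * g%:R + kap by rewrite -natr1 mulrDr mulr1.
  by move: kapG; rewrite mulNr -mulrA; lra.
case: k k0 hk => // k _; rewrite -pmulrn => hk.
have kg : (k < g)%N.
  rewrite ltnNge; apply/negP; rewrite -(ler_nat R) => gk.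
  have g1 : 1 <= g%:R :> R by rewrite ler1n.
  move: hk; rewrite ltr_distl => /andP[hk _].
  have : al * g%:R <= (1 - kap) * g%:R by rewrite ler_wpM2r.
  have : kap * 1 <= kap * g%:R by rewrite ler_pM2l.
  by rewrite mulrBl mul1r; lra.
pose e := gcdn k g; have e0 : (0 < e)%N by rewrite gcdn_gt0 g0 orbT.
have ek : (k = (k %/ e) * e)%N by rewrite divnK// dvdn_gcdl.
have eg : (g = (g %/ e) * e)%N by rewrite divnK// dvdn_gcdr.
have q0 : (0 < g %/ e)%N by rewrite divn_gt0// dvdn_leq// dvdn_gcdr.
have co : coprime (k %/ e) (g %/ e).
  rewrite /coprime -(eqn_pmul2r e0) muln_gcdl mul1n -ek -eg.
  by [].
have aq : (k %/ e < g %/ e)%N by rewrite -(ltn_pmul2r e0) -ek -eg.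
apply: (nar (g %/ e, k %/ e)%N).
  by apply: fracs_mem => //; rewrite q0 (leq_ltn_trans _ gG)// leq_div.
apply/arc_scaled => //=.
apply: le_trans (ltW hk).
rewrite {2}eg {2}ek !natrM mulrA -mulrBl normrM normr_nat ler_peMr// ler1n//.
Qed.

(** The period begins at [- kap], so the arc around 0 is not cut and all arcs lie inside. Being
    disjoint, their indicators add up to at most 1. *)
Lemma arcs_decomposition (T : R -> R) (E : R) : continuous T -> 0 <= E ->
  (forall al, - kap <= al <= 1 - kap ->
     (forall g : nat, (0 < g < G)%N -> forall k : int, kap <= `|al * g%:R - k%:~R|) -> `|T al| <= E) ->
  `|\int[mu]_(al in `[- kap, 1 - kap]) T al -
    \sum_(1 <= q < G) \sum_(a < q | coprime a q)
      \int[mu]_(al in `[a%:R / q%:R - kap / q%:R, a%:R / q%:R + kap / q%:R]) T al| <= E.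
Proof.
move=> cT E0 hE; rewrite -(sum_fracs G (fun q a =>  \int[mu]_(al in `[a%:R / q%:R - kap / q%:R, a%:R / q%:R + kap / q%:R]) T al)).
under eq_bigr do rewrite rint_on.
rewrite rint_on -rint_sum; last by move=> x; exact: Int_on.
have iU := Int_on (- kap) (1 - kap) cT.
have iS : Int mu (fun al => \sum_(x <- fracs G) \1_(arc kap x) al * T al).
  by apply: Int_sum => x; exact: Int_on.
rewrite -RintegralB//.
have i1 : Int mu (fun al => \1_[set al | - kap <= al <= 1 - kap] al * E).
  by apply: (@Int_on _ _ _ (fun=> E)); exact: cst_continuous.
apply: le_trans (rint_abs (IntB iU iS) i1 _) _.
  move=> al; rewrite -mulr_suml.
  have -> : \sum_(x <- fracs G) \1_(arc kap x) al = (has (fun x => `[< arc kap x al >]) (fracs G))%:R :> R.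
    rewrite -sum_indic; last 2 first.
    - exact: fracs_uniq.
    - by move=> x y xs ys /asboolP h1 /asboolP h2; exact: arcs_disjoint h1 h2.
    by apply: eq_bigr => x _; rewrite indicE; congr (nat_of_bool _)%:R.
  rewrite -mulrBl !indicE.
  have [hs|hs] := boolP (has _ _).
    have /hasP[x xs /asboolP hx] := hs.
    by rewrite mem_set ?subrr ?mul0r ?normr0 ?mul1r//=; exact: arc_sub xs hx.
  rewrite subr0; have [/set_mem /= alU|alU] := boolP (al \in _); last by rewrite !mul0r normr0.
  rewrite !mul1r; apply: hE => //; apply: minor_sep => // x xs hx.
  by move/hasPn : hs => /(_ x xs) /asboolP.
rewrite -(rint_on (- kap) (1 - kap) (fun=> E)) Rintegral_cst//=.
have -> : fine (mu [set` `[- kap, 1 - kap]]) = 1.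
  have h : - kap < 1 - kap by lra.
  by rewrite lebesgue_measure_itv /= lte_fin h /= opprK subrK.
by rewrite mulr1.
Qed.

End FareyArcs.

(** * Trigonometric polynomials with integer frequencies *)

Section TrigonometricPolynomials.
Context {R : realType}.
Notation mu := (@lebesgue_measure R).
Variables (I : Type) (s : seq I) (u : I -> R) (P : I -> int).

Definition tpoly (al : R) : R := \sum_(b <- s) u b * cos (2 * pi * (al * (P b)%:~R)).

Let prim (al : R) : R := \sum_(b <- s) u b *
  (if P b == 0 then al else sin (2 * pi * (al * (P b)%:~R)) / (2 * pi * (P b)%:~R)).

Lemma continuous_tpoly : continuous tpoly.
Proof.
rewrite /tpoly; elim: s => [|b r IH] al.
  by under eq_fun do rewrite big_nil; exact: cst_continuous.
under eq_fun do rewrite big_cons.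
have cb : continuous (fun al : R => u b * cos (2 * pi * (al * (P b)%:~R))).
  move=> x; apply: (@continuousM _ _ (fun=> u b)); first exact: cst_continuous.
  apply: (@continuous_comp _ _ _ (fun al : R => 2 * pi * (al * (P b)%:~R)) cos); last exact: continuous_cos.
  apply: (@continuousM _ _ (fun=> 2 * pi) (fun al : R => al * (P b)%:~R)); first exact: cst_continuous.
  by apply: (@continuousM _ _ id (fun=> (P b)%:~R)); [exact: cvg_id|exact: cst_continuous].
by apply: cvgD; [exact: cb|exact: IH].
Qed.

Let derive_mull (k x df : R) (f : R -> R) : is_derive x (1:R) f df ->
  is_derive x (1:R) (fun s => k * f s) (k * df).
Proof. by move=> h; exact: (@is_deriveZ _ _ _ f k x 1 df h). Qed.

Lemma prim_term (m : int) (y : R) : is_derive y (1:R)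
  (fun al => if m == 0 then al else sin (2 * pi * (al * m%:~R)) / (2 * pi * m%:~R))
  (cos (2 * pi * (y * m%:~R))).
Proof.
have [->|m0] := eqVneq m 0; first by rewrite mulr0 mulr0 cos0; exact: is_derive_id.
have p0 : 2 * pi * m%:~R != 0 :> R by rewrite !mulf_neq0 ?intr_eq0// gt_eqF// pi_gt0.
have h := @is_derive_affine R sin _ (2 * pi * m%:~R) 0 y (is_derive_sin _).
rewrite (_ : (fun al => _) = (fun al => (2 * pi * m%:~R)^-1 * sin (2 * pi * m%:~R * al + 0))); last first.
  by apply/funext => al; rewrite addr0 mulrC (mulrC al) !mulrA.
have -> : cos (2 * pi * (y * m%:~R)) = (2 * pi * m%:~R)^-1 * (2 * pi * m%:~R * cos (2 * pi * m%:~R * y + 0)).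
  by rewrite mulKf// addr0 (mulrC y) !mulrA.
exact: derive_mull.
Qed.

(** The affine change of variable is built into the primitive, so that integrals over an arc are
    rescaled by evaluating primitives at the endpoints. *)
Lemma prim_derive (k c x : R) : k != 0 ->
  is_derive x (1:R) (fun g => k * prim (c + g / k)) (tpoly (c + x / k)).
Proof.
move=> k0.
have hb b : is_derive x (1:R) (fun g => u b * (k * (if P b == 0 then c + g / k else
  sin (2 * pi * ((c + g / k) * (P b)%:~R)) / (2 * pi * (P b)%:~R)))) (u b * cos (2 * pi * ((c + x / k) * (P b)%:~R))).
  have := prim_term (P b) (c + x / k); rewrite (addrC c) (mulrC x) => hd.
  have := derive_mull (u b) (derive_mull k (is_derive_affine hd)).
  rewrite mulVKf// => h.
  rewrite (_ : (fun g => _) = (fun s : R => u b * (k * (if P b == 0 then k^-1 * s + c else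
    sin (2 * pi * ((k^-1 * s + c) * (P b)%:~R)) / (2 * pi * (P b)%:~R))))); first exact: h.
  by apply/funext => g; rewrite (addrC c) (mulrC g).
rewrite (_ : (fun g => _) = (fun g => \sum_(b <- s) u b * (k * (if P b == 0 then c + g / k else
  sin (2 * pi * ((c + g / k) * (P b)%:~R)) / (2 * pi * (P b)%:~R))))); last first.
  by apply/funext => g; rewrite /prim mulr_sumr; apply: eq_bigr => b _; rewrite mulrCA.
rewrite /tpoly; elim: s => [|b r IH].
  by under eq_fun do rewrite big_nil; rewrite big_nil; exact: is_derive_cst.
under eq_fun do rewrite big_cons; rewrite big_cons.
exact: is_deriveD (hb b) IH.
Qed.

Lemma rint_tpoly_period kap : - kap <= 1 - kap ->
  \int[mu]_(al in `[- kap, 1 - kap]) tpoly al = \sum_(b <- s | P b == 0) u b.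
Proof.
move=> h.
have := @rint_ftc R (fun g => 1 * prim (0 + g / 1)) (fun x => tpoly (0 + x / 1)) _ _ h
  (fun x => prim_derive 0 x (oner_neq0 _)).
rewrite (_ : (fun x => tpoly (0 + x / 1)) = tpoly); last by apply/funext => x; rewrite add0r divr1.
move=> ->; last exact: continuous_tpoly.
rewrite !mul1r !add0r !divr1 /prim -sumrB [RHS]big_mkcond; apply: eq_bigr => b _.
rewrite -mulrBr; case: eqP => _; first by rewrite opprK subrK mulr1.
rewrite -mulrBl (_ : sin _ - sin _ = 0) ?mul0r ?mulr0//.
apply/eqP; rewrite subr_eq0 -eqr_opp -!cosDpihalf; apply/eqP.
by rewrite -[RHS](cos_2piz _ (P b)); congr cos; ring.
Qed.

Lemma rint_tpoly_scale (k c dl : R) : 0 < k -> 0 <= dl ->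
  \int[mu]_(al in `[c - dl, c + dl]) tpoly al =
  k^-1 * \int[mu]_(g in `[- (k * dl), k * dl]) tpoly (c + g / k).
Proof.
move=> k0 dl0; have kd : - (k * dl) <= k * dl by have := mulr_ge0 (ltW k0) dl0; lra.
have cd : c - dl <= c + dl by lra.
have k1 : k != 0 by rewrite gt_eqF.
have := @rint_ftc R (fun g => 1 * prim (0 + g / 1)) (fun x => tpoly (0 + x / 1)) _ _ cd
  (fun x => prim_derive 0 x (oner_neq0 _)).
rewrite (_ : (fun x => tpoly (0 + x / 1)) = tpoly); last by apply/funext => x; rewrite add0r divr1.
move=> ->; last exact: continuous_tpoly.
have -> : \int[mu]_(g in `[- (k * dl), k * dl]) tpoly (c + g / k) =
    k * prim (c + (k * dl) / k) - k * prim (c + - (k * dl) / k).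
  apply: (@rint_ftc R (fun g => k * prim (c + g / k)) (fun x => tpoly (c + x / k)) _ _ kd).
    by move=> x; exact: prim_derive.
  move=> x; apply: (@continuous_comp _ _ _ (fun x : R => c + x / k) tpoly); last exact: continuous_tpoly.
  apply: (@continuousD _ _ _ (fun=> c) (fun x : R => x / k)); first exact: cst_continuous.
  by apply: (@continuousM _ _ id (fun=> k^-1)); [exact: cvg_id|exact: cst_continuous].
by rewrite -[in RHS]mulrBr mulKf// !mul1r !add0r !divr1 mulNr (mulrAC k) divff// mul1r.
Qed.

End TrigonometricPolynomials.

Section Circle.
Context {R : realType} {n : nat}.
Notation mu := (@lebesgue_measure R).
Notation d := n.+1.
Notation V := 'cV[R]_d.
Notation Zn := 'cV[int]_d.

Lemma coprime_rev a q : (a <= q)%N -> coprime (q - a) q = coprime a q.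
Proof.
move=> aq; rewrite /coprime -{2 3}(subnK aq) gcdnDr addnC.
by rewrite gcdnDr gcdnC.
Qed.

(** The reflection [a -> q - a] preserves coprimality. For [q = 1] the only index is 0, whose
    reflection is out of range; this is what [s 0 = 0] is for. *)
Lemma sum_odd_fracs (q : nat) (s : nat -> R) : (0 < q)%N -> s 0%N = 0 ->
  (forall a, (a <= q)%N -> s (q - a)%N = - s a) -> \sum_(a < q | coprime a q) s a = 0.
Proof.
move=> q0 s0 odd; case: (leqP q 1) => [q1|q1].
  have -> : q = 1%N by apply/eqP; rewrite eqn_leq q1.
  by rewrite big_mkcond big_ord1 /= s0.
have e0 : \sum_(a < q | coprime a q) s a = \sum_(1 <= a < q | coprime a q) s a.
  by rewrite -(big_mkord (fun a => coprime a q) s) big_ltn_cond// /coprime gcd0n gtn_eqF.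
have : \sum_(a < q | coprime a q) s a = - \sum_(a < q | coprime a q) s a.
  rewrite e0 [LHS]big_nat_rev big_nat_cond [in RHS]big_nat_cond -sumrN.
  apply: eq_big => [a|a /andP[/andP[a1 aq] co]].
    case: (boolP (1 <= a < q)%N) => //= /andP[a1 aq].
    by rewrite add1n subSS coprime_rev// ltnW.
  by rewrite add1n subSS odd// ltnW.
by move/eqP; rewrite -addr_eq0 -mulr2n mulrn_eq0 /= => /eqP.
Qed.

Lemma osc_shift K p M B (w f : V -> R) D g th : weight K p M B w D -> continuous f ->
  osc w f g th = cos (2 * pi * th) * osc w f g 0 - sin (2 * pi * th) * osc w f g (- 4^-1).
Proof.
move=> hw cf; have i0 := bfun_Int (weight_bfun g 0 hw cf).
have i1 := bfun_Int (weight_bfun g (- 4^-1) hw cf).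
rewrite /osc -(rintZ _ i0) -(rintZ _ i1) -RintegralB//; last 2 first.
- exact: IntZ i0.
- exact: IntZ i1.
apply: eq_Rintegral => z _; rewrite /wphase addr0.
have -> : 2 * pi * (g * f z + th) = 2 * pi * (g * f z) + 2 * pi * th by ring.
have -> : 2 * pi * (g * f z + - 4^-1) = 2 * pi * (g * f z) - pi / 2 by field.
by rewrite cosBpihalf cosD; ring.
Qed.

Lemma osc_int_bound K p M B (w f : V -> R) D g th : (0 < p)%N -> weight K p M B w D -> continuous f ->
  `|osc w f g th| <= M * 8 ^+ d.
Proof.
move=> p0 hw cf; pose N := (Num.truncn `|B|).+1.
have BN : B <= N%:R by apply: le_trans (ler_norm _) (ltW (truncnS_gt _)).
have M0 := weight_ge0 hw.
have cb (i : 'I_d) : continuous (fun x : R => (1 + x ^+ 2)^-1) by exact: continuous_inv1sqr.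
have b01 (i : 'I_d) (x : R) : 0 <= (1 + x ^+ 2)^-1 <= 1 by case/andP: (omega_factor x) => /ltW -> ->.
have ip := bfun_Int (bfun_pbox N cb b01).
apply: le_trans (rint_abs (bfun_Int (weight_bfun g th hw cf)) (IntZ M ip) _) _.
  move=> z; have pb0 : 0 <= pbox N (fun=> fun x : R => (1 + x ^+ 2)^-1) z.
    apply: prodr_ge0 => i _; apply: mulr_ge0; first by case/andP: (b01 i (z i 0)).
    by rewrite indicE; case: (_ \in _).
  have [/existsP[i hi]|/existsPn hB] := boolP [exists i, B <= `|z i 0|].
    by rewrite /wphase (weight_vanish hw hi) mul0r normr0 mulr_ge0.
  apply: le_trans (wphase_le _ _ _ _ _) _; apply: le_trans (weight_bound z hw) _.
  rewrite ler_wpM2l// (_ : pbox _ _ _ = omega z).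
    rewrite -[leRHS]expr1 ler_wiXn2l ?omega_ge0 ?omega_le1//.
  apply: eq_bigr => i _; rewrite indicE mem_set ?mulr1//=.
  by have := hB i; rewrite -ltNge => /ltW h; apply: le_trans h BN.
rewrite rintZ//; apply: ler_wpM2l => //.
apply: rint_pbox => // i s hs.
have := @sum_shift_sqr R 1 0 s N; rewrite ltr01 lexx divr1 => /(_ isT).
by under eq_bigr do rewrite mul1r addr0.
Qed.

Lemma Int_lorentz (c : R) : 0 < c ->
  Int mu (fun x => (c ^+ 2 + x ^+ 2)^-1) /\ \int[mu]_x (c ^+ 2 + x ^+ 2)^-1 <= pi / c.
Proof.
move=> c0; have den x : 0 < c ^+ 2 + x ^+ 2 by rewrite ltr_wpDr ?sqr_ge0// exprn_gt0.
have cf : continuous (fun x : R => (c ^+ 2 + x ^+ 2)^-1).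
  move=> x; apply: (@continuousV _ _ (fun x : R => c ^+ 2 + x ^+ 2)); first by rewrite gt_eqF.
  by apply: (@continuousD _ _ _ (fun=> c ^+ 2) (fun x : R => x ^+ 2)); [exact: cst_continuous|exact: exprn_continuous].
have dF x : is_derive x (1:R) (fun x => c^-1 * atan (c^-1 * x + 0)) ((c ^+ 2 + x ^+ 2)^-1).
  have -> : (c ^+ 2 + x ^+ 2)^-1 = c^-1 * (c^-1 * (1 + (c^-1 * x + 0) ^+ 2)^-1).
    have -> : c ^+ 2 + x ^+ 2 = c ^+ 2 * (1 + (c^-1 * x + 0) ^+ 2) by field; rewrite gt_eqF.
    by rewrite invfM -exprVn expr2 mulrA.
  have h := is_derive_affine (is_derive1_atan (c^-1 * x + 0)).
  exact: (@is_deriveZ _ _ _ _ c^-1 x 1 _ h).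
have hE (N : nat) : \int[mu]_(x in `[- N%:R, N%:R]) (c ^+ 2 + x ^+ 2)^-1 <= pi / c.
  rewrite (rint_ftc _ dF cf); last by rewrite ge0_cp.
  rewrite -mulrBr mulrC; apply: ler_wpM2r; first by rewrite invr_ge0 ltW.
  have := atan_ltpi2 (c^-1 * N%:R + 0); have := atan_gtNpi2 (c^-1 * - N%:R + 0).
  by lra.
have iI : Int mu (fun x => (c ^+ 2 + x ^+ 2)^-1).
  by apply: (@Int_exhaust _ _ (pi / c)) => // x; rewrite invr_ge0 ltW.
split=> //; have cv := cvg_rint cf iI.
rewrite -(cvg_lim _ cv)//; apply: limr_le; first by apply: cvgP cv.
by apply: nearW.
Qed.

Lemma osc_decay_sqrt (A : 'M[int]_d) p K : A^T = A -> \det A != 0 -> (d < p)%N -> (d.*2 <= K)%N ->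
  exists2 C, 0 <= C & forall M B (w : V -> R) D, weight K p M B w D ->
  forall l c gam, gam != 0 -> `|osc w (qf A l c) gam 0| <= C * M / Num.sqrt `|gam| ^+ d.
Proof.
move=> sA detA dp dK; have [C C0 hC] := osc_bound (R := R) sA detA dp dK.
exists (Num.sqrt C); first exact: sqrtr_ge0.
move=> M B w D hw l c gam g0; have M0 := weight_ge0 hw.
have s0 : 0 < Num.sqrt `|gam| ^+ d by rewrite exprn_gt0// sqrtr_gt0 normr_gt0.
rewrite -(@ler_pXn2r _ 2) ?nnegrE ?divr_ge0 ?mulr_ge0 ?sqrtr_ge0 ?(ltW s0)//.
rewrite real_normK ?num_real//; apply: le_trans (hC _ _ _ _ hw l c gam 0 g0) _.
by rewrite !exprMn sqr_sqrtr// exprVn -exprM mulnC exprM sqr_sqrtr.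
Qed.

Lemma Int_restrict (a b : R) (u : R -> R) : Int mu u ->
  Int mu (fun x => \1_[set x | a <= x <= b] x * u x).
Proof.
move=> iu; apply: (@Int_le _ _ _ mu (fun x => \1_[set x | a <= x <= b] x * u x) (fun x => `|u x|)).
- apply: measurable_funM; last exact: Int_meas iu.
  apply: measurable_indic; rewrite (_ : [set x | _] = [set` `[a, b]]); first exact: measurable_itv.
  by apply/seteqP; split=> x /=; rewrite in_itv.
- exact: Int_norm.
move=> x; rewrite normrM -[leRHS]mul1r ler_wpM2r// indicE.
by case: (_ \in _); rewrite ?normr1 ?normr0.
Qed.

(** Beyond [Gam] the decay [|g|^(-d/2)] is at most [Gam^(-(d-4)/2) * 2 / (Gam^2 + g^2)], whose
    integral over the line is explicit. *)
Lemma osc_tail (A : 'M[int]_d) p K : A^T = A -> \det A != 0 -> (d < p)%N -> (d.*2 <= K)%N -> (4 <= d)%N ->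
  exists2 C, 0 <= C & forall M B (w : V -> R) D, weight K p M B w D -> forall l c,
  Int mu (fun g => osc w (qf A l c) g 0) /\
  forall Gam, 0 < Gam ->
    `|\int[mu]_g osc w (qf A l c) g 0 - \int[mu]_(g in `[- Gam, Gam]) osc w (qf A l c) g 0|
      <= C * M / Num.sqrt Gam ^+ (d - 2).
Proof.
move=> sA detA dp dK d4; have [C C0 hC] := osc_decay_sqrt sA detA dp dK.
have p0 : 0 <= pi :> R by rewrite ltW// pi_gt0.
exists (C * 2 * pi); first by nng.
move=> M B w D hw l c; have M0 := weight_ge0 hw.
set o := fun g => osc w (qf A l c) g 0.
have iO : Int mu o.
  have [E E0 hE] := osc_decay l c sA detA d4 dp dK hw.
  have bw := bfun_w hw.
  have [i _] := abel_limit bw (fun g => (hE 1 g ltr01).1).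
  rewrite (_ : o = oscW A l c w)//; apply/funext => g; exact: osc_oscW.
split=> // Gam G0.
have sG : 0 < Num.sqrt Gam by rewrite sqrtr_gt0.
rewrite rint_on -RintegralB//; last first.
  exact: Int_restrict.
have [iL bL] := Int_lorentz G0.
pose k := C * M / Num.sqrt Gam ^+ (d - 4) * 2.
have k0 : 0 <= k by rewrite /k mulr_ge0// divr_ge0 ?mulr_ge0 ?exprn_ge0 ?sqrtr_ge0.
apply: (@le_trans _ _ (\int[mu]_x (k * (Gam ^+ 2 + x ^+ 2)^-1))).
  apply: rint_abs; first by apply: IntB => //; exact: Int_restrict.
    by apply: IntZ.
  move=> g; rewrite indicE; have [_|/negP hg] := boolP (_ \in _).
    by rewrite mul1r subrr normr0 mulr_ge0// invr_ge0 addr_ge0 ?sqr_ge0.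
  rewrite mul0r subr0; have {hg} : Gam < `|g|.
    rewrite ltNge; apply/negP => h; apply: hg; rewrite inE /=; by rewrite -ler_norml.
  move=> hg; have g0 : 0 < `|g| by apply: lt_trans hg.
  apply: le_trans (hC _ _ _ _ hw l c g _) _; first by rewrite -normr_gt0.
  have sg : Num.sqrt Gam <= Num.sqrt `|g| by rewrite ler_wsqrtr// ltW.
  have sg0 : 0 < Num.sqrt `|g| by rewrite sqrtr_gt0.
  rewrite /k -!mulrA -{1}(subnK d4) exprD invfM.
  apply: ler_wpM2l => //; apply: ler_wpM2l => //; apply: ler_pM.
  - by rewrite invr_ge0 exprn_ge0// sqrtr_ge0.
  - by rewrite invr_ge0 exprn_ge0// sqrtr_ge0.
  - by rewrite lef_pV2 ?posrE ?exprn_gt0//; apply: lerXn2r; rewrite ?nnegrE ?sqrtr_ge0.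
  rewrite (exprM _ 2 2) sqr_sqrtr ?normr_ge0// real_normK ?num_real//.
  have gg : Gam ^+ 2 <= g ^+ 2 by rewrite -(real_normK (num_real g)) lerXn2r ?nnegrE// ltW.
  have g2 : 0 < Gam ^+ 2 by rewrite exprn_gt0.
  rewrite -[leLHS]mul1r ler_pdivrMr ?(lt_le_trans g2)// mulrAC ler_pdivlMr; first by lra.
  by lra.
rewrite rintZ//; apply: le_trans (ler_wpM2l k0 bL) _.
rewrite /k le_eqVlt; apply/orP; left; apply/eqP.
have -> : (d - 2 = (d - 4) + 2)%N by clear -d4; lia.
rewrite exprD sqr_sqrtr ?(ltW G0)//.
have : Num.sqrt Gam ^+ (d - 4) != 0 by rewrite expf_neq0// gt_eqF.
move: (Num.sqrt Gam ^+ (d - 4)) (pi : R) => x P x0.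
by field; rewrite x0 gt_eqF.
Qed.

Lemma sin_2piz (x : R) (k : int) : sin (x + 2 * pi * k%:~R) = sin x.
Proof.
rewrite -[LHS]opprK -[RHS]opprK -!cosDpihalf -[in RHS](cos_2piz _ k).
by congr (- cos _); ring.
Qed.

(** In each residue class modulo q the phase [a P(b) / q] is constant modulo 1, and the class is a
    shifted lattice of mesh [q / L], to which [riemann_sum] applies. The sum over all numerators is
    treated at once, since only it is free of sine terms. *)
Lemma major_arc (A : 'M[int]_d) (l : V) (c r0 L : R) (t0 : int) (n0 : Zn) K p M B w D q N g :
  even_symmetric A -> (forall j, `|l j 0| <= r0) -> 0 <= r0 ->
  weight K.+1 p M B w D -> (K.+1 < p)%N -> 1 <= L -> (0 < q)%N -> q%:R <= L ->
  (forall b : Zn, L ^+ 2 * qf A l c (L^-1 *: zR b) = (@qpoly R n A t0 (b + n0))%:~R) ->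
  zsupp N (fun b => w (L^-1 *: zR b)) ->
  `|\sum_(a < q | coprime a q) tpoly (zbox N d) (fun b => w (L^-1 *: zR b))
       (fun b => @qpoly R n A t0 (b + n0)) (a%:R / q%:R + g / L ^+ 2)
    - (L / q%:R) ^+ d * Gsum (@qpoly R n A t0) q * osc w (qf A l c) g 0| <=
  q%:R * L ^+ d * (@CRie R n K.+1 (qC A r0) * M * (q%:R / L * (1 + `|g|)) ^+ K.+1).
Proof.
move=> eA lr r00 hw Kp L1 q0 qL hP sN; have [sA _] := eA.
set f := qf A l c; set P := fun b => @qpoly R n A t0 (b + n0).
have L0 : 0 < L by lra.
have q1 : 0 < q%:R :> R by rewrite ltr0n.
pose lam := q%:R / L; have lam0 : 0 < lam by rewrite divr_gt0.
have Lr : 0 < lam <= 1 by rewrite lam0 /lam ler_pdivrMr// mul1r.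
pose N' := (N + (Num.truncn ((`|B| + 1) * L)).+1)%N.
set E := _ * _ ^+ K.+1.
pose th (a : nat) (r : 'cV['I_q]_d) : R := a%:R * (P (ordb r))%:~R / q%:R.
pose S (a : nat) (r : 'cV['I_q]_d) := \sum_(s <- zbox N' d)
  wphase w f g (th a r) (lam *: zR s + L^-1 *: zR (ordb r)).
have TE (a : nat) : tpoly (zbox N d) (fun b => w (L^-1 *: zR b)) P (a%:R / q%:R + g / L ^+ 2) =
    \sum_(r : 'cV['I_q]_d) S a r.
  rewrite /tpoly (@zsum_residues R n q N N')//; last 2 first.
  - by move=> b; rewrite mulf_eq0 negb_or => /andP[h _]; exact: sN.
  - by rewrite /N' addnS ltnS leq_addr.
  apply: eq_bigr => r _; apply: eq_bigr => s _; rewrite /wphase.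
  have zE : L^-1 *: zR (ordb r + q%:Z *: s) = lam *: zR s + L^-1 *: zR (ordb r) :> V.
    by rewrite zRD zRZ scalerDr scalerA addrC mulrC.
  rewrite zE; congr (_ * _).
  have /dvdzP[k /eqP] := @qpoly_period R n A eA t0 q (ordb r + n0) s; rewrite subr_eq => /eqP hk.
  rewrite -zE /f /th /P; have := hP (ordb r + q%:Z *: s).
  rewrite addrAC hk intrD intrM -pmulrn; move: (qf A l c _) => F hF.
  have -> : F = (k%:~R * q%:R + (@qpoly R n A t0 (ordb r + n0))%:~R) / L ^+ 2.
    by rewrite -hF mulrAC divff ?mul1r// expf_neq0// gt_eqF.
  rewrite -[RHS](cos_2piz _ (a%:Z * k)) intrM -pmulrn; congr cos.
  by field; rewrite (gt_eqF q1) (gt_eqF L0).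
have hS (a : nat) r : `|lam ^+ d * S a r - osc w f g (th a r)| <= E.
  apply: (riemann_sum g (th a r) hw (quadf_qf c sA lr) (qC_ge1 A r00) Kp Lr) => //.
    by rewrite /N' addnS.
  move=> i; rewrite !mxE /= normrM gtr0_norm ?invr_gt0// -pmulrn normr_nat.
  have hr : L^-1 * (nat_of_ord (r i 0))%:R <= 1.
    rewrite mulrC ler_pdivrMr// mul1r; apply: le_trans qL; by rewrite ler_nat ltnW.
  apply: (@le_trans _ _ (`|B| + 1)); first by apply: lerD => //; exact: ler_norm.
  have hN : (`|B| + 1) * L <= N'%:R.
    by apply: le_trans (ltW (truncnS_gt _)) _; rewrite ler_nat leq_addl.
  rewrite /lam mulrAC ler_pdivlMr//; apply: le_trans hN _.
  by rewrite -[leLHS]mul1r ler_wpM2r// ler1n.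
(* Splitting off the phase leaves a cosine and a sine sum. The sine sum is odd under [a -> q - a]
   and vanishes; the shift by [n0] is absorbed by running over all residues. *)
have e1 : \sum_(a < q | coprime a q) \sum_(r : 'cV['I_q]_d) osc w f g (th a r) =
    Gsum (@qpoly R n A t0) q * osc w f g 0.
  have cf : continuous f by exact: continuous_qf.
  under eq_bigr do under eq_bigr do rewrite (osc_shift g _ hw cf).
  under eq_bigr do rewrite sumrB -!mulr_suml.
  rewrite sumrB -!mulr_suml.
  rewrite (@sum_odd_fracs q (fun a => \sum_(r : 'cV['I_q]_d) sin (2 * pi * th a r)))//; last 2 first.
  - by apply: big1 => r _; rewrite /th mul0r mul0r mulr0 sin0.
  - move=> a aq; rewrite -sumrN; apply: eq_bigr => r _.
    rewrite /th natrB// -sinN -(sin_2piz (- _) (P (ordb r))); congr sin.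
    by field; rewrite gt_eqF.
  rewrite mul0r subr0; congr (_ * _); apply: eq_bigr => a _.
  rewrite /th /P.
  rewrite (@sum_res_shift d R q (fun b => cos (2 * pi * (a%:R * (@qpoly R n A t0 b)%:~R / q%:R))))//.
  exact: zper_cos (@qpoly_period R n A eA t0) _ _ q0.
have -> : \sum_(a < q | coprime a q) tpoly (zbox N d) (fun b => w (L^-1 *: zR b)) P (a%:R / q%:R + g / L ^+ 2)
    - (L / q%:R) ^+ d * Gsum (@qpoly R n A t0) q * osc w f g 0 =
   (L / q%:R) ^+ d * \sum_(a < q | coprime a q) \sum_(r : 'cV['I_q]_d) (lam ^+ d * S a r - osc w f g (th a r)).
  under [in RHS]eq_bigr do rewrite sumrB.
  rewrite sumrB e1 mulrBr mulrA; congr (_ - _).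
  rewrite mulr_sumr; apply: eq_bigr => a _; rewrite TE.
  rewrite -mulr_sumr mulrA -exprMn /lam mulrA divfK ?gt_eqF// divff ?gt_eqF// expr1n mul1r//.
have Ld0 : 0 <= (L / q%:R) ^+ d by rewrite exprn_ge0// divr_ge0// ltW.
have E0 : 0 <= E by apply: le_trans (hS 0%N (const_mx (Ordinal q0))).
rewrite normrM ger0_norm//.
apply: (@le_trans _ _ ((L / q%:R) ^+ d * (q%:R * (q%:R ^+ d * E)))).
  apply: ler_wpM2l => //; apply: le_trans (ler_norm_sum _ _ _) _.
  rewrite big_mkcond /=.
  apply: (@le_trans _ _ (\sum_(a < q) (q%:R ^+ d * E))).
    apply: ler_sum => a _; case: ifP => _; last by rewrite mulr_ge0// exprn_ge0.
    apply: le_trans (ler_norm_sum _ _ _) _.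
    apply: (@le_trans _ _ (\sum_(r : 'cV['I_q]_d) E)); first by apply: ler_sum => r _; exact: hS.
    by rewrite sumr_const card_res -[_ *+ (q ^ d)]mulr_natl natrX.
  by rewrite sumr_const card_ord -[_ *+ q]mulr_natl.
rewrite le_eqVlt; apply/orP; left; apply/eqP.
rewrite expr_div_n; have : q%:R ^+ d != 0 :> R by rewrite expf_neq0// gt_eqF.
move: (q%:R ^+ d) => x x0; by field.
Qed.

End Circle.

(** * The circle method for weights of compact support *)

Section CircleMethod.
Context {R : realType} {n : nat}.
Notation mu := (@lebesgue_measure R).
Notation d := n.+1.
Notation V := 'cV[R]_d.
Notation Zn := 'cV[int]_d.
Notation qpoly := (@qpoly R n).

(** With denominators q up to [L / Y] and radius parameter [1 / (8 L Y)], the rescaled variable on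
    an arc is at most [L / (8 Y q)], so [(q / L) (1 + |g|)] is at most [2 / Y]: each derivative
    gains. The 8 leaves ample room for disjointness. *)
Definition farey_order (L Y : R) : nat := (Num.truncn (L / Y)).+1.
Definition arc_radius (L Y : R) : R := (8 * L * Y)^-1.

Lemma farey_order_bounds L Y : 1 <= Y -> Y <= L -> L / Y <= (farey_order L Y)%:R <= 2 * (L / Y).
Proof.
move=> Y1 YL; have Y0 : 0 < Y by lra.
have x1 : 1 <= L / Y by rewrite ler_pdivlMr// mul1r.
rewrite /farey_order (ltW (truncnS_gt _))/= -natr1; have := truncn_le (L / Y); rewrite (_ : 0 <= L / Y); last by lra.
by move=> h; move: h; lra.
Qed.

Lemma arc_radius_gt0 L Y : 1 <= Y -> Y <= L -> 0 < arc_radius L Y.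
Proof. by move=> Y1 YL; rewrite invr_gt0 !mulr_gt0//; lra. Qed.

Lemma arc_radius_order L Y : 1 <= Y -> Y <= L -> 2 * arc_radius L Y * (farey_order L Y)%:R <= 1.
Proof.
move=> Y1 YL; have /andP[_ h] := farey_order_bounds Y1 YL; have k0 := arc_radius_gt0 Y1 YL.
apply: (@le_trans _ _ (2 * arc_radius L Y * (2 * (L / Y)))).
  by apply: ler_wpM2l h; rewrite mulr_ge0// ltW.
have -> : 2 * arc_radius L Y * (2 * (L / Y)) = (Y ^+ 2)^-1 / 2 by rewrite /arc_radius; field; rewrite !gt_eqF//; lra.
have : (Y ^+ 2)^-1 <= 1 by rewrite invf_le1 ?exprn_ege1// exprn_gt0//; lra.
by lra.
Qed.

(** The separation given by the arcs bounds the one-dimensional sums by [160 Y^2], and the root of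
    Weyl's estimate is then [L^(d/2) Y^d]. *)
Lemma minor_arc (A : 'M[int]_d) p K : A^T = A -> \det A != 0 -> (d < p)%N -> (d.*2 <= K)%N ->
  exists2 C, 0 <= C & forall M B (w : V -> R) D, weight K p M B w D ->
  forall L Y l c (P : Zn -> int) N, 1 <= Y -> Y <= L ->
  (forall b : Zn, L ^+ 2 * qf A l c (L^-1 *: zR b) = (P b)%:~R) ->
  zsupp N (fun b => w (L^-1 *: zR b)) -> forall al,
  (forall g : nat, (0 < g < farey_order L Y)%N -> forall k : int, arc_radius L Y <= `|al * g%:R - k%:~R|) ->
  `|tpoly (zbox N d) (fun b => w (L^-1 *: zR b)) P al| <= C * M * Num.sqrt L ^+ d * Y ^+ d.
Proof.
move=> sA detA dp dK; have [C C0 hC] := weyl (R := R) detA dp dK.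
exists (Num.sqrt (C * 160 ^+ d)); first exact: sqrtr_ge0.
move=> M B w D hw L Y l c P N Y1 YL hP sN al sep; have M0 := weight_ge0 hw.
have L1 : 1 <= L by apply: le_trans YL.
have L0 : 0 < L by lra. have Y0 : 0 < Y by lra.
have hX N' : \sum_(k <- irange N') xfac L al k <= 160 * Y ^+ 2.
  apply: le_trans (xfac_sum N' L0 (arc_radius_gt0 Y1 YL) (ltn0Sn _) sep) _.
  have -> : (2 * L * arc_radius L Y)^-1 = 4 * Y by rewrite /arc_radius; field; rewrite !gt_eqF//; lra.
  have : L / (farey_order L Y)%:R <= Y.
    rewrite ler_pdivrMr ?ltr0n// mulrC -ler_pdivrMr//.
    by have /andP[] := farey_order_bounds Y1 YL.
  have : 0 <= L / (farey_order L Y)%:R by rewrite divr_ge0// ltW.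
  rewrite -/(farey_order L Y); move: (L / _) => x x0 xY.
  apply: (@le_trans _ _ (16 * (2 * Y) * (5 * Y))); last by rewrite expr2; lra.
  by apply: ler_pM; lra.
have hT := hC M B w D hw L al (160 * Y ^+ 2) L1 hX (fun b => al * (P b)%:~R) _ N sN.
have {}hT : tpoly (zbox N d) (fun b => w (L^-1 *: zR b)) P al ^+ 2 <= C * M ^+ 2 * L ^+ d * (160 * Y ^+ 2) ^+ d.
  apply: hT => h; have [e he] := qf_phase l c L^-1 (al * L ^+ 2) 0 h sA; exists e => b.
  have hq b' : al * L ^+ 2 * qf A l c (L^-1 *: zR b') = al * (P b')%:~R by rewrite -mulrA hP.
  have := he b; rewrite !addr0 !hq => ->; congr (_ + _ + _).
  apply: eq_bigr => i _; congr (_ * _).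
  by rewrite exprVn mulfK// expf_neq0// gt_eqF.
rewrite -(@ler_pXn2r _ 2) ?nnegrE//; last first.
  by rewrite !mulr_ge0 ?exprn_ge0 ?sqrtr_ge0// ltW.
rewrite real_normK ?num_real//; apply: le_trans hT _.
have -> : (Num.sqrt (C * 160 ^+ d) * M * Num.sqrt L ^+ d * Y ^+ d) ^+ 2 =
   C * 160 ^+ d * M ^+ 2 * L ^+ d * (Y ^+ d) ^+ 2.
  rewrite !exprMn sqr_sqrtr; last by rewrite mulr_ge0// exprn_ge0.
  by rewrite -(exprM (Num.sqrt L)) (mulnC d) exprM sqr_sqrtr// ltW.
have Yd : (Y ^+ 2) ^+ d = (Y ^+ d) ^+ 2 by rewrite -!exprM mulnC.
by rewrite exprMn Yd le_eqVlt; apply/orP; left; apply/eqP; ring.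
Qed.

Lemma major_tail_power (L Y : R) (q : nat) : 1 <= Y -> Y <= L -> (0 < q)%N -> (2 <= d)%N ->
  L ^+ (d - 2) * (q%:R / @sqrtn R q ^+ d) * (Num.sqrt (L ^+ 2 * (arc_radius L Y / q%:R)) ^+ (d - 2))^-1 =
  (Num.sqrt 8 * Num.sqrt L * Num.sqrt Y) ^+ (d - 2).
Proof.
move=> Y1 YL q0 d2; have L0 : 0 < L by lra. have Y0 : 0 < Y by lra.
have q1 : 0 < q%:R :> R by rewrite ltr0n.
have sq : 0 < @sqrtn R q by exact: sqrtn_gt0.
have aL : 0 < Num.sqrt L by rewrite sqrtr_gt0.
have aY : 0 < Num.sqrt Y by rewrite sqrtr_gt0.
have a8 : 0 < Num.sqrt 8 :> R by rewrite sqrtr_gt0.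
have -> : Num.sqrt (L ^+ 2 * (arc_radius L Y / q%:R)) = Num.sqrt L / (Num.sqrt 8 * Num.sqrt Y * @sqrtn R q).
  have -> : L ^+ 2 * (arc_radius L Y / q%:R) = L / (8 * Y * q%:R).
    by rewrite /arc_radius; field; rewrite !gt_eqF.
  by rewrite sqrtrM ?(ltW L0)// sqrtrV ?mulr_ge0 ?ltW// -!sqrtrM ?mulr_ge0 ?ltW.
have e0 : q%:R / @sqrtn R q ^+ d = (@sqrtn R q ^+ (d - 2))^-1.
  rewrite -{1}(subnK d2) exprD sqrtn_sqr; field.
  by rewrite !gt_eqF// exprn_gt0.
have eL : L ^+ (d - 2) = (Num.sqrt L ^+ 2) ^+ (d - 2) by rewrite sqr_sqrtr// ltW.
rewrite e0 eL -!exprVn -!exprMn; congr (_ ^+ _).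
by rewrite -/(@sqrtn R q); field; rewrite !gt_eqF.
Qed.

Lemma series_tail_power (L Y : R) : 1 <= Y -> Y <= L -> (4 <= d)%N ->
  L ^+ (d - 2) * ((farey_order L Y)%:R ^+ 2 / @sqrtn R (farey_order L Y) ^+ d) <= Num.sqrt L ^+ d * Y ^+ d.
Proof.
move=> Y1 YL d4; have L0 : 0 < L by lra. have Y0 : 0 < Y by lra.
set G := farey_order L Y; have G0 : (0 < G)%N by [].
have sG : 0 < @sqrtn R G by exact: sqrtn_gt0.
have aL : 0 < Num.sqrt L by rewrite sqrtr_gt0.
have aY : 0 < Num.sqrt Y by rewrite sqrtr_gt0.
have y1 : 1 <= Num.sqrt Y by rewrite -[leLHS]sqrtr1 ler_wsqrtr.
have hs : Num.sqrt L / Num.sqrt Y <= @sqrtn R G.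
  rewrite -(sqrtrV (ltW Y0)) -(sqrtrM _ (ltW L0)) /sqrtn; apply: ler_wsqrtr.
  by have /andP[] := farey_order_bounds Y1 YL.
have -> : G%:R ^+ 2 / @sqrtn R G ^+ d = (@sqrtn R G ^+ (d - 4))^-1.
  rewrite -{1}(subnK d4) exprD -sqrtn_sqr -exprM.
  by field; rewrite !gt_eqF// exprn_gt0.
have a0 : 0 < Num.sqrt L / Num.sqrt Y by rewrite divr_gt0.
apply: (@le_trans _ _ (L ^+ (d - 2) * ((Num.sqrt L / Num.sqrt Y) ^+ (d - 4))^-1)).
  apply: ler_wpM2l; first by rewrite exprn_ge0// ltW.
  rewrite lef_pV2 ?posrE ?exprn_gt0//; apply: lerXn2r; rewrite ?nnegrE ?(ltW a0) ?(ltW sG)//.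
have -> : L ^+ (d - 2) * ((Num.sqrt L / Num.sqrt Y) ^+ (d - 4))^-1 = Num.sqrt L ^+ d * Num.sqrt Y ^+ (d - 4).
  rewrite -{1}(sqr_sqrtr (ltW L0)) -exprM (_ : (2 * (d - 2) = d + (d - 4))%N); last by lia.
  rewrite exprD expr_div_n invf_div; field; rewrite gt_eqF// exprn_gt0//.
apply: ler_wpM2l; first by rewrite exprn_ge0// ltW.
apply: (@le_trans _ _ (Num.sqrt Y ^+ (2 * d))); first by rewrite ler_weXn2l//; lia.
by rewrite exprM sqr_sqrtr// ltW.
Qed.

Lemma rint_itv_cst (a b c : R) : a <= b -> \int[mu]_(x in `[a, b]) c = c * (b - a).
Proof.
move=> ab; rewrite Rintegral_cst//=; congr (_ * _).
rewrite [X in fine X](_ : _ = mu [set` `[a, b]])// lebesgue_measure_itv /= lte_fin.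
case: ltP => [//|ba]; have -> : a = b by apply/le_anti; rewrite ab.
by rewrite subrr.
Qed.

Lemma osc_integral_bound (A : 'M[int]_d) p K : A^T = A -> \det A != 0 -> (d < p)%N -> (d.*2 <= K)%N -> (4 <= d)%N ->
  exists2 C, 0 <= C & forall M B (w : V -> R) D, weight K p M B w D -> forall l c,
  `|\int[mu]_g osc w (qf A l c) g 0| <= C * M.
Proof.
move=> sA detA dp dK d4; have [C C0 hC] := osc_tail (R := R) sA detA dp dK d4.
have p0 : (0 < p)%N by exact: leq_trans dp.
exists (2 * 8 ^+ d + C); first by nng.
move=> M B w D hw l c; have [iO hTail] := hC M B w D hw l c.
rewrite -(subrK (\int[mu]_(g in `[- 1, 1]) osc w (qf A l c) g 0) (\int[mu]_g osc w (qf A l c) g 0)).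
apply: le_trans (ler_normD _ _) _.
have h1 : `|\int[mu]_(g in `[- 1, 1]) osc w (qf A l c) g 0| <= M * 8 ^+ d * (1 - - 1).
  have m11 : - 1 <= 1 :> R by lra.
  rewrite -(rint_itv_cst _ m11) !rint_on; apply: rint_abs; first exact: Int_restrict.
    by apply: (@Int_on _ _ _ (fun=> _)); exact: cst_continuous.
  move=> x; rewrite normrM ger0_norm; last by rewrite indicE; case: (_ \in _).
  apply: ler_wpM2l; first by rewrite indicE; case: (_ \in _).
  exact: osc_int_bound p0 hw (@continuous_qf _ _ A l c).
have := hTail 1 ltr01; rewrite sqrtr1 expr1n divr1 => h2.
by apply: le_trans (lerD h2 h1) _; rewrite le_eqVlt; apply/orP; left; apply/eqP; ring.
Qed.

(** The condition [L ^+ d <= Y ^+ K.+1] says that K + 1 gains of order Y outweigh the trivial bound,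
    so that the Riemann sum errors stay bounded; the other errors all have the order of the minor
    arcs or less. *)
Lemma circle_method (A : 'M[int]_d) p K r0 : even_symmetric A -> \det A != 0 -> (5 <= d)%N ->
  (d.*2 <= K.+1)%N -> (K.+1 < p)%N -> 0 <= r0 ->
  exists2 C, 0 <= C & forall M B (w : V -> R) D, weight K.+1 p M B w D ->
  forall L Y (l : V) c t0 (n0 : Zn) N, (forall j, `|l j 0| <= r0) -> 1 <= Y -> Y <= L -> L ^+ d <= Y ^+ K.+1 ->
  (forall b : Zn, L ^+ 2 * qf A l c (L^-1 *: zR b) = (qpoly A t0 (b + n0))%:~R) ->
  zsupp N (fun b => w (L^-1 *: zR b)) ->
  `|\sum_(b <- zbox N d | qpoly A t0 (b + n0) == 0) w (L^-1 *: zR b) -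
    L ^+ (d - 2) * \int[mu]_g osc w (qf A l c) g 0 * @singular_sum R n A t0| <= C * M * Num.sqrt L ^+ d * Y ^+ d.
Proof.
move=> eA detA d5 dK Kp r00; have [sA _] := eA.
have dp : (d < p)%N by move: dK; rewrite -addnn; lia.
have p0 : (0 < p)%N by lia. have d4 : (4 <= d)%N by lia. have d2 : (2 <= d)%N by lia.
have [C1 C10 hC1] := minor_arc sA detA dp dK.
have [C2 C20 hC2] := osc_tail (R := R) sA detA dp dK d4.
have [C5 C50 hC5] := osc_integral_bound sA detA dp dK d4.
pose C3 := @CRie R n K.+1 (qC A r0).
pose C4 := @Gconst R n A eA detA.
have C40 : 0 <= C4 by exact: Gconst_ge0.
have C30 : 0 <= C3.
  rewrite /C3 /CRie !mulr_ge0 ?exprn_ge0 ?mulr_ge0//; first by rewrite ltW// pi_gt0.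
  by have := qC_ge1 A r00; lra.
have a80 : 0 <= Num.sqrt 8 :> R by exact: sqrtr_ge0.
exists (C1 + C3 * 2 ^+ K.+1 + C4 * C2 * Num.sqrt 8 ^+ (d - 2) + 4 * C4 * C5); first by nng.
move=> M B w D hw L Y l c t0 n0 N lr Y1 YL LY hP sN; have M0 := weight_ge0 hw.
have L1 : 1 <= L by apply: le_trans YL.
have L0 : 0 < L by lra. have Y0 : 0 < Y by lra.
set G := farey_order L Y; set kap := arc_radius L Y.
have k0 : 0 < kap by exact: arc_radius_gt0.
have kG : 2 * kap * G%:R <= 1 by exact: arc_radius_order.
have /andP[G1 G2] := farey_order_bounds Y1 YL; rewrite -/G in G1 G2.
set P := fun b => qpoly A t0 (b + n0).
set u := fun b : Zn => w (L^-1 *: zR b).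
set T := tpoly (zbox N d) u P.
set f := qf A l c.
set H := \int[mu]_g osc w f g 0.
have [iO hTail] := hC2 M B w D hw l c; rewrite -/f -/H in iO hTail.
pose g (q : nat) := Gsum (qpoly A t0) q / q%:R ^+ d : R.
set X := Num.sqrt L ^+ d * Y ^+ d.
have X0 : 0 <= X by rewrite mulr_ge0 ?exprn_ge0 ?sqrtr_ge0// ltW.
have cT : continuous T by exact: continuous_tpoly.
(* Minor arcs. *)
have E1 : `|\sum_(b <- zbox N d | P b == 0) u b - \sum_(1 <= q < G) \sum_(a < q | coprime a q)
      \int[mu]_(al in `[a%:R / q%:R - kap / q%:R, a%:R / q%:R + kap / q%:R]) T al| <= C1 * M * X.
  rewrite -(rint_tpoly_period (zbox N d) u P (kap := kap)); last lra.
  have CX : 0 <= C1 * M * X by rewrite mulr_ge0// mulr_ge0.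
  apply: (arcs_decomposition k0 kG cT CX).
  move=> al _ sep; rewrite /X mulrA; exact: hC1 hw L Y l c P N Y1 YL hP sN al sep.
(* One denominator: the first summand comes from replacing lattice sums by integrals, the second
   from completing the truncated integral over [[- Gam, Gam]] to the whole line. *)
have E2 q : (0 < q < G)%N ->
   `|\sum_(a < q | coprime a q) \int[mu]_(al in `[a%:R / q%:R - kap / q%:R, a%:R / q%:R + kap / q%:R]) T al
     - L ^+ (d - 2) * H * g q| <=
   2 * kap * (C3 * M * 2 ^+ K.+1) + C4 * C2 * M * (Num.sqrt 8 * Num.sqrt L * Num.sqrt Y) ^+ (d - 2).
  move=> /andP[q0 qG].
  have q1 : 0 < q%:R :> R by rewrite ltr0n.
  have qLY : q%:R <= L / Y.
    apply: (@le_trans _ _ (Num.truncn (L / Y))%:R); first by rewrite ler_nat.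
    by rewrite truncn_le; rewrite divr_ge0 ?ltW.
  have qL : q%:R <= L by apply: le_trans qLY _; rewrite ler_pdivrMr// ler_peMr// ltW.
  pose Gam := L ^+ 2 * (kap / q%:R).
  have Gam0 : 0 < Gam by rewrite mulr_gt0 ?exprn_gt0// divr_gt0.
  pose J := \int[mu]_(g in `[- Gam, Gam]) osc w f g 0.
  pose c0 := q%:R * L ^+ d * (C3 * M * (2 / Y) ^+ K.+1).
  pose Th (a : nat) (g : R) : R := T ((a%:R / q%:R : R) + g / L ^+ 2).
  have cTh a : continuous (Th a).
    move=> x; apply: (@continuous_comp _ _ _ (fun x : R => a%:R / q%:R + x / L ^+ 2) T); last exact: cT.
    apply: (@continuousD _ _ _ (fun _ : R => a%:R / q%:R : R) (fun x : R => x / L ^+ 2)); first exact: cst_continuous.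
    by apply: (@continuousM _ _ id (fun=> (L ^+ 2)^-1)); [exact: cvg_id|exact: cst_continuous].
  have hsum : \sum_(a < q | coprime a q) \int[mu]_(al in `[a%:R / q%:R - kap / q%:R, a%:R / q%:R + kap / q%:R]) T al
     = (L ^+ 2)^-1 * \int[mu]_x (\sum_(a < q | coprime a q) \1_[set x | - Gam <= x <= Gam] x * Th a x).
    rewrite rint_sum; last by move=> a; exact: Int_on.
    rewrite mulr_sumr; apply: eq_bigr => a _; rewrite -rint_on.
    by apply: rint_tpoly_scale; rewrite ?exprn_gt0// divr_ge0// ltW.
  have iS : Int mu (fun x => \sum_(a < q | coprime a q) \1_[set x | - Gam <= x <= Gam] x * Th a x).
    by apply: Int_sum => a; exact: Int_on.
  have iJ : Int mu (fun x => (L / q%:R) ^+ d * Gsum (qpoly A t0) q * (\1_[set x | - Gam <= x <= Gam] x * osc w f x 0)).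
    by apply: IntZ; exact: Int_restrict.
  have GG : - Gam <= Gam by apply: (@le_trans _ _ 0); rewrite ?oppr_le0 ltW.
  have B1 : `|\int[mu]_x (\sum_(a < q | coprime a q) \1_[set x | - Gam <= x <= Gam] x * Th a x) -
       (L / q%:R) ^+ d * Gsum (qpoly A t0) q * J| <= c0 * (Gam - - Gam).
    rewrite -(rint_itv_cst c0 GG) rint_on /J rint_on -rintZ; last exact: Int_restrict.
    rewrite -RintegralB//; apply: rint_abs; first exact: IntB.
      by apply: (@Int_on _ _ _ (fun=> c0)); exact: cst_continuous.
    move=> x; rewrite mulrCA -mulr_sumr -mulrBr normrM ger0_norm; last by rewrite indicE; case: (_ \in _).
    rewrite indicE; have [/set_mem /= hx|_] := boolP (x \in _); last by rewrite !mul0r.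
    rewrite !mul1r; have hmaj := major_arc (x : R) eA lr r00 hw Kp L1 q0 qL hP sN; apply: le_trans hmaj _.
    rewrite /c0; apply: ler_wpM2l; first by rewrite mulr_ge0// exprn_ge0// ltW.
    apply: ler_wpM2l; first by rewrite mulr_ge0.
    have hx' : `|x| <= Gam by rewrite ler_norml.
    apply: lerXn2r; rewrite ?nnegrE ?mulr_ge0 ?invr_ge0 ?addr_ge0 ?(ltW L0) ?(ltW Y0)//.
    apply: (@le_trans _ _ (q%:R / L * (1 + Gam))).
      by apply: ler_wpM2l; rewrite ?divr_ge0 ?(ltW L0)// lerD2l.
    have -> : q%:R / L * (1 + Gam) = q%:R / L + (8 * Y)^-1.
      by rewrite /Gam /kap /arc_radius; field; rewrite !gt_eqF.
    have h1 : q%:R / L <= Y^-1 by rewrite ler_pdivrMr// mulrC.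
    have h2 : (8 * Y)^-1 <= Y^-1 by rewrite lef_pV2 ?posrE ?mulr_gt0// ler_peMl ?ler1n// ltW.
    have -> : 2 / Y = Y^-1 + Y^-1 by ring.
    exact: lerD.
  have B2 := hTail Gam Gam0; rewrite -/J in B2.
  set SI := \int[mu]_x _ in hsum B1.
  rewrite hsum.
  have -> : (L ^+ 2)^-1 * SI - L ^+ (d - 2) * H * g q =
     (L ^+ 2)^-1 * (SI - (L / q%:R) ^+ d * Gsum (qpoly A t0) q * J) + L ^+ (d - 2) * g q * (J - H).
    have Ld : L ^+ d = L ^+ (d - 2) * L ^+ 2 by rewrite -exprD subnK.
    have e1 : (L / q%:R) ^+ d * Gsum (qpoly A t0) q = L ^+ 2 * (L ^+ (d - 2) * g q).
      by rewrite expr_div_n Ld /g; ring.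
    by rewrite e1; field; rewrite gt_eqF.
  have L20 : 0 < (L ^+ 2)^-1 by rewrite invr_gt0 exprn_gt0.
  apply: le_trans (ler_normD _ _) _; apply: lerD.
    rewrite normrM (gtr0_norm L20); apply: le_trans (ler_wpM2l (ltW L20) B1) _.
    have Yk : 0 < Y ^+ K.+1 by rewrite exprn_gt0.
    have -> : (L ^+ 2)^-1 * (c0 * (Gam - - Gam)) = 2 * kap * (C3 * M * 2 ^+ K.+1) * (L ^+ d / Y ^+ K.+1).
      rewrite /c0 /Gam expr_div_n.
      by move: (Y ^+ K.+1) (L ^+ d) (2 ^+ K.+1 : R) Yk => y x z y0; field; rewrite !gt_eqF.
    apply: ler_piMr; last by rewrite ler_pdivrMr// mul1r.
    by nng.
  rewrite (normrM (_ * g q)) (normrM (L ^+ (d - 2))) (@ger0_norm _ (L ^+ (d - 2))) ?exprn_ge0 ?(ltW L0)//.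
  rewrite -(major_tail_power Y1 YL q0 d2) -/kap -/Gam distrC.
  have -> : C4 * C2 * M * (L ^+ (d - 2) * (q%:R / @sqrtn R q ^+ d) / Num.sqrt Gam ^+ (d - 2)) =
     L ^+ (d - 2) * (C4 * (q%:R / @sqrtn R q ^+ d)) * (C2 * M / Num.sqrt Gam ^+ (d - 2)) by ring.
  apply: ler_pM => //; first by rewrite mulr_ge0// exprn_ge0// ltW.
  apply: ler_wpM2l; first by rewrite exprn_ge0// ltW.
  exact: Gsum_bound.
have H0 : `|H| <= C5 * M := hC5 M B w D hw l c.
(* Completion of the singular series, with [series_tail_power] for the exponents. *)
have E3 : `|L ^+ (d - 2) * H * \sum_(1 <= q < G) g q - L ^+ (d - 2) * H * @singular_sum R n A t0| <=
    4 * C4 * C5 * M * X.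
  rewrite -mulrBr normrM distrC.
  have hS := @singular_sum_tail R n A eA detA d5 t0 _ (ltn0Sn (Num.truncn (L / Y))).
  rewrite -/(farey_order L Y) -/G in hS.
  have LH : `|L ^+ (d - 2) * H| <= L ^+ (d - 2) * (C5 * M).
    rewrite normrM ger0_norm ?exprn_ge0 ?(ltW L0)//; apply: ler_wpM2l => //.
    by rewrite exprn_ge0// ltW.
  apply: le_trans (ler_pM _ _ LH hS) _ => //.
  rewrite /Gtail -/C4.
  have -> : L ^+ (d - 2) * (C5 * M) * (4 * C4 * (G%:R ^+ 2 / @sqrtn R G ^+ d)) =
    (4 * C4 * C5 * M) * (L ^+ (d - 2) * (G%:R ^+ 2 / @sqrtn R G ^+ d)) by ring.
  apply: ler_wpM2l; last exact: series_tail_power.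
  by rewrite !mulr_ge0.
set S0 := \sum_(b <- zbox N d | P b == 0) u b in E1 *.
set S1 := \sum_(1 <= q < G) \sum_(a < q | coprime a q) _ in E1.
(* Summation over at most [L / Y] denominators. The bound in [E2] does not depend on q, since the
   size [q^(1-d/2)] of the Gauss sums cancels against the growth [q^((d-2)/2)] of the tail beyond
   [Gam]. *)
have E4 : `|S1 - L ^+ (d - 2) * H * \sum_(1 <= q < G) g q| <= 
   C3 * 2 ^+ K.+1 * M * X + C4 * C2 * Num.sqrt 8 ^+ (d - 2) * M * X.
  rewrite mulr_sumr /S1 -sumrB big_nat_cond.
  apply: le_trans (ler_norm_sum _ _ _) _.
  set E := 2 * kap * _ + _ in E2.
  apply: (@le_trans _ _ (\sum_(1 <= q < G | (1 <= q < G)%N && true) E)).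
    by apply: ler_sum => q /andP[hq _]; exact: E2.
  rewrite -big_nat_cond sumr_const_nat -[leLHS]mulr_natl subn1 /G /farey_order /=.
  have E0 : 0 <= E.
    by have s1 := sqrtr_ge0 L; have s2 := sqrtr_ge0 Y; rewrite /E; nng.
  have x0 : 0 <= L / Y by rewrite divr_ge0 ?ltW.
  have hx : (Num.truncn (L / Y))%:R <= L / Y by rewrite truncn_le.
  apply: le_trans (ler_wpM2r E0 hx) _; rewrite /E mulrDr; apply: lerD.
    have -> : L / Y * (2 * kap * (C3 * M * 2 ^+ K.+1)) = C3 * 2 ^+ K.+1 * M * ((4 * Y ^+ 2)^-1).
      by rewrite /kap /arc_radius; field; rewrite !gt_eqF.
    apply: ler_wpM2l; first by nng.
    apply: (@le_trans _ _ 1).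
      by rewrite invf_le1 ?mulr_gt0 ?exprn_gt0//; have : 1 <= Y ^+ 2 by [rewrite exprn_ege1|]; lra.
    have l1 : 1 <= Num.sqrt L by rewrite -[leLHS]sqrtr1 ler_wsqrtr.
    by rewrite -[leLHS]mulr1 /X; apply: ler_pM; rewrite ?exprn_ege1.
  have -> : L / Y * (C4 * C2 * M * (Num.sqrt 8 * Num.sqrt L * Num.sqrt Y) ^+ (d - 2)) =
    C4 * C2 * Num.sqrt 8 ^+ (d - 2) * M * (Num.sqrt L ^+ d * (Num.sqrt Y ^+ (d - 2) / Y)).
    have -> : Num.sqrt L ^+ d = Num.sqrt L ^+ (d - 2) * L.
      by rewrite -{1}(subnK d2) exprD sqr_sqrtr// ltW.
    by rewrite !exprMn; ring.
  apply: ler_wpM2l; first by nng.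
  rewrite /X; apply: ler_wpM2l; first by rewrite exprn_ge0// sqrtr_ge0.
  rewrite ler_pdivrMr// -exprSr -[X in _ <= X ^+ _](sqr_sqrtr (ltW Y0)) -exprM.
  have y1 : 1 <= Num.sqrt Y by rewrite -[leLHS]sqrtr1 ler_wsqrtr.
  rewrite ler_weXn2l// (leq_trans (leq_subr 2 d))// mul2n -addnn.
  exact: leq_trans (leqnSn _) (leq_addr _ _).
set S2 := L ^+ (d - 2) * H * \sum_(1 <= q < G) g q in E3 E4.
set S3 := L ^+ (d - 2) * H * _ in E3 *.
have -> : S0 - S3 = (S0 - S1) + (S1 - S2) + (S2 - S3) by ring.
apply: le_trans (ler_normD _ _) _; apply: le_trans (lerD (ler_normD _ _) (lexx _)) _.
apply: le_trans (lerD (lerD E1 E4) E3) _.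
by rewrite -[leRHS]mulrA -/X le_eqVlt; apply/orP; left; apply/eqP; ring.
Qed.

End CircleMethod.

(** * Surface measure *)

Section DensityMeasures.
Local Open Scope ereal_scope.
Context d (T : measurableType d) {R : realType}.
Variable m : {measure set T -> \bar R}.

Section Density.
Variable k : T -> R.
Hypothesis mk : measurable_fun setT k.
Hypothesis k0 : forall x, (0 <= k x)%R.

(** The two proofs are arguments so that the measure structure can be attached to the term
    itself. *)
Definition dens of measurable_fun setT k & (forall x, (0 <= k x)%R) :=
  fun A : set T => \int[m]_(x in A) (k x)%:E.
Notation nu := (dens mk k0).

Let dens0 : nu set0 = 0.
Proof. exact: integral_set0. Qed.

Let dens_ge0 A : 0 <= nu A.
Proof. by apply: integral_ge0 => x _; rewrite lee_fin. Qed.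

Let dens_sigma_additive : semi_sigma_additive nu.
Proof.
apply: (@semi_sigma_additive_nng_induced _ _ _ m (EFin \o k)); first exact/measurable_EFinP.
by move=> x; rewrite lee_fin.
Qed.

HB.instance Definition _ := isMeasure.Build _ _ _ nu dens0 dens_ge0 dens_sigma_additive.

Import HBNNSimple.

Lemma integral_dens (h : T -> \bar R) : measurable_fun setT h -> (forall x, 0 <= h x) ->
  \int[nu]_x h x = \int[m]_x (h x * (k x)%:E).
Proof.
move=> mh h0; pose h_ := nnsfun_approx measurableT mh.
have kE x : 0 <= (k x)%:E by rewrite lee_fin.
transitivity (limn (fun n => \int[nu]_x (h_ n x)%:E)).
  rewrite -monotone_convergence//.
  - by apply: eq_integral => x _; apply/esym/cvg_lim => //; exact: cvg_nnsfun_approx.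
  - by move=> n; exact/measurable_EFinP/measurable_funP.
  - by move=> n y _; rewrite lee_fin.
  - by move=> y _ a b ab; rewrite lee_fin; exact/lefP/nd_nnsfun_approx.
rewrite [X in limn X](_ : _ = (fun n => \int[m]_x ((h_ n x)%:E * (k x)%:E))).
  rewrite -monotone_convergence//; last 3 first.
    - move=> n; apply: emeasurable_funM; last exact/measurable_EFinP.
      exact/measurable_EFinP/measurable_funP.
    - by move=> n x _ /=; rewrite mule_ge0// lee_fin.
    - by move=> x _ a b ab; rewrite lee_wpmul2r// lee_fin; exact/lefP/nd_nnsfun_approx.
  apply: eq_integral => x _; apply/cvg_lim => //.
  by apply: cvgeZr => //; exact: cvg_nnsfun_approx.
apply/funext => n.
have mi r : measurable_fun setT (fun x => (r * \1_(h_ n @^-1` [set r]) x)%R).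
  by apply: measurable_funM => //; exact: measurable_indic.
transitivity (\sum_(r \in range (h_ n)) \int[m]_x ((r * \1_(h_ n @^-1` [set r]) x)%:E * (k x)%:E)).
  under eq_integral do rewrite fimfunE -fsumEFin//.
  rewrite ge0_integral_fsum//; last 2 first.
  - by move=> r; exact/measurable_EFinP.
  - by move=> r x _; rewrite nnfun_muleindic_ge0.
  apply: eq_fsbigr => r; rewrite inE => -[x _ <-].
  rewrite integralZl_indic_nnsfun// integral_indic// setIT.
  rewrite [X in _ * X = _](_ : _ = \int[m]_(x in h_ n @^-1` [set h_ n x]) (k x)%:E)//.
  rewrite integral_mkcond -ge0_integralZl//; last 3 first.
  - apply/(measurable_restrict _ _ _) => //; apply: measurable_funTS; exact/measurable_EFinP.
  - by move=> y _; rewrite patchE; case: ifP.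
  - by rewrite lee_fin.
  apply: eq_integral => y _; rewrite patchE indicE.
  by case: (y \in _); rewrite ?mulr1 ?mulr0 ?mule0 ?mul0e.
rewrite -ge0_integral_fsum//.
- apply: eq_integral => x _; rewrite -ge0_mule_fsuml; last by move=> r; rewrite nnfun_muleindic_ge0.
  by rewrite fsumEFin// -fimfunE.
- by move=> r; apply: emeasurable_funM; exact/measurable_EFinP.
- by move=> r x _; rewrite mule_ge0// nnfun_muleindic_ge0.
Qed.

End Density.

Import HBNNSimple.

(** An integral is built from suprema over simple functions, whose level sets are measurable; so two
    set functions agreeing on measurable sets have the same integrals, even if one of them is no
    measure. *)
Lemma raw_integral_eq (m1 m2 : set T -> \bar R) D (f : T -> \bar R) :
  (forall A, measurable A -> m1 A = m2 A) -> \int[m1]_(x in D) f x = \int[m2]_(x in D) f x.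
Proof.
move=> mm; rewrite /integral; congr (_ - _); congr ereal_sup; apply/seteqP; split=> _ /= [h hf <-];
  exists h => //; rewrite /sintegral; apply: eq_fsbigr => r _; rewrite mm//; exact: (measurable_funPTI h).
Qed.

(** Works with the supremum over simple functions below [f], each of which vanishes off [N]; it is
    used for the sums over points of a surface piece, for which no measurability is at hand. *)
Lemma raw_integral_null (N : set T) (f : T -> \bar R) : measurable N -> m N = 0 ->
  (forall x, 0 <= f x) -> (forall x, ~ N x -> f x = 0) -> \int[m]_x f x = 0.
Proof.
move=> mN N0 f0 fN; rewrite ge0_integralTE//; apply/eqP; rewrite eq_le; apply/andP; split; last first.
  by apply: ereal_sup_ubound; exists nnsfun0; rewrite ?sintegral0//= => x; exact: f0.
apply: ge_ereal_sup => _ [h /= hf <-].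
rewrite -integralT_nnsfun -[leRHS](integral0 m setT).
apply: ae_ge0_le_integral => //.
- by move=> x _; rewrite lee_fin.
- by apply/measurable_EFinP.
exists N; split=> // x /= hx; apply: contrapT => Nx; apply: hx => _.
by rewrite -(fN x Nx); exact: hf.
Qed.

End DensityMeasures.

Section SurfaceMeasure.
Context {R : realType} {n : nat}.
Notation d := n.+1.
Notation V := 'cV[R]_d.
Variables (A : 'M[int]_d) (l : V) (c : R).
Hypothesis symA : A^T = A.
Hypothesis detA : \det A != 0.
Notation f := (qf A l c).

Lemma qf_line z j s : f (z + s *: delta_mx j 0) = f z + s * qg A l j z + s ^+ 2 * qh A j.
Proof. by have [C [_ [_ fE _ _ _]]] := quadf_any l c symA. Qed.

Lemma pd_qf i z : pd i f z = qg A l i z.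
Proof.
have h0 : (fun h : R => qg A l i z + h * qh A i) @ 0^' --> qg A l i z.
  have cg : {for 0, continuous (fun h : R => qg A l i z + h * qh A i)}.
    apply: (@continuousD _ _ _ (fun=> qg A l i z) (fun h : R => h * qh A i)); first exact: cst_continuous.
    by apply: (@continuousM _ _ id (fun=> qh A i)); [exact: cvg_id|exact: cst_continuous].
  have h : (fun h : R => qg A l i z + h * qh A i) @ (0 : R) --> qg A l i z.
    by have := cg; rewrite /prop_for /continuous_at mul0r addr0.
  by apply: cvg_within_filter; exact: h.
apply: cvg_lim => //; apply: cvg_trans h0; apply: near_eq_cvg.
near=> h; have hn0 : h != 0 by near: h; exact: nbhs_dnbhs_neq.
have -> : (f \o shift z) (h *: delta_mx i 0) = f (z + h *: delta_mx i 0) by rewrite /= addrC.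
by rewrite qf_line /GRing.scale /=; field.
Unshelve. all: by end_near. Qed.

Lemma grad_qf z : grad f z = \col_i qg A l i z.
Proof. by apply/matrixP => i j; rewrite !mxE pd_qf. Qed.

Lemma density_grad i z : qg A l i z != 0 ->
  graph_density f i z = enorm (grad f z) / `|qg A l i z|.
Proof.
move=> g0; have g20 : 0 < qg A l i z ^+ 2 by rewrite exprn_even_gt0.
rewrite /graph_density /enorm -sqrtr_sqr -sqrtrV ?sqr_ge0// -sqrtrM; last first.
  by apply: sumr_ge0 => j _; rewrite -expr2 sqr_ge0.
congr Num.sqrt; rewrite [in RHS]/dot [in RHS](bigD1 i)//= mulrDl grad_qf mxE -expr2 divff ?gt_eqF//; congr (_ + _).
rewrite mulr_suml; apply: eq_bigr => j _; rewrite !pd_qf mxE.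
by rewrite expr_div_n expr2.
Qed.

Lemma insert0 y (s : R) : @insert R d 0 y s = consv (s, y).
Proof.
apply/matrixP => i j; rewrite ord1 /insert [LHS]mxE; case: (unliftP 0 i) => [k|] ->; first by rewrite consvS.
by rewrite consv0.
Qed.

Lemma roots_piece y s : graph_piece f 0 (consv (s, y)) <-> s \in yroots A l c y.
Proof.
rewrite /graph_piece /zero_set /= pd_qf (f_line l c symA) (x_line l c symA).
split=> [[h1 [h2 _]]|/sroots_mem[h1 h2]]; first by apply/sroots_mem.
by split=> //; split.
Qed.

(** The roots by the quadratic formula, hence measurable in y. If the leading coefficient is 0 the
    formulas for both branches coincide, and [valid] keeps only [true]. *)
Definition rt (b : bool) (y : 'cV[R]_n) : R :=
  if (qh A 0 : R) == 0 then - ccoef A l c y / lcoef A l y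
  else (- lcoef A l y + (if b then 1 else - 1) * Num.sqrt (disc A l c y)) / (2 * qh A 0).

Definition valid (b : bool) (y : 'cV[R]_n) : bool :=
  if (qh A 0 : R) == 0 then b && (lcoef A l y != 0) else 0 < disc A l c y.

Lemma yroots_branches (G : R -> R) y : \sum_(s <- yroots A l c y) G s =
  (valid true y)%:R * G (rt true y) + (valid false y)%:R * G (rt false y).
Proof.
rewrite /yroots /sroots /valid /rt -/(disc A l c y); case: eqP => _ /=.
  by case: eqP => _; rewrite ?big_nil ?big_seq1 /= ?mul0r ?mul1r ?addr0.
case: ifP => _; last by rewrite big_nil !mul0r addr0.
by rewrite big_cons big_seq1 /= !mul1r mulN1r addrC.
Qed.

(** The inverse is the pointwise limit of [x / (x^2 + 1/(k+1))] also at 0, where both sides are 0 by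
    the convention for division by zero. *)
Lemma measurable_inv : measurable_fun setT (fun x : R => x^-1).
Proof.
have ck k : continuous (fun x : R => x / (x ^+ 2 + (k.+1%:R)^-1)).
  move=> x; apply: (@continuousM _ _ id (fun x : R => (x ^+ 2 + (k.+1%:R)^-1)^-1)); first exact: cvg_id.
  apply: (@continuousV _ _ (fun x : R => x ^+ 2 + (k.+1%:R)^-1)).
    by rewrite gt_eqF// ltr_wpDl ?sqr_ge0// invr_gt0.
  by apply: (@continuousD _ _ _ (fun x : R => x ^+ 2) (fun=> (k.+1%:R)^-1)); [exact: exprn_continuous|exact: cst_continuous].
apply: (@measurable_fun_cvg _ (measurableTypeR R) R setT (fun k (x : R) => x / (x ^+ 2 + (k.+1%:R)^-1)) (fun x => x^-1)).
  by move=> k; apply: continuous_measurable_fun.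
move=> x _; have [->|x0] := eqVneq x 0.
  by rewrite invr0; under eq_fun do rewrite mul0r; exact: cvg_cst.
have x20 : x ^+ 2 != 0 by rewrite expf_neq0.
rewrite [X in _ --> X](_ : _ = x / (x ^+ 2 + 0)); last by rewrite addr0; field.
apply: cvgM; first exact: cvg_cst.
apply: cvgV; first by rewrite addr0.
by apply: cvgD; [exact: cvg_cst|exact: cvg_harmonic].
Qed.

Lemma measurable_fun_inv d' (T : measurableType d') (g : T -> R) : measurable_fun setT g ->
  measurable_fun setT (fun x => (g x)^-1).
Proof. by move=> mg; apply: (measurableT_comp measurable_inv). Qed.

Lemma measurable_fun_sqrt d' (T : measurableType d') (g : T -> R) : measurable_fun setT g ->
  measurable_fun setT (fun x => Num.sqrt (g x)).
Proof.
have ms : measurable_fun setT (Num.sqrt : R -> R).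
  by apply: continuous_measurable_fun; exact: sqrt_continuous.
exact: measurableT_comp ms.
Qed.

Let cconsv : continuous (fun y : 'cV[R]_n => consv (0, y)). Proof. exact: continuous_consv1. Qed.

Lemma measurable_lcoef : measurable_fun setT (lcoef A l : @borel R n -> R).
Proof.
apply: measurable_continuousR => y; apply: (@continuous_comp _ _ _ (fun y => consv (0, y)) (qg A l 0)).
  exact: cconsv.
exact: continuous_x.
Qed.

Lemma measurable_ccoef : measurable_fun setT (ccoef A l c : @borel R n -> R).
Proof.
apply: measurable_continuousR => y; apply: (@continuous_comp _ _ _ (fun y => consv (0, y)) f).
  exact: cconsv.
exact: continuous_qf.
Qed.

Lemma measurable_disc : measurable_fun setT (disc A l c : @borel R n -> R).
Proof.
apply: measurable_funB; first by apply: measurable_funX; exact: measurable_lcoef.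
by apply: measurable_funM => //; exact: measurable_ccoef.
Qed.

Lemma measurable_rt b : measurable_fun setT (rt b : @borel R n -> R).
Proof.
rewrite /rt; case: eqP => _; apply: measurable_funM => //.
- by apply: measurableT_comp => //; exact: measurable_ccoef.
- by apply: measurable_fun_inv; exact: measurable_lcoef.
apply: measurable_funD; first by apply: measurableT_comp => //; exact: measurable_lcoef.
by apply: measurable_funM => //; apply: measurable_fun_sqrt; exact: measurable_disc.
Qed.

Lemma measurable_valid b : measurable_fun setT ((fun y => (valid b y)%:R) : @borel R n -> R).
Proof.
have mb (v : @borel R n -> bool) : measurable_fun setT v -> measurable_fun setT (fun y => (v y)%:R : R).
  move=> mv; rewrite (_ : (fun y => _) = (fun y => \1_(v @^-1` [set true]) y)).
    by apply: measurable_indic; rewrite -[X in measurable X]setTI; exact: mv.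
  apply/funext => y; rewrite indicE; congr (nat_of_bool _)%:R.
  by case: (boolP (v y)) => vy; [rewrite mem_set|rewrite memNset//= (negPf vy)].
apply: mb; rewrite /valid; case: eqP => _; last by apply: measurable_fun_ltr => //; exact: measurable_disc.
case: b => //=; apply: measurable_neg.
by apply: measurable_fun_eqr => //; exact: measurable_lcoef.
Qed.

Definition root_point (b : bool) (y : 'cV[R]_n) : V := consv (rt b y, y).

Lemma measurable_root_point b :
  measurable_fun setT (root_point b : @borel R n -> @borel R d).
Proof.
apply: (measurableT_comp (@measurable_consv R n)).
by apply: measurable_fun_pair; [exact: measurable_rt|exact: measurable_id].
Qed.

(** The area element [|grad f| / |d_0 f|] of the graph of the branch, set to 0 where the branch does
    not exist. *)
Definition root_weight (b : bool) (y : 'cV[R]_n) : R :=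
  (valid b y)%:R * enorm (grad f (root_point b y)) / `|qg A l 0 (root_point b y)|.

Lemma measurable_enorm_grad : measurable_fun setT ((fun z => enorm (grad f z)) : @borel R d -> R).
Proof.
apply: measurable_fun_sqrt; apply: measurable_sum => j.
have mj : measurable_fun setT ((fun z => grad f z j 0) : @borel R d -> R).
  rewrite (_ : (fun z => _) = (fun z => qg A l j z)); last by apply/funext => z; rewrite grad_qf mxE.
  apply: measurable_continuousR; rewrite (_ : qg A l j = (fun z => dot (\col_k (A j k)%:~R) z + l j 0)).
    by move=> z; apply: (@continuousD _ _ _ (dot (\col_k (A j k)%:~R))); [exact: continuous_dot|exact: cst_continuous].
  by apply/funext => z; rewrite /qg mxE; congr (_ + _); apply: eq_bigr => k _; rewrite !mxE.
exact: measurable_funM.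
Qed.

Lemma measurable_root_weight b : measurable_fun setT (root_weight b : @borel R n -> R).
Proof.
apply: measurable_funM; first apply: measurable_funM.
- exact: measurable_valid.
- exact: (measurableT_comp measurable_enorm_grad (measurable_root_point b)).
apply: measurable_fun_inv; apply: measurableT_comp => //.
apply: (measurableT_comp _ (measurable_root_point b)).
by apply: measurable_continuousR; exact: continuous_x.
Qed.

Lemma root_weight_ge0 b y : 0 <= root_weight b y.
Proof. by rewrite /root_weight !mulr_ge0// ?sqrtr_ge0// invr_ge0. Qed.

Definition branch_measure (b : bool) : set (@borel R d) -> \bar R :=
  fun E => dens (lebm n) (measurable_root_weight b) (root_weight_ge0 b) (root_point b @^-1` E).

Let branch0 b : branch_measure b set0 = 0%E.
Proof. by rewrite /branch_measure preimage_set0 measure0. Qed.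

Let branch_ge0 b E : (0 <= branch_measure b E)%E.
Proof. exact: measure_ge0. Qed.

Let branch_sigma_additive b : semi_sigma_additive (branch_measure b).
Proof.
have mr (E : set (@borel R d)) : measurable E -> measurable (root_point b @^-1` E : set (@borel R n)).
  by move=> mE; rewrite -[X in measurable X]setTI; exact: measurable_root_point.
move=> F mF tF mUF; rewrite /branch_measure preimage_bigcup.
apply: measure_semi_sigma_additive.
- by move=> i; exact: mr.
- apply/trivIsetP => /= i j _ _ ij; rewrite -preimage_setI.
  by move/trivIsetP : tF => /(_ _ _ _ _ ij) ->//; rewrite preimage_set0.
- by rewrite -preimage_bigcup; exact: mr.
Qed.

HB.instance Definition _ b := isMeasure.Build _ _ _ (branch_measure b)
  (branch0 b) (@branch_ge0 b) (@branch_sigma_additive b).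

Lemma integral_branch b (g : V -> R) : measurable_fun setT (g : @borel R d -> R) -> (forall z, 0 <= g z) ->
  (\int[branch_measure b]_z (g z)%:E = \int[lebm n]_y (g (root_point b y) * root_weight b y)%:E)%E.
Proof.
move=> mg g0.
have -> : (\int[branch_measure b]_z (g z)%:E)%E =
   (\int[pushforward (dens (lebm n) (measurable_root_weight b) (root_weight_ge0 b)) (root_point b : @borel R n -> @borel R d)]_z (g z)%:E)%E by [].
rewrite ge0_integral_pushforward//; last 3 first.
- exact: measurable_root_point.
- exact/measurable_EFinP.
- by move=> z _; rewrite lee_fin.
rewrite preimage_setT integral_dens//.
- apply/measurable_EFinP; exact: (measurableT_comp mg (measurable_root_point b)).
- by move=> y; rewrite lee_fin.
Qed.

Lemma insert_lin i (y e : 'cV[R]_n) (t u s : R) :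
  @insert R d i (y + s *: e) (t + s * u) = @insert R d i y t + s *: @insert R d i e u.
Proof.
by apply/matrixP => k j; rewrite !mxE; case: (unlift i k) => [m|]; rewrite ?mxE.
Qed.

Lemma insert_eta i (z : V) : z = @insert R d i (\col_k z (lift i k) 0) (z i 0).
Proof.
by apply/matrixP => k j; rewrite ord1 /insert [RHS]mxE; case: (unliftP i k) => [m|] ->; rewrite ?mxE.
Qed.

Lemma insert_delta i (y : 'cV[R]_n) (s : R) :
  @insert R d i y s = @insert R d i y 0 + s *: delta_mx i 0.
Proof.
have -> : delta_mx i 0 = @insert R d i 0 1 :> V.
  apply/matrixP => k j; rewrite ord1 /insert [RHS]mxE; case: (unliftP i k) => [m|] ->; rewrite !mxE.
    by rewrite eq_sym (negPf (neq_lift _ _)).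
  by rewrite !eqxx.
by rewrite -insert_lin scaler0 addr0 mulr1 add0r.
Qed.

Lemma real_mx_unit : (real_mx A : 'M[R]_d) \in unitmx.
Proof. by rewrite unitmxE /real_mx det_map_mx unitfE intr_eq0. Qed.

(* A quadric containing an affine hyperplane transversal to the i-th axis has a totally
   isotropic space of dimension d - 1, which a nondegenerate form has not for d >= 3. *)
Lemma hyperplane_not_in_quadric (i j : 'I_d) : A 0 i != 0 -> j != 0 -> j != i ->
  ~ forall z, qg A l 0 z = 0 -> f z = 0.
Proof.
move=> ai j0 ji h; pose al := (A 0 i)%:~R : R.
have al0 : al != 0 by rewrite intr_eq0.
have Adelta (k m : 'I_d) : (real_mx A *m (delta_mx m 0 : V)) k 0 = (A k m)%:~R by exact: mulmx_delta.
pose z0 : V := (- l 0 0 / al) *: delta_mx i 0.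
have z0E : qg A l 0 z0 = 0.
  by rewrite /qg -scalemxAr mxE_scale Adelta -/al divfK// addNr.
have iso v : (real_mx A *m v) 0 0 = 0 -> qform A v = 0 :> R.
  move=> v0; have shift s : f (z0 + s *: v) = 0.
    apply: h; have -> : qg A l 0 (z0 + s *: v) = qg A l 0 z0 + s * (real_mx A *m v) 0 0.
      by rewrite /qg mulmxDr -(scalemxAr s) mxE_add mxE_scale; ring.
    by rewrite v0 mulr0 addr0.
  have := shift 1; have := shift (-1); have := shift 0.
  rewrite /qf !qformD// !dotDr !qformZ -!scalemxAr !dotZl !dotZr; lra.
have polar v v' : (real_mx A *m v) 0 0 = 0 -> (real_mx A *m v') 0 0 = 0 -> dot (real_mx A *m v) v' = 0 :> R.
  move=> h1 h2; have := iso (v' + v); rewrite mulmxDr mxE_add h1 h2 addr0 => /(_ erefl).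
  by rewrite qformD// (iso _ h1) (iso _ h2) !add0r.
(* These vectors span the kernel of the zeroth row of A; on it the form vanishes by [iso], and the
   bilinear form by polarisation. *)
pose u (k : 'I_d) : V := al *: delta_mx k 0 - (A 0 k)%:~R *: delta_mx i 0.
have uE (w : V) k : dot w (u k) = al * w k 0 - (A 0 k)%:~R * w i 0 :> R.
  by rewrite /u dotDr -scaleNr !dotZr !dot_delta mulNr.
have u0 k : (real_mx A *m u k) 0 0 = 0.
  rewrite /u mulmxBr -!scalemxAr [LHS]mxE mxE_scale Adelta [X in _ + X]mxE mxE_scale Adelta /al; ring.
(* The vector [A u_j] is orthogonal to all [u k], hence proportional to the zeroth row of A, which
   by symmetry is A applied to the zeroth basis vector. Invertibility then forces a vector to vanish
   whose j-th coordinate is [al^2]. *)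
have hA : real_mx A *m (al *: u j - (real_mx A *m u j) i 0 *: delta_mx 0 0) = 0.
  apply/matrixP => k m; rewrite ord1 mulmxBr -!scalemxAr [LHS]mxE mxE_scale [X in _ + X]mxE mxE_scale Adelta.
  have := polar _ _ (u0 j) (u0 k); rewrite uE => /eqP; rewrite subr_eq0 => /eqP ->.
  have -> : A k 0 = A 0 k by rewrite -{1}symA mxE.
  by rewrite mulrC subrr mxE.
have : al *: u j - (real_mx A *m u j) i 0 *: delta_mx 0 0 = 0.
  by rewrite -[LHS](mulKmx real_mx_unit) hA mulmx0.
move/matrixP/(_ j 0); rewrite !mxE !eqxx (negPf j0) (negPf ji) /= !mulr0 mulr1 !subr0 => /eqP.
by rewrite mulf_eq0 (negPf al0).
Qed.

Lemma quadratic_f : quadratic_fun f.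
Proof.
exists (fun z e => dot (real_mx A *m z) e + dot l e), (fun e => qform A e); split=> [z e s|e].
  by rewrite /qf qformD// qformZ -scalemxAr dotZl dotDr dotZr (dot_mx e z symA) (dotC e); ring.
exists (fun z => dot (real_mx A *m z) e) => z z' s.
by rewrite mulmxDr -scalemxAr dotDl dotZl; ring.
Qed.

(** On a piece with [i != 0] the zeroth partial derivative vanishes, which is an affine equation. If
    it does not involve the i-th coordinate, it confines y to a hyperplane; otherwise it determines
    that coordinate from y, and y lies in the zero set of a quadratic function, nonzero by
    [hyperplane_not_in_quadric]. *)
Lemma piece_null (i : 'I_d) : (3 <= d)%N -> i != 0 -> exists N : set (@borel R n),
  [/\ measurable N, lebm n N = 0%E & forall y s, graph_piece f i (@insert R d i y s) -> N y].
Proof.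
move=> d3 i0; pose g (y : 'cV[R]_n) := qg A l 0 (@insert R d i y 0).
have gE y s : qg A l 0 (@insert R d i y s) = g y + s * (A 0 i)%:~R.
  by rewrite insert_delta /g /qg mulmxDr -scalemxAr mxE_add mxE_scale mulmx_delta; ring.
have i1 : (0 < i)%N by rewrite lt0n.
have piece0 y s : graph_piece f i (@insert R d i y s) -> g y + s * (A 0 i)%:~R = 0 /\ f (@insert R d i y s) = 0.
  by move=> [h1 [_ h2]]; split=> //; rewrite -gE -pd_qf; exact: h2.
have Tlin t y e s : @insert R d i (y + s *: e) t = @insert R d i y t + s *: @insert R d i e 0.
  by rewrite -insert_lin mulr0 addr0.
have ag : affine_fun g by exact: (affine_comp (Tlin 0) (affine_x A l)).
have cins (t : 'cV[R]_n -> R) : continuous t -> continuous (fun y => @insert R d i y (t y)).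
  move=> ct; apply: continuous_mx => k j; case: (unliftP i k) => [m|] ->.
    rewrite (_ : (fun z => _) = (fun z : 'cV[R]_n => z m 0)); first exact: continuous_coord.
    by apply/funext => z; rewrite /insert mxE liftK.
  rewrite (_ : (fun z => _) = t)//; by apply/funext => z; rewrite /insert mxE unlift_none.
have cg : continuous g.
  move=> y; apply: (@continuous_comp _ _ _ (fun y => @insert R d i y 0) (qg A l 0)); last exact: continuous_x.
  by apply: (cins (fun=> 0)); exact: cst_continuous.
have meas0 (q : 'cV[R]_n -> R) : continuous q -> measurable (q @^-1` [set 0] : set (@borel R n)).
  move=> cq; rewrite -[X in measurable X]setTI; exact: (measurable_continuousR cq).
have [Ai|Ai] := eqVneq (A 0 i) 0.
  exists (g @^-1` [set 0]); split; first exact: meas0.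
    apply: lebm_zero_set; [exact: affine_quadratic|exact: measurable_continuousR|].
    have [z hz] := x_neq0 l detA; exists (\col_k z (lift i k) 0).
    have := gE (\col_k z (lift i k) 0) (z i 0); rewrite -insert_eta Ai mulr0 addr0 => <-; exact: hz.
  by move=> y s /piece0[]; rewrite Ai mulr0 addr0.
have al0 : (A 0 i)%:~R != 0 :> R by rewrite intr_eq0.
pose sy (y : 'cV[R]_n) := - g y / (A 0 i)%:~R.
pose T y := @insert R d i y (sy y).
have [k hk] := ag.
have TT y e s : T (y + s *: e) = T y + s *: @insert R d i e (- k e / (A 0 i)%:~R).
  by rewrite /T -insert_lin /sy hk; congr (@insert R d i _ _); field.
have csy : continuous sy.
  move=> y; apply: (@continuousM _ _ (fun y => - g y) (fun=> ((A 0 i)%:~R)^-1)); last exact: cst_continuous.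
  by apply: (@continuousN _ _ _ g); exact: cg.
have cq : continuous (f \o T).
  move=> y; apply: (@continuous_comp _ _ _ T f); [exact: cins|exact: continuous_qf].
exists ((f \o T) @^-1` [set 0]); split; first exact: meas0.
  apply: lebm_zero_set; [exact: (quadratic_comp TT quadratic_f)|exact: measurable_continuousR|].
  apply: contrapT => hn.
  have [j [j0 ji]] : exists j : 'I_d, j != 0 /\ j != i.
    have [i2|i2] := eqVneq (val i) 1%N.
      by exists (Ordinal d3); split=> //; rewrite -val_eqE /= i2.
    by exists (Ordinal (ltnW d3)); split=> //; rewrite -val_eqE /= eq_sym.
  apply: (hyperplane_not_in_quadric Ai j0 ji) => z hz; apply/eqP; apply: contrapT => /negP hf.
  apply: hn; exists (\col_k z (lift i k) 0).
  have := gE (\col_k z (lift i k) 0) (z i 0); rewrite -insert_eta hz => /eqP; rewrite eq_sym addr_eq0 => /eqP e.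
  by rewrite /= /T /sy e opprK mulfK// -insert_eta.
move=> y s /piece0[h1 h2]; rewrite /= /T /sy.
by have -> : - g y = s * (A 0 i)%:~R; [apply/eqP; rewrite eq_sym -addr_eq0 addrC; apply/eqP|rewrite mulfK].
Qed.

Lemma esum_seq (r : seq R) (P : set R) (h : R -> R) : uniq r -> (forall s, 0 <= h s) ->
  (\esum_(s in [set s | s \in r /\ P s]) (h s)%:E = (\sum_(s <- r) \1_P s * h s)%:E)%E.
Proof.
move=> ur h0; have -> : [set s | s \in r /\ P s] = [set` [seq s <- r | s \in P]].
  apply/seteqP; split=> s /=; rewrite mem_filter; first by case=> sr /mem_set ->.
  by case/andP => /set_mem hs sr; split.
rewrite (esum_fset (finite_seq _)); last by move=> s _; rewrite lee_fin.
rewrite -fsbig_seq ?filter_uniq// big_filter sumEFin; congr EFin.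
by rewrite big_mkcond; apply: eq_bigr => s _; rewrite indicE; case: (s \in P); rewrite ?mul1r ?mul0r.
Qed.

Lemma valid_root b y : valid b y -> rt b y \in yroots A l c y.
Proof.
rewrite /valid /yroots /sroots /rt -/(disc A l c y); case: eqP => _.
  by case/andP => _ /negPf ->; rewrite inE.
move=> ->; case: b; rewrite !inE.
  by rewrite mul1r eqxx orbT.
by rewrite mulN1r eqxx.
Qed.

Lemma root_point_piece b y : valid b y ->
  f (root_point b y) = 0 /\ `|qg A l 0 (root_point b y)| = Num.sqrt (disc A l c y) /\
  qg A l 0 (root_point b y) != 0.
Proof.
move=> /valid_root hr; have [h1 h2] := sroots_mem _ _ _ _ hr.
rewrite /root_point (f_line l c symA) (x_line l c symA); split=> //; split=> //.
exact: sroots_slope hr.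
Qed.

Lemma root_weight_density b y (g : V -> R) : (valid b y)%:R * (g (root_point b y) * graph_density f 0 (root_point b y)) =
  g (root_point b y) * root_weight b y.
Proof.
case: (boolP (valid b y)) => hv; last by rewrite /root_weight (negPf hv) !mul0r mulr0.
have [_ [_ h]] := root_point_piece hv.
by rewrite /root_weight hv density_grad// !mul1r.
Qed.

(** Only the piece over the zeroth axis has positive measure; its points above y are the simple
    roots, split into the two branches to make the sum measurable. *)
Lemma surface_measureE (E : set (@borel R d)) : (3 <= d)%N -> measurable E ->
  surface_measure f E = (branch_measure true E + branch_measure false E)%E.
Proof.
move=> d3 mE; rewrite /surface_measure big_ord_recl big1 ?adde0; last first.
  move=> i _; have i0 : lift ord0 i != 0 :> 'I_d by [].
  have [N [mN N0 hN]] := piece_null d3 i0.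
  rewrite (raw_integral_eq (m2 := lebm n)); last by move=> S mS; exact: leb_lebm.
  apply: (raw_integral_null mN N0) => y; first by apply: esum_ge0 => s _; rewrite lee_fin sqrtr_ge0.
  move=> Ny; rewrite (_ : [set s | _] = set0) ?esum_set0//.
  by apply/seteqP; split=> s //= [_ /hN].
rewrite (raw_integral_eq (m2 := lebm n)); last by move=> S mS; exact: leb_lebm.
have mrw b : measurable_fun setT ((fun y => \1_E (root_point b y) * root_weight b y) : @borel R n -> R).
  apply: measurable_funM; last exact: measurable_root_weight.
  exact: (measurableT_comp (measurable_indic mE) (measurable_root_point b)).
have rw0 b y : 0 <= \1_E (root_point b y) * root_weight b y.
  by rewrite mulr_ge0// ?root_weight_ge0// indicE; case: (_ \in _).
have bE b : branch_measure b E = (\int[lebm n]_y (\1_E (root_point b y) * root_weight b y)%:E)%E.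
  rewrite /branch_measure /dens integral_mkcond; apply: eq_integral => y _.
  rewrite patchE indicE; have -> : (y \in root_point b @^-1` E) = (root_point b y \in E) by apply/idP/idP; rewrite !inE.
  by case: (_ \in E); rewrite ?mul1r ?mul0r.
rewrite !bE -ge0_integralD//; last 4 first.
- by move=> y _; rewrite lee_fin; exact: rw0.
- by apply/measurable_EFinP; exact: mrw.
- by move=> y _; rewrite lee_fin; exact: rw0.
- by apply/measurable_EFinP; exact: mrw.
apply: eq_integral => y _.
have -> : [set s | (E `&` graph_piece f ord0) (@insert R d ord0 y s)] =
    [set s | s \in yroots A l c y /\ [set s | E (consv (s, y))] s].
  apply/seteqP; split=> s; rewrite /setI /= -/(@insert R d 0 y s) insert0.
    by move=> [h1 /roots_piece h2].
  by move=> [h1 h2]; split=> //; apply/roots_piece.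
have -> : (\esum_(s in [set s | s \in yroots A l c y /\ [set s | E (consv (s, y))] s])
    (graph_density f ord0 (@insert R d ord0 y s))%:E =
   \esum_(s in [set s | s \in yroots A l c y /\ [set s | E (consv (s, y))] s])
    (graph_density f 0 (consv (s, y)))%:E)%E.
  by apply: eq_esum => s _; rewrite -/(@insert R d 0 y s) insert0.
rewrite (@esum_seq _ _ (fun s => graph_density f 0 (consv (s, y))) (sroots_uniq _ _ _)); last first.
  by move=> s; exact: sqrtr_ge0.
rewrite -EFinD; congr EFin; rewrite yroots_branches.
by congr (_ + _); exact: (root_weight_density _ y (\1_E)).
Qed.

Lemma measurable_zero_indic : measurable_fun setT ((fun z => (f z == 0)%:R) : @borel R d -> R).
Proof.
rewrite (_ : (fun z => _) = \1_(f @^-1` [set 0])).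
  apply: measurable_indic; rewrite -[X in measurable X]setTI.
  exact: (measurable_continuousR (@continuous_qf _ _ A l c)).
by apply/funext => z; rewrite eq0_indic.
Qed.

Let gsig (w : V -> R) (z : V) : R := (f z == 0)%:R * (w z / enorm (grad f z)).

Let measurable_gsig w : measurable_fun setT (w : @borel R d -> R) ->
  measurable_fun setT (gsig w : @borel R d -> R).
Proof.
move=> mw; apply: measurable_funM; first exact: measurable_zero_indic.
by apply: measurable_funM => //; apply: measurable_fun_inv; exact: measurable_enorm_grad.
Qed.

Lemma sigma_inftyE w : (3 <= d)%N ->
  sigma_infty w f = (\int[measure_add (branch_measure true) (branch_measure false)]_z (gsig w z)%:E)%E.
Proof.
move=> d3; rewrite /sigma_infty.
rewrite (raw_integral_eq (m2 := measure_add (branch_measure true) (branch_measure false))); last first.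
  by move=> E mE; rewrite surface_measureE// measure_addE.
rewrite integral_mkcond; apply: eq_integral => z _; rewrite patchE.
case: (boolP (z \in _)) => [/set_mem[/= f0 _]|/negP hz].
  by rewrite /gsig f0 eqxx mul1r.
rewrite /gsig; case: eqP => f0; last by rewrite mul0r.
(* At a singular point the integrand has the value 0, because 0 is its own inverse; so the smooth
   part may be replaced by the whole zero set. *)
have -> : grad f z = 0.
  by apply/eqP; apply: contrapT => /negP h; apply: hz; rewrite inE; split.
by rewrite /enorm /dot big1 ?sqrtr0 ?invr0 ?mulr0// => j _; rewrite mxE mul0r.
Qed.

Lemma sigma_infty_fiber w : (3 <= d)%N -> measurable_fun setT (w : @borel R d -> R) -> (forall z, 0 <= w z) ->
  sigma_infty w f = (\int[lebm n]_y (\sum_(s <- yroots A l c y) w (consv (s, y)) / Num.sqrt (disc A l c y))%:E)%E.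
Proof.
move=> d3 mw w0; rewrite sigma_inftyE//.
have g0 z : 0 <= gsig w z by rewrite /gsig mulr_ge0// divr_ge0// sqrtr_ge0.
have mg := measurable_gsig mw.
rewrite ge0_integral_measure_add//; last 2 first.
- by move=> z _; rewrite lee_fin.
- exact/measurable_EFinP.
pose u b y := gsig w (root_point b y) * root_weight b y.
have mu b : measurable_fun setT (EFin \o u b : @borel R n -> \bar R).
  apply/measurable_EFinP; apply: measurable_funM; last exact: measurable_root_weight.
  exact: (measurableT_comp mg (measurable_root_point b)).
have u0 b (y : @borel R n) : setT y -> (0 <= (EFin \o u b) y)%E.
  by move=> _; rewrite lee_fin mulr_ge0// root_weight_ge0.
have bI b : (\int[branch_measure b]_z (gsig w z)%:E = \int[lebm n]_y (EFin \o u b) y)%E.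
  exact: integral_branch.
rewrite [X in (X + _)%E = _]bI [X in (_ + X)%E = _]bI.
rewrite -(ge0_integralD (lebm n) measurableT (u0 true) (mu true) (u0 false) (mu false)).
apply: eq_integral => y _; rewrite /= -EFinD; congr EFin; rewrite /u.
rewrite (yroots_branches (fun s => w (consv (s, y)) / Num.sqrt (disc A l c y))).
(* The factor [|grad f|] of the area element cancels the denominator of the integrand, leaving
   [1 / |d_0 f|]. *)
have br b : gsig w (root_point b y) * root_weight b y = (valid b y)%:R * (w (consv (rt b y, y)) / Num.sqrt (disc A l c y)).
  case: (boolP (valid b y)) => hv; last by rewrite /root_weight (negPf hv) !mul0r mulr0.
  have [f0 [gE gn0]] := root_point_piece hv.
  rewrite /gsig f0 eqxx /root_weight hv !mul1r gE -/(root_point b y).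
  have e0 : enorm (grad f (root_point b y)) != 0.
    rewrite gt_eqF// /enorm sqrtr_gt0 /dot (bigD1 0)//= ltr_pwDl//.
      by rewrite grad_qf mxE -expr2 exprn_even_gt0.
    by apply: sumr_ge0 => j _; rewrite -expr2 sqr_ge0.
  by rewrite mulrA divfK.
by congr (_ + _); exact: br.
Qed.

Lemma sigma_inftyB w1 w2 : (3 <= d)%N ->
  measurable_fun setT (w1 : @borel R d -> R) -> measurable_fun setT (w2 : @borel R d -> R) ->
  (forall z, 0 <= w1 z) -> (forall z, 0 <= w2 z) ->
  (sigma_infty w1 f < +oo)%E -> (sigma_infty w2 f < +oo)%E ->
  sigma_infty (fun z => w1 z - w2 z) f = (sigma_infty w1 f - sigma_infty w2 f)%E.
Proof.
move=> d3 m1 m2 w10 w20; rewrite !sigma_inftyE//; set nu := measure_add _ _ => h1 h2.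
have int w : measurable_fun setT (w : @borel R d -> R) -> (forall z, 0 <= w z) ->
    (\int[nu]_z (gsig w z)%:E < +oo)%E -> nu.-integrable setT (EFin \o gsig w).
  move=> mw w0 h; apply/integrableP; split; first by apply/measurable_EFinP; exact: measurable_gsig.
  rewrite (_ : (\int[nu]_x `|(EFin \o gsig w) x|)%E = (\int[nu]_z (gsig w z)%:E)%E)//.
  apply: eq_integral => z _ /=.
  by rewrite ger0_norm// /gsig mulr_ge0// divr_ge0// sqrtr_ge0.
rewrite -integralB//; [|exact: int|exact: int].
by apply: eq_integral => z _ /=; rewrite -EFinB; congr EFin; rewrite /gsig; ring.
Qed.

Lemma measurable_fiber_sum (w : V -> R) (k : R -> R) : measurable_fun setT (w : @borel R d -> R) ->
  measurable_fun setT k ->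
  measurable_fun setT ((fun y => \sum_(s <- yroots A l c y) w (consv (s, y)) * k (disc A l c y)) : @borel R n -> R).
Proof.
move=> mw mk.
rewrite (_ : (fun y => _) = (fun y : @borel R n => (valid true y)%:R * (w (root_point true y) * k (disc A l c y)) +
    (valid false y)%:R * (w (root_point false y) * k (disc A l c y)))); last first.
  by apply/funext => y; rewrite (yroots_branches (fun s => w (consv (s, y)) * k (disc A l c y))).
have mb b : measurable_fun setT ((fun y => (valid b y)%:R * (w (root_point b y) * k (disc A l c y))) : @borel R n -> R).
  apply: measurable_funM; first exact: measurable_valid.
  apply: measurable_funM; first exact: (measurableT_comp mw (measurable_root_point b)).
  by apply: (measurableT_comp mk); exact: measurable_disc.
exact: measurable_funD.
Qed.

Lemma cvg_bigsum (r : seq R) (F : nat -> R -> R) (G : R -> R) :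
  (forall s, s \in r -> F ^~ s @ \oo --> G s) ->
  (fun m => \sum_(s <- r) F m s) @ \oo --> \sum_(s <- r) G s.
Proof.
elim: r => [|s r IH] h; first by under eq_fun do rewrite big_nil; rewrite big_nil; exact: cvg_cst.
under eq_fun do rewrite big_cons; rewrite big_cons.
apply: cvgD; first by apply: h; rewrite inE eqxx.
by apply: IH => t tr; apply: h; rewrite inE tr orbT.
Qed.

(** For nonnegative w the smoothed fibre sums increase to the true ones as eta decreases to 0.
    Monotone convergence thus gives the surface integral, and [smoothed_fiber_limit] computes the
    same limit, which also shows it finite. *)
Lemma sigma_infty_osc w D K p M B : (4 <= d)%N -> (d < p)%N -> (d.*2 <= K)%N ->
  weight K p M B w D -> 0 < B -> (forall z, 0 <= w z) ->
  sigma_infty w f = (\int[@lebesgue_measure R]_g osc w f g 0)%R%:E.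
Proof.
move=> d4 dp dK hw B0 w0; have mw := measurable_continuousR (weight_cont hw).
rewrite sigma_infty_fiber ?(ltnW d4)//.
have M0 := weight_ge0 hw.
pose k eta D : R := Num.sqrt D / (D + eta ^+ 2).
pose h (m : nat) y := \sum_(s <- yroots A l c y) w (consv (s, y)) * k (m.+1%:R^-1) (disc A l c y).
have mkk eta : measurable_fun setT (k eta).
  apply: measurable_funM; first by apply: measurable_fun_sqrt.
  by apply: measurable_fun_inv; apply: measurable_funD.
have dpos y s : s \in yroots A l c y -> 0 < disc A l c y.
  by move=> hs; have [_ h0] := sroots_mem _ _ _ _ hs; have := sroots_slope hs => e; move: h0; rewrite -normr_gt0 e sqrtr_gt0.
have mh m : measurable_fun setT (h m : @borel R n -> R) by apply: measurable_fiber_sum.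
have h0 m y : 0 <= h m y.
  rewrite /h big_seq; apply: sumr_ge0 => s /dpos D0; apply: mulr_ge0 => //.
  by rewrite divr_ge0 ?sqrtr_ge0// addr_ge0 ?sqr_ge0// ltW.
have hcvg y : (fun m => h m y) @ \oo --> \sum_(s <- yroots A l c y) w (consv (s, y)) / Num.sqrt (disc A l c y).
  apply: cvg_bigsum => s /dpos D0; apply: cvgM; first exact: cvg_cst.
  rewrite [X in _ --> X](_ : _ = Num.sqrt (disc A l c y) / (disc A l c y + 0 ^+ 2)); last first.
    by rewrite expr0n addr0 -{3}(sqr_sqrtr (ltW D0)); field; rewrite gt_eqF// sqrtr_gt0.
  apply: cvgM; first exact: cvg_cst.
  apply: cvgV; first by rewrite expr0n addr0 gt_eqF.
  apply: cvgD; first exact: cvg_cst.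
  have := @cvg_harmonic R => hh; exact: (cvgM hh hh).
have hnd y : {homo (fun m => (h m y)%:E) : m m' / (m <= m')%N >-> (m <= m')%E}.
  move=> m m' mm; rewrite lee_fin /h big_seq [leRHS]big_seq; apply: ler_sum => s /dpos D0.
  apply: ler_wpM2l => //; apply: ler_wpM2l; first exact: sqrtr_ge0.
  have dn q : 0 < disc A l c y + (q.+1%:R^-1) ^+ 2 by rewrite ltr_wpDr ?sqr_ge0.
  rewrite (lef_pV2 (dn m) (dn m')) lerD2l; apply: lerXn2r; rewrite ?nnegrE ?invr_ge0//.
  by rewrite lef_pV2 ?posrE// ler_nat.
have hb m : bfun (h m : 'cV[R]_n -> R).
  split; first exact: mh.
  have e0 : 0 < (m.+1%:R : R)^-1 by rewrite invr_gt0.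
  exists (M * m.+1%:R + M * m.+1%:R), B; split=> [y|y i hi].
    rewrite /h (yroots_branches (fun s => w (consv (s, y)) * k (m.+1%:R^-1) (disc A l c y))).
    have br b : `|(valid b y)%:R * (w (consv (rt b y, y)) * k m.+1%:R^-1 (disc A l c y))| <= M * m.+1%:R.
      case: (boolP (valid b y)) => hv; last by rewrite mul0r normr0 mulr_ge0.
      rewrite mul1r normrM; apply: ler_pM => //; first exact: weight_max hw.
      have D0 := dpos _ _ (valid_root hv).
      have den : 0 < disc A l c y + (m.+1%:R^-1) ^+ 2 by rewrite ltr_wpDr ?sqr_ge0.
      (* From [sqrt D * eta <= D + eta^2] the smoothed density is at most [1 / eta], so every
         approximant is bounded. *)
      rewrite /k ger0_norm ?divr_ge0 ?sqrtr_ge0 ?(ltW den)// ler_pdivrMr// -[X in _ <= X * _]invrK ler_pdivlMl//.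
      rewrite -{2}(sqr_sqrtr (ltW D0)); move: (Num.sqrt _) (m.+1%:R^-1) => x e.
      by have := sqr_ge0 (x - e); have := sqr_ge0 x; have := sqr_ge0 e; nra.
    by apply: le_trans (ler_normD _ _) _; apply: lerD; exact: br.
  rewrite /h big1// => s _; rewrite (weight_vanish hw (i := lift 0 i)) ?mul0r// consvS.
  exact: ltW.
have hE m : (\int[lebm n]_y (h m y)%:E)%E = (smoothed_fiber A l c w (m.+1%:R^-1))%:E.
  by rewrite -EFin_rint//; exact: bfun_Int.
have lim1 := @cvg_monotone_convergence _ _ _ (lebm n) setT measurableT (fun m y => (h m y)%:E)
  (fun m => (measurable_EFinP _ _).2 (mh m)) _ (fun y _ => hnd y).
have lim2 : (fun m => (\int[lebm n]_y (h m y)%:E)%E) @ \oo -->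
    (\int[@lebesgue_measure R]_g osc w f g 0)%R%:E.
  under eq_fun do rewrite hE.
  by apply: cvg_EFin; [exact: nearW|exact: (smoothed_fiber_limit symA detA d4 dp dK hw B0)].
rewrite (cvg_unique _ lim2 (lim1 _))//; last by move=> m y _; rewrite lee_fin.
apply: eq_integral => y _; apply/esym/cvg_lim => //.
by apply: cvg_EFin; [exact: nearW|exact: hcvg].
Qed.

End SurfaceMeasure.

(** * Reduction to nonnegative weights of compact support *)

Section NonnegativeWeights.
Context {R : realType} {n : nat}.
Notation d := n.+1.
Notation V := 'cV[R]_d.
Notation Zn := 'cV[int]_d.
Notation qpoly := (@qpoly R n).

Lemma zbox_cover (s : seq Zn) : exists N, {subset s <= zbox N d}.
Proof.
elim: s => [|b s [N hN]]; first by exists 0%N.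
pose M := (\sum_i absz (b i 0%R)).+1.
exists (maxn N M) => x; rewrite inE => /orP[/eqP ->|/hN]; last by apply: zbox_le; exact: leq_maxl.
apply: (@zbox_le _ M); first exact: leq_maxr.
rewrite mem_zbox; apply/forallP => i.
have : (absz (b i 0%R) <= \sum_i absz (b i 0%R))%N by rewrite (bigD1 i)//= leq_addr.
by rewrite /M; lia.
Qed.

(** Each [S k] is at most the full sum because [chi <= 1]. Conversely a finite set carrying all but
    [eps / 2] of the sum is eventually weighted by nearly 1, so [S k] is squeezed. *)
Lemma cvg_lattice_cutoff (a : Zn -> R) (chi : nat -> Zn -> R) (S : nat -> R) T :
  (forall b, 0 <= a b) -> (forall k b, 0 <= chi k b <= 1) -> (forall b, chi ^~ b @ \oo --> (1 : R)) ->
  (forall N, \sum_(b <- zbox N d) a b <= T) ->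
  (forall k, exists N0, forall N, (N0 <= N)%N -> S k = \sum_(b <- zbox N d) a b * chi k b) ->
  exists2 s, (\esum_(b in [set: Zn]) (a b)%:E = s%:E)%E & S @ \oo --> s.
Proof.
move=> a0 chi01 chi1 aT hS.
have finite_uniq (X : set Zn) : finite_set X -> exists2 Y : seq Zn, X = [set` Y] & uniq Y.
  move=> /finite_seqP[Y ->]; exists (undup Y); last exact: undup_uniq.
  by apply/seteqP; split=> b /=; rewrite mem_undup.
set e := (\esum_(b in [set: Zn]) (a b)%:E)%E.
have fin_le (X : seq Zn) : uniq X -> \sum_(b <- X) a b <= T.
  move=> uX; have [N hN] := zbox_cover X.
  by apply: le_trans (aT N); apply: sum_sub => //; exact: zbox_uniq.
have part (X : seq Zn) : uniq X -> ((\sum_(b <- X) a b)%:E <= e)%E.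
  move=> uX; apply: esum_ge; exists [set` X]; first by split=> //; exact: finite_seq.
  by rewrite -fsbig_seq// sumEFin.
have eT : (e <= T%:E)%E.
  apply: ge_ereal_sup => _ [X [fX _] <-].
  have [Y hY uY] := finite_uniq _ fX.
  by rewrite hY -fsbig_seq// sumEFin lee_fin; exact: fin_le.
have e0 : (0 <= e)%E by apply: esum_ge0 => b _; rewrite lee_fin.
have efin : e \is a fin_num by rewrite ge0_fin_numE// (le_lt_trans eT)// ltry.
exists (fine e); first by rewrite fineK.
have Sle k : S k <= fine e.
  have [N0 /(_ N0 (leqnn _)) ->] := hS k; rewrite -lee_fin fineK//.
  apply: le_trans (part _ (zbox_uniq N0 d)); rewrite lee_fin; apply: ler_sum => b _.
  by have /andP[_ h] := chi01 k b; rewrite ler_piMr.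
apply/cvgrPdist_le => eps eps0.
have e2 : 0 < eps / 2 by rewrite divr_gt0.
have [_ [X [fX _] <-] hX] := ub_ereal_sup_adherent e2 efin.
have [Y hY uY] := finite_uniq _ fX.
move: hX; rewrite hY -fsbig_seq// sumEFin.
rewrite [X in (X - _ < _)%E](_ : _ = (fine e)%:E); last by rewrite fineK.
rewrite -EFinB lte_fin => hX.
have cY : (fun k => \sum_(b <- Y) a b * chi k b) @ \oo --> \sum_(b <- Y) a b.
  rewrite [X in _ --> X](_ : _ = \sum_(b <- Y) a b * 1); last by apply: eq_bigr => b _; rewrite mulr1.
  elim: (Y) => [|b r IH].
    by under eq_fun do rewrite big_nil; rewrite big_nil; exact: cvg_cst.
  under eq_fun do rewrite big_cons; rewrite big_cons.
  by apply: cvgD => //; apply: cvgM; [exact: cvg_cst|exact: chi1].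
have /cvgrPdist_le/(_ _ e2) := cY.
apply: filterS => k; rewrite ler_distl => /andP[_ hk].
have [N1 hN1] := zbox_cover Y; have [N0 hN0] := hS k.
have SY : \sum_(b <- Y) a b * chi k b <= S k.
  rewrite (hN0 (maxn N0 N1) (leq_maxl _ _)); apply: sum_sub => //; first exact: zbox_uniq.
    by move=> b /hN1; apply: zbox_le; exact: leq_maxr.
  by move=> b; rewrite mulr_ge0//; have /andP[] := chi01 k b.
rewrite ger0_norm ?subr_ge0//; have := Sle k; move: hk; rewrite -lerBlDr => hk.
by move: hX hk SY; lra.
Qed.

(** The weight is cut off at radius [k + 1]. All constants are independent of k, so the estimate
    passes to the limit once the lattice sums and the surface integrals are known to converge to
    finite values. *)
Lemma nonneg_case (A : 'M[int]_d) p K r0 : even_symmetric A -> \det A != 0 -> (5 <= d)%N ->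
  (d.*2 <= K.+1)%N -> (K.+1 < p)%N -> 0 <= r0 ->
  exists2 C, 0 <= C & forall M (w : V -> R) D, 0 <= M -> smooth K.+1 p M w D -> (forall z, 0 <= w z) ->
  forall L Y (l : V) c t0 (n0 : Zn), (forall j, `|l j 0| <= r0) -> 1 <= Y -> Y <= L -> L ^+ d <= Y ^+ K.+1 ->
  (forall b : Zn, L ^+ 2 * qf A l c (L^-1 *: zR b) = (qpoly A t0 (b + n0))%:~R) ->
  exists Nw Hw : R,
  [/\ (\esum_(b in [set b : Zn | (qpoly A t0 (b + n0) = 0)%R]) (w (L^-1 *: zR b))%:E = Nw%:E)%E,
      sigma_infty w (qf A l c) = Hw%:E &
      `|Nw - L ^+ (d - 2) * Hw * @singular_sum R n A t0| <= C * M * Num.sqrt L ^+ d * Y ^+ d].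
Proof.
move=> eA detA d5 dK Kp r00; have [sA _] := eA.
have dp : (d < p)%N by move: dK; rewrite -addnn; lia.
have p0 : (0 < p)%N by lia. have d4 : (4 <= d)%N by lia. have d3 : (3 <= d)%N by lia.
have [C1 C10 hC1] := circle_method (R := R) eA detA d5 dK Kp r00.
have [C2 C20 hC2] := osc_integral_bound (R := R) sA detA dp dK d4.
have [M' M0' hchi] := @cutoff_weight R d K.+1.
exists (C1 * (2 ^+ K.+1 * M')); first by nng.
move=> M w D M0 sw w0 L Y l c t0 n0 lr Y1 YL LY hP.
have L1 : 1 <= L by apply: le_trans YL.
have L0 : 0 < L by lra. have Li : 0 < L^-1 by rewrite invr_gt0.
have Lr : 0 < L^-1 <= 1 by rewrite Li invf_le1.
pose chi k : V -> R := cutoff K.+3 k.+1%:R.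
pose wk k z := w z * chi k z.
pose Mk := 2 ^+ K.+1 * (M * M').
have hwk k : exists Dk, weight K.+1 p Mk k.+1%:R (wk k) Dk.
  have [E hE] := hchi k.+1%:R (ler1n _ _ : 1 <= k.+1%:R).
  by eexists; exact: weight_mul M0 M0' sw hE.
have wk0 k z : 0 <= wk k z.
  by rewrite mulr_ge0//; have /andP[] := @cutoff_itv R d K.+3 k.+1%:R z (ltr0n _ _).
pose H k : R := \int[@lebesgue_measure R]_g osc (wk k) (qf A l c) g 0.
have sH k : sigma_infty (wk k) (qf A l c) = (H k)%:E.
  by have [Dk hk] := hwk k; exact: (sigma_infty_osc l c sA detA d4 dp dK hk (ltr0n _ _) (wk0 k)).
have Hle k : `|H k| <= C2 * Mk by have [Dk hk] := hwk k; exact: hC2 hk l c.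
have cw : continuous w by case: sw => e _ _ h; rewrite -(e 0); exact: h.
have mw := measurable_continuousR cw.
(* Monotone convergence on the fibres, the cutoffs increasing with k; finiteness of the limit comes
   from the uniform bound on [H k]. *)
have [Hw sHw cHw] : exists2 Hw, sigma_infty w (qf A l c) = Hw%:E & H @ \oo --> Hw.
  pose h v y := \sum_(s <- yroots A l c y) v (consv (s, y)) * (Num.sqrt (disc A l c y))^-1.
  have msq : measurable_fun setT (fun x : R => (Num.sqrt x)^-1).
    by apply: measurable_fun_inv; apply: measurable_fun_sqrt.
  have hI v : measurable_fun setT (v : @borel R d -> R) -> (forall z, 0 <= v z) ->
      sigma_infty v (qf A l c) = (\int[lebm n]_y (h v y)%:E)%E by move=> mv v0; exact: sigma_infty_fiber.
  have mwk k : measurable_fun setT (wk k : @borel R d -> R).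
    by have [Dk hk] := hwk k; exact: measurable_continuousR (weight_cont hk).
  have h0 v y : (forall z, 0 <= v z) -> 0 <= h v y.
    by move=> v0; apply: sumr_ge0 => s _; rewrite mulr_ge0// invr_ge0 sqrtr_ge0.
  have lim1 := @cvg_monotone_convergence _ _ _ (lebm n) setT measurableT (fun k y => (h (wk k) y)%:E)
    (fun k => (measurable_EFinP _ _).2 (measurable_fiber_sum A l c (mwk k) msq)) _ _.
  have {lim1}lim1 : (fun k => (H k)%:E) @ \oo --> sigma_infty w (qf A l c).
    rewrite hI//; under eq_fun do rewrite -sH hI//.
    have -> : (\int[lebm n]_y (h w y)%:E = \int[lebm n]_y limn (fun k => (h (wk k) y)%:E))%E.
      apply: eq_integral => y _; apply/esym/cvg_lim => //; apply: cvg_EFin; first exact: nearW.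
      apply: cvg_bigsum => s _; apply: cvgM; last exact: cvg_cst.
      rewrite -[X in _ --> X]mulr1; apply: cvgM; first exact: cvg_cst.
      exact: cutoff_cvg.
    apply: lim1 => [k y _|y _ k k' kk]; first by rewrite lee_fin; exact: h0.
    rewrite lee_fin; apply: ler_sum => s _; apply: ler_wpM2r; first by rewrite invr_ge0 sqrtr_ge0.
    by apply: ler_wpM2l => //; apply: cutoff_homo => //; rewrite ler_nat.
  have s0 : (0 <= sigma_infty w (qf A l c))%E.
    by rewrite hI//; apply: integral_ge0 => y _; rewrite lee_fin; exact: h0.
  have sle : (sigma_infty w (qf A l c) <= (C2 * Mk)%:E)%E.
    rewrite -(cvg_lim _ lim1)//; apply: lime_le; first exact: cvgP lim1.
    by apply: nearW => k; rewrite lee_fin; apply: le_trans (ler_norm _) (Hle k).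
  have sfin : sigma_infty w (qf A l c) \is a fin_num by rewrite ge0_fin_numE// (le_lt_trans sle)// ltry.
  exists (fine (sigma_infty w (qf A l c))); first by rewrite fineK.
  by rewrite -(fineK sfin) in lim1; exact: (fine_cvg lim1).
pose a (b : Zn) := if qpoly A t0 (b + n0) == 0 then w (L^-1 *: zR b) else 0.
(* Any box containing the support of the k-th cut-off weight would do; [xget] picks one. *)
pose S k : R := \sum_(b <- zbox (xget 0%N [set N | zsupp N (fun b : Zn => wk k (L^-1 *: zR b))]) d | qpoly A t0 (b + n0) == 0) wk k (L^-1 *: zR b).
have zsx k : zsupp (xget 0%N [set N | zsupp N (fun b : Zn => wk k (L^-1 *: zR b))]) (fun b : Zn => wk k (L^-1 *: zR b)).
  have [Dk hk] := hwk k; have [N hN] := zsupp_exists Li (fun z i => weight_vanish hk (z := z) (i := i)).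
  by apply: (@xgetPex _ 0%N [set N | zsupp N (fun b : Zn => wk k (L^-1 *: zR b))]); exists N; exact: hN.
have hSk k : `|S k - L ^+ (d - 2) * H k * @singular_sum R n A t0| <= C1 * Mk * Num.sqrt L ^+ d * Y ^+ d.
  have [Dk hk] := hwk k; exact: (hC1 _ _ _ _ hk L Y l c t0 n0 _ lr Y1 YL LY hP (zsx k)).
have [s hs cS] : exists2 s, (\esum_(b in [set: Zn]) (a b)%:E = s%:E)%E & S @ \oo --> s.
  apply: (@cvg_lattice_cutoff a (fun k b => chi k (L^-1 *: zR b)) S (M * (8 / L^-1) ^+ d)).
  - by move=> b; rewrite /a; case: ifP.
  - by move=> k b; apply: cutoff_itv.
  - by move=> b; exact: cutoff_cvg.
  - move=> N; apply: le_trans (ler_wpM2l M0 (sum_omega N Lr)); rewrite mulr_sumr; apply: ler_sum => b _.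
    have wb z : w z <= M * omega z.
      case: sw => e _ h _; apply: le_trans (ler_norm _) _; rewrite -(e 0); apply: le_trans (h 0 0%N z isT) _.
      by rewrite ler_wpM2l// -[leRHS]expr1 ler_wiXn2l ?omega_ge0 ?omega_le1.
    by rewrite /a; case: ifP => _ //; rewrite mulr_ge0// omega_ge0.
  move=> k; exists (xget 0%N [set N | zsupp N (fun b : Zn => wk k (L^-1 *: zR b))]) => N hN.
  rewrite /S big_mkcond (@zsum_supp R d _ N); first by apply: eq_bigr => b _; rewrite /a /wk; case: ifP => _ //; rewrite mul0r.
    by move=> b; case: ifP => _; [exact: zsx|rewrite eqxx].
  by move=> b; case: ifP => _; [move=> h; apply: (zbox_le hN); exact: zsx|rewrite eqxx].
exists s, Hw; split=> //.
  rewrite -hs [LHS]esum_mkcond; apply: eq_esum => b _; rewrite /a.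
  case: (boolP (b \in _)) => [/set_mem /= ->|/negP hb]; first by rewrite eqxx.
  by case: eqP => // e; case: hb; rewrite inE.
have -> : C1 * (2 ^+ K.+1 * M') * M * Num.sqrt L ^+ d * Y ^+ d = C1 * Mk * Num.sqrt L ^+ d * Y ^+ d by rewrite /Mk; ring.
have lim : (fun k => `|S k - L ^+ (d - 2) * H k * @singular_sum R n A t0|) @ \oo --> `|s - L ^+ (d - 2) * Hw * @singular_sum R n A t0|.
  apply: cvg_norm; apply: cvgB => //; apply: cvgM; last exact: cvg_cst.
  by apply: cvgM => //; exact: cvg_cst.
rewrite -(cvg_lim _ lim)//; apply: limr_le; first exact: cvgP lim.
exact: nearW.
Qed.

End NonnegativeWeights.

(** * From the classical norms to weight functions *)

Section ClassicalWeights.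
Context {R : realType} {n : nat}.
Notation d := n.+1.
Notation V := 'cV[R]_d.
Implicit Types (w : V -> R) (z : V).

Lemma iter_pd_nseq l j w : iter_pd (nseq l j) w = iter l (pd j) w.
Proof. by elim: l => //= l ->. Qed.

Lemma multi_pd_single l j w : multi_pd (fun i => if i == j then l else 0%N) w = iter l (pd j) w.
Proof.
rewrite /multi_pd.
have h (r : seq 'I_d) : uniq r ->
    foldr (fun i g => iter (if i == j then l else 0%N) (pd i) g) w r = if j \in r then iter l (pd j) w else w.
  elim: r => //= i r IH /andP[ir ur]; rewrite IH// inE.
  by have [ij|ij] := eqVneq i j; first by rewrite -ij (negPf ir).
by rewrite h ?enum_uniq// mem_enum.
Qed.

Lemma is_derive_line w z (e : V) (s : R) : derivable w (z + s *: e) e ->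
  is_derive s (1:R) (fun s => w (z + s *: e)) ('D_e w (z + s *: e)).
Proof.
have E : (fun h : R => h^-1 *: (((fun s => w (z + s *: e)) \o shift s) (h *: (1:R)) - w (z + s *: e))) =
   (fun h : R => h^-1 *: ((w \o shift (z + s *: e)) (h *: e) - w (z + s *: e))).
  apply/funext => h; congr (_ *: (w _ - _)).
  change (z + (h * 1 + s) *: e = h *: e + (z + s *: e)); by rewrite mulr1 scalerDl addrCA.
move=> hd; apply: DeriveDef; first by rewrite /derivable E.
by rewrite /derive E.
Qed.

(** Each factor [1 + z_i^2] is at most twice the square of the bracket, and there are d of them. *)
Lemma bracket_omega z : (omega z)^-1 <= 2 ^+ d * bracket z ^+ (d.*2).
Proof.
have b1 : 1 <= bracket z by rewrite /bracket le_max lexx.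
have hb i : 1 + (z i 0) ^+ 2 <= 2 * bracket z ^+ 2.
  have : (z i 0) ^+ 2 <= bracket z ^+ 2.
    apply: (@le_trans _ _ (enorm z ^+ 2)).
      rewrite /enorm sqr_sqrtr; last by apply: sumr_ge0 => j _; rewrite -expr2 sqr_ge0.
      by rewrite /dot (bigD1 i)//= -expr2 lerDl; apply: sumr_ge0 => j _; rewrite -expr2 sqr_ge0.
    by apply: lerXn2r; rewrite ?nnegrE ?sqrtr_ge0 ?(le_trans ler01 b1)// /bracket le_max lexx orbT.
  have : 1 <= bracket z ^+ 2 by rewrite exprn_ege1.
  by lra.
rewrite /omega -prodfV -muln2 mulnC exprM -exprMn -[X in _ ^+ X](card_ord d) -prodr_const.
by apply: ler_prod => i _; rewrite invrK hb andbT addr_ge0// sqr_ge0.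
Qed.

Lemma Cnorm_ge0 K1 K2 w : (0 <= Cnorm K1 K2 w)%E.
Proof.
apply: (@le_trans _ _ (`|multi_pd (fun=> 0%N) w 0| * bracket (0 : V) `^ K2)%:E).
  by rewrite lee_fin mulr_ge0// powR_ge0.
by apply: ereal_sup_ubound; exists 0, (fun=> 0%N); split=> //; rewrite sum_nat_const muln0.
Qed.

(** By [bracket_omega] the decay [omega ^+ p] costs the exponent [2 d p] and the factor
    [2 ^+ (d * p)]. Among the mixed partials only the pure ones are extracted from the norm. *)
Lemma smooth_Cspace K p w m : Csmooth K w -> Cnorm K (d.*2 * p)%:R w = m%:E ->
  smooth K p (2 ^+ (d * p) * m) w (fun j l => iter l (pd j) w).
Proof.
move=> sw hm; split=> //.
- move=> j z l s lK; have [] := sw (nseq l j); first by rewrite size_nseq ltnW.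
  rewrite size_nseq iter_pd_nseq => _ /(_ lK j (z + s *: delta_mx j 0)) hd.
  by have := is_derive_line hd; rewrite /= /pd.
- move=> j l z lK.
  have h : `|iter l (pd j) w z| * bracket z ^+ (d.*2 * p) <= m.
    rewrite -lee_fin -hm -multi_pd_single; apply: ereal_sup_ubound.
    exists z, (fun i => if i == j then l else 0%N); split; last first.
      by rewrite powR_mulrn// /bracket le_max ler01.
    by rewrite (bigD1 j)//= eqxx big1 ?addn0// => i /negPf ->.
  have b0 : 0 < bracket z by rewrite /bracket lt_max ltr01.
  have o0 := omega_gt0 z.
  rewrite -(ler_pM2r (_ : 0 < (omega z)^-1 ^+ p)) ?exprn_gt0 ?invr_gt0//.
  rewrite exprVn -[leRHS]mulrA divff ?mulr1 ?expf_neq0 ?gt_eqF// -exprVn.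
  apply: (@le_trans _ _ (`|iter l (pd j) w z| * (2 ^+ d * bracket z ^+ d.*2) ^+ p)).
    apply: ler_wpM2l => //; apply: lerXn2r; rewrite ?nnegrE ?invr_ge0 ?(ltW o0)//; last exact: bracket_omega.
    by rewrite mulr_ge0// exprn_ge0// ltW.
  by rewrite exprMn -!exprM mulrCA ler_wpM2l// exprn_ge0.
move=> j l lK; have [] := sw (nseq l j); first by rewrite size_nseq.
by rewrite iter_pd_nseq.
Qed.

End ClassicalWeights.

(** * The asymptotic formula *)

Theorem corollary1p6 (R : realType) (d : nat) (hd : (5 <= d)%N)
    (eps : R) (heps : 0 < eps <= 1) :
  exists (K1 : nat) (K2 K3 : R),
  forall A : 'M[int]_d, even_symmetric A -> \det A != 0 ->
  forall tau r : R,
  exists C : R,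
  forall zs : 'cV[R]_d, enorm zs = r ->
  let f z := qform A z + dot zs z + tau in
  let zz := invmx (real_mx A) *m zs in
  let m := 2^-1 * dot zz (real_mx A *m zz) - tau in
  forall L : R, 1 <= L -> lattice L zz -> tau * L ^+ 2 \is a Num.int ->
  forall w : 'cV[R]_d -> R, (Cspace K1 K2 `&` Cspace 0 K3) w ->
  (`| lattice_sum L w f
      - sigma_infty w f * (singular_series A (Num.floor (L ^+ 2 * m)) * L ^+ (d - 2))%:E |
    <= (C * L `^ (d%:R / 2 + eps))%:E * (Cnorm K1 K2 w + Cnorm 0 K3 w))%E.
Proof.
case: d hd => [//|n] hd; have /andP[eps0 eps1] := heps.
have d0 : 0 < n.+1%:R :> R by [].
(* The first summand pays for the d second differences in Weyl's inequality, the second, of order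
   [d^2 / eps], ensures [L^d <= Y^(K+1)]. *)
pose K := (n.+1.*2 + Num.truncn (n.+1%:R * n.+1%:R / eps))%N.
pose p := K.+2.
have dK : (n.+1.*2 <= K.+1)%N by rewrite /K -addnS leq_addr.
have Kp : (K.+1 < p)%N by [].
(* The second exponent is the price of the decay [omega ^+ p] in terms of the bracket. It and the
   smoothness depend on d and eps alone. *)
exists K.+1, (n.+1.*2 * p)%:R, 0 => A eA detA tau r; have [sA _] := eA.
have [C1 C10 hC1] := nonneg_case (R := R) eA detA hd dK Kp (normr_ge0 r).
have [Mg Mg1 [Dg sg]] := @majorant R n.+1 K.+1 p.
pose c2 : R := 2 ^+ (n.+1 * p).
have c20 : 0 <= c2 by rewrite exprn_ge0.
(* The weights [w1] and [w2] have constants [M + M Mg] and [M Mg], with [M = c2 * m1]; their sum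
   explains [1 + 2 Mg]. *)
exists (C1 * (c2 * (1 + 2 * Mg))) => zs hz f zz m L L1 [n0 hn0] hint w [[sw cw] _].
have L0 : 0 < L by lra.
have fin1 : Cnorm K.+1 (n.+1.*2 * p)%:R w \is a fin_num by rewrite ge0_fin_numE ?Cnorm_ge0.
pose m1 := fine (Cnorm K.+1 (n.+1.*2 * p)%:R w).
have hm1 : Cnorm K.+1 (n.+1.*2 * p)%:R w = m1%:E by rewrite fineK.
have m10 : 0 <= m1 by rewrite -lee_fin -hm1 Cnorm_ge0.
pose M := c2 * m1; have M0 : 0 <= M by rewrite mulr_ge0.
have Mg0 : 0 <= Mg by lra.
have s0 := smooth_Cspace (p := p) sw hm1; rewrite -/c2 -/M in s0.
have s2 := smoothZ M0 sg; have s1 := smoothD s0 s2.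
(* By the decay of w this multiple of the majorant is at least [|w|], so [w1 = w + w2] is
   nonnegative. *)
set w2 := (fun z => M * omega z ^+ p) in s1 s2.
set w1 := (fun z => w z + w2 z) in s1.
have w20 z : 0 <= w2 z by rewrite mulr_ge0// exprn_ge0// omega_ge0.
have w10 z : 0 <= w1 z.
  case: s0 => _ _ /(_ ord0 0%N z isT) /= h _.
  by move: h; rewrite ler_norml /w1 /w2 => /andP[h _]; lra.
have lr (j : 'I_n.+1) : `|zs j 0| <= `|r|.
  rewrite -hz /enorm [leRHS]ger0_norm ?sqrtr_ge0// -[leLHS]sqrtr_sqr; apply: ler_wsqrtr.
  rewrite /dot (bigD1 j)//= -expr2 lerDl; apply: sumr_ge0 => k _; by rewrite -expr2 sqr_ge0.
(* Then [Y^d = L^eps], and [Y <= L] because [eps <= 1 <= d]. *)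
pose Y := L `^ (eps / n.+1%:R).
have Y1 : 1 <= Y by rewrite -[leLHS](powRr0 L); apply: ler_powR => //; rewrite divr_ge0// ltW.
have YL : Y <= L.
  rewrite -[leRHS]powRr1 ?(ltW L0)//; apply: ler_powR => //.
  by rewrite ler_pdivrMr// mul1r (le_trans eps1)// ler1n.
have LY : L ^+ n.+1 <= Y ^+ K.+1.
  rewrite -!powR_mulrn ?(ltW L0) ?powR_ge0// /Y -powRrM; apply: ler_powR => //.
  rewrite mulrAC ler_pdivlMr// -ler_pdivrMl// mulrC.
  apply: le_trans (ltW (truncnS_gt _)) _; by rewrite ler_nat /K -addnS leq_addl.
have YE : Num.sqrt L ^+ n.+1 * Y ^+ n.+1 = L `^ (n.+1%:R / 2 + eps).
  rewrite -powR12_sqrt ?(ltW L0)// -!powR_mulrn ?powR_ge0// /Y -!powRrM -powRD; last first.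
    by rewrite (gt_eqF L0) implybT.
  by congr (_ `^ _); rewrite divfK ?gt_eqF// (mulrC 2^-1).
(* The floor is exact: [L^2 m] is the integral form at [n0] minus the integer [tau L^2]. *)
pose t0 := Num.floor (L ^+ 2 * m).
have zzE : zz = L^-1 *: zR n0 by [].
have zsE : zs = L^-1 *: zR (A *m n0).
  by rewrite -zR_mul -[map_mx _ _]/(real_mx A) scalemxAr -zzE mulKVmx// real_mx_unit.
have mE : L ^+ 2 * m = qform A (zR n0) - tau * L ^+ 2.
  rewrite /m (dotC zz) -[_ * dot _ _]/(qform A zz) zzE qformZ.
  by field; rewrite gt_eqF.
have t0E : t0%:~R = qform A (zR n0) - tau * L ^+ 2 :> R.
  rewrite /t0 mE floorK//; have [F [FE _]] := @qform_int R n A eA.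
  by rewrite FE rpredB// intr_int.
have hP b : L ^+ 2 * qf A zs tau (L^-1 *: zR b) = (@qpoly R n A t0 (b + n0))%:~R.
  rewrite qpolyE// t0E zRD qformD// /qf qformZ dotZr zsE dotZl zR_mul.
  by field; rewrite gt_eqF.
have M10 : 0 <= M + M * Mg by rewrite addr_ge0// mulr_ge0.
have M20 : 0 <= M * Mg by rewrite mulr_ge0.
have [N1 [H1 [eN1 eH1 b1]]] := hC1 _ w1 _ M10 s1 w10 L Y zs tau t0 n0 lr Y1 YL LY hP.
have [N2 [H2 [eN2 eH2 b2]]] := hC1 _ w2 _ M20 s2 w20 L Y zs tau t0 n0 lr Y1 YL LY hP.
have wE : w = (fun z => w1 z - w2 z) by apply/funext => z; rewrite /w1 addrK.
have esumE v (N : R) : (\esum_(b in [set b | (@qpoly R n A t0 (b + n0) = 0)%R]) (v (L^-1 *: zR b))%:E = N%:E)%E ->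
    (\esum_(z in zero_set f `&` lattice L) (v z)%:E = N%:E)%E.
  move=> <-; apply: (@reindex_esum R _ _ _ _ (fun b => L^-1 *: zR b) (fun z => (v z)%:E)).
  have zf b : f (L^-1 *: zR b) = 0 <-> @qpoly R n A t0 (b + n0) = 0.
    have := hP b; rewrite -[qf A zs tau _]/(f _) => h; split=> e.
      by apply/eqP; rewrite -(intr_eq0 R) -h e mulr0.
    by apply/eqP; move: h; rewrite e => /eqP; rewrite mulf_eq0 expf_eq0 (gt_eqF L0).
  split=> [b /zf hb|b b' _ _|z [hz0 [b hb]]].
  - by split=> //; exists b.
  - move/(scalerI (lt0r_neq0 _)) => h; apply/matrixP => i j.
    have : zR b i j = zR b' i j :> R by rewrite h// invr_gt0.
    by rewrite !mxE => /intr_inj.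
  by exists b; [apply/zf; rewrite -[zR b]/(map_mx intr b) -hb|rewrite hb].
have latE : lattice_sum L w f = (N1 - N2)%:E.
  have sm v (N : R) : (forall z, 0 <= v z) -> (\esum_(z in zero_set f `&` lattice L) (v z)%:E = N%:E)%E ->
      summable (zero_set f `&` lattice L) (fun z => (v z)%:E).
    move=> v0 e; rewrite /summable (eq_esum (b := fun z => (v z)%:E)) ?e ?ltry// => z _.
    by rewrite /= ger0_norm.
  have e1 := esumE w1 N1 eN1; have e2 := esumE w2 N2 eN2.
  (* The sum is defined by the positive and negative parts of w, not by [w1] and [w2]; for summable
     nonnegative functions [esumB] shows that the difference does not depend on the
     decomposition. *)
  rewrite /lattice_sum.
  have -> : (fun z => (w z)%:E) = ((fun z => (w1 z)%:E) \- (fun z => (w2 z)%:E))%E.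
    by apply/funext => z; rewrite {1}wE EFinB.
  rewrite (esumB (sm _ _ w10 e1) (sm _ _ w20 e2)) ?e1 ?e2//.
  - by move=> z _; rewrite lee_fin.
  - by move=> z _; rewrite lee_fin.
have sigE : sigma_infty w f = (H1 - H2)%:E.
  have [cm1 cm2] : continuous w1 /\ continuous w2.
    by case: s1 => e1 _ _ h1; case: s2 => e2 _ _ h2; split; [rewrite -(e1 ord0)|rewrite -(e2 ord0)]; [exact: h1|exact: h2].
  rewrite {1}wE -[f]/(qf A zs tau) (@sigma_inftyB R n A zs tau sA detA)//.
  - by rewrite eH1 eH2.
  - exact: leq_trans hd.
  - exact: measurable_continuousR.
  - exact: measurable_continuousR.
  - by rewrite eH1 ltry.
  - by rewrite eH2 ltry.
rewrite latE sigE (singular_seriesE eA detA hd) -EFinM -EFinB /=.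
have E0 : 0 <= C1 * (c2 * (1 + 2 * Mg)) * L `^ (n.+1%:R / 2 + eps).
  by rewrite mulr_ge0 ?powR_ge0// mulr_ge0// mulr_ge0//; lra.
apply: (@le_trans _ _ ((C1 * (c2 * (1 + 2 * Mg)) * L `^ (n.+1%:R / 2 + eps))%:E * m1%:E)%E); last first.
  by rewrite hm1; apply: lee_wpmul2l; rewrite ?lee_fin// leeDl// Cnorm_ge0.
rewrite -EFinM lee_fin.
have -> : N1 - N2 - (H1 - H2) * (@singular_sum R n A t0 * L ^+ (n.+1 - 2)) =
  (N1 - L ^+ (n.+1 - 2) * H1 * @singular_sum R n A t0) - (N2 - L ^+ (n.+1 - 2) * H2 * @singular_sum R n A t0) by ring.
apply: le_trans (ler_normB _ _) _; apply: le_trans (lerD b1 b2) _.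
rewrite -YE le_eqVlt; apply/orP; left; apply/eqP; rewrite /M; ring.
Qed.
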